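(* Let $M$ be a smooth compact Riemannian manifold of dimension $n$ without boundary, let $V\in C^\infty(S^1\times M,\mathbb{R})$, and let $x\in Crit$ be nondegenerate. Then $$\mu_{CZ}(z_x)=-Ind(x)$$ if the bundle $x^*TM\to S^1$ is trivial, and $$\mu_{CZ}(z_x)=-Ind(x)+1$$ if the bundle $x^*TM\to S^1$ is nontrivial.
   Context: $S^1=\mathbb{R}/\mathbb{Z}$. $g(x):T_xM\to T_x^*M$ is the isomorphism induced by the metric, $\nabla$ the Levi-Civita connection, $R$ the Riemann curvature tensor (sign convention: $\langle R(X,Y)Y,X\rangle$ is the sectional curvature for orthonormal $X,Y$), $V_t=V(t,\cdot)$, and $\nabla V_t$ the gradient in the $M$-variable; $\nabla_t$ is covariant differentiation along $x$. Critical points and Morse index. $Crit=\{x\in C^\infty(S^1,M)\mid-\nabla_t\dot x-\nabla V_t(x)=0\}$ is the set of critical points of $\mathcal{S}_V(x)=\int_0^1(\frac12|\dot x|^2-V(t,x))dt$ on the space of smooth free loops in $M$. For $x\in Crit$ let $A_x\xi=-\nabla_t\nabla_t\xi-R(\xi,\dot x)\dot x-\nabla_\xi\nabla V_t(x)$, a self-adjoint operator on $L^2(S^1,x^*TM)$ with dense domain $W^{2,2}(S^1,x^*TM)$. $x$ is nondegenerate if $A_x$ is injective. $Ind(x)$ is the number of negative eigenvalues of $A_x$ counted with multiplicities. Hamiltonian side. On $T^*M$ with $\omega_{can}=\sum_i dx^i\wedge dy_i$ in natural coordinates, let $H(t,x,y)=\frac12|y|^2+V(t,x)$, let $X_H$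 be defined by $\omega_{can}(X_H,\cdot)=dH$, and let $\varphi_t$ be the flow of $X_H$ starting at time $0$. For $x\in Crit$ the loop $z_x=(x,g(x)\dot x)$ is a $1$-periodic orbit. $T_{z}T^*M$ at $z=(x,y)$ is identified with $T_xM\oplus T_x^*M$ via the Levi-Civita connection, by the isomorphism taking $\partial_tz(t)$ to $(\partial_tx(t),\nabla_ty(t))$ for curves $z(t)=(x(t),y(t))$. Trivializations. Let $\sigma=\sigma(x)=0$ if $x^*TM\to S^1$ is trivial and $\sigma=1$ otherwise; $E_\sigma=\mathrm{diag}_n((-1)^\sigma,1,\dots,1)$. Choose a smooth orthonormal trivialization $\phi:[0,1]\times\mathbb{R}^n\to x^*TM$ with $\phi(1)=\phi(0)E_\sigma$ (the result does not depend on this choice), and put $\Phi=\begin{pmatrix}\phi&0\\0&(\phi^* )^{-1}\end{pmatrix}$. Let $$U(t)=\begin{pmatrix}\mathrm{diag}_n(\cos\pi t,1,\dots,1)&\mathrm{diag}_n(-\sin\pi t,0,\dots,0)\\ \mathrm{diag}_n(\sin\pi t,0,\dots,0)&\mathrm{diag}_n(\cos\pi t,1,\dots,1)\end{pmatrix},\qquad \Phi_U=\Phi\,U^{-\sigma}.$$ Then $\Phi_U$ is a unitary trivialization of $x^*TM\oplus x^*T^*M$ over $S^1$. Define the path of symplectic matrices $\gamma(t)=\Phi_U(t)^{-1}\,d\varphi_t(z_x(0))\,\Phi_U(0)$, $t\in[0,1]$. If $x$ is nondegenerate, then $\det(\mathbb 1-\gamma(1))\ne0$, and one defines $\mu_{CZ}(z_x):=\mu_{CZ}(\gamma)$.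 Conley-Zehnder index. Let $J_0=\begin{pmatrix}0&-\mathbb 1\\ \mathbb 1&0\end{pmatrix}$ on $\mathbb{R}^{2n}$, $\omega_0=\langle J_0\cdot,\cdot\rangle$, and let $Sp(2n)$ be the group of linear maps preserving $\omega_0$. $\mu_{CZ}$ is defined on continuous paths $\gamma:[0,1]\to Sp(2n)$ with $\gamma(0)=\mathbb 1$ and $\det(\mathbb 1-\gamma(1))\neq0$, normalized by $\mu_{CZ}(t\mapsto e^{-tJ_0S})=-\frac12\mathrm{sign}\,S$ for nonsingular symmetric $S$ with $\|S\|<2\pi$, where $\mathrm{sign}$ is the number of positive minus the number of negative eigenvalues. Explicitly: if $\gamma$ is $C^1$, a crossing is a $t$ with $\ker(\mathbb 1-\gamma(t))\ne0$; its crossing form is the quadratic form $\Gamma(\gamma,t)\zeta=-\langle\zeta,S(t)\zeta\rangle$ on $\ker(\mathbb 1-\gamma(t))$ with $S(t)=J_0\dot\gamma(t)\gamma(t)^{-1}$. If all crossing forms are nonsingular, $\mu_{CZ}(\gamma)=\frac12\mathrm{sign}\,\Gamma(\gamma,0)+\sum_{0<t<1}\mathrm{sign}\,\Gamma(\gamma,t)$, the sum over crossings. A general path is assigned the index of any such regular $C^1$ path homotopic to it with fixed endpoints. *)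

(* Defs.v *)
From HB Require Import structures.
From mathcomp Require Import all_boot all_order all_algebra.
From mathcomp Require Import all_classical all_reals all_analysis.

Set Implicit Arguments.
Unset Strict Implicit.
Unset Printing Implicit Defensive.

Import Order.TTheory GRing.Theory Num.Theory.
Import numFieldNormedType.Exports.

Local Open Scope classical_set_scope.
Local Open Scope ring_scope.

(* Vectors of R^m are columns, so that matrices act on the left. *)
Section Calculus.
Variables (R : realType).

Definition pd m (k : 'I_m) (f : 'cV[R]_m -> R) (q : 'cV[R]_m) : R :=
  'D_(delta_mx k ord0 : 'cV[R]_m) f q.

Fixpoint Ck_on m (r : nat) (U : set 'cV[R]_m) (f : 'cV[R]_m -> R) : Prop :=
  if r is r'.+1 then
    (forall k q, U q -> derivable f q (delta_mx k ord0 : 'cV[R]_m)) /\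
    (forall k, Ck_on r' U (pd k f))
  else forall q, U q -> {for q, continuous f}.

(* Meant for open U. *)
Definition smooth_on m (U : set 'cV[R]_m) (f : 'cV[R]_m -> R) : Prop :=
  forall r, Ck_on r U f.

Definition jac m p (F : 'cV[R]_m -> 'cV[R]_p) (q : 'cV[R]_m) : 'M[R]_(p, m) :=
  \matrix_(a, b) pd b (fun u => F u a ord0) q.

(* Meant for open D. *)
Definition smooth_curve_on (W : normedModType R) (D : set R) (f : R -> W) :=
  forall r t, D t -> derivable (derive1n r f) t 1.

End Calculus.

(* A Hausdorff, second countable space with a smooth atlas modelled on R^n
   (hence without boundary).  [chart_at] selects a preferred chart around each
   point; it carries no condition besides [mem_chart_at]. *)
Record smooth_manifold (R : realType) (n : nat) := SmoothManifold {
  carrier :> topologicalType;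
  carrier_hausdorff : hausdorff_space carrier;
  carrier_second_countable : @second_countable carrier;
  chart_index : Type;
  dom : chart_index -> set carrier;
  chart : chart_index -> carrier -> 'cV[R]_n;
  chart_inv : chart_index -> 'cV[R]_n -> carrier;
  chart_at : carrier -> chart_index;
  mem_chart_at : forall p, dom (chart_at p) p;
  dom_open : forall i, open (dom i);
  img_open : forall i, open (chart i @` dom i);
  chartK : forall i p, dom i p -> chart_inv i (chart i p) = p;
  chart_continuous : forall i, {within dom i, continuous (chart i)};
  chart_inv_continuous :
    forall i, {within chart i @` dom i, continuous (chart_inv i)};
  transition_smooth : forall i j k,
    smooth_on (chart i @` (dom i `&` dom j))
      (fun q => chart j (chart_inv i q) k ord0)
}.

Section Manifold.
Variables (R : realType) (n : nat) (M : smooth_manifold R n).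

Definition img (i : chart_index M) : set 'cV[R]_n := @chart _ _ M i @` dom i.

(* Derivative at p of the transition map from chart i to chart j. *)
Definition tchg (i j : chart_index M) (p : M) : 'M[R]_n :=
  jac (fun q => chart j (chart_inv i q)) (chart i p).

(* A tangent vector at p is represented by its components in the preferred
   chart at p, so that T_pM is 'cV[R]_n for every p; [vcoord i p v] gives its
   components in another chart i around p.  A cotangent vector is likewise
   represented by the column of its components, so that the points of T*M are
   the pairs (p, y) : M * 'cV[R]_n. *)
Definition vcoord (i : chart_index M) (p : M) (v : 'cV[R]_n) : 'cV[R]_n :=
  tchg (chart_at p) i p *m v.

(* Natural coordinates (x, y) on T*M over chart i, and their inverse. *)
Definition cot_coord (i : chart_index M) (z : M * 'cV[R]_n) : 'cV[R]_(n + n) :=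
  col_mx (chart i z.1) ((tchg i (chart_at z.1) z.1)^T *m z.2).

Definition cot_point (i : chart_index M) (u : 'cV[R]_(n + n)) : M * 'cV[R]_n :=
  let p := chart_inv i (usubmx u) in
  (p, (tchg (chart_at p) i p)^T *m dsubmx u).

(* Gram matrix at q of the metric tensor G in the coordinates of chart i. *)
Definition metric_coord (G : M -> 'M[R]_n) (i : chart_index M) (q : 'cV[R]_n) :
    'M[R]_n :=
  let p := chart_inv i q in
  let T := tchg i (chart_at p) p in T^T *m G p *m T.

End Manifold.

(* [metric p] is the Gram matrix of the inner product of T_pM; it is also the
   matrix of the induced isomorphism g(p) : T_pM -> T_p*M. *)
Record riemannian_metric (R : realType) (n : nat) (M : smooth_manifold R n) :=
  RiemannianMetric {
  metric :> M -> 'M[R]_n;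
  metric_sym : forall p, (metric p)^T = metric p;
  metric_pos : forall p (v : 'cV[R]_n),
    v != 0 -> 0 < (v^T *m metric p *m v) ord0 ord0;
  metric_smooth : forall i k l,
    smooth_on (img i) (fun q => metric_coord metric i q k l)
}.

(* Tensor calculus in a coordinate patch with metric coefficients G. *)
Section LocalGeometry.
Variables (R : realType) (n : nat) (G : 'cV[R]_n -> 'M[R]_n).

Definition christoffel (k a b : 'I_n) (q : 'cV[R]_n) : R :=
  2^-1 * \sum_l invmx (G q) k l *
    (pd a (fun u => G u l b) q + pd b (fun u => G u l a) q
     - pd l (fun u => G u a b) q).

Definition christoffel_form (q v w : 'cV[R]_n) : 'cV[R]_n :=
  \col_k \sum_a \sum_b christoffel k a b q * v a ord0 * w b ord0.

(* R(e_a, e_b) e_c = \sum_d (riem_coef d a b c) e_d, where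
   R(X, Y) Z = \nabla_X \nabla_Y Z - \nabla_Y \nabla_X Z - \nabla_[X, Y] Z. *)
Definition riem_coef (d a b c : 'I_n) (q : 'cV[R]_n) : R :=
  pd a (christoffel d b c) q - pd b (christoffel d a c) q
  + \sum_e (christoffel d a e q * christoffel e b c q
            - christoffel d b e q * christoffel e a c q).

Definition riemann (q X Y Z : 'cV[R]_n) : 'cV[R]_n :=
  \col_d \sum_a \sum_b \sum_c
    riem_coef d a b c q * X a ord0 * Y b ord0 * Z c ord0.

Definition gradient (f : 'cV[R]_n -> R) (q : 'cV[R]_n) : 'cV[R]_n :=
  invmx (G q) *m \col_k pd k f q.

Definition cov_gradient (f : 'cV[R]_n -> R) (q v : 'cV[R]_n) : 'cV[R]_n :=
  jac (gradient f) q *m v + christoffel_form q v (gradient f q).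

(* Matrix of w |-> (\sum_(a, l) christoffel l a k * w_a * y_l)_k: along a curve
   in T*M, (\nabla_t y)_k = y_k' - \sum_(a, l) christoffel l a k * x_a' * y_l. *)
Definition cot_connection (q y : 'cV[R]_n) : 'M[R]_n :=
  \matrix_(k, a) \sum_l christoffel l a k q * y l ord0.

End LocalGeometry.

(* Functions on S^1 = R/Z are 1-periodic functions on R. *)
Definition periodic1 (R : realType) (T : Type) (f : R -> T) : Prop :=
  forall t, f (t + 1) = f t.

Section Loops.
Variables (R : realType) (n : nat) (M : smooth_manifold R n).
Variable (g : riemannian_metric M).
Implicit Types (x : R -> M) (xi eta zeta : R -> 'cV[R]_n) (V : R -> M -> R).

Local Notation gloc := (metric_coord g).
Local Notation leb := (@lebesgue_measure R).

Definition smooth_potential V : Prop :=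
  periodic1 V /\
  forall i : chart_index M,
    smooth_on [set u : 'cV[R]_(1 + n) | img i (dsubmx u)]
      (fun u => V (usubmx u ord0 ord0) (chart_inv i (dsubmx u))).

Definition smooth_loop x : Prop :=
  [/\ periodic1 x, continuous x &
      forall i, smooth_curve_on (x @^-1` dom i) (fun t => chart i (x t))].

Definition velocity x (t : R) : 'cV[R]_n :=
  derive1 (fun s => chart (chart_at (x t)) (x s)) t.

Definition cov_deriv x xi (t : R) : 'cV[R]_n :=
  let i := chart_at (x t) in
  derive1 (fun s => vcoord i (x s) (xi s)) t
  + christoffel_form (gloc i) (chart i (x t)) (velocity x t) (xi t).

Definition gradV V (t : R) (p : M) : 'cV[R]_n :=
  let i := chart_at p in
  gradient (gloc i) (fun q => V t (chart_inv i q)) (chart i p).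

Definition cov_gradV V (t : R) (p : M) (v : 'cV[R]_n) : 'cV[R]_n :=
  let i := chart_at p in
  cov_gradient (gloc i) (fun q => V t (chart_inv i q)) (chart i p) v.

Definition curvature (p : M) (X Y Z : 'cV[R]_n) : 'cV[R]_n :=
  let i := chart_at p in riemann (gloc i) (chart i p) X Y Z.

Definition Crit V x : Prop :=
  smooth_loop x /\
  forall t, - cov_deriv x (velocity x) t - gradV V t (x t) = 0.

(* In dimension one, the elements of W^{1,2} are (represented by) the continuous
   functions that are integrals of their L^2 weak derivatives.  Being local,
   both conditions below are imposed on the compact intervals that x maps into
   the domain of one chart. *)
Definition in_chart x (i : chart_index M) (a b : R) : Prop :=
  a <= b /\ forall s, a <= s <= b -> dom i (x s).

Definition L2_field x xi : Prop :=
  forall i a b k, in_chart x i a b ->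
    let f := fun s => vcoord i (x s) (xi s) k ord0 in
    measurable_fun (`[a, b]%classic : set R) f /\
    leb.-integrable `[a, b]%classic (EFin \o (fun s => f s ^+ 2)).

Definition weak_cov_deriv x xi eta : Prop :=
  forall i a b k, in_chart x i a b ->
    let d := fun s =>
      (vcoord i (x s) (eta s)
       - christoffel_form (gloc i) (chart i (x s))
           (derive1 (fun r => chart i (x r)) s) (vcoord i (x s) (xi s))) k ord0
    in
    leb.-integrable `[a, b]%classic (EFin \o d) /\
    vcoord i (x b) (xi b) k ord0 - vcoord i (x a) (xi a) k ord0
    = \int[leb]_(s in `[a, b]%classic) d s.

(* xi belongs to W^{2,2}(S^1, x^*TM), with first and second covariant
   derivatives eta and zeta. *)
Definition W22_field x xi eta zeta : Prop :=
  [/\ [/\ periodic1 xi, periodic1 eta & periodic1 zeta],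
      [/\ L2_field x xi, L2_field x eta & L2_field x zeta],
      weak_cov_deriv x xi eta &
      weak_cov_deriv x eta zeta].

(* Graph of A_x: xi is in W^{2,2} and A_x xi = f in L^2. *)
Definition A_op V x xi (f : R -> 'cV[R]_n) : Prop :=
  exists eta zeta, W22_field x xi eta zeta /\
    {ae leb, forall t,
      - zeta t - curvature (x t) (xi t) (velocity x t) (velocity x t)
      - cov_gradV V t (x t) (xi t) = f t}.

Definition nondegenerate_crit V x : Prop :=
  forall xi xi' f, A_op V x xi f -> A_op V x xi' f -> xi = xi'.

Definition A_eigenspace V x (lambda : R) : set (R -> 'cV[R]_n) :=
  [set xi | A_op V x xi (fun t => lambda *: xi t)].

Definition has_dim (E : set (R -> 'cV[R]_n)) (m : nat) : Prop :=
  exists b : 'I_m -> (R -> 'cV[R]_n),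
    (forall c : 'I_m -> R, E (fun t => \sum_j c j *: b j t)) /\
    (forall xi, E xi ->
       exists! c : 'I_m -> R, xi = (fun t => \sum_j c j *: b j t)).

Definition multiplicity V x (lambda : R) : nat :=
  xget 0%N [set m | has_dim (A_eigenspace V x lambda) m].

Definition Ind V x : nat :=
  \big[addn/0%N]_(lambda \in [set l : R | l < 0]) multiplicity V x lambda.

End Loops.

Section Hamiltonian.
Variables (R : realType) (n : nat) (M : smooth_manifold R n).
Variable (g : riemannian_metric M).
Implicit Types (V : R -> M -> R) (z : M * 'cV[R]_n).

Definition Ham V (t : R) z : R :=
  2^-1 * (z.2^T *m invmx (g z.1) *m z.2) ord0 ord0 + V t z.1.

(* \sum_i dx^i /\ dy_i *)
Definition omega_can (v w : 'cV[R]_(n + n)) : R :=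
  \sum_i (usubmx v i ord0 * dsubmx w i ord0 - dsubmx v i ord0 * usubmx w i ord0).

Definition ham_flow V (psi : R -> M * 'cV[R]_n -> M * 'cV[R]_n) : Prop :=
  forall z, [/\ psi 0 z = z, continuous (fun t => (psi t z).1) &
    forall t, let i := chart_at (psi t z).1 in
      let c := fun s => cot_coord i (psi s z) in
      derivable c t 1 /\
      forall w, omega_can (derive1 c t) w
                = 'D_w (fun u => Ham V t (cot_point i u)) (c t)].

(* Differential of f : T*M -> T*M at z, in the natural coordinates over the
   preferred charts at (the base points of) z and f z. *)
Definition cot_diff (f : M * 'cV[R]_n -> M * 'cV[R]_n) z : 'M[R]_(n + n) :=
  let i := chart_at z.1 in
  jac (fun u => cot_coord (chart_at (f z).1) (f (cot_point i u)))
    (cot_coord i z).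

(* T_zT*M -> T_pM + T_p*M for z = (p, y), with the natural coordinates over the
   preferred chart at p on the left-hand side. *)
Definition split_cot z : 'M[R]_(n + n) :=
  let i := chart_at z.1 in
  block_mx 1%:M 0
    (- cot_connection (metric_coord g i) (chart i z.1) z.2) 1%:M.

Definition orbit (x : R -> M) (t : R) : M * 'cV[R]_n :=
  (x t, g (x t) *m velocity x t).

End Hamiltonian.

Section Trivializations.
Variables (R : realType) (n : nat) (M : smooth_manifold R n).
Variable (g : riemannian_metric M).
Implicit Types (x : R -> M) (phi : R -> 'M[R]_n).

(* diag_n(a, b, ..., b) *)
Definition diagn (a b : R) : 'M[R]_n :=
  diag_mx (\row_(i < n) if (i : nat) == 0%N then a else b).

(* [phi t] : R^n -> T_(x t)M *)
Definition smooth_frame x phi : Prop :=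
  forall i, smooth_curve_on (x @^-1` dom i)
    (fun t => tchg (chart_at (x t)) i (x t) *m phi t).

Definition trivial_pullback x : Prop :=
  exists F : R -> 'M[R]_n,
    [/\ periodic1 F, smooth_frame x F & forall t, F t \in unitmx].

Definition sigma x : bool := ~~ `[< trivial_pullback x >].

Definition E_sigma x : 'M[R]_n := diagn ((-1) ^+ sigma x) 1.

(* A smooth orthonormal frame over [0, 1] extends to one over R, the values
   outside [0, 1] being irrelevant. *)
Definition adapted_frame x phi : Prop :=
  [/\ smooth_frame x phi,
      forall t, (phi t)^T *m g (x t) *m phi t = 1%:M &
      phi 1 = phi 0 *m E_sigma x].

Definition Umat (t : R) : 'M[R]_(n + n) :=
  block_mx (diagn (cos (pi * t)) 1) (diagn (- sin (pi * t)) 0)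
           (diagn (sin (pi * t)) 0) (diagn (cos (pi * t)) 1).

Definition Phi phi (t : R) : 'M[R]_(n + n) :=
  block_mx (phi t) 0 0 (invmx (phi t)^T).

Definition Phi_U x phi (t : R) : 'M[R]_(n + n) :=
  if sigma x then Phi phi t *m invmx (Umat t) else Phi phi t.

Definition gamma (psi : R -> M * 'cV[R]_n -> M * 'cV[R]_n) x phi (t : R) :
    'M[R]_(n + n) :=
  let z0 := orbit g x 0 in
  invmx (Phi_U x phi t)
  *m (split_cot g (psi t z0) *m cot_diff (psi t) z0 *m invmx (split_cot g z0))
  *m Phi_U x phi 0.

End Trivializations.

Section ConleyZehnder.
Variables (R : realType) (n : nat).
Implicit Types (A : 'M[R]_(n + n)) (beta : R -> 'M[R]_(n + n)).

Definition J0 : 'M[R]_(n + n) := block_mx 0 (- 1%:M) 1%:M 0.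

Definition omega0 (v w : 'cV[R]_(n + n)) : R :=
  ((J0 *m v)^T *m w) ord0 ord0.

Definition Sp A : Prop :=
  forall v w, omega0 (A *m v) (A *m w) = omega0 v w.

(* Number of positive minus number of negative eigenvalues, for symmetric S. *)
Definition sign m (S : 'M[R]_m) : int :=
  (\big[addn/0%N]_(a \in [set a : R | 0 < a]) \rank (eigenspace S a))%:Z
  - (\big[addn/0%N]_(a \in [set a : R | a < 0]) \rank (eigenspace S a))%:Z.

(* The rows of [fix_basis A] form a basis of ker (1 - A). *)
Definition fix_basis A := row_base (kermx (1%:M - A)^T).

Definition crossing beta (t : R) : Prop := kermx (1%:M - beta t)^T != 0.

Definition Smat beta (t : R) : 'M[R]_(n + n) :=
  J0 *m derive1 beta t *m invmx (beta t).

(* Gram matrix of the crossing form in the basis [fix_basis (beta t)]. *)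
Definition crossing_form beta (t : R) :=
  - (fix_basis (beta t) *m Smat beta t *m (fix_basis (beta t))^T).

(* A C^1 path on [0, 1] is the restriction of a C^1 map on R; which extension is
   chosen does not affect the derivatives on [0, 1]. *)
Definition regular_path beta : Prop :=
  [/\ forall t, derivable beta t 1, continuous (derive1 beta) &
      forall t, 0 <= t <= 1 -> crossing beta t ->
        crossing_form beta t \in unitmx].

Definition crossing_index beta : rat :=
  2^-1 * (sign (crossing_form beta 0))%:~R
  + (\sum_(t \in [set t : R | 0 < t < 1 /\ crossing beta t])
       sign (crossing_form beta t))%:~R.

Definition sp_homotopic (gam beta : R -> 'M[R]_(n + n)) : Prop :=
  exists h : R * R -> 'M[R]_(n + n),
    [/\ {within (`[0, 1]%classic `*` `[0, 1]%classic : set (R * R)),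
          continuous h},
        forall s t, 0 <= s <= 1 -> 0 <= t <= 1 -> Sp (h (s, t)),
        forall t, 0 <= t <= 1 -> h (0, t) = gam t /\ h (1, t) = beta t &
        forall s, 0 <= s <= 1 -> h (s, 0) = gam 0 /\ h (s, 1) = gam 1].

(* Meaningful for continuous gam : [0, 1] -> Sp(2n) with gam 0 = 1 and
   det (1 - gam 1) != 0. *)
Definition mu_CZ (gam : R -> 'M[R]_(n + n)) : rat :=
  xget 0 [set m | exists beta,
    [/\ regular_path beta, sp_homotopic gam beta & crossing_index beta = m]].

End ConleyZehnder.

(* Main.v *)
(* In the frame phi the linearised flow solves Y' = [[- B, 1], [- Q, - B]] Y with
   B skew and Q symmetric, so gamma = rot Y, where rot is the rotation U if x^*TM is
   nontrivial and 1 otherwise. Replacing Q by Q + lam gives a pencil Y_lam such that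
   ker (1 - rot(1) Y_lam(1)) is isomorphic to ker (A_x - lam), A_x being the operator
   - (d/dt + B)^2 - Q with boundary condition twisted by E_sigma. The path gamma is
   homotopic to one that ends with lam |-> rot(1) Y_lam(1), lam increasing from - K to
   0; before that, it leaves the identity along a hyperbolic one-parameter group,
   except for a rotation by pi in one plane when x^*TM is nontrivial, and has no
   other crossing. On the last piece every crossing form is negative definite, so
   each negative eigenvalue contributes minus its multiplicity; the initial crossing
   contributes 0, or 1 when x^*TM is nontrivial.

   The Conley-Zehnder index is well defined on homotopy classes because twice the
   crossing index is the difference, between the end and the start of the path, of
   the signatures of symmetric matrices: those of a discrete action functional whose
   kernel at time t is ker (1 - gamma(t)). *)

Require Import Defs.
From HB Require Import structures.
From mathcomp Require Import all_boot all_order all_algebra.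
From mathcomp Require Import all_classical all_reals all_analysis.
From mathcomp Require Import spectral mxred.
From mathcomp Require complex.
From mathcomp Require Import ring lra zify measurable_realfun.
Import Order.TTheory GRing.Theory Num.Theory.
Import numFieldNormedType.Exports.
Set Implicit Arguments.
Unset Strict Implicit.
Unset Printing Implicit Defensive.
Local Open Scope classical_set_scope.
Local Open Scope ring_scope.

(** * Entrywise calculus of matrix-valued functions *)

Section MatrixFunctions.
Variable R : realType.

(** [mu_CZ] picks a value with [xget], so evaluating it on a convenient path presupposes that all
    regular paths in a homotopy class have the same crossing index. Intermediate paths of a homotopy
    are merely continuous and have no crossing forms to follow; the discrete action, which only
    samples the path, makes sense for them and stays nondegenerate as long as the end point has no
    eigenvalue 1. [ham_flow] provides orbits but says nothing about differentiability in the initial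
    point. The derivative of the flow is obtained by comparing neighbouring orbits with Gronwall
    estimates inside charts. This is done for Newton's equation on TM, where the variational
    equation becomes the Jacobi equation once Christoffel terms are collected into curvature. The
    definiteness in the last stage has one source: at a fixed vector, the derivative of [Y_lam(1)]
    in lam, paired through J, is the integral over a period of the squared position component, and
    this vanishes only for the zero solution. Eigenspaces of [A_x] are defined through weak
    derivatives; in dimension one a weak eigenfield is automatically a classical solution, so it is
    determined by an initial value in the fixed space of a matrix. *)

Lemma mxaddE m n (A B : 'M[R]_(m, n)) i j : (A + B) i j = A i j + B i j.
Proof. by rewrite mxE. Qed.

Lemma mxoppE m n (A : 'M[R]_(m, n)) i j : (- A) i j = - A i j.
Proof. by rewrite mxE. Qed.

Lemma mxscaleE m n a (A : 'M[R]_(m, n)) i j : (a *: A) i j = a * A i j.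
Proof. by rewrite mxE. Qed.

(** Continuity at a point, derivability and [Ck_on] all define subalgebras of functions. Products,
    determinants and adjugates of matrices are polynomial in the entries, so they are treated once
    for all three; inverses then follow from Cramer's formula. *)
Definition alg_closed (T : Type) (P : (T -> R) -> Prop) :=
  [/\ forall c, P (fun=> c),
      forall f g, P f -> P g -> P (fun s => f s + g s) &
      forall f g, P f -> P g -> P (fun s => f s * g s)].

Lemma alg_sum (T I : Type) (P : (T -> R) -> Prop) (r : seq I) (Q : pred I)
    (f : I -> T -> R) :
  alg_closed P -> (forall i, P (f i)) -> P (fun s => \sum_(i <- r | Q i) f i s).
Proof.
move=> [Pc PD PM] Pf; elim: r => [|i r IH].
  by under eq_fun do rewrite big_nil; exact: Pc.
under eq_fun do rewrite big_cons.
by case: (Q i) => //; exact: PD.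
Qed.

Lemma alg_prod (T I : Type) (P : (T -> R) -> Prop) (r : seq I) (Q : pred I)
    (f : I -> T -> R) :
  alg_closed P -> (forall i, P (f i)) -> P (fun s => \prod_(i <- r | Q i) f i s).
Proof.
move=> [Pc PD PM] Pf; elim: r => [|i r IH].
  by under eq_fun do rewrite big_nil; exact: Pc.
under eq_fun do rewrite big_cons.
by case: (Q i) => //; exact: PM.
Qed.

Lemma alg_mulmx (T : Type) (P : (T -> R) -> Prop) m n p
    (F : T -> 'M[R]_(m, n)) (G : T -> 'M[R]_(n, p)) :
  alg_closed P -> (forall i j, P (fun s => F s i j)) ->
  (forall i j, P (fun s => G s i j)) ->
  forall i j, P (fun s => (F s *m G s) i j).
Proof.
move=> Pa PF PG i j; under eq_fun do rewrite mxE.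
by apply: alg_sum => // k; case: Pa => _ _; apply.
Qed.

Lemma alg_det (T : Type) (P : (T -> R) -> Prop) n (F : T -> 'M[R]_n) :
  alg_closed P -> (forall i j, P (fun s => F s i j)) -> P (fun s => \det (F s)).
Proof.
move=> Pa PF; rewrite /determinant; apply: alg_sum => // s.
case: (Pa) => Pc _ PM; apply: (PM (fun=> _)); first exact: Pc.
exact: alg_prod.
Qed.

Lemma alg_adj (T : Type) (P : (T -> R) -> Prop) n (F : T -> 'M[R]_n) :
  alg_closed P -> (forall i j, P (fun s => F s i j)) ->
  forall i j, P (fun s => (\adj (F s)) i j).
Proof.
move=> Pa PF i j; under eq_fun do rewrite mxE /cofactor.
case: (Pa) => Pc _ PM; apply: (PM (fun=> _)); first exact: Pc.
apply: alg_det => // k l; under eq_fun do rewrite !mxE; exact: PF.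
Qed.

Lemma invmxE n (A : 'M[R]_n) : A \in unitmx ->
  forall i j, invmx A i j = (\det A)^-1 * (\adj A) i j.
Proof. by move=> Au i j; rewrite /invmx Au mxE. Qed.

(** Entrywise convergence, so that scalar limit lemmas apply directly; [mctsP] identifies it with
    continuity for the matrix topology. *)
Definition mcts (T : topologicalType) m n (F : T -> 'M[R]_(m, n)) (t : T) :=
  forall i j, (fun s => F s i j) @ t --> F t i j.

Lemma mctsP (T : topologicalType) m n (F : T -> 'M[R]_(m, n)) (t : T) :
  mcts F t <-> {for t, continuous F}.
Proof.
split=> [cF|cF i j].
  move=> A [P PF sPA]; rewrite nbhs_filterE /=.
  suff : \forall s \near t, forall i j, P i j (F s i j).
    by apply: filterS => s Ps; exact: sPA.
  apply: filter_forall => i; apply: filter_forall => j.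
  exact: (cF i j _ (PF i j)).
exact: (@continuous_comp _ _ _ F (fun A => A i j) t cF (@coord_continuous _ _ _ _ _ _)).
Qed.

Lemma cts_alg_closed (T : topologicalType) (t : T) :
  alg_closed (fun f : T -> R => f @ t --> f t).
Proof.
split=> [c|f g cf cg|f g cf cg]; first exact: cvg_cst.
  exact: (cvgD cf cg).
exact: (cvgM cf cg).
Qed.

Lemma cvg_to_pair (T U V : topologicalType) (f : T -> U) (g : T -> V) (t : T) :
  f @ t --> f t -> g @ t --> g t -> (fun s => (f s, g s)) @ t --> (f t, g t).
Proof.
move=> cf cg.
exact: (@cvg_pair _ _ _ (nbhs t) (nbhs (f t)) (nbhs (g t)) _ _ _ f g cf cg).
Qed.

Lemma cts_sum (T : topologicalType) (I : Type) (r : seq I) (f : I -> T -> R) (t : T) :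
  (forall k, f k @ t --> f k t) ->
  (fun s => \sum_(k <- r) f k s) @ t --> \sum_(k <- r) f k t.
Proof.
move=> cf; elim: r => [|k r IH].
  by under eq_fun do rewrite big_nil; rewrite big_nil; exact: cvg_cst.
under eq_fun do rewrite big_cons; rewrite big_cons; exact: (cvgD (cf k) IH).
Qed.

Lemma mcts_cst (T : topologicalType) m n (A : 'M[R]_(m, n)) (t : T) :
  mcts (fun=> A) t.
Proof. by move=> i j; exact: cvg_cst. Qed.

Lemma mctsD (T : topologicalType) m n (F G : T -> 'M[R]_(m, n)) (t : T) :
  mcts F t -> mcts G t -> mcts (fun s => F s + G s) t.
Proof.
move=> cF cG i j; rewrite mxE; under eq_fun do rewrite mxE.
exact: (cvgD (cF i j) (cG i j)).
Qed.

Lemma mctsN (T : topologicalType) m n (F : T -> 'M[R]_(m, n)) (t : T) :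
  mcts F t -> mcts (fun s => - F s) t.
Proof. by move=> cF i j; rewrite mxE; under eq_fun do rewrite mxE; exact: (cvgN (cF i j)). Qed.

Lemma mctsB (T : topologicalType) m n (F G : T -> 'M[R]_(m, n)) (t : T) :
  mcts F t -> mcts G t -> mcts (fun s => F s - G s) t.
Proof. by move=> cF cG; apply: mctsD => //; exact: mctsN. Qed.

Lemma mctsZ (T : topologicalType) m n (f : T -> R) (F : T -> 'M[R]_(m, n)) (t : T) :
  f @ t --> f t -> mcts F t -> mcts (fun s => f s *: F s) t.
Proof.
move=> cf cF i j; rewrite mxE; under eq_fun do rewrite mxE.
exact: (cvgM cf (cF i j)).
Qed.

Lemma mctsM (T : topologicalType) m n p (F : T -> 'M[R]_(m, n))
    (G : T -> 'M[R]_(n, p)) (t : T) :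
  mcts F t -> mcts G t -> mcts (fun s => F s *m G s) t.
Proof. by move=> cF cG; exact: (alg_mulmx (cts_alg_closed t) cF cG). Qed.

Lemma mcts_tr (T : topologicalType) m n (F : T -> 'M[R]_(m, n)) (t : T) :
  mcts F t -> mcts (fun s => (F s)^T) t.
Proof. by move=> cF i j; rewrite mxE; under eq_fun do rewrite mxE; exact: cF. Qed.

Lemma mcts_block (T : topologicalType) m1 m2 n1 n2
    (A : T -> 'M[R]_(m1, n1)) (B : T -> 'M[R]_(m1, n2))
    (C : T -> 'M[R]_(m2, n1)) (D : T -> 'M[R]_(m2, n2)) (t : T) :
  mcts A t -> mcts B t -> mcts C t -> mcts D t ->
  mcts (fun s => block_mx (A s) (B s) (C s) (D s)) t.
Proof.
move=> cA cB cC cD i j; rewrite -[i]splitK -[j]splitK.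
by case: (fintype.split i) => i'; case: (fintype.split j) => j' /=;
  rewrite ?block_mxEul ?block_mxEur ?block_mxEdl ?block_mxEdr;
  under eq_fun do rewrite ?block_mxEul ?block_mxEur ?block_mxEdl ?block_mxEdr;
  first [exact: cA|exact: cB|exact: cC|exact: cD].
Qed.

Lemma near_unitmx (T : topologicalType) n (F : T -> 'M[R]_n) (t : T) :
  mcts F t -> F t \in unitmx -> \forall s \near t, F s \in unitmx.
Proof.
move=> cF Fu.
have cdet : (fun s => \det (F s)) @ t --> \det (F t).
  by exact: (alg_det (cts_alg_closed t) cF).
have d0 : \det (F t) != 0 by move: Fu; rewrite unitmxE unitfE.
have H : \forall s \near t, \det (F s) != 0.
  exact: (cdet _ (open_nbhs_nbhs (conj (@open_neq R 0) d0))).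
by apply: filterS H => s ds; rewrite unitmxE unitfE.
Qed.

Lemma mcts_near_eq (T : topologicalType) m n (F G : T -> 'M[R]_(m, n)) (t : T) :
  (\forall s \near t, F s = G s) -> mcts F t -> mcts G t.
Proof.
move=> FG cF i j; have FGt := nbhs_singleton FG.
apply: (@cvg_trans _ ((fun s => F s i j) @ t)).
  by apply: near_eq_cvg; apply: filterS FG => s ->.
by rewrite -FGt; exact: cF.
Qed.

Lemma mctsV (T : topologicalType) n (F : T -> 'M[R]_n) (t : T) :
  mcts F t -> F t \in unitmx -> mcts (fun s => invmx (F s)) t.
Proof.
move=> cF Fu.
apply: (@mcts_near_eq _ _ _ (fun s => (\det (F s))^-1 *: \adj (F s))).
  by apply: filterS (near_unitmx cF Fu) => s Fs; rewrite /invmx Fs.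
apply: mctsZ; last exact: (alg_adj (cts_alg_closed t) cF).
apply: cvgV; first by move: Fu; rewrite unitmxE unitfE.
by exact: (alg_det (cts_alg_closed t) cF).
Qed.

Lemma mcts_comp (T T' : topologicalType) m n (F : T' -> 'M[R]_(m, n)) (f : T -> T')
    (t : T) :
  f @ t --> f t -> mcts F (f t) -> mcts (fun s => F (f s)) t.
Proof. by move=> cf cF i j; exact: (cvg_comp _ _ cf (cF i j)). Qed.

(** Asserts differentiability together with the value of the derivative, which the total function
    [derive1] does not. *)
Definition dmx m n (F : R -> 'M[R]_(m, n)) (t : R) (D : 'M[R]_(m, n)) : Prop :=
  forall i j, is_derive t (1 : R) (fun s => F s i j) (D i j).

Lemma dmx_derive1 m n (F : R -> 'M[R]_(m, n)) t D :
  dmx F t D -> derivable F t 1 /\ derive1 F t = D.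
Proof.
move=> dF; have dF' : derivable F t 1.
  by apply/derivable_mxP => i j; have := dF i j; case.
split=> //; rewrite derive1E derive_mx //; apply/matrixP => i j; rewrite mxE.
by have := dF i j => dFij; rewrite derive_val.
Qed.

Lemma derivable_dmx m n (F : R -> 'M[R]_(m, n)) (t : R) :
  derivable F t 1 -> dmx F t (derive1 F t).
Proof.
move=> dF i j; rewrite derive1E derive_mx // mxE.
by apply: derivableP; exact: ((derivable_mxP F t 1).1 dF i j).
Qed.

Lemma dmx_uniq m n (F : R -> 'M[R]_(m, n)) t D D' : dmx F t D -> dmx F t D' -> D = D'.
Proof. by move=> /dmx_derive1[_ <-] /dmx_derive1[_ <-]. Qed.

Lemma dmx_near_eq m n (F G : R -> 'M[R]_(m, n)) t D :
  (\forall s \near t, F s = G s) -> dmx F t D -> dmx G t D.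
Proof.
move=> FG dF i j; apply: near_eq_is_derive (dF i j).
by apply: filterS FG => s ->.
Qed.

Lemma dmx_mcts m n (F : R -> 'M[R]_(m, n)) t D : dmx F t D -> mcts F t.
Proof.
move=> dF i j; apply: differentiable_continuous; apply/derivable1_diffP.
by have := dF i j; case.
Qed.

Lemma dmx_cst m n (A : 'M[R]_(m, n)) t : dmx (fun=> A) t 0.
Proof. by move=> i j; rewrite mxE; exact: is_derive_cst. Qed.

Lemma dmxD m n (F G : R -> 'M[R]_(m, n)) t D E :
  dmx F t D -> dmx G t E -> dmx (fun s => F s + G s) t (D + E).
Proof.
move=> dF dG i j; under eq_fun do rewrite mxE; rewrite mxE.
exact: (is_deriveD (dF i j) (dG i j)).
Qed.

Lemma dmxN m n (F : R -> 'M[R]_(m, n)) t D :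
  dmx F t D -> dmx (fun s => - F s) t (- D).
Proof.
move=> dF i j; under eq_fun do rewrite mxE; rewrite mxE.
exact: (is_deriveN (dF i j)).
Qed.

Lemma dmxB m n (F G : R -> 'M[R]_(m, n)) t D E :
  dmx F t D -> dmx G t E -> dmx (fun s => F s - G s) t (D - E).
Proof. by move=> dF dG; apply: dmxD => //; exact: dmxN. Qed.

Lemma is_derive_sumfin (I : Type) (r : seq I) (f : I -> R -> R) t (d : I -> R) :
  (forall i, is_derive t (1 : R) (f i) (d i)) ->
  is_derive t (1 : R) (fun s => \sum_(i <- r) f i s) (\sum_(i <- r) d i).
Proof.
move=> df; elim: r => [|i r IH].
  by under eq_fun do rewrite big_nil; rewrite big_nil; exact: is_derive_cst.
under eq_fun do rewrite big_cons; rewrite big_cons; exact: (is_deriveD (df i) IH).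
Qed.

Lemma dmxM m n p (F : R -> 'M[R]_(m, n)) (G : R -> 'M[R]_(n, p)) t D E :
  dmx F t D -> dmx G t E -> dmx (fun s => F s *m G s) t (D *m G t + F t *m E).
Proof.
move=> dF dG i j; under eq_fun do rewrite mxE; rewrite !mxE -big_split /=.
apply: is_derive_sumfin => k.
apply: is_derive_eq; first exact: (is_deriveM (dF i k) (dG k j)).
by rewrite addrC /GRing.scale /=; congr (_ + _); rewrite mulrC.
Qed.

Lemma dmxZ m n (f : R -> R) (F : R -> 'M[R]_(m, n)) t d D :
  is_derive t (1 : R) f d -> dmx F t D ->
  dmx (fun s => f s *: F s) t (d *: F t + f t *: D).
Proof.
move=> df dF i j; under eq_fun do rewrite mxE; rewrite !mxE.
apply: is_derive_eq; first exact: (is_deriveM df (dF i j)).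
by rewrite addrC /GRing.scale /=; congr (_ + _); rewrite mulrC.
Qed.

Lemma dmx_tr m n (F : R -> 'M[R]_(m, n)) t D : dmx F t D -> dmx (fun s => (F s)^T) t D^T.
Proof. by move=> dF i j; under eq_fun do rewrite mxE; rewrite mxE; exact: dF. Qed.

Lemma dmx_block m1 m2 n1 n2
    (A : R -> 'M[R]_(m1, n1)) (B : R -> 'M[R]_(m1, n2))
    (C : R -> 'M[R]_(m2, n1)) (D : R -> 'M[R]_(m2, n2)) t A' B' C' D' :
  dmx A t A' -> dmx B t B' -> dmx C t C' -> dmx D t D' ->
  dmx (fun s => block_mx (A s) (B s) (C s) (D s)) t (block_mx A' B' C' D').
Proof.
move=> dA dB dC dD i j; rewrite -[i]splitK -[j]splitK.
by case: (fintype.split i) => i'; case: (fintype.split j) => j' /=;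
  rewrite ?block_mxEul ?block_mxEur ?block_mxEdl ?block_mxEdr;
  under eq_fun do rewrite ?block_mxEul ?block_mxEur ?block_mxEdl ?block_mxEdr.
Qed.

Lemma dmx_col m1 m2 n (A : R -> 'M[R]_(m1, n)) (B : R -> 'M[R]_(m2, n)) t A' B' :
  dmx A t A' -> dmx B t B' ->
  dmx (fun s => col_mx (A s) (B s)) t (col_mx A' B').
Proof.
move=> dA dB i j; rewrite -[i]splitK.
by case: (fintype.split i) => i' /=; under eq_fun do rewrite ?col_mxEu ?col_mxEd;
  rewrite ?col_mxEu ?col_mxEd.
Qed.

Lemma dmx_usub m1 m2 n (A : R -> 'M[R]_(m1 + m2, n)) t A' :
  dmx A t A' -> dmx (fun s => usubmx (A s)) t (usubmx A').
Proof. by move=> dA i j; under eq_fun do rewrite mxE; rewrite mxE. Qed.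

Lemma dmx_dsub m1 m2 n (A : R -> 'M[R]_(m1 + m2, n)) t A' :
  dmx A t A' -> dmx (fun s => dsubmx (A s)) t (dsubmx A').
Proof. by move=> dA i j; under eq_fun do rewrite mxE; rewrite mxE. Qed.

Lemma is_derive_mulr (c t : R) : is_derive t (1 : R) (fun s => s * c) c.
Proof.
have -> : (fun s => s * c) = c \*: (@id R) by apply/funext => s; rewrite /= mulrC.
by apply: is_derive_eq; rewrite /GRing.scale /= mulr1.
Qed.

Lemma dmx_comp m n (F : R -> 'M[R]_(m, n)) (f : R -> R) t d D :
  is_derive t (1 : R) f d -> dmx F (f t) D -> dmx (fun s => F (f s)) t (d *: D).
Proof.
move=> df dF i j; rewrite mxE.
have [dfa fE] := df; have [dFa FE] := dF i j.
have := derive1_comp dfa dFa; rewrite !derive1E fE FE => E.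
apply: DeriveDef; last by rewrite E mulrC.
apply/derivable1_diffP; apply: (@differentiable_comp _ _ _ _ f (fun s => F s i j));
  exact/derivable1_diffP.
Qed.

Lemma dmx_opp m n (F : R -> 'M[R]_(m, n)) t D :
  dmx F t D -> dmx (fun s => F (- s)) (- t) (- D).
Proof.
move=> dF; rewrite -[- D]scaleN1r.
by apply: (dmx_comp (f := fun s => - s)); rewrite opprK.
Qed.

Lemma derivable_alg_closed (t : R) :
  alg_closed (fun f : R -> R => derivable f t 1).
Proof.
split=> [c|f g df dg|f g df dg]; first exact: derivable_cst.
  exact: (derivableD df dg).
exact: (derivableM df dg).
Qed.

(** Cramer's formula gives derivability; the value then comes from differentiating
    [F *m invmx F = 1] near [t]. *)
Lemma dmxV n (F : R -> 'M[R]_n) t D :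
  dmx F t D -> F t \in unitmx ->
  dmx (fun s => invmx (F s)) t (- (invmx (F t) *m D *m invmx (F t))).
Proof.
move=> dF Fu; have FU := near_unitmx (dmx_mcts dF) Fu.
have dF' i j : derivable (fun s => F s i j) t 1 by have := dF i j; case.
have dV : derivable (fun s => invmx (F s)) t 1.
  apply/derivable_mxP => i j.
  apply: (@near_eq_derivable _ _ _ (fun s => (\det (F s))^-1 * \adj (F s) i j)).
    by apply: filterS FU => s Fs; rewrite /= invmxE.
  apply: derivableM.
    apply: derivableV; first by move: Fu; rewrite unitmxE unitfE.
    exact: (alg_det (derivable_alg_closed t)).
  exact: (alg_adj (derivable_alg_closed t)).
have dV' := derivable_dmx dV.
have H : dmx (fun s => F s *m invmx (F s)) t 0.
  apply: dmx_near_eq (dmx_cst 1%:M t).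
  by apply: filterS FU => s Fs; rewrite mulmxV.
have := dmx_uniq (dmxM dF dV') H => /eqP; rewrite addrC addr_eq0 => /eqP E.
suff -> : - (invmx (F t) *m D *m invmx (F t)) = derive1 (fun s => invmx (F s)) t by [].
have := congr1 (mulmx (invmx (F t))) E; rewrite mulmxA mulVmx // mul1mx => ->.
by rewrite mulmxN mulmxA.
Qed.

End MatrixFunctions.

(** * Signature of symmetric matrices *)

Section SymmetricMatrices.
Import complex.
Variable R : realType.

(** The spectral theorem is applied over [R[i]]; both the matrix and its diagonal form are real, and
    a complex similarity between real matrices can be replaced by a real one. The resulting [Q] is
    invertible but not known to be orthogonal, which shapes the next lemmas. *)
Lemma symmetric_diagonalizable m (S : 'M[R]_m) : S^T = S ->
  exists (Q : 'M[R]_m) (d : 'rV[R]_m),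
    Q \in unitmx /\ Q *m S = diag_mx d *m Q.
Proof.
move=> Ssym; pose f : {rmorphism R -> R[i]} := real_complex R.
pose A : 'M[R[i]]_m := map_mx f S.
have Areal : A \is a mxOver Num.real.
  by apply/mxOverP => i j; rewrite mxE complex_real.
have Asym : A \is symmetricmx.
  by apply/is_hermitianmxP; rewrite expr0 scale1r map_mx_id // /A map_trmx Ssym.
have Aherm := realsym_hermsym Asym Areal.
have /orthomx_spectralP /= AE := hermitian_normalmx Aherm.
have Dreal : diag_mx (spectral_diag A) \is a mxOver Num.real.
  have /mxOverP dr := hermitian_spectral_diag_real Aherm.
  by apply/mxOverP => i j; rewrite mxE; case: eqP => _; rewrite ?mulr1n ?mulr0n.
have Pu := spectral_unit A.
have AD : similar (spectralmx A) A (diag_mx (spectral_diag A)).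
  apply/similarP => //.
  by rewrite {2}AE !mulmxA mulmxV // mul1mx.
have [P /andP[/mxOverP Preal Punit]] :=
  real_similar (ex_intro2 (fun P => is_true (P \in unitmx)) _ _ Pu AD) Areal Dreal.
move=> /(similarP Punit) E.
pose g := map_mx (@complex.Re R) : 'M[R[i]]_m -> 'M[R]_m.
have PE : map_mx f (g P) = P.
  by apply/matrixP => i j; rewrite !mxE; apply/esym/eqP; rewrite eq_complex /= eqxx /=;
    move: (Preal i j); case: (P i j) => a b; rewrite complex_real.
have DE : map_mx f (diag_mx (map_mx (@complex.Re R) (spectral_diag A)))
    = diag_mx (spectral_diag A).
  move/mxOverP: Dreal => Dreal.
  apply/matrixP => i j; rewrite !mxE; case: (eqVneq i j) => [->|_].
    rewrite !mulr1n; move: (Dreal j j); rewrite !mxE eqxx mulr1n.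
    by case: (spectral_diag A 0 j) => a b; rewrite complex_real => /eqP ->.
  by rewrite !mulr0n.
exists (g P), (map_mx (@complex.Re R) (spectral_diag A)); split.
  by rewrite -(map_unitmx f) PE.
by apply: (@map_mx_inj _ _ f); rewrite !map_mxM /= PE DE.
Qed.

End SymmetricMatrices.

Section Signature.
Variable R : realType.

Lemma rank_diag_mx m (d : 'rV[R]_m) :
  \rank (diag_mx d) = (\sum_i ((d ord0 i != 0)%R : nat))%N.
Proof.
elim: m d => [|m IH] d; first by rewrite big_ord0 flatmx0 mxrank0.
rewrite big_ord_recl.
have E : (diag_mx d : 'M[R]_(1 + m))
    = block_mx (d 0 0)%:M 0 0 (diag_mx (rsubmx (d : 'rV[R]_(1 + m)))).
  apply/matrixP => i j; rewrite -(splitK i) -(splitK j).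
  case: (fintype.split i) => i'; case: (fintype.split j) => j' /=;
    rewrite ?block_mxEul ?block_mxEur ?block_mxEdl ?block_mxEdr !mxE ?ord1 //.
  by rewrite !eqxx; congr (d _ _ *+ _); exact: val_inj.
rewrite (etrans (congr1 (@mxrank _ _ _) E) (rank_diag_block_mx _ _)) IH.
congr (_ + _)%N.
  have [->|d0] := eqVneq (d 0 0) 0; first by rewrite raddf0 mxrank0.
  by rewrite -scalemx1 mxrank_scale_nz // mxrank1.
apply: eq_bigr => i _; rewrite mxE; congr (nat_of_bool (d _ _ != _)); exact: val_inj.
Qed.

Lemma rank_eigenspace_diag m (S Q : 'M[R]_m) (d : 'rV[R]_m) (a : R) :
  Q \in unitmx -> Q *m S = diag_mx d *m Q ->
  \rank (eigenspace S a) = (\sum_i ((d ord0 i == a)%R : nat))%N.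
Proof.
move=> Qu QS; rewrite /eigenspace mxrank_ker.
have Qf : row_free Q by rewrite row_free_unit.
have -> : \rank (S - a%:M) = \rank (diag_mx (d - const_mx a)).
  rewrite -(mxrankMfree (diag_mx (d - const_mx a)) Qf).
  rewrite raddfB /= diag_const_mx mulmxBl -QS -scalar_mxC -mulmxBr.
  by rewrite eqmxMfull // row_full_unit.
rewrite rank_diag_mx -[X in (X - _)%N]card_ord -sum1_card -sumnB; last first.
  by move=> i _; case: (_ != _).
by apply: eq_bigr => i _; rewrite !mxE subr_eq0; case: (_ == _).
Qed.

Lemma sum_rank_eigenspace m (S Q : 'M[R]_m) (d : 'rV[R]_m) (p : pred R) :
  Q \in unitmx -> Q *m S = diag_mx d *m Q ->
  \big[addn/0%N]_(a \in [set a | p a]) \rank (eigenspace S a)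
  = #|[pred i | p (d ord0 i)]|.
Proof.
move=> Qu QS; pose r := [seq a <- undup [seq d ord0 i | i <- enum 'I_m] | p a].
have ru : uniq r by rewrite filter_uniq // undup_uniq.
rewrite -(@fsbig_widen _ _ _ _ [set` r]); first last.
- move=> a [/= pa /negP]; rewrite mem_filter pa /= mem_undup => ar.
  rewrite (rank_eigenspace_diag a Qu QS) big1 // => i _.
  case: eqP => // E; case/negP: ar; apply/mapP; exists i; rewrite ?mem_enum //.
- by move=> a /=; rewrite mem_filter => /andP[].
rewrite -fsbig_seq // -sum1_card.
under eq_bigr do rewrite (rank_eigenspace_diag _ Qu QS).
rewrite exchange_big /= [RHS]big_mkcond /=; apply: eq_bigr => i _.
rewrite inE; case: ifP => pi.
  rewrite (bigD1_seq (d ord0 i)) //= ?eqxx.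
    by rewrite big1 // => a ai; rewrite eq_sym (negPf ai).
  rewrite mem_filter pi mem_undup; apply: map_f; by rewrite mem_enum.
rewrite big1_seq // => a; rewrite mem_filter => /andP[_ /andP[pa _]].
by case: eqP => // E; rewrite E pa in pi.
Qed.

Lemma sign_diagE m (S Q : 'M[R]_m) (d : 'rV[R]_m) :
  Q \in unitmx -> Q *m S = diag_mx d *m Q ->
  sign S = #|[pred i | 0 < d ord0 i]|%:Z - #|[pred i | d ord0 i < 0]|%:Z.
Proof.
move=> Qu QS; rewrite /sign.
by rewrite (sum_rank_eigenspace (fun a => 0 < a) Qu QS)
  (sum_rank_eigenspace (fun a => a < 0) Qu QS).
Qed.

(** Substitute for the orthogonality of [Q]: by symmetry of [S], [Q *m Q^T] commutes with the
    diagonal matrix of eigenvalues, hence preserves its eigenspaces and commutes with every function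
    of it, here the square root of the absolute value. *)
Lemma mul_form_diag m (S Q : 'M[R]_m) (d : 'rV[R]_m) (e : 'rV[R]_m) :
  S^T = S -> Q *m S = diag_mx d *m Q ->
  (forall i, e ord0 i = Num.sqrt `|d ord0 i|) ->
  Q *m Q^T *m diag_mx e = diag_mx e *m (Q *m Q^T).
Proof.
move=> Ssym QS eE; set H := Q *m Q^T.
have DH : diag_mx d *m H = H *m diag_mx d.
  rewrite /H mulmxA -QS -!mulmxA; congr (_ *m _).
  by rewrite -{1}Ssym -trmx_mul QS trmx_mul tr_diag_mx.
apply/matrixP => i j; move/matrixP/(_ i j): DH.
rewrite !mul_diag_mx !mul_mx_diag !mxE !eE mulrC => /eqP.
rewrite -subr_eq0 -mulrBr mulf_eq0 => /orP[/eqP ->|]; first by rewrite mulr0 mul0r.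
by rewrite subr_eq0 => /eqP ->; rewrite mulrC.
Qed.

(** With [e] the square roots of the eigenvalues, [mul_form_diag] moves one factor [e] to the other
    side of [Q *m Q^T], and the form becomes the squared length of [c *m diag_mx e *m Q]. *)
Lemma form_diag_ge0 m (S Q : 'M[R]_m) (d : 'rV[R]_m) (c : 'rV[R]_m) :
  S^T = S -> Q *m S = diag_mx d *m Q ->
  (forall i, c ord0 i != 0 -> 0 <= d ord0 i) ->
  0 <= ((c *m Q) *m S *m (c *m Q)^T) 0 0.
Proof.
move=> Ssym QS cd; pose e := \row_i Num.sqrt `|d ord0 i|.
have eE i : e ord0 i = Num.sqrt `|d ord0 i| by rewrite mxE.
have HE := mul_form_diag Ssym QS eE.
have cE : c *m diag_mx d = c *m diag_mx e *m diag_mx e.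
  apply/rowP => i; rewrite !mul_mx_diag !mxE -mulrA -expr2 sqr_sqrtr //.
  by have [->|/cd di] := eqVneq (c ord0 i) 0; rewrite ?mul0r ?ger0_norm.
rewrite -(mulmxA c) QS mulmxA cE trmx_mul !mulmxA.
have -> : c *m diag_mx e *m diag_mx e *m Q *m Q^T *m c^T
   = (c *m diag_mx e *m Q) *m (c *m diag_mx e *m Q)^T.
  rewrite !trmx_mul tr_diag_mx !mulmxA; congr (_ *m _).
  by rewrite -!mulmxA -HE !mulmxA.
rewrite mxE; apply: sumr_ge0 => i _; rewrite [X in _ * X]mxE -expr2 sqr_ge0 //.
Qed.

(** Dimension count: the submatrix with rows in [A] and columns in [B] has more rows than columns,
    hence a nonzero left kernel. *)
Lemma exists_row_supp p m (M : 'M[R]_(p, m)) (A : pred 'I_p) (B : pred 'I_m) :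
  (#|B| < #|A|)%N ->
  exists x : 'rV[R]_p, [/\ x != 0, forall i, ~~ A i -> x ord0 i = 0 &
    forall i, B i -> (x *m M) ord0 i = 0].
Proof.
move=> BA; pose M' : 'M[R]_(#|A|, #|B|) :=
  mxsub (@enum_val _ A) (@enum_val _ B) M.
have : kermx M' != 0.
  rewrite -mxrank_eq0 mxrank_ker -lt0n subn_gt0.
  exact: leq_ltn_trans (rank_leq_col _) BA.
move=> /rowV0Pn[y /sub_kermxP yM y0].
pose E : 'M[R]_(#|A|, p) := \matrix_(k, i) (i == enum_val k)%:R.
exists (y *m E); split.
- apply: contraNneq y0 => yE; apply/eqP/rowP => k; rewrite mxE.
  move/rowP/(_ (enum_val k)): yE; rewrite !mxE (bigD1 k) //= mxE eqxx mulr1.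
  rewrite big1 ?addr0 // => l lk; rewrite mxE (inj_eq enum_val_inj) eq_sym (negPf lk).
  by rewrite mulr0.
- move=> i Ai; rewrite mxE big1 // => k _; rewrite mxE; case: eqP => [E1|]; last by rewrite mulr0.
  by case/negP: Ai; rewrite E1; have := enum_valP k.
- move=> i Bi; have Bi' : i \in B by [].
  move/rowP/(_ (enum_rank_in Bi' i)): yM; rewrite !mxE => H; rewrite -[RHS]H.
  under eq_bigr do rewrite mxE big_distrl /=.
  rewrite exchange_big /=; apply: eq_bigr => k _.
  rewrite mxE enum_rankK_in // (bigD1 (enum_val k)) //= mxE eqxx mulr1.
  rewrite big1 ?addr0 // => l lk; by rewrite mxE (negPf lk) mulr0 mul0r.
Qed.

(** One half of Sylvester's law of inertia: otherwise some nonzero vector of the positive subspace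
    would have no component along positive eigenvectors, and the form would be nonpositive on it. *)
Lemma card_pos_le p m (T : 'M[R]_(p, m)) (S Q : 'M[R]_m) (d : 'rV[R]_m)
    (s : pred 'I_p) :
  S^T = S -> Q \in unitmx -> Q *m S = diag_mx d *m Q ->
  (forall x : 'rV[R]_p, x != 0 -> (forall i, ~~ s i -> x ord0 i = 0) ->
     0 < ((x *m T) *m S *m (x *m T)^T) 0 0) ->
  (#|s| <= #|[pred i | (0 < d ord0 i)%R]|)%N.
Proof.
move=> Ssym Qu QS Tpos; rewrite leqNgt; apply/negP => lt.
have [x [x0 xs xd]] := exists_row_supp (T *m invmx Q) lt.
have := Tpos x x0 xs; apply/negP; rewrite -leNgt.
have -> : x *m T = (x *m (T *m invmx Q)) *m Q by rewrite -!mulmxA mulVmx // mulmx1.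
set c := x *m (T *m invmx Q) in xd *.
have QS' : Q *m (- S) = diag_mx (- d) *m Q by rewrite mulmxN QS raddfN mulNmx.
have := @form_diag_ge0 m (- S) Q (- d) c; rewrite linearN /= Ssym => /(_ erefl QS').
rewrite mulmxN mulNmx mxE oppr_ge0; apply => i ci; rewrite mxE oppr_ge0 leNgt.
by apply: contra ci => di; rewrite xd.
Qed.

(** [card_pos_le] for [S] and for [- S] gives two inequalities whose left sides add up to [m]; both
    are therefore equalities, and no eigenvalue is left to be zero. *)
Lemma sign_split p m (T : 'M[R]_(p, m)) (S : 'M[R]_m) (s : pred 'I_p) :
  p = m -> S^T = S ->
  (forall x : 'rV[R]_p, x != 0 -> (forall i, ~~ s i -> x ord0 i = 0) ->
     0 < ((x *m T) *m S *m (x *m T)^T) 0 0) ->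
  (forall x : 'rV[R]_p, x != 0 -> (forall i, s i -> x ord0 i = 0) ->
     ((x *m T) *m S *m (x *m T)^T) 0 0 < 0) ->
  sign S = #|s|%:Z - #|[predC s]|%:Z /\ S \in unitmx.
Proof.
move=> pm Ssym Tpos Tneg; have [Q [d [Qu QS]]] := symmetric_diagonalizable Ssym.
rewrite (sign_diagE Qu QS).
have le1 := card_pos_le Ssym Qu QS Tpos.
have QS' : Q *m (- S) = diag_mx (- d) *m Q by rewrite mulmxN QS raddfN mulNmx.
have := @card_pos_le p m T (- S) Q (- d) [predC s]; rewrite linearN /= Ssym.
move=> /(_ erefl Qu QS'); rewrite (eq_card (A := [pred i | 0 < (- d) ord0 i]) (B := [pred i | d ord0 i < 0])); last first.
  by move=> i; rewrite !inE mxE oppr_gt0.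
have Tn (x : 'rV[R]_p) : x != 0 -> (forall i, ~~ [predC s] i -> x ord0 i = 0) ->
     0 < ((x *m T) *m - S *m (x *m T)^T) 0 0.
  move=> x0 xs; rewrite mulmxN mulNmx mxE oppr_gt0; apply: Tneg => // i si.
  by apply: xs; rewrite /= negbK.
move=> /(_ Tn) le2.
have le3 : (#|[pred i | (0 < d ord0 i)%R]| + #|[pred i | (d ord0 i < 0)%R]| <= m)%N.
  rewrite -cardUI [X in (_ + X)%N]eq_card0 ?addn0; last first.
    by move=> i; rewrite !inE; apply/negP => /andP[/lt_trans h /h]; rewrite ltxx.
  by rewrite -[leqRHS]card_ord max_card.
have le4 : (#|s| + #|[predC s]|)%N = m by rewrite (cardC s) card_ord.
have e1 : #|s| = #|[pred i | 0 < d ord0 i]|.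
  apply/eqP; rewrite eqn_leq le1 /= -(leq_add2r #|[predC s]|) le4.
  by apply: leq_trans le3; rewrite leq_add2l.
have e2 : #|[predC s]| = #|[pred i | d ord0 i < 0]|.
  apply/eqP; rewrite eqn_leq le2 /= -(leq_add2l #|s|) le4.
  by apply: leq_trans le3; rewrite leq_add2r.
split; first by rewrite e1 e2.
have d0 i : d ord0 i != 0.
  apply/negP => /eqP di; suff : (m < m)%N by rewrite ltnn.
  rewrite -[X in (X < _)%N]le4 e1 e2.
  rewrite -cardUI [X in (_ + X)%N]eq_card0 ?addn0; last first.
    by move=> k; rewrite !inE; apply/negP => /andP[/lt_trans h /h]; rewrite ltxx.
  rewrite -[X in (_ < X)%N]card_ord; apply/proper_card/properP; split; first exact/fintype.subsetP.
  by exists i; rewrite ?inE // di ltxx.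
rewrite -(mulKmx Qu S) QS !unitmx_mul unitmx_inv Qu /= andbT.
by rewrite unitmxE det_diag unitfE; apply/prodf_neq0 => i _.
Qed.

Lemma form_gt0_open m (L : 'M[R]_m) (s : pred 'I_m) :
  (forall x : 'rV[R]_m, x != 0 -> (forall i, ~~ s i -> x ord0 i = 0) ->
     0 < (x *m L *m x^T) 0 0) ->
  exists2 eps : R, 0 < eps & forall E : 'M[R]_m,
    (forall i j, `|E i j - L i j| < eps) ->
    forall x : 'rV[R]_m, x != 0 -> (forall i, ~~ s i -> x ord0 i = 0) ->
     0 < (x *m E *m x^T) 0 0.
Proof.
move=> Lpos.
pose A : set 'rV[R]_m := [set x : 'rV[R]_m | `|x| = 1 /\ forall i, ~~ s i -> x ord0 i = 0].
have [[z0 Az0]|A0] := pselect (A !=set0); last first.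
  exists 1 => // E _ x x0 xs; exfalso; apply: A0; exists (`|x|^-1 *: x); split.
    by rewrite normrZ normfV normr_id mulVf // normr_eq0.
  by move=> i /xs xi; rewrite mxE xi mulr0.
have cA : compact A.
  apply: bounded_closed_compact.
    exists 1; split=> // y y1 x [xn _]; apply: (@le_trans _ _ 1); last exact: ltW.
    by rewrite le_eqVlt; apply/orP; left; apply/eqP; exact: xn.
  have -> : A = (fun x : 'rV[R]_m => `|x|) @^-1` [set 1]
      `&` \bigcap_(i in [set i | ~~ s i]) ((fun x : 'rV[R]_m => x ord0 i) @^-1` [set 0]).
    by apply/seteqP; split=> x [x1 xs]; split=> // i; exact: xs.
  apply: closedI.
    by apply: closed_comp => [x _|]; [exact: norm_continuous|exact: closed_eq].
  apply: closed_bigI => i _; apply: closed_comp => [x _|]; last exact: closed_eq.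
  exact: coord_continuous.
have cf : {within A, continuous (fun x : 'rV[R]_m => (x *m L *m x^T) 0 0)}.
  apply: continuous_subspaceT => x.
  have cid : mcts (fun x : 'rV[R]_m => x) x by move=> i j; exact: coord_continuous.
  have H : mcts (fun y : 'rV[R]_m => y *m L *m y^T) x.
    by apply: mctsM; [apply: mctsM => //; exact: mcts_cst|exact: mcts_tr].
  exact: (H 0 0).
have [x1] := EVT_min_rV (ex_intro _ _ Az0) cA cf.
rewrite inE => -[nx1 x1s] x1min; set c := (x1 *m L *m x1^T) 0 0 in x1min.
have c0 : 0 < c by apply: Lpos => //; rewrite -normr_eq0 nx1 oner_eq0.
(* On vectors of sup norm 1, perturbing each entry by less than [eps] changes the form by at most
   [m * m * eps], which must stay below the minimum [c]. *)
exists (c / (m * m).+1%:R); first by rewrite divr_gt0.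
move=> E EL x x0 xs; set eps := c / _ in EL.
have nx0 : 0 < `|x| by rewrite normr_gt0.
pose y := `|x|^-1 *: x.
have ny : `|y| = 1 by rewrite normrZ normfV normr_id mulVf // normr_eq0.
have ys i : ~~ s i -> y ord0 i = 0 by move=> /xs xi; rewrite mxE xi mulr0.
have -> : (x *m E *m x^T) 0 0 = `|x| ^+ 2 * (y *m E *m y^T) 0 0.
  rewrite /y linearZ /= -scalemxAl -scalemxAl -scalemxAr !mxE expr2.
  by set a := \sum_j _; field; rewrite gt_eqF.
apply: mulr_gt0; first exact: exprn_gt0.
have yL : c <= (y *m L *m y^T) 0 0 by apply: x1min; rewrite inE; split.
have yi i : `|y ord0 i| <= 1.
  by rewrite -ny [leRHS]/Num.Def.normr /= mx_normrE; exact: (le_bigmax _ _ (ord0, i)).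
clearbody y.
have yE : `|(y *m (E - L) *m y^T) 0 0| <= (m * m)%:R * eps.
  rewrite -mulmxA mxE; under eq_bigr do rewrite mxE mulr_sumr.
  apply: le_trans (ler_norm_sum _ _ _) _.
  apply: (@le_trans _ _ (\sum_(i < m) \sum_(j < m) eps)).
    apply: ler_sum => i _; apply: le_trans (ler_norm_sum _ _ _) _.
    apply: ler_sum => j _; rewrite [X in _ * (_ * X)]mxE !normrM.
    rewrite mulrA mulrAC -[leRHS]mul1r; apply: ler_pM; rewrite ?mulr_ge0 //.
      by rewrite -[leRHS]mulr1; apply: ler_pM.
    by have := EL i j; rewrite !mxE => /ltW.
  by rewrite !sumr_const !card_ord -mulrnA mulr_natl.
have : (m * m)%:R * eps < c.
  by rewrite /eps mulrCA gtr_pMr // ltr_pdivrMr // mul1r ltr_nat.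
have -> : y *m E *m y^T = y *m (E - L) *m y^T + y *m L *m y^T.
  by rewrite mulmxBr mulmxBl subrK.
rewrite [X in _ -> 0 < X]mxE.
move: yL yE; set a := (_ *m (E - _) *m _) 0 0; set b := (_ *m _ *m _) 0 0.
rewrite ler_norml => le1 /andP[le2 _] lt; move: le1 le2 lt; lra.
Qed.

Lemma sign_near p m (L : 'M[R]_p) (s : pred 'I_p) : p = m ->
  (forall x : 'rV[R]_p, x != 0 -> (forall i, ~~ s i -> x ord0 i = 0) ->
     0 < (x *m L *m x^T) 0 0) ->
  (forall x : 'rV[R]_p, x != 0 -> (forall i, s i -> x ord0 i = 0) ->
     (x *m L *m x^T) 0 0 < 0) ->
  exists2 eps : R, 0 < eps & forall (S : 'M[R]_m) (T : 'M[R]_(p, m)), S^T = S ->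
    (forall i j, `|(T *m S *m T^T) i j - L i j| < eps) ->
    sign S = #|s|%:Z - #|[predC s]|%:Z /\ S \in unitmx.
Proof.
move=> pm Lpos Lneg; have [e1 e10 H1] := form_gt0_open Lpos.
have Ln (x : 'rV[R]_p) : x != 0 -> (forall i, ~~ [predC s] i -> x ord0 i = 0) ->
     0 < (x *m (- L) *m x^T) 0 0.
  move=> x0 xs; rewrite mulmxN mulNmx mxE oppr_gt0; apply: Lneg => // i si.
  by apply: xs; rewrite /= negbK.
have [e2 e20 H2] := form_gt0_open Ln.
exists (Num.min e1 e2); first by rewrite lt_min e10.
move=> S T Ssym ST.
have E (x : 'rV[R]_p) : x *m T *m S *m (x *m T)^T = x *m (T *m S *m T^T) *m x^T.
  by rewrite trmx_mul !mulmxA.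
apply: (@sign_split p m T S s pm Ssym) => x x0 xs; rewrite E.
  by apply: H1 => // i j; apply: lt_le_trans (ST i j) _; rewrite ge_min lexx.
rewrite -oppr_gt0.
have -> : - (x *m (T *m S *m T^T) *m x^T) 0 0 = (x *m (- (T *m S *m T^T)) *m x^T) 0 0.
  by rewrite mulmxN mulNmx [RHS]mxE.
apply: H2 => // [i j|i].
  apply: lt_le_trans (_ : _ < Num.min e1 e2) _; last by rewrite ge_min lexx orbT.
  by rewrite [in X in X - _]mxE [in X in _ - X]mxE -opprD normrN; exact: ST.
by rewrite negbK => si; apply: xs.
Qed.

Lemma form_diag_gt0 m (S Q : 'M[R]_m) (d : 'rV[R]_m) (c : 'rV[R]_m) :
  S^T = S -> Q \in unitmx -> Q *m S = diag_mx d *m Q -> c != 0 ->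
  (forall i, c ord0 i != 0 -> 0 < d ord0 i) ->
  0 < ((c *m Q) *m S *m (c *m Q)^T) 0 0.
Proof.
move=> Ssym Qu QS c0 cd; pose e := \row_i Num.sqrt `|d ord0 i|.
have eE i : e ord0 i = Num.sqrt `|d ord0 i| by rewrite mxE.
have HE := mul_form_diag Ssym QS eE.
have cE : c *m diag_mx d = c *m diag_mx e *m diag_mx e.
  apply/rowP => i; rewrite !mul_mx_diag !mxE -mulrA -expr2 sqr_sqrtr //.
  by have [->|/cd di] := eqVneq (c ord0 i) 0; rewrite ?mul0r ?gtr0_norm.
rewrite -(mulmxA c) QS mulmxA cE trmx_mul !mulmxA.
have -> : c *m diag_mx e *m diag_mx e *m Q *m Q^T *m c^T
   = (c *m diag_mx e *m Q) *m (c *m diag_mx e *m Q)^T.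
  rewrite !trmx_mul tr_diag_mx !mulmxA; congr (_ *m _).
  by rewrite -!mulmxA -HE !mulmxA.
set y := _ *m Q.
have [i yi] : exists i, y ord0 i != 0.
  apply/rV0Pn; apply: contraNneq c0 => y0; apply/eqP/rowP => i.
  have : (y *m invmx Q) ord0 i = 0 by rewrite y0 mul0mx mxE.
  rewrite /y mulmxK // mul_mx_diag !mxE => /eqP; rewrite mulf_eq0.
  case/orP => [/eqP //|]; rewrite sqrtr_eq0 normr_le0 => di.
  by apply/eqP; apply/negPn/negP => /cd; rewrite (eqP di) ltxx.
rewrite mxE (bigD1 i) //= ltr_pwDl //; first by rewrite [X in _ * X]mxE -expr2 exprn_even_gt0.
by apply: sumr_ge0 => j _; rewrite [X in _ * X]mxE -expr2 sqr_ge0.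
Qed.

Lemma mcts_near_lt (T : topologicalType) m n (F : T -> 'M[R]_(m, n)) (t : T) (e : R) :
  mcts F t -> 0 < e -> \forall s \near t, forall i j, `|F s i j - F t i j| < e.
Proof.
move=> cF e0; apply: filter_forall => i; apply: filter_forall => j.
have /cvgrPdist_lt/(_ e e0) := cF i j.
by apply: filterS => s; rewrite distrC.
Qed.

Lemma dmx_slope m n (F : R -> 'M[R]_(m, n)) (t : R) D : dmx F t D ->
  mcts (fun s => if s == t then D else (s - t)^-1 *: (F s - F t)) t.
Proof.
move=> dF i j; rewrite eqxx.
have [/cvg_ex[l Fl] E] := dF i j.
have lE : l = D i j by rewrite -E /derive; apply/esym/cvg_lim.
move: Fl; rewrite lE => /cvgrPdist_lt Fl.
apply/cvgrPdist_lt => e e0; have := Fl e e0.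
rewrite -nbhs_nearE => -[d /= d0 dF'].
exists d => //= s sd; case: eqP => [_|/eqP st]; first by rewrite subrr normr0.
have := dF' (s - t); rewrite /= sub0r normrN distrC => /(_ sd).
rewrite subr_eq0 => /(_ st); rewrite /GRing.scale /= mulr1 subrK.
by rewrite !mxE.
Qed.

(** The limit form of [sign_jump_right]: [f] selects nonzero eigenvalues of [S], while [Y]
    diagonalises the form [G] on the kernel. *)
Lemma block_form_gt0 r k m (S Q : 'M[R]_m) (d : 'rV[R]_m) (G Y : 'M[R]_k)
    (e : 'rV[R]_k) (f : 'I_r -> 'I_m) (x : 'rV[R]_(r + k)) :
  injective f -> S^T = S -> Q \in unitmx -> Q *m S = diag_mx d *m Q ->
  G^T = G -> Y \in unitmx -> Y *m G = diag_mx e *m Y -> x != 0 ->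
  (forall a, x ord0 (lshift k a) != 0 -> 0 < d ord0 (f a)) ->
  (forall b, x ord0 (rshift r b) != 0 -> 0 < e ord0 b) ->
  0 < (x *m block_mx (rowsub f Q *m S *m (rowsub f Q)^T) 0 0 (Y *m G *m Y^T)
       *m x^T) 0 0.
Proof.
move=> finj Ssym Qu QS Gsym Yu YG x0 xd xe.
have -> : x = row_mx (lsubmx x) (rsubmx x) by rewrite hsubmxK.
set x1 := lsubmx x; set x2 := rsubmx x.
rewrite mul_row_block !mulmx0 addr0 add0r tr_row_mx mul_row_col.
pose c := x1 *m rowsub f 1%:M.
have cQ : x1 *m rowsub f Q = c *m Q by rewrite /c -mulmxA mul_rowsub_mx mul1mx.
have cf a : c ord0 (f a) = x1 ord0 a.
  rewrite mxE (bigD1 a) //= !mxE eqxx mulr1 big1 ?addr0 // => b ba.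
  by rewrite !mxE (inj_eq finj) (negPf ba) mulr0.
have c0 i : c ord0 i != 0 -> exists2 a, i = f a & x1 ord0 a != 0.
  move=> ci; have [[a ia]|nia] := pselect (exists a, i = f a).
    by exists a => //; rewrite -cf -ia.
  case/eqP: ci; rewrite mxE big1 // => a _; rewrite !mxE; case: eqP => [E|]; last by rewrite mulr0.
  by case: nia; exists a.
have cd i : c ord0 i != 0 -> 0 < d ord0 i.
  by move=> /c0[a -> xa]; apply: xd; rewrite mxE in xa.
have x2e b : x2 ord0 b != 0 -> 0 < e ord0 b by rewrite mxE; exact: xe.
have -> : x1 *m (rowsub f Q *m S *m (rowsub f Q)^T) *m x1^T
    = (c *m Q) *m S *m (c *m Q)^T by rewrite -cQ trmx_mul !mulmxA.
have -> : x2 *m (Y *m G *m Y^T) *m x2^T = (x2 *m Y) *m G *m (x2 *m Y)^T.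
  by rewrite trmx_mul !mulmxA.
rewrite mxE.
have [x10|x1n] := eqVneq x1 0.
  rewrite ltr_wpDl //; first by apply: (form_diag_ge0 Ssym QS) => i /cd /ltW.
  apply: (form_diag_gt0 Gsym Yu YG) => //; apply: contraNneq x0 => x20.
  by rewrite -[x]hsubmxK -/x1 -/x2 x10 x20 row_mx0.
rewrite ltr_wpDr //; first by apply: (form_diag_ge0 Gsym YG) => i /x2e /ltW.
apply: (form_diag_gt0 Ssym Qu QS) => //; apply: contraNneq x1n => cE.
by apply/eqP/rowP => a; rewrite -cf cE !mxE.
Qed.

(** A blow-up replaces the perturbation theory of eigenvalues. Eigenvectors for nonzero eigenvalues
    are kept, and kernel vectors are divided by the square root of [t - t0]. In this moving frame
    the form converges to the direct sum of the nondegenerate part of [S t0] and the derivative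
    restricted to the kernel, and a nondegenerate limit fixes the signature nearby. *)
Lemma sign_jump_right m k (S : R -> 'M[R]_m) (t0 : R) (D : 'M[R]_m)
    (Kb : 'M[R]_(k, m)) :
  (S t0)^T = S t0 -> D^T = D -> dmx S t0 D ->
  Kb *m S t0 = 0 -> (\rank (S t0) + k = m)%N -> Kb *m D *m Kb^T \in unitmx ->
  \forall t \near t0, t0 < t -> (S t)^T = S t ->
    sign (S t) = sign (S t0) + sign (Kb *m D *m Kb^T) /\ S t \in unitmx.
Proof.
move=> Ssym Dsym dS KS rk Gu.
set G := Kb *m D *m Kb^T in Gu *.
have Gsym : G^T = G by rewrite /G !trmx_mul trmxK Dsym mulmxA.
have [Q [d [Qu QS]]] := symmetric_diagonalizable Ssym.
have [Y [e [Yu YG]]] := symmetric_diagonalizable Gsym.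
have e0 i : e ord0 i != 0.
  have : diag_mx e \in unitmx.
    by rewrite -(mulmxK Yu (diag_mx e)) -YG !unitmx_mul Yu Gu unitmx_inv Yu.
  by rewrite unitmxE det_diag unitfE => /prodf_neq0 /(_ i isT).
pose A := [pred i | d ord0 i != 0].
have rS : \rank (S t0) = #|A|.
  rewrite -(eqmxMfull (S t0) (_ : row_full Q)) ?row_full_unit //.
  rewrite QS mxrankMfree ?row_free_unit // rank_diag_mx -sum1_card [RHS]big_mkcond.
  by apply: eq_bigr => i _; rewrite inE; case: (_ != _).
have rA : (#|A| + k)%N = m by rewrite -rS.
pose f : 'I_#|A| -> 'I_m := @enum_val _ A.
have finj : injective f := enum_val_inj.
have fd a : d ord0 (f a) != 0 by have := enum_valP a.
pose Qr := rowsub f Q; pose Z := Y *m Kb.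
pose L := block_mx (Qr *m S t0 *m Qr^T) 0 0 (Z *m D *m Z^T).
have LE : L = block_mx (Qr *m S t0 *m Qr^T) 0 0 (Y *m G *m Y^T).
  by rewrite /L /Z trmx_mul /G !mulmxA.
pose s : pred 'I_(#|A| + k) := fun i => match fintype.split i with
  | inl a => 0 < d ord0 (f a) | inr b => 0 < e ord0 b end.
have Lpos (x : 'rV[R]_(#|A| + k)) : x != 0 -> (forall i, ~~ s i -> x ord0 i = 0) ->
    0 < (x *m L *m x^T) 0 0.
  move=> x0 xs; rewrite LE; apply: (block_form_gt0 finj Ssym Qu QS Gsym Yu YG) => // a;
    apply: contraR => na; rewrite xs // /s ?(unsplitK (inl a)) ?(unsplitK (inr a)) //.
have Lneg (x : 'rV[R]_(#|A| + k)) : x != 0 -> (forall i, s i -> x ord0 i = 0) ->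
    (x *m L *m x^T) 0 0 < 0.
  move=> x0 xs; rewrite LE -oppr_gt0.
  set B := block_mx _ _ _ _.
  have -> : - (x *m B *m x^T) 0 0 = (x *m (- B) *m x^T) 0 0.
    by rewrite mulmxN mulNmx [RHS]mxE.
  have -> : - B = block_mx (Qr *m (- S t0) *m Qr^T) 0 0 (Y *m (- G) *m Y^T).
    by rewrite opp_block_mx !mulmxN !mulNmx !oppr0.
  have QS' : Q *m (- S t0) = diag_mx (- d) *m Q by rewrite mulmxN QS raddfN mulNmx.
  have YG' : Y *m (- G) = diag_mx (- e) *m Y by rewrite mulmxN YG raddfN mulNmx.
  apply: (block_form_gt0 finj _ Qu QS' _ Yu YG') => // [||a|a];
    rewrite ?linearN /= ?Ssym ?Gsym // mxE oppr_gt0; apply: contraR; rewrite -leNgt le_eqVlt eq_sym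
      ?(negPf (fd a)) ?(negPf (e0 a)) /= => ha;
    by rewrite xs // /s ?(unsplitK (inl a)) ?(unsplitK (inr a)).
have [eps eps0 H] := sign_near rA Lpos Lneg.
have signE0 : sign (S t0) + sign G = #|s|%:Z - #|[predC s]|%:Z.
  rewrite (sign_diagE Qu QS) (sign_diagE Yu YG).
  have sE (pd : pred R) (P : pred 'I_(#|A| + k)) : ~~ pd 0 ->
      (forall a, P (lshift k a) = pd (d ord0 (f a))) ->
      (forall b, P (rshift #|A| b) = pd (e ord0 b)) ->
      #|P| = (#|[pred i | pd (d ord0 i)]| + #|[pred i | pd (e ord0 i)]|)%N.
    move=> pd0 P1 P2; rewrite -sum1_card big_mkcond big_split_ord /=.
    congr (_ + _)%N; rewrite -[RHS]sum1_card; last first.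
      by rewrite [RHS]big_mkcond; apply: eq_bigr => b _; rewrite !inE -P2.
    under eq_bigr do rewrite -topredE /= P1.
    rewrite -(big_enum_val (A := A) (fun i => if pd (d ord0 i) then 1%N else 0%N)).
    rewrite -big_mkcondr /=; apply: eq_bigl => i; rewrite !inE andbC.
    by case: (boolP (pd _)) => //= pi; apply: contraNneq pd0 => <-.
  rewrite (sE (fun a => 0 < a) s) ?ltxx //; first last.
  - by move=> b; rewrite /s (unsplitK (inr b)).
  - by move=> a; rewrite /s (unsplitK (inl a)).
  rewrite (sE (fun a => a < 0) [predC s]) ?ltxx //; first last.
  - by move=> b; rewrite /= -topredE /= /s (unsplitK (inr b)) -leNgt le_eqVlt (negPf (e0 b)).
  - by move=> a; rewrite /= -topredE /= /s (unsplitK (inl a)) -leNgt le_eqVlt (negPf (fd a)).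
  by rewrite !PoszD; lia.
pose M t := if t == t0 then D else (t - t0)^-1 *: (S t - S t0).
have cM : mcts M t0 by exact: dmx_slope.
have cS : mcts S t0 := dmx_mcts dS.
have csq : (fun t => Num.sqrt `|t - t0|) @ t0 --> Num.sqrt `|t0 - t0|.
  apply: (cvg_comp (fun t => `|t - t0|) Num.sqrt); last exact: sqrt_continuous.
  apply: cvg_norm; apply: cvgB; [exact: cvg_id|exact: cvg_cst].
(* The Gram matrix in the rescaled frame, written with the difference quotient [M]. The mixed blocks
   keep a factor that tends to 0, because the kernel vectors annihilate [S t0]. *)
pose E t := block_mx (Qr *m S t *m Qr^T) (Num.sqrt `|t - t0| *: (Qr *m M t *m Z^T))
  (Num.sqrt `|t - t0| *: (Z *m M t *m Qr^T)) (Z *m M t *m Z^T).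
have cE : mcts E t0.
  by apply: mcts_block; do ?apply: mctsZ => //; do ?[apply: mctsM => //]; exact: mcts_cst.
have EL : E t0 = L by rewrite /E /L /M eqxx subrr normr0 sqrtr0 !scale0r.
have := mcts_near_lt cE eps0; rewrite EL.
apply: filterS => t tE t0t St; rewrite signE0.
have dt : 0 < t - t0 by rewrite subr_gt0.
pose T := col_mx Qr ((Num.sqrt (t - t0))^-1 *: Z).
apply: (H (S t) T St) => i j; suff -> : T *m S t *m T^T = E t by exact: tE.
have sq0 : Num.sqrt (t - t0) != 0 by rewrite gt_eqF // sqrtr_gt0.
have sqE : (Num.sqrt (t - t0))^-1 = Num.sqrt (t - t0) * (t - t0)^-1.
  by rewrite -[in X in _ * X^-1](sqr_sqrtr (ltW dt)) expr2 invfM mulrA divff // mul1r.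
have ZS0 : Z *m S t0 = 0 by rewrite /Z -mulmxA KS mulmx0.
have SZ0 : S t0 *m Z^T = 0 by rewrite -Ssym -trmx_mul ZS0 trmx0.
have ME : M t = (t - t0)^-1 *: (S t - S t0) by rewrite /M gt_eqF.
rewrite /T mul_col_mx tr_col_mx mul_col_row /E gtr0_norm // ME linearZ /=.
rewrite -!(scalemxAl, scalemxAr) !scalerA !mulmxBr !mulmxBl -!sqE.
rewrite -[Qr *m S t0 *m Z^T]mulmxA SZ0 ZS0 !mulmx0 !mul0mx !subr0.
congr block_mx; congr (_ *: _).
by rewrite -invfM -expr2 sqr_sqrtr // ltW.
Qed.

Lemma signN m (S : 'M[R]_m) : sign (- S) = - sign S.
Proof.
have E (p q : pred R) : (forall a, p a = q (- a)) ->
    (\big[addn/0%N]_(a \in [set a : R | p a]) \rank (eigenspace (- S) a))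
    = (\big[addn/0%N]_(a \in [set a : R | q a]) \rank (eigenspace S a)).
  move=> pq; rewrite (reindex_fsbig (fun a : R => - a) [set a | q a]).
    apply: eq_fsbigr => a _; rewrite /eigenspace !mxrank_ker; congr (_ - _)%N.
    by rewrite -opprD [(- a)%:M]raddfN mxrank_opp.
  split=> [a /= qa|a b _ _ /oppr_inj //|a /= pa]; first by rewrite pq opprK.
  by exists (- a); rewrite ?opprK //= -pq.
rewrite /sign (E (fun a => 0 < a) (fun a => a < 0)); last by move=> a; rewrite oppr_lt0.
rewrite (E (fun a => a < 0) (fun a => 0 < a)); last by move=> a; rewrite oppr_gt0.
by rewrite opprB.
Qed.

Lemma sign_jump_left m k (S : R -> 'M[R]_m) (t0 : R) (D : 'M[R]_m)
    (Kb : 'M[R]_(k, m)) :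
  (S t0)^T = S t0 -> D^T = D -> dmx S t0 D ->
  Kb *m S t0 = 0 -> (\rank (S t0) + k = m)%N -> Kb *m D *m Kb^T \in unitmx ->
  \forall t \near t0, t < t0 -> (S t)^T = S t ->
    sign (S t) = sign (S t0) - sign (Kb *m D *m Kb^T) /\ S t \in unitmx.
Proof.
move=> Ssym Dsym dS KS rk Gu.
have dS' : dmx (fun s => S (- s)) (- t0) (- D) := dmx_opp dS.
have D'sym : (- D)^T = - D by rewrite linearN /= Dsym.
have Gu' : Kb *m - D *m Kb^T \in unitmx.
  by rewrite mulmxN mulNmx -scaleN1r unitmxZ ?unitrN1.
have Ssym' : (S (- - t0))^T = S (- - t0) by rewrite opprK.
have KS' : Kb *m S (- - t0) = 0 by rewrite opprK.
have rk' : (\rank (S (- - t0)) + k = m)%N by rewrite opprK.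
have H := sign_jump_right Ssym' D'sym dS' KS' rk' Gu'.
have cN : -%R @ t0 --> - t0 by exact: opp_continuous.
have H2 : \forall t \near t0, - t0 < - t -> (S (- - t))^T = S (- - t) ->
    sign (S (- - t)) = sign (S (- - t0)) + sign (Kb *m - D *m Kb^T)
    /\ S (- - t) \in unitmx by exact: (cN _ H).
apply: filterS H2 => t; rewrite !opprK ltrN2 mulmxN mulNmx signN.
by move=> Ht tt0 St; exact: Ht.
Qed.

Lemma sign_locally_cst m (S0 : 'M[R]_m) : S0^T = S0 -> S0 \in unitmx ->
  exists2 eps : R, 0 < eps & forall S : 'M[R]_m, S^T = S ->
    (forall i j, `|S i j - S0 i j| < eps) -> sign S = sign S0.
Proof.
move=> S0sym S0u; have [Q [d [Qu QS]]] := symmetric_diagonalizable S0sym.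
have d0 i : d ord0 i != 0.
  have : diag_mx d \in unitmx by rewrite -(mulmxK Qu (diag_mx d)) -QS !unitmx_mul Qu S0u unitmx_inv.
  by rewrite unitmxE det_diag unitfE => /prodf_neq0 /(_ i isT).
pose s : pred 'I_m := fun i => 0 < d ord0 i.
have E (S : 'M[R]_m) (x : 'rV[R]_m) : x *m (Q *m S *m Q^T) *m x^T = (x *m Q) *m S *m (x *m Q)^T.
  by rewrite trmx_mul !mulmxA.
have [|x x0 xs|x x0 xs|eps eps0 H] := @sign_near m m (Q *m S0 *m Q^T) s => //.
- rewrite E; apply: (form_diag_gt0 S0sym Qu QS) => // i; apply: contraR => /xs ->.
  by rewrite eqxx.
- rewrite E -oppr_gt0.
  have -> : - (x *m Q *m S0 *m (x *m Q)^T) 0 0 = ((x *m Q) *m (- S0) *m (x *m Q)^T) 0 0.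
    by rewrite mulmxN mulNmx [RHS]mxE.
  have QS' : Q *m (- S0) = diag_mx (- d) *m Q by rewrite mulmxN QS raddfN mulNmx.
  apply: (form_diag_gt0 _ Qu QS') => //; first by rewrite linearN /= S0sym.
  move=> i; rewrite mxE oppr_gt0; apply: contraR; rewrite -leNgt le_eqVlt eq_sym (negPf (d0 i)).
  by move=> /= ?; rewrite xs.
have cid : mcts (fun A : 'M[R]_m => A) S0 by move=> i j; exact: coord_continuous.
have cQ : mcts (fun A : 'M[R]_m => Q *m A *m Q^T) S0.
  by apply: mctsM; [apply: mctsM => //; exact: mcts_cst|exact: mcts_cst].
have := mcts_near_lt cQ eps0; rewrite -nbhs_nearE => /nbhs_ballP[r /= r0 rH].
exists r => // S Ssym SS0.
have [|-> _] := H S Q Ssym; first by apply: rH; split=> // i j; rewrite /ball /= distrC.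
have [|-> _] := H S0 Q S0sym; first by move=> i j; rewrite subrr normr0.
by [].
Qed.

End Signature.

(** * Homotopy invariance of the crossing index *)

Section JumpFormula.
Variable R : realType.

Lemma near_dist (t0 : R) (P : R -> Prop) : (\forall t \near t0, P t) ->
  exists2 d : R, 0 < d & forall t, `|t - t0| < d -> P t.
Proof.
rewrite -nbhs_nearE => /nbhs_ballP[d /= d0 dP]; exists d => // t td.
by apply: dP; rewrite /ball /= distrC.
Qed.

Variables (f c : R -> int) (Cr : set R).
Hypothesis c0 : forall t : R, 0 <= t <= 1 -> ~ Cr t -> c t = 0.
Hypothesis fr : forall t0 : R, 0 <= t0 <= 1 -> \forall t \near t0, t0 < t -> t <= 1 ->
  f t = f t0 + c t0 /\ ~ Cr t.
Hypothesis fl : forall t0 : R, 0 <= t0 <= 1 -> \forall t \near t0, t < t0 -> 0 <= t ->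
  f t = f t0 - c t0 /\ ~ Cr t.

(** The set for a continuous induction on [u]; finiteness of the crossings in []0, u[] is part of
    the claim, not an assumption. *)
Let G (u : R) := 0 < u <= 1 /\ exists s : seq R,
  [/\ uniq s, forall t, t \in s <-> (0 < t < u /\ Cr t) &
      f u - f 0 = c 0 + c u + (\sum_(t <- s) c t) *+ 2].

Let G_init : exists u, G u.
Proof.
have [d d0 H] := near_dist (fr (t0 := 0) ltac:(by rewrite lexx ler01)).
have m0 : 0 < Num.min 1 (d / 2) by rewrite lt_min ltr01 divr_gt0.
have inb t : 0 < t <= Num.min 1 (d / 2) -> t <= 1 /\ `|t - 0| < d.
  move=> /andP[t0]; rewrite le_min => /andP[t1 td]; split=> //.
  by rewrite subr0 gtr0_norm //; lra.
exists (Num.min 1 (d / 2)); split; first by rewrite m0 ge_min lexx.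
exists [::]; split=> // [t|].
  split=> // -[/andP[t0 /ltW tm] Ct].
  have [t1 td] := inb t ltac:(by rewrite t0 tm).
  by have [_] := H t td t0 t1.
have [t1 td] := inb (Num.min 1 (d / 2)) ltac:(by rewrite m0 lexx).
have [-> nC] := H _ td m0 t1.
by rewrite big_nil mul0rn addr0 (c0 _ nC) ?(ltW m0) //; lia.
Qed.

Let G_left u : 0 < u <= 1 -> exists2 d, 0 < d & forall v, G v -> u - d < v < u -> G u.
Proof.
move=> u01; have u01' : 0 <= u <= 1 by case/andP: u01 => /ltW -> ->.
have [d d0 H] := near_dist (fl u01').
exists d => // v [v01 [s [us sE fE]]] /andP[dv vu]; split=> //.
have inb t : v <= t < u -> [/\ `|t - u| < d, t < u & 0 <= t].
  move=> /andP[vt tu]; split=> //; last by case/andP: v01 => ? _; lra.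
  by rewrite ltr0_norm ?subr_lt0 //; lra.
exists s; split=> // [t|].
  rewrite sE; split=> -[/andP[t0 tv] Ct]; split=> //; rewrite t0 /=; first by lra.
  rewrite ltNge; apply/negP => vt.
  by have [a b e] := inb t ltac:(by rewrite vt tv); have [_] := H t a b e.
have [a b e] := inb v ltac:(by rewrite lexx vu); have [fv nC] := H v a b e.
move: fE; rewrite fv (c0 _ nC); last by case/andP: v01 => /ltW -> ->.
by clear; rewrite !mulr2n; move: (\sum_(t <- s) c t) (f u) (f 0) (c 0) (c u) => S a b e g; lia.
Qed.

Let G_right u : G u -> u < 1 -> exists2 v, u < v & G v.
Proof.
move=> [u01 [s [us sE fE]]] u1; have u01' : 0 <= u <= 1 by case/andP: u01 => /ltW -> ->.
have [d d0 H] := near_dist (fr u01').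
set v := Num.min 1 (u + d / 2).
have uv : u < v by rewrite lt_min u1 /=; lra.
have inb t : u < t <= v -> `|t - u| < d /\ t <= 1.
  move=> /andP[ut]; rewrite le_min => /andP[t1 tv]; split=> //.
  by rewrite gtr0_norm ?subr_gt0 //; lra.
exists v => //; split; first by rewrite ge_min lexx andbT; case/andP: u01 => ? _; lra.
exists (if `[< Cr u >] then u :: s else s); split.
- case: asboolP => // Cu /=; rewrite us andbT; apply/negP => /sE[].
  by rewrite ltxx andbF.
- move=> t; have -> : t \in (if `[< Cr u >] then u :: s else s) <-> (t = u /\ Cr u) \/ t \in s.
    case: asboolP => Cu; rewrite ?inE.
      by split=> [/orP[/eqP|]|[[-> _]|->]]; [left|right|rewrite eqxx|rewrite orbT].
    by split=> [|[[]|]]; [right| |].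
  rewrite sE; split.
    case=> [[-> Cu]|[/andP[t0 tu] Ct]]; split=> //; first by rewrite uv andbT; case/andP: u01.
    by rewrite t0 (lt_trans tu).
  move=> [/andP[t0 tv] Ct]; case: (ltgtP t u) => [tu|ut|tu].
  - by right; rewrite t0.
  - have [a b] := inb t ltac:(by rewrite ut ltW).
    by have [_] := H t a ut b.
  - by left; split=> //; rewrite -tu.
have [a b] := inb v ltac:(by rewrite uv lexx).
have [fv nC] := H v a uv b.
rewrite fv (c0 _ nC); last by rewrite b andbT; case/andP: u01 => ? _; lra.
move: fE; rewrite !mulr2n; case: asboolP => Cu.
  by rewrite big_cons; move: (\sum_(t <- s) c t) => S; lia.
by rewrite (c0 u01' Cu); move: (\sum_(t <- s) c t) => S; lia.
Qed.

(** An interior point is passed from both sides and contributes its jump twice, an end point only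
    once. The supremum of the parameters satisfying [G] belongs to that set by [G_left] and equals 1
    by [G_right]. *)
Lemma jump_formula :
  finite_set [set t : R | 0 < t < 1 /\ Cr t] /\
  f 1 - f 0 = c 0 + c 1 + (\sum_(t \in [set t : R | 0 < t < 1 /\ Cr t]) c t) *+ 2.
Proof.
have [u0 Gu0] := G_init.
have hsG : has_sup [set u | G u].
  by split; [exists u0|exists 1 => u [/andP[]]].
set w := sup [set u | G u].
have w01 : 0 < w <= 1.
  apply/andP; split; last by apply: ge_sup; [exists u0|move=> u [/andP[]]].
  by case: (Gu0) => /andP[u00 _] _; apply: lt_le_trans u00 _; apply: ub_le_sup => //; case: hsG.
have Gw : G w.
  have [d d0 H] := G_left w01.
  have [v Gv wv] := sup_adherent d0 hsG.
  have : v <= w by apply: ub_le_sup => //; case: hsG.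
  by rewrite le_eqVlt => /orP[/eqP <- //|vw]; apply: (H v) => //; rewrite wv.
have w1 : w = 1.
  apply/eqP; rewrite eq_le; case/andP: (w01) => _ -> /=; rewrite leNgt; apply/negP => w1.
  have [v wv Gv] := G_right Gw w1.
  have : v <= w by apply: ub_le_sup => //; case: hsG.
  by rewrite leNgt wv.
case: Gw; rewrite w1 => _ [s [us sE fE]].
have -> : [set t : R | 0 < t < 1 /\ Cr t] = [set` s].
  by apply/seteqP; split=> t /=; rewrite -?sE //; move=> /sE.
split; first exact: finite_seq.
by rewrite fE -fsbig_seq.
Qed.

End JumpFormula.

(** * Symplectic matrices and the Cayley transform *)

Section SymplecticBasics.
Variables (R : realType) (n : nat).
Local Notation J := (J0 R n).

Lemma J0T : J^T = - J.
Proof. by rewrite /J0 tr_block_mx linearN /= !trmx1 !trmx0 opp_block_mx opprK oppr0. Qed.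

Lemma J0J0 : J *m J = - 1%:M.
Proof.
rewrite /J0 mulmx_block !mulmx0 !mul0mx !addr0 !add0r mulmx1 mul1mx.
by rewrite [in RHS]scalar_mx_block opp_block_mx oppr0.
Qed.

Lemma J0_unit : J \in unitmx.
Proof. by have [] := mulmx1_unit (_ : J *m (- J) = 1%:M); rewrite ?mulmxN ?J0J0 ?opprK. Qed.

Lemma SpE (A : 'M[R]_(n + n)) : Sp A <-> A^T *m J *m A = J.
Proof.
have E (v w : 'cV[R]_(n + n)) : omega0 v w = - (v^T *m J *m w) 0 0.
  by rewrite /omega0 trmx_mul J0T mulmxN mulNmx mxE.
have EA (v w : 'cV[R]_(n + n)) : omega0 (A *m v) (A *m w) = - (v^T *m (A^T *m J *m A) *m w) 0 0.
  by rewrite E trmx_mul !mulmxA.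
split=> [SA|AJ v w]; last by rewrite EA AJ E.
apply/matrixP => i j; have := SA (delta_mx i 0) (delta_mx j 0).
rewrite EA E => /oppr_inj; rewrite !trmx_delta -!rowE -!colE.
by rewrite ![col _ _ _ _]mxE ![row _ _ _ _]mxE.
Qed.

Lemma Sp_unit (A : 'M[R]_(n + n)) : Sp A -> A \in unitmx.
Proof.
move=> /SpE AJ; have := J0_unit; rewrite -AJ !unitmx_mul.
by move=> /andP[_].
Qed.

Lemma SpM (A B : 'M[R]_(n + n)) : Sp A -> Sp B -> Sp (A *m B).
Proof.
move=> /SpE AJ /SpE BJ; apply/SpE.
by rewrite trmx_mul -!mulmxA (mulmxA J A) (mulmxA A^T) (mulmxA A^T) AJ mulmxA BJ.
Qed.

Lemma SpV (A : 'M[R]_(n + n)) : Sp A -> Sp (invmx A).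
Proof.
move=> SA; have Au := Sp_unit SA; move/SpE: SA => AJ; apply/SpE.
by rewrite -{1}AJ trmx_inv -!mulmxA mulmxV // mulmx1 mulmxA mulVmx ?unitmx_tr // mul1mx.
Qed.

(** This is J (A - 1) (A + 1)^-1, written with a single occurrence of [A] so that it is easy to
    differentiate. It encodes the graph of [A], in midpoint coordinates, as a symmetric matrix. *)
Definition cay (A : 'M[R]_(n + n)) := J *m (1%:M - 2 *: invmx (A + 1%:M)).

Lemma cayE (A : 'M[R]_(n + n)) : A + 1%:M \in unitmx ->
  cay A *m (A + 1%:M) = J *m (A - 1%:M).
Proof.
move=> Au; rewrite /cay -mulmxA mulmxBl mul1mx -scalemxAl mulVmx //.
by congr (_ *m _); rewrite scaler_nat mulr2n opprD addrA addrK.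
Qed.

(** Multiplying by [(A + 1)^T] on the left and [A + 1] on the right clears the inverses and leaves a
    polynomial consequence of [A^T J A = J]. *)
Lemma cay_sym (A : 'M[R]_(n + n)) : Sp A -> A + 1%:M \in unitmx -> (cay A)^T = cay A.
Proof.
move=> /SpE AJ Au; have AuT : (A + 1%:M)^T \in unitmx by rewrite unitmx_tr.
apply: (can_inj (mulKmx AuT)); apply: (can_inj (mulmxK Au)).
rewrite -trmx_mul cayE // -[RHS]mulmxA cayE //.
have E1 : (A - 1%:M)^T = A^T - 1%:M by rewrite linearB /= trmx1.
have E2 : (A + 1%:M)^T = A^T + 1%:M by rewrite linearD /= trmx1.
rewrite trmx_mul J0T E1 E2.
rewrite !(mulmxDl, mulmxDr, mulmxN, mulNmx) !mul1mx !mulmx1 !mulmxA AJ.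
by move: (A^T *m J) (J *m A) J => X Y Z; apply/matrixP => i j; rewrite !mxE; ring.
Qed.

End SymplecticBasics.

Section FormMatrix.
Variable R : realType.

Lemma lin_rowE p (f : 'rV[R]_p -> R) :
  (forall a u v, f (a *: u + v) = a * f u + f v) ->
  forall u, f u = \sum_i u ord0 i * f (delta_mx 0 i).
Proof.
move=> fl u.
have f0 : f 0 = 0 by have := fl (-1) 0 0; rewrite scaler0 addr0 mulN1r addNr.
rewrite {1}[u]row_sum_delta.
elim/big_rec2: _ => [//|i y x _ <-].
by rewrite fl.
Qed.

Definition form_mx p (b : 'rV[R]_p -> 'rV[R]_p -> R) : 'M[R]_p :=
  \matrix_(i, j) b (delta_mx 0 i) (delta_mx 0 j).

Lemma form_mxE p (b : 'rV[R]_p -> 'rV[R]_p -> R) :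
  (forall a u v w, b (a *: u + v) w = a * b u w + b v w) ->
  (forall a u v w, b w (a *: u + v) = a * b w u + b w v) ->
  forall u v, (u *m form_mx b *m v^T) 0 0 = b u v.
Proof.
move=> bl br u v; rewrite (lin_rowE (f := fun u => b u v)) ?mxE; last by move=> *; rewrite bl.
under eq_bigr do rewrite mxE mulr_suml.
rewrite exchange_big /=; apply: eq_bigr => i _.
rewrite (lin_rowE (f := b (delta_mx 0 i))); last by move=> *; rewrite br.
rewrite mulr_sumr; apply: eq_bigr => j _.
by rewrite [form_mx b i j]mxE [v^T j 0]mxE mulrAC mulrA.
Qed.

End FormMatrix.

(** * The discrete action functional and its kernel *)

Section DiscreteAction.
Variables (R : realType) (n m : nat).
Hypothesis m_even : ~~ odd m.
Local Notation J := (J0 R n).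
Local Notation N := m.+1.
Local Notation d := (n + n)%N.
Implicit Types z w : 'M[R]_(d, N).

Definition mid z (k : 'I_N) : 'cV[R]_d := col k z + col (ordS k) z.
Definition dif z (k : 'I_N) : 'cV[R]_d := col (ordS k) z - col k z.

(* For a path beta in Sp(2n), with [C k] the Cayley transform of
   beta(t_(k+1)) beta(t_k)^-1, the kernel of this form consists of the discrete
   orbits z_k = beta(t_k) z_0 that close up, i.e. of ker(1 - beta(1)). An odd
   number of points is needed for z to be determined by its midpoints. *)
Definition bform (C : 'I_N -> 'M[R]_d) z w : R :=
  \sum_k ((mid w k)^T *m (J *m dif z k - C k *m mid z k)) 0 0.

Lemma mid_lin a z w k : mid (a *: z + w) k = a *: mid z k + mid w k.
Proof. by apply/colP => i; rewrite !mxE; ring. Qed.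

Lemma dif_lin a z w k : dif (a *: z + w) k = a *: dif z k + dif w k.
Proof. by apply/colP => i; rewrite !mxE; ring. Qed.

Lemma bform_linl C a z z' w : bform C (a *: z + z') w = a * bform C z w + bform C z' w.
Proof.
rewrite /bform mulr_sumr -big_split /=; apply: eq_bigr => k _.
have -> : J *m dif (a *: z + z') k - C k *m mid (a *: z + z') k
    = a *: (J *m dif z k - C k *m mid z k) + (J *m dif z' k - C k *m mid z' k).
  rewrite mid_lin dif_lin; move: (dif z k) (dif z' k) (mid z k) (mid z' k) => A B E F.
  rewrite !mulmxDr -!scalemxAr; move: (J *m A) (J *m B) (C k *m E) (C k *m F) => X Y Z T.
  by apply/matrixP => i j; rewrite !mxE; ring.
move: (J *m dif z k - C k *m mid z k) (J *m dif z' k - C k *m mid z' k) => Y Z.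
by rewrite mulmxDr -scalemxAr mxaddE mxscaleE.
Qed.

Lemma bform_linr C a z w w' : bform C z (a *: w + w') = a * bform C z w + bform C z w'.
Proof.
rewrite /bform mulr_sumr -big_split /=; apply: eq_bigr => k _.
rewrite mid_lin; have -> : (a *: mid w k + mid w' k)^T = a *: (mid w k)^T + (mid w' k)^T.
  by rewrite linearP.
by rewrite mulmxDl -scalemxAl mxaddE mxscaleE.
Qed.

Lemma sum_ordS (F : 'I_N -> R) : \sum_k F (ordS k) = \sum_k F k.
Proof. by rewrite [RHS](reindex_inj (@ordS_inj N)). Qed.

Lemma scalar_form_tr (a b : 'cV[R]_d) (S : 'M[R]_d) :
  (a^T *m S *m b) 0 0 = (b^T *m S^T *m a) 0 0.
Proof.
have -> : b^T *m S^T *m a = (a^T *m S *m b)^T by rewrite !trmx_mul trmxK mulmxA.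
by rewrite [RHS]mxE.
Qed.

(** Discrete integration by parts: the antisymmetric part of the J-term at [k] is a difference
    [F (ordS k) - F k], which sums to zero around the cycle. *)
Lemma bform_sym C z w : (forall k, (C k)^T = C k) -> bform C z w = bform C w z.
Proof.
move=> Csym; apply/eqP; rewrite -subr_eq0 /bform -sumrB.
pose F k := 2 * ((col k w)^T *m J *m col k z) 0 0.
rewrite (eq_bigr (fun k => F (ordS k) - F k)); last first.
  move=> k _; rewrite /F /mid /dif; move: (C k) (Csym k) => S Ssym.
  move: (col k z) (col (ordS k) z) (col k w) (col (ordS k) w) => z0 z1 w0 w1.
  have E1 := scalar_form_tr (w0 + w1) (z0 + z1) S.
  rewrite !mulmxBr !mulmxA !mxaddE !mxoppE E1 Ssym.
  have q (a b : 'cV[R]_d) : (a^T *m J *m b) 0 0 = - (b^T *m J *m a) 0 0.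
    by rewrite scalar_form_tr J0T mulmxN mulNmx mxoppE.
  have qD (a b c : 'cV[R]_d) : ((a + b)^T *m J *m c) 0 0 = (a^T *m J *m c) 0 0 + (b^T *m J *m c) 0 0.
    by rewrite linearD /= !mulmxDl mxE.
  rewrite !qD (q z0 w0) (q z0 w1) (q z1 w0) (q z1 w1); ring.
by rewrite sumrB sum_ordS subrr.
Qed.

(** If [y] annihilates all midpoint sequences, consecutive values are opposite; after an odd number
    of steps around the cycle this gives [y ord0 = - y ord0]. *)
Lemma mid_surj (y : 'I_N -> 'cV[R]_d) :
  (forall w, \sum_k ((mid w k)^T *m y k) 0 0 = 0) -> forall k, y k = 0.
Proof.
move=> H.
have E w : \sum_k ((mid w k)^T *m y k) 0 0
    = \sum_k ((col (ordS k) w)^T *m (y (ordS k) + y k)) 0 0.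
  under eq_bigr do rewrite /mid linearD /= mulmxDl mxE.
  rewrite big_split /= -(sum_ordS (fun k => ((col k w)^T *m y k) 0 0)) -big_split /=.
  by apply: eq_bigr => k _; rewrite mulmxDr [RHS]mxE.
have anti k : y (ordS k) = - y k.
  (* With this test sequence the summed pairing becomes a sum of squares of [y (ordS k) + y k]. *)
  pose w : 'M[R]_(d, N) := \matrix_(a, l) (y l + y (ord_pred l)) a ord0.
  have wE l : col (ordS l) w = y (ordS l) + y l.
    by apply/colP => a; rewrite !mxE ordSK.
  have := H w; rewrite E => /eqP; rewrite psumr_eq0; last first.
    by move=> l _; rewrite wE mxE; apply: sumr_ge0 => a _; rewrite mxE -expr2 sqr_ge0.
  move=> /allP /(_ k); rewrite mem_index_enum wE mxE => /(_ isT) /implyP /(_ isT).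
  rewrite psumr_eq0; last by move=> a _; rewrite mxE -expr2 sqr_ge0.
  move=> /allP Ha; apply/eqP; rewrite -addr_eq0; apply/eqP/colP => a; rewrite [RHS]mxE.
  have := Ha a; rewrite mem_index_enum => /(_ isT); rewrite [_^T _ _]mxE /=.
  by rewrite mulf_eq0 orbb => /eqP.
have yS (k : nat) (km : (k < N)%N) : y (inord k) = (-1) ^+ k *: y ord0.
  elim: k km => [|k IH] km; first by rewrite expr0 scale1r; congr y; apply: val_inj; rewrite /= inordK.
  have -> : inord k.+1 = ordS (inord k : 'I_N).
    by apply: val_inj; rewrite /= !inordK ?modn_small // ltnW.
  by rewrite anti IH ?(ltnW km) // exprS mulN1r scaleNr.
have y0 : y ord0 = 0.
  have := anti (inord m); have -> : ordS (inord m : 'I_N) = ord0.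
    by apply: val_inj; rewrite /= inordK // modnn.
  rewrite yS // -signr_odd (negPf m_even) expr0 scale1r => /eqP.
  by rewrite -addr_eq0 -mulr2n -scaler_nat scaler_eq0 pnatr_eq0 => /eqP.
by move=> k; rewrite -[k]inord_val yS // y0 scaler0.
Qed.

Variable P : nat -> 'M[R]_d.
Hypothesis P_Sp : forall k, (k <= N)%N -> Sp (P k).
Definition step k := P k.+1 *m invmx (P k).
Hypothesis step1 : forall k, (k < N)%N -> step k + 1%:M \in unitmx.
Hypothesis P0 : P 0 = 1%:M.

Definition discr : 'M[R]_(d * N) := form_mx (fun u v =>
  bform (fun k : 'I_N => cay (step k)) (vec_mx u) (vec_mx v)).

Lemma step_Sp k : (k < N)%N -> Sp (step k).
Proof. by move=> kN; apply: SpM; [exact: P_Sp|apply: SpV; apply: P_Sp; exact: ltnW]. Qed.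

Lemma discrE u v : (u *m discr *m v^T) 0 0 =
  bform (fun k : 'I_N => cay (step k)) (vec_mx u) (vec_mx v).
Proof.
rewrite form_mxE // => [a u1 u2 w|a u1 u2 w]; rewrite linearP /=.
  by rewrite bform_linl.
by rewrite bform_linr.
Qed.

Lemma discr_sym : discr^T = discr.
Proof.
apply/matrixP => i j; rewrite !mxE; apply: bform_sym => k.
by apply: cay_sym; [exact: step_Sp|exact: step1].
Qed.

Definition traj (zeta : 'cV[R]_d) : 'M[R]_(d, N) := \matrix_(a, k) (P k *m zeta) a 0.

Lemma col_traj zeta k : col k (traj zeta) = P k *m zeta.
Proof. by apply/colP => a; rewrite !mxE. Qed.

Lemma col_ordS_traj zeta (k : 'I_N) : P N *m zeta = zeta ->
  col (ordS k) (traj zeta) = P k.+1 *m zeta.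
Proof.
move=> fz; rewrite col_traj /=; have [kN|] := ltnP k.+1 N; first by rewrite modn_small.
rewrite leq_eqVlt ltnNge ltn_ord orbF => /eqP E.
by rewrite -E modnn P0 mul1mx fz.
Qed.

Lemma stepE k : (k < N)%N -> step k *m P k = P k.+1.
Proof. by move=> kN; rewrite /step mulmxKV //; apply: Sp_unit; apply: P_Sp; exact: ltnW. Qed.

Lemma traj_ker zeta w : P N *m zeta = zeta ->
  bform (fun k : 'I_N => cay (step k)) (traj zeta) w = 0.
Proof.
move=> fz; rewrite /bform big1 // => k _.
have -> : mid (traj zeta) k = (step k + 1%:M) *m (P k *m zeta).
  by rewrite /mid col_ordS_traj // col_traj mulmxDl mul1mx mulmxA stepE // addrC.
have -> : dif (traj zeta) k = (step k - 1%:M) *m (P k *m zeta).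
  by rewrite /dif col_ordS_traj // col_traj mulmxBl mul1mx mulmxA stepE.
by rewrite [cay _ *m _]mulmxA cayE ?step1 // -mulmxA subrr mulmx0 mxE.
Qed.

(** By [mid_surj] the equation [J dif = cay mid] holds at every index separately; solving it for the
    next point gives [z_(k+1) = step k z_k], and closing the cycle makes [z_0] a fixed vector of
    [P N]. *)
Lemma ker_traj z : (forall w, bform (fun k : 'I_N => cay (step k)) z w = 0) ->
  exists2 zeta, P N *m zeta = zeta & z = traj zeta.
Proof.
move=> /mid_surj H.
have zS (k : 'I_N) : col (ordS k) z = step k *m col k z.
  have := H k => /eqP; rewrite subr_eq0 => /eqP E.
  set A := step k in E *; have Au : A + 1%:M \in unitmx by exact: step1.
  have [u zu] : exists u, mid z k = (A + 1%:M) *m u.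
    by exists (invmx (A + 1%:M) *m mid z k); rewrite mulKVmx.
  have zd : dif z k = (A - 1%:M) *m u.
    apply: (can_inj (mulKmx (J0_unit R n))); by rewrite E zu mulmxA cayE // mulmxA.
  have z2 : (2 : R) *: col (ordS k) z = 2 *: (A *m u).
    have -> : (2 : R) *: col (ordS k) z = mid z k + dif z k.
      by apply/colP => i; rewrite !mxE; ring.
    rewrite zu zd -mulmxDl addrACA subrr addr0 -mulr2n mulmxDl scaler_nat mulr2n.
    by [].
  have z1 : (2 : R) *: col k z = 2 *: u.
    have -> : (2 : R) *: col k z = mid z k - dif z k.
      by apply/colP => i; rewrite !mxE; ring.
    rewrite zu zd -mulmxBl opprB addrC addrA subrK -mulr2n mulmxDl mul1mx.
    by rewrite scaler_nat mulr2n.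
  have two0 : (2 : R) != 0 by rewrite pnatr_eq0.
  by rewrite (scalerI two0 z2) (scalerI two0 z1).
have zP k : (k < N)%N -> col (inord k) z = P k *m col ord0 z.
  elim: k => [|k IH] kN.
    by rewrite P0 mul1mx; congr (col _ z); apply: val_inj; rewrite /= inordK.
  have -> : inord k.+1 = ordS (inord k : 'I_N).
    by apply: val_inj; rewrite /= !inordK ?modn_small // ltnW.
  by rewrite zS IH ?(ltnW kN) // mulmxA inordK ?(ltnW kN) // stepE // ltnW.
exists (col ord0 z); last first.
  by apply/matrixP => a k; rewrite mxE -zP // inord_val mxE.
have <- : ordS (inord m : 'I_N) = ord0 by apply: val_inj; rewrite /= inordK // modnn.
rewrite {2}zS zP // mulmxA inordK // stepE //.
by congr (P _ *m col _ z); apply: val_inj; rewrite /= inordK // modnn.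
Qed.

Lemma discr_ker0 (v : 'rV[R]_(d * N)) :
  v *m discr = 0 <->
  forall w, bform (fun k : 'I_N => cay (step k)) (vec_mx v) w = 0.
Proof.
split=> [v0 w|H].
  by rewrite -[w]mxvecK -discrE v0 mul0mx mxE.
apply/rowP => j; rewrite [RHS]mxE.
have := discrE v (delta_mx 0 j); rewrite H trmx_delta -colE mxE.
by [].
Qed.

Definition traj_rows r (F : 'M[R]_(r, d)) : 'M[R]_(r, d * N) :=
  \matrix_(i < r) mxvec (traj (row i F)^T).

Lemma mul_traj_rows r (F : 'M[R]_(r, d)) (c : 'rV[R]_r) :
  c *m traj_rows F = mxvec (traj (c *m F)^T).
Proof.
apply/rowP => j; case/mxvec_indexP: j => a k; rewrite mxvecE !mxE.
under eq_bigr do rewrite mxE mxvecE !mxE mulr_sumr.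
rewrite exchange_big /=; apply: eq_bigr => b _; rewrite !mxE mulr_sumr.
by apply: eq_bigr => i _; rewrite !mxE mulrCA.
Qed.

Lemma traj_inj zeta zeta' : traj zeta = traj zeta' -> zeta = zeta'.
Proof. by move=> /(congr1 (col ord0)); rewrite !col_traj P0 !mul1mx. Qed.

Section KernelRows.
Variables (r : nat) (F : 'M[R]_(r, d)).
Hypothesis Ffree : row_free F.
Hypothesis FE : (F :=: kermx (1%:M - P N)^T)%MS.

Lemma fix_rows (c : 'rV[R]_r) : P N *m (c *m F)^T = (c *m F)^T.
Proof.
have /sub_kermxP : (c *m F <= kermx (1%:M - P N)^T)%MS by rewrite -FE submxMl.
move=> /(congr1 trmx); rewrite trmx_mul trmxK trmx0 mulmxBl mul1mx => /eqP.
by rewrite subr_eq0 => /eqP.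
Qed.

Lemma traj_rows_ker : traj_rows F *m discr = 0.
Proof.
apply/row_matrixP => i; rewrite row0 row_mul rowE mul_traj_rows.
by apply/discr_ker0 => w; rewrite mxvecK traj_ker // fix_rows.
Qed.

(** The nullity of the discrete form is the dimension of the fixed space of [P N], so the form
    degenerates exactly at crossings; this is the rank hypothesis of the jump lemmas. *)
Lemma rank_discr : (\rank discr + r = d * N)%N.
Proof.
have Kfree : row_free (traj_rows F).
  apply/row_freeP; apply/row_freeP; rewrite -kermx_eq0; apply/rowV0P => c.
  move=> /sub_kermxP; rewrite mul_traj_rows => E; have : traj (c *m F)^T = traj 0.
    apply: (can_inj (@mxvecK R d N)); rewrite E; apply/rowP => j.
    by case/mxvec_indexP: j => a k; rewrite mxvecE !mxE big1 // => b _; rewrite mxE mulr0.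
  move=> /traj_inj /(congr1 trmx); rewrite trmxK trmx0 => cF.
  by apply: (row_free_inj Ffree); rewrite cF mul0mx.
have KE : (kermx discr :=: traj_rows F)%MS.
  apply/eqmxP/andP; split; last by apply/sub_kermxP; exact: traj_rows_ker.
  apply/row_subP => i; set v := row i _.
  have /discr_ker0 /ker_traj [zeta fz vz] : v *m discr = 0.
    by apply/sub_kermxP; exact: row_sub.
  have : (zeta^T <= F)%MS.
    rewrite FE; apply/sub_kermxP; rewrite -trmx_mul mulmxBl mul1mx fz subrr.
    by rewrite trmx0.
  move=> /submxP[c cF]; apply/submxP; exists c.
  by rewrite mul_traj_rows -cF trmxK -vz vec_mxK.
have := mxrank_ker discr; rewrite KE (eqP Kfree) => rE.
by rewrite {1}rE subnKC // rank_leq_row.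
Qed.

End KernelRows.

End DiscreteAction.

(** * The crossing index as a difference of signatures *)

Section CrossingIndex.
Variables (R : realType) (n : nat).
Local Notation J := (J0 R n).
Local Notation d := (n + n)%N.

Lemma signZ m a (S : 'M[R]_m) : 0 < a -> sign (a *: S) = sign S.
Proof.
move=> a0; have an : a != 0 by rewrite gt_eqF.
have E (p : pred R) : (forall b, p b = p (a * b)) ->
    (\big[addn/0%N]_(b \in [set b : R | p b]) \rank (eigenspace (a *: S) b))
    = (\big[addn/0%N]_(b \in [set b : R | p b]) \rank (eigenspace S b)).
  move=> pq; rewrite (reindex_fsbig (fun b : R => a * b) [set b | p b]).
    apply: eq_fsbigr => b _; rewrite /eigenspace !mxrank_ker; congr (_ - _)%N.
    by rewrite -scale_scalar_mx -scalerBr mxrank_scale_nz.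
  split=> [b /=|b e _ _ /(mulfI an) //|b /= pb]; first by rewrite -pq.
  by exists (a^-1 * b); rewrite ?mulVKf //= pq mulVKf.
rewrite /sign (E (fun b => 0 < b)) => [|b]; last by rewrite pmulr_rgt0.
by rewrite (E (fun b => b < 0)) // => b; rewrite pmulr_rlt0.
Qed.

Lemma sign_flat m (S : 'M[R]_m) : m = 0%N -> sign S = 0.
Proof.
move=> m0; rewrite /sign !fsbig1 ?subrr // => a _;
  by apply/eqP; rewrite -leqn0 (leq_trans (rank_leq_row _)) // m0.
Qed.

Lemma unitmx_flat m (S : 'M[R]_m) : m = 0%N -> S \in unitmx.
Proof. by move=> m0; subst m; rewrite unitmxE det_mx00 unitr1. Qed.

(** Symmetry of [S] is known on [0, 1] only, so at an end point the derivative is approached by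
    difference quotients taken from inside the interval. *)
Lemma sym_derive m (S : R -> 'M[R]_m) t0 D : dmx S t0 D -> 0 <= t0 <= 1 ->
  (forall t, 0 <= t <= 1 -> (S t)^T = S t) -> D^T = D.
Proof.
move=> dS t01 Ssym; apply/matrixP => i j; apply/eqP; rewrite mxE -subr_eq0.
apply/negPn/negP => Dn; set a := D j i - D i j in Dn.
have a0 : 0 < `|a| / 2 by rewrite divr_gt0 ?normr_gt0.
have [e e0 H] := near_dist (mcts_near_lt (dmx_slope dS) a0).
rewrite eqxx in H.
have [t [tt0 te t1]] : exists t, [/\ t != t0, `|t - t0| < e & 0 <= t <= 1].
  case/andP: t01 => t00 t01; have [lt|ge] := ltP t0 1.
    exists (Num.min 1 (t0 + e / 2)); have tm : t0 < Num.min 1 (t0 + e / 2).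
      by rewrite lt_min lt /=; lra.
    split; first by rewrite gt_eqF.
      rewrite gtr0_norm ?subr_gt0 // ltrBlDl; apply: le_lt_trans (_ : t0 + e / 2 < _); last lra.
      by rewrite ge_min lexx orbT.
    by rewrite ge_min lexx andbT; lra.
  have -> : t0 = 1 by lra.
  exists (Num.max 0 (1 - e / 2)); have tm : Num.max 0 (1 - e / 2) < 1.
    by rewrite gt_max ltr01 /=; lra.
  split; first by rewrite lt_eqF.
    rewrite ltr0_norm ?subr_lt0 // opprB ltrBlDl -ltrBlDr.
    by apply: lt_le_trans (_ : 1 - e / 2 <= _); [lra|rewrite le_max lexx orbT].
  by rewrite le_max lexx /= ltW.
have h1 := H t te i j; have h2 := H t te j i.
move: h1 h2; rewrite (negPf tt0).
have -> : ((t - t0)^-1 *: (S t - S t0)) j i = ((t - t0)^-1 *: (S t - S t0)) i j.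
  by rewrite -[in LHS](Ssym t) // -[in LHS](Ssym t0) // !mxE.
move: (((t - t0)^-1 *: (S t - S t0)) i j) => b h1 h2.
suff : `|a| < `|a| by rewrite ltxx.
have : `|a| <= `|b - D i j| + `|b - D j i|.
  have -> : a = (b - D i j) - (b - D j i) by rewrite /a; ring.
  exact: ler_normB.
move=> h3; apply: le_lt_trans h3 _; rewrite [ltRHS](splitr `|a|); exact: ltrD.
Qed.

Lemma dmx_cay (A : R -> 'M[R]_d) t A' : dmx A t A' -> A t + 1%:M \in unitmx ->
  dmx (fun s => cay (A s)) t
    (2 *: (J *m (invmx (A t + 1%:M) *m A' *m invmx (A t + 1%:M)))).
Proof.
move=> dA Au.
have dA1 : dmx (fun s => A s + 1%:M) t A'.
  by rewrite -[A']addr0; apply: dmxD => //; exact: dmx_cst.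
have dV := dmxV dA1 Au.
have d2V : dmx (fun s => 1%:M - 2 *: invmx (A s + 1%:M)) t
   (0 - (0 *: invmx (A t + 1%:M) + 2 *: - (invmx (A t + 1%:M) *m A' *m invmx (A t + 1%:M)))).
  apply: dmxB; first exact: dmx_cst.
  by apply: (dmxZ (f := fun=> 2)) => //; exact: is_derive_cst.
have := dmxM (dmx_cst J t) d2V; rewrite mul0mx add0r sub0r scale0r add0r scalerN opprK.
by rewrite -scalemxAr.
Qed.

(** The derivative of the Cayley transform of [B A^-1], evaluated on midpoints of trajectories, is a
    difference of the same expression for [B] and for [A]. Summed along the discretisation it
    telescopes. *)
Lemma Sp_derive (A : R -> 'M[R]_d) A' t B' (B : R -> 'M[R]_d) (u v : 'cV[R]_d) :
  dmx A t A' -> dmx B t B' -> Sp (A t) -> Sp (B t) ->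
  let M := B t *m invmx (A t) in
  M + 1%:M \in unitmx ->
  (((M + 1%:M) *m (A t *m u))^T *m
    (2 *: (J *m (invmx (M + 1%:M) *m (B' *m invmx (A t) - B t *m (invmx (A t) *m A' *m invmx (A t)))
      *m invmx (M + 1%:M)))) *m ((M + 1%:M) *m (A t *m v))) 0 0
  = 2 * ((u^T *m ((B t)^T *m J *m B') *m v) 0 0 - (u^T *m ((A t)^T *m J *m A') *m v) 0 0).
Proof.
move=> dA dB SA SB M Mu.
have SM : Sp M by apply: SpM => //; exact: SpV.
have Au := Sp_unit SA; have Munit := Sp_unit SM.
have MJ : M^T *m J = J *m invmx M.
  by move/SpE: SM => E; apply: (can_inj (mulmxK Munit)); rewrite E mulmxKV.
have E1 : (M + 1%:M)^T *m J *m invmx (M + 1%:M) = M^T *m J.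
  rewrite linearD /= trmx1 mulmxDl mul1mx MJ.
  have -> : J *m invmx M + J = J *m invmx M *m (M + 1%:M).
    by rewrite mulmxDr mulmx1 mulmxKV // addrC.
  by rewrite mulmxK.
rewrite -scalemxAr -scalemxAl mxscaleE; congr (2 * _).
set X := B' *m invmx (A t) - _.
have -> : ((M + 1%:M) *m (A t *m u))^T *m (J *m (invmx (M + 1%:M) *m X *m invmx (M + 1%:M)))
     *m ((M + 1%:M) *m (A t *m v)) = u^T *m ((A t)^T *m (M^T *m J) *m X *m A t) *m v.
  rewrite -E1 !trmx_mul !mulmxA; congr (_ *m _ *m _).
  by rewrite mulmxKV.
have -> : (A t)^T *m (M^T *m J) *m X *m A t = (B t)^T *m J *m B' - (A t)^T *m J *m A'.
  have -> : (A t)^T *m (M^T *m J) = (B t)^T *m J.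
    by rewrite /M trmx_mul trmx_inv !mulmxA mulmxV ?unitmx_tr // mul1mx.
  rewrite /X mulmxBr mulmxBl; congr (_ - _); first by rewrite mulmxA mulmxKV.
  rewrite !mulmxA mulmxKV //; move/SpE: SB => ->.
  congr (_ *m _); move/SpE: SA => E; apply: (can_inj (mulmxK Au)).
  by rewrite E mulmxKV.
by rewrite mulmxBr mulmxBl mxaddE mxoppE.
Qed.

Lemma half_int_sum (a b S : int) :
  2^-1 * a%:~R + S%:~R = 2^-1 * (a + b + S *+ 2)%:~R - 2^-1 * b%:~R :> rat.
Proof. by rewrite -[S *+ 2]mulr_natl !intrD intrM; field. Qed.

Lemma half_int_sub (a b c g h0 h1 : int) : a = h1 -> b = c -> g = h0 -> h1 = h0 ->
  2^-1 * (a - b)%:~R - 2^-1 * 0%:~R = 2^-1 * (g - c)%:~R :> rat.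
Proof. by move=> -> -> -> ->; rewrite mulr0 subr0. Qed.

Section RegularPath.
Variables (beta : R -> 'M[R]_d) (m : nat).
Hypothesis m_even : ~~ odd m.
Hypothesis beta_reg : regular_path beta.
Hypothesis beta_Sp : forall t, 0 <= t <= 1 -> Sp (beta t).
Hypothesis beta0 : beta 0 = 1%:M.
(** The partition of [0, t] is stretched with [t], so the discrete forms for all [t] have the same
    size; at [t = 0] every sample is the identity. *)
Let P t (k : nat) := beta (t * (k%:R / m.+1%:R)).
Hypothesis stepP : forall t k, 0 <= t <= 1 -> (k < m.+1)%N -> step (P t) k + 1%:M \in unitmx.

Let P_Sp t k : 0 <= t <= 1 -> (k <= m.+1)%N -> Sp (P t k).
Proof.
move=> /andP[t0 t1] km; apply: beta_Sp; rewrite mulr_ge0 ?divr_ge0 //=.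
by rewrite mulr_ile1 ?divr_ge0 // ler_pdivrMr // mul1r ler_nat.
Qed.

Let P00 t : P t 0 = 1%:M. Proof. by rewrite /P mul0r mulr0. Qed.
Let PN t : P t m.+1 = beta t. Proof. by rewrite /P divff ?pnatr_eq0 // mulr1. Qed.

Let Q t := discr m (P t).

Let Q_sym t : 0 <= t <= 1 -> (Q t)^T = Q t.
Proof. by move=> t01; apply: discr_sym => // k km; [exact: P_Sp|exact: stepP]. Qed.

Let P' t (k : nat) := (k%:R / m.+1%:R) *: derive1 beta (t * (k%:R / m.+1%:R)).

Let dP t k : dmx (P^~ k) t (P' t k).
Proof.
apply: (dmx_comp (f := fun s => s * (k%:R / m.+1%:R))).
  exact: is_derive_mulr.
by apply: derivable_dmx; case: beta_reg => + _ _; apply.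
Qed.

Let step' t k := P' t k.+1 *m invmx (P t k) - P t k.+1 *m (invmx (P t k) *m P' t k *m invmx (P t k)).
Let C' t (k : 'I_m.+1) := 2 *: (J *m (invmx (step (P t) k + 1%:M) *m step' t k
   *m invmx (step (P t) k + 1%:M))).

Let dC t (k : 'I_m.+1) : 0 <= t <= 1 -> dmx (fun s => cay (step (P s) k)) t (C' t k).
Proof.
move=> t01; apply: dmx_cay; last exact: stepP.
rewrite /step /step' -mulmxN; apply: dmxM; first exact: dP.
by apply: dmxV; [exact: dP|apply: Sp_unit; apply: P_Sp => //; exact: ltnW].
Qed.

Let D t : 'M[R]_(d * m.+1) :=
  form_mx (fun u v => bform (C' t) (vec_mx u) (vec_mx v))
  - form_mx (fun u v => bform (fun=> 0) (vec_mx u) (vec_mx v)).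

Let bformB C (z w : 'M[R]_(d, m.+1)) : bform C z w - bform (fun=> 0) z w
  = - \sum_(k < m.+1) ((mid w k)^T *m (C k *m mid z k)) 0 0.
Proof.
rewrite /bform -sumrB -sumrN; apply: eq_bigr => k _.
by rewrite mul0mx subr0 mulmxBr mxaddE mxoppE addrAC subrr add0r.
Qed.

Let dQ t : 0 <= t <= 1 -> dmx Q t (D t).
Proof.
move=> t01 i j; rewrite mxaddE mxoppE !mxE bformB.
have -> : (fun s => Q s i j) = (fun s => bform (fun=> 0) (vec_mx (delta_mx 0 i)) (vec_mx (delta_mx 0 j))
   - \sum_(k < m.+1) ((mid (vec_mx (delta_mx 0 j)) k)^T *m (cay (step (P s) k) *m mid (vec_mx (delta_mx 0 i)) k)) 0 0).
  by apply/funext => s; rewrite mxE -bformB addrC subrK.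
rewrite -[X in is_derive _ _ _ X]sub0r; apply: is_deriveB.
apply: is_derive_sumfin => k.
have := dmxM (dmx_cst (mid (vec_mx (delta_mx 0 j)) k)^T t)
  (dmxM (dC k t01) (dmx_cst (mid (vec_mx (delta_mx 0 i)) k) t)).
by rewrite mul0mx add0r mulmx0 addr0 => /(_ 0 0).
Qed.

Let F t := fix_basis (beta t).
Let K t := traj_rows m (P t) (F t).

Let F_free t : row_free (F t). Proof. exact: row_base_free. Qed.
Let FE t : (F t :=: kermx (1%:M - P t m.+1)^T)%MS.
Proof. by rewrite PN; exact: eq_row_base. Qed.

(** On trajectories of fixed vectors the derivative of the discrete form is a telescoping sum, of
    which only the contribution of the end point survives. *)
Let KD t : 0 <= t <= 1 -> K t *m D t *m (K t)^T = 2 *: crossing_form beta t.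
Proof.
move=> t01; have Dsym : (D t)^T = D t by exact: (sym_derive (dQ t01) t01 Q_sym).
have -> : K t *m D t *m (K t)^T = (K t *m D t *m (K t)^T)^T.
  by rewrite !trmx_mul trmxK Dsym mulmxA.
apply/matrixP => i j; rewrite mxE.
have -> : (K t *m D t *m (K t)^T) j i = (row j (K t) *m D t *m (row i (K t))^T) 0 0.
  by rewrite -row_mul mxE [RHS]mxE; apply: eq_bigr => k _; rewrite !mxE.
have bl C a (u u' v : 'rV[R]_(d * m.+1)) : bform C (vec_mx (a *: u + u')) (vec_mx v)
    = a * bform C (vec_mx u) (vec_mx v) + bform C (vec_mx u') (vec_mx v).
  by rewrite linearP /= bform_linl.
have br C a (u u' v : 'rV[R]_(d * m.+1)) : bform C (vec_mx v) (vec_mx (a *: u + u'))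
    = a * bform C (vec_mx v) (vec_mx u) + bform C (vec_mx v) (vec_mx u').
  by rewrite linearP /= bform_linr.
have FM C (u v : 'rV[R]_(d * m.+1)) :
    (u *m form_mx (fun u v => bform C (vec_mx u) (vec_mx v)) *m v^T) 0 0
    = bform C (vec_mx u) (vec_mx v).
  by apply: form_mxE => *; [exact: bl|exact: br].
rewrite mulmxBr mulmxBl mxaddE mxoppE !FM.
rewrite bformB !rowK !mxvecK.
pose om := (row i (F t))^T; pose ze := (row j (F t))^T.
have fx l : P t m.+1 *m (row l (F t))^T = (row l (F t))^T.
  by rewrite rowE; exact: (fix_rows (FE t)).
have midE l (k : 'I_m.+1) : mid (traj m (P t) (row l (F t))^T) k
    = (step (P t) k + 1%:M) *m (P t k *m (row l (F t))^T).
  rewrite /mid col_ordS_traj // col_traj mulmxDl mul1mx mulmxA.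
  by rewrite (@stepE R n m (P t) (fun k => @P_Sp t k t01) k (ltn_ord k)) addrC.
pose q k := 2 * (om^T *m ((P t k)^T *m J *m P' t k) *m ze) 0 0.
rewrite (eq_bigr (fun k : 'I_m.+1 => q k.+1 - q k)); last first.
  move=> k _; rewrite !midE mulmxA.
  have kN : (k <= m.+1)%N by exact: ltnW.
  have := @Sp_derive _ _ t _ _ om ze (dP t k) (dP t k.+1) (P_Sp t01 kN) (P_Sp t01 (ltn_ord k)) (stepP t01 (ltn_ord k)).
  by rewrite /q -mulrBr => <-.
rewrite -(big_mkord xpredT (fun k => q k.+1 - q k)) telescope_sumr //.
(* The initial sample does not move with [t]: its derivative carries the factor [0 / m.+1]. *)
have -> : q 0%N = 0 by rewrite /q /P' mul0r scale0r mulmx0 mulmx0 mul0mx mxE mulr0.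
rewrite subr0 /q PN /P' divff ?pnatr_eq0 // scale1r mulr1.
have bt := Sp_unit (beta_Sp t01).
rewrite /crossing_form [RHS]mxE [in RHS]mxoppE mulrN; congr (- (2 * _)).
have fi : beta t *m om = om by have := fx i; rewrite PN.
have fj : invmx (beta t) *m ze = ze.
  by apply: (can_inj (mulKmx bt)); rewrite mulKVmx //; have := fx j; rewrite PN.
have -> : (F t *m Smat beta t *m (F t)^T) i j = (om^T *m Smat beta t *m ze) 0 0.
  by rewrite /om trmxK -row_mul mxE [RHS]mxE; apply: eq_bigr => k _; rewrite !mxE.
rewrite /Smat -[in RHS]mulmxA -[in RHS](mulmxA (J *m _)) fj -{2}fi trmx_mul !mulmxA.
by [].
Qed.

Let crossing_dim t : ~ crossing beta t <-> \rank (kermx (1%:M - beta t)^T) = 0%N.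
Proof.
rewrite /crossing; split=> [/negP|/eqP]; first by rewrite negbK => /eqP ->; rewrite mxrank0.
by rewrite mxrank_eq0 => /eqP ->; rewrite eqxx.
Qed.

(** The jump formula counts both ends once and interior crossings twice. Halving it matches
    [crossing_index] except at 1, where the definition counts nothing; hence the subtracted term. *)
Lemma crossing_index_sign : crossing_index beta
    = 2^-1 * (sign (discr m (P 1)) - sign (discr m (P 0)))%:~R
      - 2^-1 * (sign (crossing_form beta 1))%:~R
  /\ finite_set [set t : R | 0 < t < 1 /\ crossing beta t].
Proof.
have cu t : 0 <= t <= 1 -> crossing_form beta t \in unitmx.
  move=> t01; have [ct|nct] := pselect (crossing beta t); first by case: beta_reg => _ _; apply.
  by apply: unitmx_flat; apply/crossing_dim.
have rk t : 0 <= t <= 1 -> (\rank (Q t) + \rank (kermx (1%:M - beta t)^T) = d * m.+1)%N.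
  move=> t01; apply: rank_discr (F_free t) (FE t) => // k km; [exact: P_Sp|exact: stepP].
have KQ t : 0 <= t <= 1 -> K t *m Q t = 0.
  move=> t01; apply: traj_rows_ker (FE t) => // k km; [exact: P_Sp|exact: stepP].
have nC t : 0 <= t <= 1 -> Q t \in unitmx -> ~ crossing beta t.
  move=> t01 Qu; apply/crossing_dim; have := rk t t01.
  by rewrite (mxrank_unit Qu) -[RHS]addn0 => /addnI.
have Gu t : 0 <= t <= 1 -> K t *m D t *m (K t)^T \in unitmx.
  by move=> t01; rewrite KD // unitmxZ ?cu // unitfE pnatr_eq0.
have Gs t : 0 <= t <= 1 -> sign (K t *m D t *m (K t)^T) = sign (crossing_form beta t).
  by move=> t01; rewrite KD // signZ.
have Ds t : 0 <= t <= 1 -> (D t)^T = D t.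
  by move=> t01; exact: (sym_derive (dQ t01) t01 Q_sym).
have [|||fin E] := @jump_formula R (fun t => sign (Q t)) (fun t => sign (crossing_form beta t))
  (crossing beta).
- move=> t _ /crossing_dim r0; exact: sign_flat.
- move=> t0 t01; have := sign_jump_right (Q_sym t01) (Ds t0 t01) (dQ t01) (KQ t0 t01) (rk t0 t01) (Gu t0 t01).
  apply: filterS => t H t0t t1.
  have t01' : 0 <= t <= 1 by rewrite t1 andbT; case/andP: t01 => ? _; lra.
  have [E Qu] := H t0t (Q_sym t01').
  exact: (conj (etrans E (congr1 (fun a => sign (Q t0) + a) (Gs t0 t01))) (nC t t01' Qu)).
- move=> t0 t01; have := sign_jump_left (Q_sym t01) (Ds t0 t01) (dQ t01) (KQ t0 t01) (rk t0 t01) (Gu t0 t01).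
  apply: filterS => t H t0t t1.
  have t01' : 0 <= t <= 1 by rewrite t1; case/andP: t01 => _ ?; lra.
  have [E Qu] := H t0t (Q_sym t01').
  exact: (conj (etrans E (congr1 (fun a => sign (Q t0) - a) (Gs t0 t01))) (nC t t01' Qu)).
split=> //; rewrite /crossing_index E.
exact: half_int_sum.
Qed.

End RegularPath.

Lemma mcts_cay (T : topologicalType) (A : T -> 'M[R]_d) t : mcts A t ->
  A t + 1%:M \in unitmx -> mcts (fun s => cay (A s)) t.
Proof.
move=> cA Au; apply: mctsM; first exact: mcts_cst.
apply: mctsB; first exact: mcts_cst.
apply: mctsZ; first exact: cvg_cst.
by apply: mctsV => //; apply: mctsD => //; exact: mcts_cst.
Qed.

Lemma mcts_discr (T : topologicalType) m (P : T -> nat -> 'M[R]_d) t :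
  (forall k, mcts (P^~ k) t) -> (forall k, (k <= m.+1)%N -> Sp (P t k)) ->
  (forall k, (k < m.+1)%N -> step (P t) k + 1%:M \in unitmx) ->
  mcts (fun s => discr m (P s)) t.
Proof.
move=> cP PS Pst i j.
have E s : discr m (P s) i j
    = bform (fun k : 'I_m.+1 => cay (step (P s) k)) (vec_mx (delta_mx 0 i)) (vec_mx (delta_mx 0 j)).
  by rewrite mxE.
pose f s := bform (fun k : 'I_m.+1 => cay (step (P s) k)) (vec_mx (delta_mx 0 i)) (vec_mx (delta_mx 0 j)).
have fE : (fun s => discr m (P s) i j) = f by exact/funext.
rewrite fE (E t) /f /bform.
set z := vec_mx (delta_mx 0 i); set w := vec_mx (delta_mx 0 j).
suff Hk k : (fun s => ((mid w k)^T *m (J *m dif z k - cay (step (P s) k) *m mid z k)) 0 0) @ t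
    --> ((mid w k)^T *m (J *m dif z k - cay (step (P t) k) *m mid z k)) 0 0.
  exact: (@cts_sum R T _ (index_enum 'I_m.+1)
    (fun k s => ((mid w k)^T *m (J *m dif z k - cay (step (P s) k) *m mid z k)) 0 0) t Hk).
have H : mcts (fun s => (mid w k)^T *m (J *m dif z k - cay (step (P s) k) *m mid z k)) t.
  apply: mctsM; first exact: mcts_cst.
  apply: mctsB; first exact: mcts_cst.
  apply: mctsM; last exact: mcts_cst.
  apply: mcts_cay; last exact: Pst.
  apply: mctsM; first exact: cP.
  by apply: mctsV; [exact: cP|apply: Sp_unit; apply: PS; exact: ltnW].
exact: (H 0 0).
Qed.

(** On the diagonal [H (s, t) *m invmx (H (s, t)) + 1] is twice the identity, hence invertible;
    compactness of the square makes the admissible time step uniform. *)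
Lemma unif_step (H : R * R -> 'M[R]_d) :
  (forall q, mcts H q) -> (forall q, Sp (H q)) ->
  exists N0, forall m, (N0 <= m)%N -> forall s t t', 0 <= s <= 1 -> 0 <= t <= 1 ->
    `|t - t'| < m.+1%:R^-1 -> H (s, t') *m invmx (H (s, t)) + 1%:M \in unitmx.
Proof.
move=> cH SpH.
pose K := (`[0, 1]%classic `*` `[0, 1]%classic : set (R * R)).
have cK : compact K by apply: compact_setX; exact: segment_compact.
have /compact_near_coveringP cov := cK.
pose Pr (m : nat) (q : R * R) := forall t', `|q.2 - t'| < m.+1%:R^-1 ->
  H (q.1, t') *m invmx (H q) + 1%:M \in unitmx.
have [q Kq|N0 _ HN] := cov nat \oo Pr _; last first.
  exists N0 => m /HN Hm s t t' s01 t01 tt'.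
  by apply: (Hm (s, t)) => //; split=> /=; rewrite in_itv.
pose Psi (p : (R * R) * (R * R)) := H p.1 *m invmx (H p.2) + 1%:M.
have cPsi : mcts Psi (q, q).
  apply: mctsD; last exact: mcts_cst.
  apply: mctsM; first by apply: mcts_comp; [exact: cvg_fst|exact: cH].
  apply: mctsV; last exact: Sp_unit.
  by apply: mcts_comp; [exact: cvg_snd|exact: cH].
have Psiu : Psi (q, q) \in unitmx.
  rewrite /Psi /= mulmxV ?(Sp_unit (SpH q)) //.
  have -> : 1%:M + 1%:M = 2 *: 1%:M :> 'M[R]_d by rewrite scaler_nat mulr2n.
  by rewrite unitmxZ ?unitmx1 // unitfE pnatr_eq0.
have := near_unitmx cPsi Psiu; rewrite -nbhs_nearE => /nbhs_ballP[e /= e0 He].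
have e20 : 0 < e / 2 by rewrite divr_gt0.
exists (ball q (e / 2), [set m | m.+1%:R^-1 < e / 2]) => /=.
  split; first exact: nbhsx_ballx.
  exact: (near_infty_natSinv_lt (PosNum e20)).
move=> [[s t] m] [/= [/= bs bt] bm] t' /= tt'.
apply: (He ((s, t'), (s, t))).
have lee : e / 2 <= e by lra.
do ?split => /=; rewrite /ball /= in bs bt *; try by apply: lt_trans; [eassumption|lra].
apply: le_lt_trans (ler_distD t _ _) _.
by rewrite [ltRHS](splitr e) ltrD // (lt_trans tt').
Qed.

(** The end point keeps away from eigenvalue 1 throughout the homotopy, so the discrete form stays
    nondegenerate and its signature is locally constant in [s]. *)
Lemma sign_discr_path (H : R * R -> 'M[R]_d) m : ~~ odd m ->
  (forall q, mcts H q) -> (forall q, Sp (H q)) ->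
  (forall s, H (s, 0) = 1%:M) -> (forall s, 0 <= s <= 1 -> ~ crossing (fun t => H (s, t)) 1) ->
  (forall s t t', 0 <= s <= 1 -> 0 <= t <= 1 -> `|t - t'| <= m.+1%:R^-1 ->
    H (s, t') *m invmx (H (s, t)) + 1%:M \in unitmx) ->
  sign (discr m (fun k => H (1, k%:R / m.+1%:R))) = sign (discr m (fun k => H (0, k%:R / m.+1%:R))).
Proof.
move=> me cH SH H0 H1 Hst.
pose P s k := H (s, k%:R / m.+1%:R).
have k01 k : (k < m.+1)%N -> 0 <= (k%:R / m.+1%:R : R) <= 1.
  by move=> km; rewrite divr_ge0 //= ler_pdivrMr // mul1r ler_nat ltnW.
have st s k : 0 <= s <= 1 -> (k < m.+1)%N -> step (P s) k + 1%:M \in unitmx.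
  move=> s01 km; apply: Hst => //; first exact: k01.
  rewrite -mulrBl -[k.+1]addn1 natrD opprD addrA subrr sub0r mulN1r normrN gtr0_norm ?invr_gt0 //.
have PS s k : Sp (P s k) by exact: SH.
have P0 s : P s 0 = 1%:M by rewrite /P mul0r.
have PN s : P s m.+1 = H (s, 1) by rewrite /P divff ?pnatr_eq0.
have Psym s : 0 <= s <= 1 -> (discr m (P s))^T = discr m (P s).
  by move=> s01; apply: discr_sym => // k km; exact: st.
have Pu s : 0 <= s <= 1 -> discr m (P s) \in unitmx.
  move=> s01; pose F := row_base (kermx (1%:M - P s m.+1)^T).
  have FE : (F :=: kermx (1%:M - P s m.+1)^T)%MS by exact: eq_row_base.
  have rk : (\rank (discr m (P s)) + \rank (kermx (1%:M - P s m.+1)^T) = d * m.+1)%N.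
    by apply: rank_discr (row_base_free _) FE => // k km; exact: st.
  have r0 : \rank (kermx (1%:M - P s m.+1)^T) = 0%N.
    by move/negP: (H1 s s01); rewrite negbK -PN => /eqP ->; rewrite mxrank0.
  by rewrite r0 addn0 in rk; rewrite -row_free_unit /row_free rk.
have near_eq (s : R) : 0 <= s <= 1 -> \forall s' \near s, 0 <= s' <= 1 ->
    sign (discr m (P s')) = sign (discr m (P s)).
  move=> s01; have [e e0 He] := sign_locally_cst (Psym s s01) (Pu s s01).
  have cD : mcts (fun s => discr m (P s)) s.
    apply: mcts_discr => // [k|k km]; last exact: st.
    apply: (@mcts_comp R _ _ d d H (fun s : R => (s, k%:R / m.+1%:R : R)) s); last exact: cH.
    by apply: cvg_to_pair; [exact: cvg_id|exact: cvg_cst].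
  apply: filterS (mcts_near_lt cD e0) => s' Hs' s'01; apply: He => //.
  exact: Psym.
(* With zero jumps and no crossings, the jump formula says that a locally constant function on
   [0, 1] has equal end values. *)
have [|||_ E] := @jump_formula R (fun s => sign (discr m (P s))) (fun=> 0) set0.
- by [].
- move=> s s01; apply: filterS (near_eq s s01) => s' E ss' s'1.
  have s'01 : 0 <= s' <= 1 by rewrite s'1 andbT; case/andP: s01 => ? _; lra.
  by split; [rewrite addr0; exact: E|].
- move=> s s01; apply: filterS (near_eq s s01) => s' E ss' s'1.
  have s'01 : 0 <= s' <= 1 by rewrite s'1; case/andP: s01 => _ ?; lra.
  by split; [rewrite subr0; exact: E|].
apply/eqP; rewrite -subr_eq0; apply/eqP; move: E; rewrite fsbig1 // !addr0 mul0rn.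
Qed.

(** Clamping to [0, 1] extends a homotopy from the square to the plane, so that continuity can be
    used without restriction to a subspace. *)
Let cl (t : R) : R := Num.max 0 (Num.min 1 t).

Let cl01 t : 0 <= cl t <= 1.
Proof. by rewrite /cl le_max lexx /= ge_max ler01 ge_min lexx. Qed.

Let clE t : 0 <= t <= 1 -> cl t = t.
Proof. by move=> /andP[t0 t1]; rewrite /cl (min_idPr t1) (max_idPr t0). Qed.

Let cl_cts t : cl @ t --> cl t.
Proof.
apply: continuous_max; first exact: cvg_cst.
by apply: continuous_min; [exact: cvg_cst|exact: cvg_id].
Qed.

Lemma mul_itv01 (t u : R) : 0 <= t <= 1 -> 0 <= u <= 1 -> 0 <= t * u <= 1.
Proof. by move=> /andP[t0 t1] /andP[u0 u1]; rewrite mulr_ge0 //= mulr_ile1. Qed.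

Lemma discr_ext m (P P' : nat -> 'M[R]_d) : (forall k, (k <= m.+1)%N -> P k = P' k) ->
  discr m P = discr m P'.
Proof.
move=> PP; rewrite /discr; apply: (congr1 (@form_mx R _)).
apply/funext => u; apply/funext => v.
rewrite /bform; apply: eq_bigr => k _.
by rewrite /step (PP k (ltnW (ltn_ord k))) (PP k.+1 (ltn_ord k)).
Qed.

(** The right-hand side mentions only samples of [gam]; two regular paths homotopic to [gam] are
    then compared through one fine even [m]. *)
Lemma crossing_index_homotopic (gam beta : R -> 'M[R]_d) :
  regular_path beta -> sp_homotopic gam beta -> gam 0 = 1%:M -> ~ crossing gam 1 ->
  exists N0, forall m, (N0 <= m)%N -> ~~ odd m ->
    crossing_index beta = 2^-1 * (sign (discr m (fun k => gam (k%:R / m.+1%:R)))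
       - sign (discr m (fun=> 1%:M : 'M[R]_d)))%:~R
  /\ finite_set [set t : R | 0 < t < 1 /\ crossing beta t].
Proof.
move=> breg [h [ch hSp hgb h01]] g0 g1.
pose H (q : R * R) := h (cl q.1, cl q.2).
have HE s t : 0 <= s <= 1 -> 0 <= t <= 1 -> H (s, t) = h (s, t).
  by move=> s01 t01; rewrite /H !clE.
have I01 : 0 <= (1 : R) <= 1 by rewrite ler01 lexx.
have I00 : 0 <= (0 : R) <= 1 by rewrite ler01 lexx.
have cH q : mcts H q.
  apply/mctsP => W /= HW.
  have c2 : (fun q : R * R => (cl q.1, cl q.2)) @ q --> (cl q.1, cl q.2).
    have a1 : (fun q : R * R => cl q.1) @ q --> cl q.1 := cvg_comp _ _ cvg_fst (@cl_cts q.1).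
    have a2 : (fun q : R * R => cl q.2) @ q --> cl q.2 := cvg_comp _ _ cvg_snd (@cl_cts q.2).
    apply: cvg_to_pair; [exact: a1|exact: a2].
  have A : (`[0, 1]%classic `*` `[0, 1]%classic : set (R * R)) (cl q.1, cl q.2).
    by split; rewrite /= in_itv /= cl01.
  have /subspace_continuousP := ch => /(_ _ A W HW) => hW.
  have hW' : \forall q' \near q,
      (`[0, 1]%classic `*` `[0, 1]%classic : set (R * R)) (cl q'.1, cl q'.2) ->
      W (h (cl q'.1, cl q'.2)) by exact: (c2 _ hW).
  apply: filterS hW' => q' Hq'; apply: Hq'; by split; rewrite /= in_itv /= cl01.
have SH q : Sp (H q) by apply: hSp.
have H0 s : H (s, 0) = 1%:M by rewrite /H /= (clE I00); have [->] := h01 _ (cl01 s).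
have HN s : 0 <= s <= 1 -> H (s, 1) = gam 1.
  by move=> s01; rewrite HE //; have [] := h01 s s01.
have Hb t : 0 <= t <= 1 -> H (1, t) = beta t by move=> t01; rewrite HE //; have [] := hgb t t01.
have Hg t : 0 <= t <= 1 -> H (0, t) = gam t by move=> t01; rewrite HE //; have [] := hgb t t01.
have [N0 HN0] := unif_step cH SH.
(* The shift by one makes the step [m.+2^-1] strictly smaller than the bound [m.+1^-1] of
   [unif_step], which admits only strict inequalities. *)
exists N0.+1 => -[//|m] mN me.
have N0m : (N0 <= m)%N by [].
have Hst s t t' : 0 <= s <= 1 -> 0 <= t <= 1 -> `|t - t'| <= m.+2%:R^-1 ->
    H (s, t') *m invmx (H (s, t)) + 1%:M \in unitmx.
  move=> s01 t01 tt'; apply: (HN0 m N0m) => //; apply: le_lt_trans tt' _.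
  by rewrite ltf_pV2 ?posrE // ltr_nat.
have k01 k : (k <= m.+2)%N -> 0 <= (k%:R / m.+2%:R : R) <= 1.
  by move=> km; rewrite divr_ge0 //= ler_pdivrMr // mul1r ler_nat.
have Hc s : 0 <= s <= 1 -> ~ crossing (fun t => H (s, t)) 1 by move=> s01; rewrite /crossing HN.
have bSp t : 0 <= t <= 1 -> Sp (beta t) by move=> t01; rewrite -Hb.
have b0 : beta 0 = 1%:M by rewrite -Hb.
have bst t k : 0 <= t <= 1 -> (k < m.+2)%N ->
    step (fun k => beta (t * (k%:R / m.+2%:R))) k + 1%:M \in unitmx.
  move=> t01 km; have tk j : (j <= m.+2)%N -> 0 <= t * (j%:R / m.+2%:R) <= 1.
    by move=> /k01; exact: mul_itv01.
  rewrite /step -(Hb _ (tk _ km)) -(Hb _ (tk _ (ltnW km))).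
  apply: Hst I01 (tk _ (ltnW km)) _.
  rewrite -mulrBr -mulrBl -[k.+1]addn1 natrD opprD addrA subrr sub0r mulN1r mulrN normrN.
  case/andP: t01 => t0 t1; rewrite ger0_norm ?mulr_ge0 ?invr_ge0 //.
  by rewrite ler_piMl ?invr_ge0.
have [-> fin] := crossing_index_sign me breg bSp b0 bst; split=> //.
have -> : sign (crossing_form beta 1) = 0.
  apply: sign_flat; apply/eqP; rewrite mxrank_eq0.
  by move/negP: (Hc 1 I01); rewrite negbK Hb.
have E0 : discr m.+1 (fun k => gam (k%:R / m.+2%:R)) = discr m.+1 (fun k => H (0, k%:R / m.+2%:R)).
  by apply: discr_ext => k km; rewrite (Hg _ (k01 _ km)).
have E1 : discr m.+1 (fun k => beta (1 * (k%:R / m.+2%:R)))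
    = discr m.+1 (fun k => H (1, k%:R / m.+2%:R)).
  by apply: discr_ext => k km; rewrite mul1r (Hb _ (k01 _ km)).
have E2 : discr m.+1 (fun k => beta (0 * (k%:R / m.+2%:R))) = discr m.+1 (fun=> 1%:M).
  by apply: discr_ext => k km; rewrite mul0r.
exact: (half_int_sub (congr1 (@sign R _) E1) (congr1 (@sign R _) E2)
  (congr1 (@sign R _) E0) (sign_discr_path me cH SH H0 Hc Hst)).
Qed.

Lemma crossing_index_unique (gam beta beta' : R -> 'M[R]_d) :
  gam 0 = 1%:M -> ~ crossing gam 1 ->
  regular_path beta -> sp_homotopic gam beta ->
  regular_path beta' -> sp_homotopic gam beta' ->
  crossing_index beta = crossing_index beta'.
Proof.
move=> g0 g1 r1 h1 r2 h2.
have [N1 H1] := crossing_index_homotopic r1 h1 g0 g1.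
have [N2 H2] := crossing_index_homotopic r2 h2 g0 g1.
have me : ~~ odd (N1 + N2).*2 by rewrite odd_double.
have [|-> _] := H1 (N1 + N2).*2 _ me.
  by rewrite -addnn -addnA leq_addr.
have [|-> _ //] := H2 (N1 + N2).*2 _ me.
by rewrite -addnn addnA leq_addl.
Qed.

Lemma mu_CZ_eq (gam beta : R -> 'M[R]_d) :
  gam 0 = 1%:M -> ~ crossing gam 1 -> regular_path beta -> sp_homotopic gam beta ->
  mu_CZ gam = crossing_index beta.
Proof.
move=> g0 g1 r1 h1; rewrite /mu_CZ; case: xgetP => [m _ [b [rb hb <-]]|H].
  exact: (crossing_index_unique g0 g1).
by have := H (crossing_index beta); case; exists beta.
Qed.

End CrossingIndex.

(** * Linear differential equations *)

Section Norm.
Variable R : realType.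

(** The sum of absolute values is submultiplicative, which the maximum norm of the matrix topology
    is not. *)
Definition nrm m n (A : 'M[R]_(m, n)) : R := \sum_i \sum_j `|A i j|.

Lemma nrm_ge0 m n (A : 'M[R]_(m, n)) : 0 <= nrm A.
Proof. by apply: sumr_ge0 => i _; apply: sumr_ge0. Qed.

Lemma nrm_entry m n (A : 'M[R]_(m, n)) i j : `|A i j| <= nrm A.
Proof.
rewrite /nrm (bigD1 i) //= (bigD1 j) //= -addrA lerDl addr_ge0 //.
  exact: sumr_ge0.
by apply: sumr_ge0 => k _; apply: sumr_ge0.
Qed.

Lemma nrm0 m n : nrm (0 : 'M[R]_(m, n)) = 0.
Proof. by rewrite /nrm big1 // => i _; rewrite big1 // => j _; rewrite mxE normr0. Qed.

Lemma nrm_le0 m n (A : 'M[R]_(m, n)) : nrm A <= 0 -> A = 0.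
Proof.
move=> A0; apply/matrixP => i j; rewrite mxE; apply/eqP; rewrite -normr_le0.
exact: le_trans (nrm_entry A i j) A0.
Qed.

Lemma nrmD m n (A B : 'M[R]_(m, n)) : nrm (A + B) <= nrm A + nrm B.
Proof.
rewrite /nrm -big_split /=; apply: ler_sum => i _; rewrite -big_split /=.
by apply: ler_sum => j _; rewrite mxE ler_normD.
Qed.

Lemma nrmN m n (A : 'M[R]_(m, n)) : nrm (- A) = nrm A.
Proof. by apply: eq_bigr => i _; apply: eq_bigr => j _; rewrite mxE normrN. Qed.

Lemma nrmB m n (A B : 'M[R]_(m, n)) : nrm (A - B) <= nrm A + nrm B.
Proof. by rewrite -(nrmN B); exact: nrmD. Qed.

Lemma nrm_dist m n (A B : 'M[R]_(m, n)) : nrm A <= nrm B + nrm (A - B).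
Proof. by rewrite -{1}(subrK B A) addrC; exact: nrmD. Qed.

Lemma nrmZ m n a (A : 'M[R]_(m, n)) : nrm (a *: A) = `|a| * nrm A.
Proof.
rewrite /nrm mulr_sumr; apply: eq_bigr => i _; rewrite mulr_sumr.
by apply: eq_bigr => j _; rewrite mxE normrM.
Qed.

Lemma nrmM m n p (A : 'M[R]_(m, n)) (B : 'M[R]_(n, p)) :
  nrm (A *m B) <= nrm A * nrm B.
Proof.
rewrite {1}/nrm {2}/nrm mulr_suml; apply: ler_sum => i _.
apply: (@le_trans _ _ (\sum_j \sum_k `|A i k| * `|B k j|)).
  apply: ler_sum => j _; rewrite mxE; apply: (le_trans (ler_norm_sum _ _ _)).
  by apply: ler_sum => k _; rewrite normrM.
rewrite exchange_big /= mulr_suml; apply: ler_sum => k _.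
rewrite -mulr_sumr ler_wpM2l //.
rewrite /nrm (bigD1 k) //= lerDl; apply: sumr_ge0 => l _; exact: sumr_ge0.
Qed.

Lemma nrm_cts (T : topologicalType) m n (F : T -> 'M[R]_(m, n)) (t : T) :
  mcts F t -> (fun s => nrm (F s)) @ t --> nrm (F t).
Proof.
move=> cF; apply: (@cts_sum R T _ _ (fun i s => \sum_j `|F s i j|)) => i.
apply: (@cts_sum R T _ _ (fun j s => `|F s i j|)) => j.
exact: (cvg_norm (cF i j)).
Qed.

Lemma mcts_nrm (T : topologicalType) m n (F : T -> 'M[R]_(m, n)) (t : T) :
  (forall e : R, 0 < e -> \forall s \near t, nrm (F s - F t) <= e) -> mcts F t.
Proof.
move=> H i j; apply/cvgrPdist_le => e e0; apply: filterS (H e e0) => s; apply: le_trans.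
by rewrite distrC -mxoppE -mxaddE; exact: nrm_entry.
Qed.

Lemma mcts_nrm_near (T : topologicalType) m n (F : T -> 'M[R]_(m, n)) (t : T) :
  mcts F t -> forall e : R, 0 < e -> \forall s \near t, nrm (F s - F t) <= e.
Proof.
move=> cF e e0.
have := nrm_cts (mctsB cF (@mcts_cst R T _ _ (F t) t)); rewrite subrr nrm0 => /cvgrPdist_le /(_ e e0).
by apply: filterS => s; rewrite sub0r normrN ger0_norm // nrm_ge0.
Qed.

Lemma mcts_mx (T : topologicalType) m n (f : 'I_m -> 'I_n -> T -> R) (t : T) :
  (forall i j, f i j @ t --> f i j t) -> mcts (fun s => \matrix_(i, j) f i j s) t.
Proof.
move=> cf i j; rewrite mxE.
have -> : (fun s => (\matrix_(i, j) f i j s) i j) = f i j by apply/funext => s; rewrite mxE.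
exact: cf.
Qed.

Lemma nrm_bounded_on m n (F : R -> 'M[R]_(m, n)) a b :
  (forall t, a <= t <= b -> mcts F t) ->
  exists2 C : R, 0 < C & forall t, a <= t <= b -> nrm (F t) <= C.
Proof.
move=> cF; have [ab|ba] := leP a b; last first.
  exists 1 => // t /andP[at_ tb]; have := le_trans at_ tb; by rewrite leNgt ba.
have cN : {within `[a, b], continuous (fun t => nrm (F t))}.
  apply/continuous_in_subspaceT => t; rewrite inE /= in_itv /= => tab.
  exact: (nrm_cts (cF _ tab)).
have [c _ cmax] := EVT_max ab cN.
exists (nrm (F c) + 1); first by rewrite ltr_wpDl ?nrm_ge0.
move=> t tab; rewrite ler_wpDr //; apply: cmax; by rewrite in_itv.
Qed.

Lemma mean_value_nrm m n (F f : R -> 'M[R]_(m, n)) (u u' : R -> R) a b :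
  a <= b -> (forall s, a <= s <= b -> dmx F s (f s)) ->
  (forall s, is_derive s (1 : R) u (u' s)) ->
  (forall s, a <= s <= b -> nrm (f s) <= u' s) -> nrm (F b - F a) <= u b - u a.
Proof.
move=> ab dF du fu.
(* Pairing [F] with the signs of its increment turns the norm of the increment into the increment of
   a scalar function, to which the mean value theorem applies. *)
pose e i j := Num.sg ((F b - F a) i j).
pose G s := \sum_i \sum_j F s i j * e i j - u s.
pose g s := \sum_i \sum_j f s i j * e i j - u' s.
have dG s : a <= s <= b -> is_derive s (1 : R) G (g s).
  move=> sab; apply: (@is_deriveB _ _ _ (fun s => \sum_i \sum_j F s i j * e i j) u).
  apply: is_derive_sumfin => i; apply: is_derive_sumfin => j.
  rewrite -[f s i j * _]/((f s i j) *: e i j) -[_ *: _]mul1r.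
  apply: is_derive_eq; first exact: (is_deriveM (dF s sab i j) (is_derive_cst (e i j) s 1)).
  by rewrite scaler0 add0r mul1r /GRing.scale /= mulrC.
have [||c cab] := @MVT_segment R G g a b ab.
- move=> s; rewrite in_itv /= => /andP[/ltW as_ /ltW sb]; apply: dG; by rewrite as_.
- apply: derivable_within_continuous => s; rewrite in_itv /= => sab.
  by case: (dG s sab).
move: cab; rewrite in_itv /= => cab GE.
have : G b - G a <= 0.
  rewrite GE mulr_le0_ge0 ?subr_ge0 // /g subr_le0; apply: le_trans (fu c cab).
  apply: ler_sum => i _; apply: ler_sum => j _.
  apply: le_trans (ler_norm _) _; rewrite normrM normr_sg ler_piMr //.
  by case: eqP.
pose SS x := \sum_i \sum_j F x i j * e i j.
rewrite -[G b]/(SS b - u b) -[G a]/(SS a - u a) => H.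
have {}H : SS b - SS a <= u b - u a by lra.
apply: le_trans H; rewrite /SS -sumrB le_eqVlt; apply/orP; left; apply/eqP.
apply: eq_bigr => i _; rewrite -sumrB; apply: eq_bigr => j _.
by rewrite -mulrBl normrEsg mulrC /e mxaddE mxoppE.
Qed.

Lemma is_derive_cexp (c k a t : R) :
  is_derive t (1 : R) (fun s => c * expR (k * (s - a))) (c * (k * expR (k * (t - a)))).
Proof.
apply: (@is_deriveZ _ _ _ (fun s => expR (k * (s - a))) c t 1).
have d1 : is_derive t (1 : R) (fun s => k * (s - a)) k.
  have := is_deriveB (is_derive_mulr k t) (is_derive_cst (k * a) t 1).
  rewrite subr0; have -> // : *%R^~ k - cst (k * a) = (fun s => k * (s - a)) :> (R -> R).
  by apply/funext => s; rewrite mulrBr (mulrC k s).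
have d2 := is_derive_expR (k * (t - a)).
have [dfa fE] := d1; have [dFa FE] := d2.
have := derive1_comp dfa dFa; rewrite !derive1E fE FE => E.
apply: DeriveDef; last by rewrite E mulrC.
apply/derivable1_diffP; apply: (@differentiable_comp _ _ _ _ (fun s => k * (s - a)) expR).
  exact/derivable1_diffP.
exact/derivable1_diffP.
Qed.

Lemma half_small (c e : R) : 0 < e -> exists k, c * 2^-1 ^+ k <= e.
Proof.
move=> e0; have h : 0 <= (`|c| + 1) / e by rewrite divr_ge0 ?addr_ge0 // ltW.
have := archi_boundP h; set k := Num.bound _ => hk; exists k.
rewrite exprVn ler_pdivrMr ?exprn_gt0 // mulrC.
have k2 : (k%:R : R) <= 2 ^+ k by rewrite -natrX ler_nat ltnW // ltn_expl.
move: hk; rewrite ltr_pdivrMr // => hk.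
have : k%:R * e <= 2 ^+ k * e by rewrite ler_pM2r.
have := ler_norm c; lra.
Qed.

(** Bootstrapping in a weighted norm: because the weight grows at rate [2 * M] and not [M], each
    integration of the inequality halves the excess over [e / M]. Starting from any bound [C] on the
    segment, the excess tends to zero. *)
Lemma gronwall m n (F f : R -> 'M[R]_(m, n)) (M e : R) a b :
  0 < M -> 0 <= e ->
  (forall t, a <= t <= b -> dmx F t (f t) /\ nrm (f t) <= M * nrm (F t) + e) ->
  F a = 0 -> forall t, a <= t <= b -> nrm (F t) <= e / M * expR (2 * M * (t - a)).
Proof.
move=> M0 e0 dF Fa.
have [C C0 HC] := nrm_bounded_on (fun t tab => dmx_mcts (dF t tab).1).
have Me : 0 <= e / M by rewrite divr_ge0 // ltW.
have K k : forall t, a <= t <= b ->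
    nrm (F t) <= (C * 2^-1 ^+ k + e / M) * expR (2 * M * (t - a)).
  elim: k => [|k IH] t /andP[at_ tb].
    have E1 : 1 <= expR (2 * M * (t - a)).
      by rewrite -expR0 ler_expR mulr_ge0 ?subr_ge0 // mulr_ge0 // ltW.
    rewrite expr0 mulr1; apply: le_trans (HC t _) _; first by rewrite at_.
    apply: (@le_trans _ _ (C + e / M)); first by rewrite lerDl.
    by rewrite ler_peMr // addr_ge0 // ltW.
  set c := C * 2^-1 ^+ k.
  have c0 : 0 <= c by rewrite mulr_ge0 ?exprn_ge0 ?invr_ge0 // ltW.
  pose w := c / 2 + e / M.
  have w0 : 0 <= w by rewrite addr_ge0 // divr_ge0.
  pose v s := w * expR (2 * M * (s - a)).
  pose v' s := w * (2 * M * expR (2 * M * (s - a))).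
  have dv s : is_derive s (1 : R) v (v' s) by exact: is_derive_cexp.
  have bnd s : a <= s <= t -> nrm (f s) <= v' s.
    move=> /andP[as_ st]; have sab : a <= s <= b by rewrite as_ (le_trans st).
    have E1 : 1 <= expR (2 * M * (s - a)).
      by rewrite -expR0 ler_expR mulr_ge0 ?subr_ge0 // mulr_ge0 // ltW.
    apply: le_trans (dF s sab).2 _.
    have H1 : M * nrm (F s) <= M * ((c + e / M) * expR (2 * M * (s - a))).
      by rewrite ler_pM2l //; exact: IH.
    have H2 : e <= e * expR (2 * M * (s - a)) by rewrite ler_peMr.
    apply: le_trans (lerD H1 H2) _.
    rewrite le_eqVlt; apply/orP; left; apply/eqP; rewrite /v' /w; field.
    by rewrite gt_eqF.
  have dFt s : a <= s <= t -> dmx F s (f s).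
    by move=> /andP[as_ st]; apply: (dF s _).1; rewrite as_ (le_trans st).
  have := mean_value_nrm at_ dFt dv bnd.
  rewrite Fa subr0 /v subrr mulr0 expR0 mulr1 => H; apply: le_trans H _.
  have -> : C * 2^-1 ^+ k.+1 + e / M = w by rewrite /w /c exprSr mulrA.
  by rewrite gerBl.
move=> t tab; apply/ler_addgt0Pr => d d0.
have [k kd] := half_small (C * expR (2 * M * (t - a))) d0.
apply: le_trans (K k t tab) _; rewrite mulrDl addrC lerD2l.
by rewrite mulrAC.
Qed.

Lemma mean_value_exp m n (F f : R -> 'M[R]_(m, n)) (c k T : R) :
  F 0 = 0 -> 0 <= c -> 0 < k -> (forall s, `|s| <= T -> dmx F s (f s)) ->
  (forall s, `|s| <= T -> nrm (f s) <= c * expR (k * `|s|)) ->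
  forall t, `|t| <= T -> nrm (F t) <= c / k * expR (k * `|t|).
Proof.
move=> F0 c0 k0 dF bF t tT; rewrite -[F t]subr0 -F0; move: F F0 f dF bF t tT => F _ f.
suff K (G g : R -> 'M[R]_(m, n)) (t : R) : (forall s, `|s| <= T -> dmx G s (g s)) ->
    (forall s, `|s| <= T -> nrm (g s) <= c * expR (k * `|s|)) -> 0 <= t <= T ->
    nrm (G t - G 0) <= c / k * expR (k * t).
  move=> dF bF t tT; have [t0|/ltW t0] := leP 0 t.
    by rewrite ger0_norm //; apply: (K _ f) => //; rewrite t0 -(ger0_norm t0).
  rewrite ler0_norm // -{1}[t]opprK -{1}oppr0.
  apply: (K (fun s => F (- s)) (fun s => - f (- s))).
  - move=> s sT; rewrite -[X in dmx _ X]opprK; apply: dmx_opp; apply: dF; by rewrite normrN.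
  - by move=> s sT; rewrite nrmN -(normrN s); apply: bF; rewrite normrN.
  - by rewrite oppr_ge0 t0 -(ler0_norm t0).
move=> dG bG /andP[t0 tT].
have sT s : 0 <= s <= t -> `|s| <= T by move=> /andP[s0 st]; rewrite ger0_norm // (le_trans st).
have dGt s : 0 <= s <= t -> dmx G s (g s) by move=> st; apply: dG; exact: sT.
have bnd s : 0 <= s <= t -> nrm (g s) <= c / k * (k * expR (k * (s - 0))).
  move=> st; rewrite subr0 mulrA divfK ?gt_eqF //; have := bG s (sT s st).
  by case/andP: st => s0 _; rewrite (ger0_norm s0).
apply: le_trans (mean_value_nrm t0 dGt (fun s => is_derive_cexp (c / k) k 0 s) bnd) _.
by rewrite subr0 gerBl subrr mulr0 expR0 mulr1 divr_ge0 // ltW.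
Qed.

Lemma geom_cauchy (u : nat -> R) (c : R) :
  (forall k, `|u k.+1 - u k| <= c * 2^-1 ^+ k) ->
  forall k, `|u k - lim (u @ \oo)| <= 2 * c * 2^-1 ^+ k.
Proof.
move=> uc; pose q k : R := 2^-1 ^+ k.
have c0 : 0 <= c by have := le_trans (normr_ge0 _) (uc 0%N); rewrite expr0 mulr1.
have q0 k : 0 <= q k by rewrite /q exprn_ge0.
have qS k : q k.+1 = q k / 2 by rewrite /q exprS mulrC.
(* The subtracted term [q (k + m)] keeps the geometric sum in closed form and makes the induction on
   [m] go through. *)
have tail k m : `|u (k + m)%N - u k| <= 2 * c * (q k - q (k + m)%N).
  elim: m => [|m IH]; first by rewrite addn0 !subrr normr0 mulr0.
  rewrite addnS -[_ - u k](subrKA (u (k + m)%N)); apply: le_trans (ler_normD _ _) _.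
  apply: le_trans (lerD (uc _) IH) _.
  by rewrite -/(q _) qS; have := q0 (k + m)%N; have := c0; nra.
have tail' k m : `|u (k + m)%N - u k| <= 2 * c * q k.
  apply: le_trans (tail k m) _; rewrite ler_wpM2l ?mulr_ge0 //.
  by rewrite gerBl.
have cu : cvg (u @ \oo).
  apply: cauchy_cvg; apply: cauchy_exP => e e0.
  have e20 : 0 < e / 2 by rewrite divr_gt0.
  have [k ke] := half_small (2 * c) e20.
  exists (u k); exists k => // m /= km.
  rewrite -ball_normE /ball_ /= distrC -(subnKC km).
  by apply: le_lt_trans (tail' _ _) _; apply: le_lt_trans ke _; rewrite gtr_pMr // invf_lt1 // ltr1n.
move=> k.
have H : (fun m => `|u (k + m)%N - u k|) @ \oo --> `|lim (u @ \oo) - u k|.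
  apply: cvg_norm; apply: cvgB; last exact: cvg_cst.
  by rewrite (_ : (fun m => u (k + m)%N) = [sequence u (m + k)%N]_m) ?cvg_shiftn //;
    apply/funext => m; rewrite /= addnC.
rewrite distrC -(cvg_lim _ H) //; apply: limr_le; first by apply/cvg_ex; exists (`|lim (u @ \oo) - u k|).
by near=> m; exact: tail'.
Unshelve. all: by end_near.
Qed.

(** Integrals are taken from [- N] with [N] depending on the point; normalising at 0 makes the
    choices of [N] agree, so that they glue to a primitive on the whole line, negative times
    included. *)
Lemma primitive_ex (f : R -> R) : (forall t, f @ t --> f t) ->
  exists F : R -> R, F 0 = 0 /\ forall t, is_derive t (1 : R) F (f t).
Proof.
move=> cf.
pose I (N x : R) := \int[@lebesgue_measure R]_(s in `[- N, x]) f s.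
have intf (a b : R) : (@lebesgue_measure R).-integrable `[a, b] (EFin \o f).
  apply: continuous_compact_integrable; first exact: segment_compact.
  by apply: continuous_subspaceT => t; exact: cf.
pose F N x := I N x - I N 0.
have dF (N t : R) : - N < t -> is_derive t (1 : R) (F N) (f t).
  move=> Nt.
  have tt : t < t + 1 by rewrite ltrDl.
  have [d1 d2] : derivable (I N) t 1 /\ derive1 (I N) t = f t.
    by apply: (continuous_FTC1 tt (intf _ _)); rewrite ?bnd_simp ?ltW //; exact: cf.
  have dI : is_derive t (1 : R) (I N) (f t).
    by apply: DeriveDef; [exact: d1|rewrite -derive1E; exact: d2].
  rewrite -[f t]subr0; exact: (is_deriveB dI (is_derive_cst (I N 0) t 1)).
have consist (N K x : R) : 0 <= N -> N <= K -> - N < x -> F K x = F N x.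
  move=> N0 NK Nx.
  have split y : - N <= y -> I K y = I K (- N) + I N y.
    move=> Ny; apply/eqP; rewrite addrC -subr_eq; apply/eqP.
    rewrite /I (Rintegral_itvB (intf _ _)) ?bnd_simp ?lerN2 //.
    rewrite Rintegral_itv_obnd_cbnd //.
    apply: (integrableS _ _ _ (intf (- N) y)); try exact: measurable_itv.
    by move=> z /=; rewrite !in_itv /= => /andP[/ltW -> ->].
  by rewrite /F (split x (ltW Nx)) (split 0) ?oppr_le0 // opprD addrACA subrr add0r.
pose N (t : R) := `|t| + 1.
have N0 t : 0 <= N t by rewrite addr_ge0.
exists (fun t => F (N t) t); split; first by rewrite /F subrr.
move=> t; apply: near_eq_is_derive (dF (N t) t _); last first.
  by rewrite /N ltrNl (le_lt_trans (ler_norm _)) // normrN ltrDl.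
have : \forall s \near t, `|t - s| < 1 by apply: (@nbhsx_ballx _ R^o t 1); exact: ltr01.
apply: filterS => s ts.
have Nts : - N t < s by move: ts; rewrite ltr_norml /N => /andP[_ ?]; have := ler_norm (- t); rewrite normrN; lra.
have Nss : - N s < s by rewrite /N ltrNl (le_lt_trans (ler_norm _)) // normrN ltrDl.
have [le|/ltW le] := leP (N t) (N s); first by rewrite (consist (N t)).
by rewrite (consist (N s)).
Qed.

Lemma mprimitive_ex m n (f : R -> 'M[R]_(m, n)) : (forall t, mcts f t) ->
  exists F : R -> 'M[R]_(m, n), F 0 = 0 /\ forall t, dmx F t (f t).
Proof.
move=> cf.
have H i j := primitive_ex (fun t => cf t i j).
pose F i j := projT1 (cid (H i j)).
exists (fun t => \matrix_(i, j) F i j t); split.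
  by apply/matrixP => i j; rewrite !mxE /F; case: cid => /= G [].
move=> t i j; under eq_fun do rewrite mxE.
by rewrite /F; case: cid => /= G [].
Qed.

End Norm.

(** * Linear systems: uniqueness, existence and dependence on parameters *)

Section LinearODE.
Variable R : realType.

Lemma dmx_cst_of0 m n (F : R -> 'M[R]_(m, n)) a b :
  a <= b -> (forall t, a <= t <= b -> dmx F t 0) -> F b = F a.
Proof.
move=> ab dF; apply/eqP; rewrite -subr_eq0; apply/eqP; apply: nrm_le0.
have d0 (s : R) : is_derive s (1 : R) (fun=> 0 : R) (0 : R) by exact: is_derive_cst.
have := mean_value_nrm ab dF d0; rewrite subrr; apply.
by move=> s _; rewrite nrm0.
Qed.

Lemma ode_uniq_itv N p (X : R -> 'M[R]_N) (F G : R -> 'M[R]_(N, p)) a b :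
  (forall t, a <= t <= b -> mcts X t) ->
  (forall t, a <= t <= b -> dmx F t (X t *m F t)) ->
  (forall t, a <= t <= b -> dmx G t (X t *m G t)) ->
  F a = G a -> forall t, a <= t <= b -> F t = G t.
Proof.
move=> cX dF dG FGa t tab; apply/eqP; rewrite -subr_eq0; apply/eqP; apply: nrm_le0.
have [C C0 HC] := nrm_bounded_on cX.
have := @gronwall R _ _ (fun s => F s - G s) (fun s => X s *m (F s - G s)) C 0 a b C0 (lexx 0).
rewrite mul0r => H; have := H _ _ t tab; rewrite mul0r; apply; last by rewrite FGa subrr.
move=> s sab; split; first by rewrite mulmxBr; apply: dmxB; [exact: dF|exact: dG].
rewrite addr0; apply: le_trans (nrmM _ _) _; rewrite ler_wpM2r ?nrm_ge0 //; exact: HC.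
Qed.

Lemma ode_uniq N p (X : R -> 'M[R]_N) (F G : R -> 'M[R]_(N, p)) a :
  (forall t, mcts X t) -> (forall t, dmx F t (X t *m F t)) ->
  (forall t, dmx G t (X t *m G t)) -> F a = G a -> forall t, F t = G t.
Proof.
move=> cX dF dG FGa t; have [at_|/ltW ta] := leP a t.
  by apply: (@ode_uniq_itv N p X F G a t) => //; rewrite lexx at_.
rewrite -[t]opprK.
apply: (@ode_uniq_itv N p (fun s => - X (- s)) (fun s => F (- s)) (fun s => G (- s))
  (- a) (- t)); rewrite ?opprK ?lexx ?lerN2 ?ta //.
- move=> s _; apply: mctsN; apply: (@mcts_comp R _ _ _ _ X (fun s => - s)) => //.
  by apply: cvgN; exact: cvg_id.
- move=> s _; rewrite mulNmx -[s]opprK opprK -[X in dmx _ X]opprK; apply: dmx_opp; exact: dF.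
- move=> s _; rewrite mulNmx -[X in dmx _ X]opprK; apply: dmx_opp; exact: dG.
Qed.

Section Existence.
Variables (N : nat) (X : R -> 'M[R]_N).
Hypothesis cX : forall t, mcts X t.

Let prim (f : R -> 'M[R]_N) : R -> 'M[R]_N :=
  if pselect (exists F, F 0 = 0 /\ forall t, dmx F t (f t)) is left h
  then projT1 (cid h) else fun=> 0.

Let primP f : (forall t, mcts f t) -> prim f 0 = 0 /\ forall t, dmx (prim f) t (f t).
Proof.
move=> /mprimitive_ex H; rewrite /prim; case: pselect => // h.
by case: cid.
Qed.

(** Picard iterates for the integral equation [Y = 1 + prim (X Y)]. *)
Let S k : R -> 'M[R]_N :=
  iter k (fun F t => 1%:M + prim (fun s => X s *m F s) t) (fun=> 1%:M).

Let S_cts k (t : R) : mcts (S k) t.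
Proof.
elim: k t => [|k IH] t; first exact: mcts_cst.
apply: mctsD; first exact: mcts_cst.
have [|_ d] := @primP (fun s => X s *m S k s); last exact: dmx_mcts (d t).
by move=> s; exact: mctsM.
Qed.

Let dS k (t : R) : dmx (S k.+1) t (X t *m S k t).
Proof.
have [|_ d] := @primP (fun s => X s *m S k s); first by move=> s; exact: mctsM.
by rewrite -[X t *m _]add0r; apply: dmxD; [exact: dmx_cst|exact: d].
Qed.

Let S0 k : S k 0 = 1%:M.
Proof.
case: k => [//|k].
have [|d _] := @primP (fun s => X s *m S k s); first by move=> s; exact: mctsM.
by rewrite /S iterS d addr0.
Qed.

(** With the weight [expR (2 * M * |t|)] the Picard map contracts by one half on every bounded
    interval, however long. *)
Let step_bound (T : R) : exists2 C : R, 0 < C &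
  forall k t, `|t| <= T -> nrm (S k.+1 t - S k t) <= C * 2^-1 ^+ k.
Proof.
have cXT (t : R) : - T <= t <= T -> mcts X t by move=> _; exact: cX.
have [M M0 HM] := nrm_bounded_on cXT.
have cST (t : R) : - T <= t <= T -> mcts (fun t => S 1 t - S 0 t) t.
  by move=> _; exact: mctsB (@S_cts 1 t) (@S_cts 0 t).
have [c c0 Hc] := nrm_bounded_on cST.
have H k t : `|t| <= T -> nrm (S k.+1 t - S k t) <= c * 2^-1 ^+ k * expR (2 * M * `|t|).
  elim: k t => [|k IH] t tT.
    apply: le_trans (Hc t _) _; first by rewrite -ler_norml.
    rewrite expr0 mulr1 ler_peMr // ?(ltW c0) //.
    by rewrite -expR0 ler_expR !mulr_ge0 // ltW.
  have := @mean_value_exp R _ _ (fun s => S k.+2 s - S k.+1 s) (fun s => X s *m (S k.+1 s - S k s))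
    (M * (c * 2^-1 ^+ k)) (2 * M) T.
  rewrite !S0 subrr => /(_ erefl _ _ _ _ t tT) H.
  have {}H : nrm (S k.+2 t - S k.+1 t) <=
      M * (c * 2^-1 ^+ k) / (2 * M) * expR (2 * M * `|t|).
    apply: H; rewrite ?mulr_gt0 //.
    - by rewrite !mulr_ge0 ?exprn_ge0 ?invr_ge0 // ltW.
    - by move=> s _; rewrite mulmxBr; apply: dmxB.
    - move=> s sT; apply: le_trans (nrmM _ _) _; rewrite -mulrA; apply: ler_pM; rewrite ?nrm_ge0 //.
        by apply: HM; rewrite -ler_norml.
      exact: IH.
  apply: le_trans H _; rewrite ler_wpM2r ?expR_ge0 // le_eqVlt; apply/orP; left; apply/eqP.
  by rewrite exprSr; field; rewrite gt_eqF.
exists (c * expR (2 * M * T)); first by rewrite mulr_gt0 ?expR_gt0.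
move=> k t tT; apply: le_trans (H k t tT) _; rewrite mulrAC ler_wpM2r //.
by rewrite ler_wpM2l ?(ltW c0) // ler_expR ler_wpM2l // mulr_ge0 // ltW.
Qed.

Let Y t : 'M[R]_N := \matrix_(i, j) lim ((fun k => S k t i j) @ \oo).

Let SY (T : R) : exists2 C : R, 0 < C &
  forall k t, `|t| <= T -> nrm (S k t - Y t) <= C * 2^-1 ^+ k.
Proof.
have [C C0 HC] := step_bound T.
exists (2 * C * (N * N).+1%:R); first by rewrite !mulr_gt0.
move=> k t tT.
have E i j : `|(S k t - Y t) i j| <= 2 * C * 2^-1 ^+ k.
  rewrite mxaddE mxoppE mxE; apply: (@geom_cauchy R (fun k => S k t i j)) => m.
  by apply: le_trans (HC m t tT); rewrite -mxoppE -mxaddE nrm_entry.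
apply: (@le_trans _ _ (\sum_(i < N) \sum_(j < N) 2 * C * 2^-1 ^+ k)).
  by apply: ler_sum => i _; apply: ler_sum => j _.
rewrite !sumr_const !card_ord -mulrnA -[leLHS]mulr_natr mulrAC.
rewrite ler_wpM2r ?exprn_ge0 ?invr_ge0 // ler_wpM2l ?mulr_ge0 ?(ltW C0) //.
by rewrite ler_nat.
Qed.

Lemma ode_exists : exists F : R -> 'M[R]_N,
  F 0 = 1%:M /\ forall t, dmx F t (X t *m F t).
Proof.
have cY (t : R) : mcts Y t.
  apply: mcts_nrm => e e0.
  have [C C0 HC] := SY (`|t| + 1).
  have e30 : 0 < e / 3 by rewrite divr_gt0.
  have [k kC] := half_small C e30.
  have near1 : \forall s \near t, `|t - s| < 1 by apply: (@nbhsx_ballx _ R^o t 1); exact: ltr01.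
  have near2 := mcts_nrm_near (@S_cts k t) e30.
  apply: filterS2 near1 near2 => s ts Ss.
  have sT : `|s| <= `|t| + 1.
    by rewrite -(subrK t s) addrC (le_trans (ler_normD _ _)) // lerD2l distrC ltW.
  have tT : `|t| <= `|t| + 1 by rewrite lerDl.
  have h1 := HC k s sT; have h2 := HC k t tT.
  have -> : Y s - Y t = - (S k s - Y s) + (S k s - S k t) + (S k t - Y t).
    by rewrite opprB (addrA (Y s - _)) subrK addrA subrK.
  apply: le_trans (nrmD _ _) _; apply: le_trans (lerD (nrmD _ _) (lexx _)) _.
  rewrite nrmN; lra.
have cXY (t : R) : mcts (fun t => X t *m Y t) t by apply: mctsM; [exact: cX|exact: cY].
have [F [F0 dF]] := mprimitive_ex cXY.
exists Y.
(* The uniform limit [Y] is continuous, so [X Y] has a primitive; passing to the limit in the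
   integral equation then yields differentiability of [Y]. *)
suff YE : forall t, Y t = 1%:M + F t.
  split; first by rewrite YE F0 addr0.
  move=> t; apply: (@dmx_near_eq R _ _ (fun s => 1%:M + F s)).
    by apply: filterE => s; rewrite YE.
  by rewrite -[X t *m _]add0r; apply: dmxD; [exact: dmx_cst|exact: dF].
move=> t; apply/eqP; rewrite -subr_eq0; apply/eqP; apply: nrm_le0; apply/ler_addgt0Pr => e e0.
rewrite add0r.
have [C C0 HC] := SY `|t|.
have cXt (s : R) : - `|t| <= s <= `|t| -> mcts X s by move=> _; exact: cX.
have [M M0 HM] := nrm_bounded_on cXt.
pose E := expR (1 * `|t|).
have [k kC] := half_small (C + M * C * E) e0.
have -> : Y t - (1%:M + F t) = - (S k.+1 t - Y t) + (S k.+1 t - (1%:M + F t)).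
  by rewrite opprB addrA subrK.
have h1 := HC k.+1 t (lexx _).
have := @mean_value_exp R _ _ (fun s => S k.+1 s - (1%:M + F s)) (fun s => X s *m (S k s - Y s))
    (M * (C * 2^-1 ^+ k)) 1 `|t|.
rewrite S0 F0 addr0 subrr => /(_ erefl _ _ _ _ t (lexx _)) H.
have {}H : nrm (S k.+1 t - (1%:M + F t)) <= M * (C * 2^-1 ^+ k) / 1 * E.
  apply: H => //.
  - by rewrite !mulr_ge0 ?exprn_ge0 ?invr_ge0 // ltW.
  - move=> s _; rewrite mulmxBr; apply: dmxB; first exact: dS.
    by rewrite -[X s *m _]add0r; apply: dmxD; [exact: dmx_cst|exact: dF].
  - move=> s sT; apply: le_trans (nrmM _ _) _.
    apply: (@le_trans _ _ (M * (C * 2^-1 ^+ k))).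
      apply: ler_pM; rewrite ?nrm_ge0 //; last exact: HC.
      by apply: HM; rewrite -ler_norml.
    rewrite ler_peMr //; first by rewrite !mulr_ge0 ?exprn_ge0 ?invr_ge0 // ltW.
    by rewrite -{1}expR0 ler_expR mul1r.
apply: le_trans (nrmD _ _) _; rewrite nrmN.
have h2 : C * 2^-1 ^+ k.+1 <= C * 2^-1 ^+ k.
  by rewrite ler_wpM2l ?(ltW C0) // exprS ler_piMl ?exprn_ge0 ?invr_ge0 // invf_le1 // ler1n.
rewrite divr1 in H.
have : C * 2^-1 ^+ k + M * (C * 2^-1 ^+ k) * E <= e by apply: le_trans kC; rewrite le_eqVlt; apply/orP; left; apply/eqP; ring.
lra.
Qed.

End Existence.

Definition fundamental N (X : R -> 'M[R]_N) : R -> 'M[R]_N :=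
  if pselect (exists F : R -> 'M[R]_N, F 0 = 1%:M /\ forall t, dmx F t (X t *m F t)) is left h
  then projT1 (cid h) else fun=> 1%:M.

Lemma fundamental0 N (X : R -> 'M[R]_N) : fundamental X 0 = 1%:M.
Proof. by rewrite /fundamental; case: pselect => // h; case: cid => F []. Qed.

Lemma fundamental_dmx N (X : R -> 'M[R]_N) : (forall t, mcts X t) ->
  forall t, dmx (fundamental X) t (X t *m fundamental X t).
Proof.
move=> cX; rewrite /fundamental; case: pselect => [h|[]]; last exact: ode_exists.
by case: cid => F [].
Qed.

Lemma fundamentalE N p (X : R -> 'M[R]_N) (F : R -> 'M[R]_(N, p)) :
  (forall t, mcts X t) -> (forall t, dmx F t (X t *m F t)) ->
  forall t, F t = fundamental X t *m F 0.
Proof.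
move=> cX dF; apply: (@ode_uniq _ _ X _ _ 0) => //; last by rewrite fundamental0 mul1mx.
move=> t; rewrite mulmxA -[_ *m F 0]addr0 -[X in _ + X](mulmx0 _ (fundamental X t)).
by apply: dmxM; [exact: fundamental_dmx|exact: dmx_cst].
Qed.

(** The tube lemma for a compact segment of times; it makes local continuity in (parameter, time)
    uniform in time. *)
Lemma near_segment (P : topologicalType) (Q : P -> R -> Prop) (p0 : P) a b :
  (forall t : R, a <= t <= b -> \forall z \near (p0, t), Q z.1 z.2) ->
  \forall p \near p0, forall t, a <= t <= b -> Q p t.
Proof.
move=> H; have /compact_near_coveringP cov := @segment_compact R a b.
have : \forall p \near p0, `[a, b] `<=` [set t | Q p t].
  apply: cov => t; rewrite /= in_itv /= => tab.
  have [[A B] /= [pA tB] AB] := H t tab.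
  exists (B, A); first by split.
  by move=> [t' p] /= [Bt' Ap]; exact: (AB (p, t')).
by apply: filterS => p Hp t tab; apply: Hp; rewrite /= in_itv.
Qed.

Lemma unif_near (P : topologicalType) m n (X : P -> R -> 'M[R]_(m, n)) (p0 : P) a b :
  (forall t : R, a <= t <= b -> mcts (fun q : P * R => X q.1 q.2) (p0, t)) ->
  forall e : R, 0 < e ->
  \forall p \near p0, forall t, a <= t <= b -> nrm (X p t - X p0 t) <= e.
Proof.
move=> cX e e0; have e20 : 0 < e / 2 by rewrite divr_gt0.
apply: near_segment => t t01.
have [[A B] /= [pA tB] AB] := mcts_nrm_near (cX t t01) e20.
exists (A, B); first by split.
move=> [p t'] /= [Ap Bt'].
have h1 := AB (p, t') (conj Ap Bt').
have h2 := AB (p0, t') (conj (nbhs_singleton pA) Bt').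
rewrite /= in h1 h2.
have -> : X p t' - X p0 t' = (X p t' - X p0 t) - (X p0 t' - X p0 t) by rewrite opprB addrA subrK.
apply: le_trans (nrmB _ _) _; lra.
Qed.

Lemma fundamental_cts N (P : topologicalType) (X : P -> R -> 'M[R]_N) (p0 : P) :
  (forall p t, mcts (X p) t) ->
  (forall t : R, 0 <= t <= 1 -> mcts (fun q : P * R => X q.1 q.2) (p0, t)) ->
  mcts (fun p => fundamental (X p) 1) p0.
Proof.
move=> cX cX2; apply: mcts_nrm => e e0.
have dY p t := fundamental_dmx (cX p) t.
have [M M0 HM] := nrm_bounded_on (fun t (_ : 0 <= t <= 1) => cX p0 t).
have [C C0 HC] := nrm_bounded_on (fun t (_ : 0 <= t <= 1) => dmx_mcts (dY p0 t)).
pose M1 := M + 1; have M10 : 0 < M1 by rewrite ltr_wpDl // ltW.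
pose E := expR (2 * M1 * (1 - 0)).
(* The bound 1 keeps [nrm (X p t)] below [M1 = M + 1]; the other bound makes the Gronwall estimate
   of the difference at most [e]. *)
pose d := Num.min 1 (e * M1 / (C * E)).
have d0 : 0 < d by rewrite lt_min ltr01 divr_gt0 ?mulr_gt0 ?expR_gt0.
apply: filterS (unif_near cX2 d0) => p Hp.
have := @gronwall R _ _ (fun t => fundamental (X p) t - fundamental (X p0) t)
  (fun t => X p t *m fundamental (X p) t - X p0 t *m fundamental (X p0) t)
  M1 (d * C) 0 1 M10 (ltW (mulr_gt0 d0 C0)).
rewrite !fundamental0 subrr => /(_ _ erefl 1); rewrite lexx ler01 => H.
apply: le_trans (H _ isT) _.
  move=> t t01; split; first by apply: dmxB; exact: dY.
  set Yp := fundamental _ t; set Y0 := fundamental _ t.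
  have -> : X p t *m Yp - X p0 t *m Y0 = X p t *m (Yp - Y0) + (X p t - X p0 t) *m Y0.
    by rewrite mulmxBr mulmxBl addrA subrK.
  apply: le_trans (nrmD _ _) _; apply: lerD.
    apply: le_trans (nrmM _ _) _; rewrite ler_wpM2r ?nrm_ge0 //.
    apply: le_trans (nrm_dist _ (X p0 t)) _; apply: lerD; first exact: HM.
    by apply: le_trans (Hp t t01) _; rewrite ge_min lexx.
  apply: le_trans (nrmM _ _) _; apply: ler_pM; rewrite ?nrm_ge0 //; last exact: HC.
  exact: Hp.
have : d * (C * E) <= e * M1 by rewrite -ler_pdivlMr ?mulr_gt0 ?expR_gt0 // ge_min lexx orbT.
move=> dCE; rewrite -/E; have -> : d * C / M1 * E = d * (C * E) / M1 by rewrite mulrAC mulrA.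
by rewrite ler_pdivrMr.
Qed.

Lemma is_derive_epsP (f : R -> R) (t d : R) :
  is_derive t (1 : R) f d <->
  forall e : R, 0 < e -> \forall h \near (0 : R), `|f (t + h) - f t - h * d| <= e * `|h|.
Proof.
have key (h e : R) : h != 0 ->
    (`|d - h^-1 *: (f (h *: 1 + t) - f t)| <= e) = (`|f (t + h) - f t - h * d| <= e * `|h|).
  move=> h0; rewrite -ler_pdivrMr ?normr_gt0 // -normfV -normrM [h *: 1 + t]addrC.
  rewrite /GRing.scale /= mulr1 distrC; congr (`|_| <= _).
  by rewrite mulrBl mulrAC divff // mul1r mulrC.
split=> [[df dE] e e0|H].
  have hl : (fun h => h^-1 *: (f (h *: 1 + t) - f t)) @ (0 : R)^' --> d by rewrite -dE; exact: df.
  have hN : \forall h \near (0 : R), h != 0 -> `|d - h^-1 *: (f (h *: 1 + t) - f t)| <= e.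
    have := (cvgrPdist_le _ _).1 hl e e0; rewrite near_withinE => Hw; exact: (Hw _).
  apply: filterS hN => h Hh.
  have [->|h0] := eqVneq h 0; last by rewrite -key //; exact: Hh.
  by rewrite addr0 mul0r subrr subr0 normr0 mulr0.
have hl : (fun h => h^-1 *: (f (h *: 1 + t) - f t)) @ (0 : R)^' --> d.
  apply/cvgrPdist_le => e e0; rewrite near_withinE; apply: filterS (H e e0) => h Hh h0.
  by rewrite key.
by apply: DeriveDef; [exact: (cvgP _ hl)|exact: cvg_lim hl].
Qed.

Lemma dmx_eps m n (F : R -> 'M[R]_(m, n)) (t : R) D :
  (forall e : R, 0 < e -> \forall h \near (0 : R), nrm (F (t + h) - F t - h *: D) <= e * `|h|) ->
  dmx F t D.
Proof.
move=> H i j; apply/is_derive_epsP => e e0; apply: filterS (H e e0) => h.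
by apply: le_trans; rewrite -mxscaleE -!mxoppE -!mxaddE; exact: nrm_entry.
Qed.

Lemma nrm_card m n (A : 'M[R]_(m, n)) e :
  (forall i j, `|A i j| <= e) -> 0 <= e -> nrm A <= (m * n)%:R * e.
Proof.
move=> H e0; apply: (@le_trans _ _ (\sum_(i < m) \sum_(j < n) e)).
  by apply: ler_sum => i _; apply: ler_sum => j _.
by rewrite !sumr_const !card_ord -mulrnA mulnC mulr_natl.
Qed.

Lemma dmx_eps_near m n (F : R -> 'M[R]_(m, n)) (t : R) D : dmx F t D ->
  forall e : R, 0 < e -> \forall h \near (0 : R), nrm (F (t + h) - F t - h *: D) <= e * `|h|.
Proof.
move=> dF e e0.
have e1 : 0 < e / (m * n).+1%:R by rewrite divr_gt0.
have : \forall h \near (0 : R), forall i j,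
    `|F (t + h) i j - F t i j - h * D i j| <= e / (m * n).+1%:R * `|h|.
  apply: (@filter_forall _ _ (fun i h => forall j, `|F (t + h) i j - F t i j - h * D i j| <= e / (m * n).+1%:R * `|h|) (nbhs (0 : R))) => i.
  apply: (@filter_forall _ _ (fun j h => `|F (t + h) i j - F t i j - h * D i j| <= e / (m * n).+1%:R * `|h|) (nbhs (0 : R))) => j.
  exact: ((is_derive_epsP _ _ _).1 (dF i j) _ e1).
apply: filterS => h Hh; apply: le_trans (nrm_card _ _) _.
- by move=> i j; rewrite mxaddE mxoppE mxscaleE mxaddE mxoppE; exact: Hh.
- by rewrite mulr_ge0 // ltW.
rewrite mulrA ler_wpM2r // mulrCA -[leRHS]mulr1 ler_wpM2l ?(ltW e0) //.
by rewrite ler_pdivrMr // mul1r ler_nat.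
Qed.

(** [V] solves the equation obtained by differentiating in the parameter. The remainder Y_(t+h) -
    Y_t - h V starts at zero and solves a linear equation with a source of order o(h), so Gronwall
    bounds it by o(h). *)
Lemma fundamental_derive N (X X' : R -> R -> 'M[R]_N) (t : R) :
  (forall s, forall r : R, mcts (X s) r) -> (forall s, forall r : R, mcts (X' s) r) ->
  (forall s r, 0 <= r <= 1 -> dmx (fun s => X s r) s (X' s r)) ->
  (forall r : R, 0 <= r <= 1 -> mcts (fun q : R * R => X q.1 q.2) (t, r)) ->
  (forall r : R, 0 <= r <= 1 -> mcts (fun q : R * R => X' q.1 q.2) (t, r)) ->
  forall V : R -> 'M[R]_N, V 0 = 0 ->
  (forall r, dmx V r (X t r *m V r + X' t r *m fundamental (X t) r)) ->
  dmx (fun s => fundamental (X s) 1) t (V 1).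
Proof.
move=> cX cX' dX cX2 cX'2 V V0 dV; apply: dmx_eps => e e0.
have dY p r := fundamental_dmx (cX p) r.
have [M M0 HM] := nrm_bounded_on (fun r (_ : 0 <= r <= 1) => cX t r).
have [M' M'0 HM'] := nrm_bounded_on (fun r (_ : 0 <= r <= 1) => cX' t r).
have [C C0 HC] := nrm_bounded_on (fun r (_ : 0 <= r <= 1) => dmx_mcts (dY t r)).
have [C' C'0 HC'] := nrm_bounded_on (fun r (_ : 0 <= r <= 1) => dmx_mcts (dV r)).
pose M1 := M + 1; have M10 : 0 < M1 by rewrite ltr_wpDl // ltW.
pose E := expR (2 * M1 * (1 - 0)).
pose d := Num.min 1 (e * M1 / ((C + C') * E)).
have CC : 0 < C + C' by rewrite addr_gt0.
have E0 : 0 < E by exact: expR_gt0.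
have d0 : 0 < d by rewrite lt_min ltr01 divr_gt0 ?mulr_gt0.
have near1 := unif_near cX2 d0.
have [r0 r0p near2] := near_dist (unif_near cX'2 d0).
have n1 : \forall h \near (0 : R), forall r, 0 <= r <= 1 -> nrm (X (t + h) r - X t r) <= d.
  have ct : (fun h : R => t + h) @ (0 : R) --> t + 0.
    by apply: cvgD; [exact: cvg_cst|exact: cvg_id].
  by rewrite addr0 in ct; exact: (ct _ near1).
have n2 : \forall h \near (0 : R), `|h| < r0.
  by have := @nbhsx_ballx _ R^o 0 r0 r0p; apply: filterS => h; rewrite /ball /= sub0r normrN.
apply: filterS2 n1 n2 => h Hh hr.
have Lin r : 0 <= r <= 1 -> nrm (X (t + h) r - X t r - h *: X' t r) <= d * `|h|.
  move=> r01.
  have dG u : dmx (fun u => X (t + u) r - u *: X' t r) u (X' (t + u) r - X' t r).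
    apply: dmxB.
      rewrite -[X' _ r]scale1r; apply: (@dmx_comp R _ _ (fun s => X s r) (fun u => t + u) u 1 (X' (t + u) r));
        last exact: dX.
      have := is_deriveD (is_derive_cst t u (1 : R)) (is_derive_id u (1 : R)).
      by rewrite add0r.
    by have := dmxZ (is_derive_id u (1 : R)) (dmx_cst (X' t r) u); rewrite scale1r scaler0 addr0.
  have bnd u : `|u| <= `|h| -> nrm (X' (t + u) r - X' t r) <= d.
    move=> uh; apply: near2 => //.
    by rewrite addrC addKr (le_lt_trans uh).
  have du (u : R) : is_derive u (1 : R) (fun u => u * d) d by exact: is_derive_mulr.
  have -> : X (t + h) r - X t r - h *: X' t r =
      (X (t + h) r - h *: X' t r) - (X (t + 0) r - 0 *: X' t r).
    by rewrite addr0 scale0r subr0 addrAC.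
  have [h0|/ltW h0] := leP 0 h.
    have bh u : 0 <= u <= h -> nrm (X' (t + u) r - X' t r) <= d.
      by move=> /andP[u0 uh]; apply: bnd; rewrite !ger0_norm.
    have K := mean_value_nrm h0 (fun u _ => dG u) du bh.
    by apply: le_trans K _; rewrite mul0r subr0 mulrC (ger0_norm h0).
  have bh u : h <= u <= 0 -> nrm (X' (t + u) r - X' t r) <= d.
    by move=> /andP[u0 uh]; apply: bnd; rewrite !ler0_norm // lerN2.
  have K := mean_value_nrm h0 (fun u _ => dG u) du bh.
  by rewrite -nrmN opprB; apply: le_trans K _; rewrite mul0r sub0r mulrC (ler0_norm h0) mulrN.
have h0 : 0 <= `|h| by [].
have := @gronwall R _ _ (fun r => fundamental (X (t + h)) r - fundamental (X t) r - h *: V r)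
  (fun r => X (t + h) r *m fundamental (X (t + h)) r - X t r *m fundamental (X t) r
     - h *: (X t r *m V r + X' t r *m fundamental (X t) r))
  M1 (d * `|h| * (C + C')) 0 1 M10 (mulr_ge0 (mulr_ge0 (ltW d0) h0) (ltW CC)).
rewrite !fundamental0 subrr V0 scaler0 subrr => /(_ _ erefl 1); rewrite lexx ler01 => H.
apply: le_trans (H _ isT) _.
  move=> r r01; split.
    apply: dmxB; first by apply: dmxB; exact: dY.
    rewrite -[h *: _]add0r -(scale0r (V r)).
    exact: (dmxZ (is_derive_cst h r (1 : R)) (dV r)).
  set Yp := fundamental _ r; set Y0 := fundamental _ r.
  have -> : X (t + h) r *m Yp - X t r *m Y0 - h *: (X t r *m V r + X' t r *m Y0) =
      X (t + h) r *m (Yp - Y0 - h *: V r) + ((X (t + h) r - X t r - h *: X' t r) *m Y0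
        + h *: ((X (t + h) r - X t r) *m V r)).
    rewrite !mulmxBr !mulmxBl scalerDr scalerBr -!scalemxAr -scalemxAl.
    move: (X (t + h) r *m Yp) (X (t + h) r *m Y0) (X t r *m Y0) (X (t + h) r *m V r)
      (X t r *m V r) (X' t r *m Y0) => a1 a2 a3 a4 a5 a6.
    by apply/matrixP => i j; rewrite !mxE; ring.
  apply: le_trans (nrmD _ _) _; apply: lerD.
    apply: le_trans (nrmM _ _) _; rewrite ler_wpM2r ?nrm_ge0 //.
    apply: le_trans (nrm_dist _ (X t r)) _; apply: lerD; first exact: HM.
    by apply: le_trans (Hh r r01) _; rewrite ge_min lexx.
  apply: le_trans (nrmD _ _) _; rewrite mulrDr; apply: lerD.
    apply: le_trans (nrmM _ _) _; apply: ler_pM; rewrite ?nrm_ge0 //; last exact: HC.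
    exact: Lin.
  rewrite nrmZ mulrAC mulrC ler_wpM2r //; apply: le_trans (nrmM _ _) _.
  by apply: ler_pM; rewrite ?nrm_ge0 //; [exact: Hh|exact: HC'].
have dCE : d * ((C + C') * E) <= e * M1 by rewrite -ler_pdivlMr ?mulr_gt0 // ge_min lexx orbT.
have -> : d * `|h| * (C + C') / M1 * E = d * ((C + C') * E) / M1 * `|h|.
  by move: (M1^-1) => m1; ring.
by rewrite ler_wpM2r // ler_pdivrMr.
Qed.

End LinearODE.

(** * Multivariate calculus and local Riemannian geometry *)

Lemma add3K (W : zmodType) (a b c : W) : a + b + c - a = b + c.
Proof. by rewrite addrC !addrA addNr add0r. Qed.

Section Multivariate.
Variable R : realType.

Lemma lin_bound m n (F f : R -> 'M[R]_(m, n)) (D : 'M[R]_(m, n)) (h d : R) :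
  (forall u, `|u| <= `|h| -> dmx F u (f u) /\ nrm (f u - D) <= d) ->
  nrm (F h - F 0 - h *: D) <= d * `|h|.
Proof.
move=> H.
pose G u := F u - u *: D.
have dG u : `|u| <= `|h| -> dmx G u (f u - D).
  move=> uh; apply: dmxB; first exact: (H u uh).1.
  by have := dmxZ (is_derive_id u (1 : R)) (dmx_cst D u); rewrite scale1r scaler0 addr0.
have du (u : R) : is_derive u (1 : R) (fun u => u * d) d by exact: is_derive_mulr.
have -> : F h - F 0 - h *: D = G h - G 0 by rewrite /G scale0r subr0 addrAC.
have [h0|/ltW h0] := leP 0 h.
  have bh u : 0 <= u <= h -> `|u| <= `|h|.
    by move=> /andP[u0 uh]; rewrite !ger0_norm.
  have K := mean_value_nrm h0 (fun u uh => dG u (bh u uh)) du (fun u uh => (H u (bh u uh)).2).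
  by apply: le_trans K _; rewrite mul0r subr0 mulrC (ger0_norm h0).
have bh u : h <= u <= 0 -> `|u| <= `|h|.
  by move=> /andP[u0 uh]; rewrite !ler0_norm // lerN2.
have K := mean_value_nrm h0 (fun u uh => dG u (bh u uh)) du (fun u uh => (H u (bh u uh)).2).
by rewrite -nrmN opprB; apply: le_trans K _; rewrite mul0r sub0r mulrC (ler0_norm h0) mulrN.
Qed.

Lemma lin_boundR (F f : R -> R) (c h d : R) :
  (forall u, `|u| <= `|h| -> is_derive u (1 : R) F (f u) /\ `|f u - c| <= d) ->
  `|F h - F 0 - h * c| <= d * `|h|.
Proof.
move=> H.
have N (a : R) : nrm (a%:M : 'M[R]_1) = `|a| by rewrite /nrm !big_ord1 mxE eqxx.
have D (a b : R) : a%:M - b%:M = (a - b)%:M :> 'M[R]_1.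
  by apply/matrixP => i j; rewrite !mxE !ord1 eqxx.
have := @lin_bound 1 1 (fun s => (F s)%:M) (fun s => (f s)%:M) c%:M h d.
rewrite !D scale_scalar_mx D N; apply=> u uh; rewrite D N; have [dF ?] := H u uh; split=> //.
move=> i j; rewrite !ord1 mxE eqxx; under eq_fun do rewrite mxE eqxx; exact: dF.
Qed.

Lemma derivable_line m (f : 'cV[R]_m -> R) (p v : 'cV[R]_m) (s : R) :
  derivable f (p + s *: v) v ->
  is_derive s (1 : R) (fun u => f (p + u *: v)) ('D_v f (p + s *: v)).
Proof.
have E : (fun h : R => h^-1 *: (f (p + (h *: 1 + s) *: v) - f (p + s *: v))) =
    (fun h : R => h^-1 *: (f (h *: v + (p + s *: v)) - f (p + s *: v))).
  apply/funext => h; congr (_ *: (f _ - _)).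
  by rewrite /GRing.scale /= mulr1 -/(GRing.scale _ _) scalerDl addrCA.
by move=> df; apply: DeriveDef; rewrite /derivable /derive E.
Qed.

Lemma near_nrmP m (q : 'cV[R]_m) (P : 'cV[R]_m -> Prop) :
  (\forall w \near q, P w) <->
  exists2 d : R, 0 < d & forall w, nrm (w - q) < d -> P w.
Proof.
split=> [|[d d0 H]].
  move=> /nbhs_ballP[d /= d0 H]; exists d => // w wq; apply: H.
  split=> // i j; apply: le_lt_trans wq.
  by rewrite /= distrC -mxoppE -mxaddE; exact: nrm_entry.
have cN : mcts (fun w : 'cV[R]_m => w) q by apply/mctsP; exact: cvg_id.
have d20 : 0 < d / 2 by rewrite divr_gt0.
have := mcts_nrm_near cN d20; apply: filterS => w wd; apply: H.
by apply: le_lt_trans wd _; rewrite ltr_pdivrMr // mulr_natr mulr2n ltrDl.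
Qed.

Lemma nrm_mono m n (A B : 'M[R]_(m, n)) :
  (forall i j, `|A i j| <= `|B i j|) -> nrm A <= nrm B.
Proof. by move=> H; apply: ler_sum => i _; apply: ler_sum => j _. Qed.

Lemma nrm_cV m (w : 'cV[R]_m) : nrm w = \sum_k `|w k ord0|.
Proof. by apply: eq_bigr => k _; rewrite big_ord1. Qed.

Lemma cts_nrmP m (f : 'cV[R]_m -> R) q : {for q, continuous f} <->
  forall e : R, 0 < e -> exists2 d : R, 0 < d & forall w, nrm (w - q) < d -> `|f w - f q| <= e.
Proof.
have P := @cvgrPdist_le R R 'cV[R]_m (nbhs q) (nbhs_filter q) f (f q).
split=> [cf e e0|H].
  have /near_nrmP[d d0 Hd] := P.1 cf e e0.
  by exists d => // w wd; rewrite distrC; exact: Hd.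
apply/P => e e0; have [d d0 Hd] := H e e0.
by apply/near_nrmP; exists d => // w wd; rewrite distrC; exact: Hd.
Qed.

Section C1.
Variables (m : nat) (U : set 'cV[R]_m).
Hypothesis oU : open U.
Implicit Types (f : 'cV[R]_m -> R) (q : 'cV[R]_m).

Lemma open_tube q : U q -> exists2 d : R, 0 < d & forall w, nrm (w - q) < d -> U w.
Proof. by move=> Uq; apply/near_nrmP; exact: oU. Qed.

Lemma C1_expansion f q : Ck_on 1 U f -> U q -> forall e : R, 0 < e ->
  exists2 d : R, 0 < d & forall w, nrm w < d ->
    `|f (q + w) - f q - \sum_k w k ord0 * pd k f q| <= e * nrm w.
Proof.
move=> [df cf] Uq e e0.
have /near_nrmP[d1 d10 H1] : \forall w \near q, forall k, `|pd k f w - pd k f q| <= e.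
  apply: (@filter_forall _ _ (fun k w => `|pd k f w - pd k f q| <= e) (nbhs q)) => k.
  by apply/near_nrmP; exact: ((cts_nrmP _ _).1 (cf k q Uq) e e0).
have [d2 d20 H2] := open_tube Uq.
exists (Num.min d1 d2); first by rewrite lt_min d10.
move=> w; rewrite lt_min => /andP[wd1 wd2].
(* [tr k] keeps the first [k] coordinates of [w]: the increment of [f] is split into moves parallel
   to the axes, along which only partial derivatives are needed. *)
pose tr k : 'cV[R]_m := \col_l if (l < k)%N then w l ord0 else 0.
have trS (k : 'I_m) : tr k.+1 = tr k + w k ord0 *: delta_mx k ord0.
  apply/matrixP => i j; rewrite /tr !mxE (ord1 j) eqxx andbT ltnS leq_eqVlt.
  have [->|ne] := eqVneq i k; first by rewrite eqxx ltnn add0r mulr1.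
  by rewrite (negbTE (ne : (i : nat) != k)) /= mulr0 addr0.
have step (k : 'I_m) : `|f (q + tr k.+1) - f (q + tr k) - w k ord0 * pd k f q|
    <= e * `|w k ord0|.
  rewrite trS addrA -{2}[q + tr k]addr0 -(scale0r (delta_mx k ord0 : 'cV[R]_m)).
  pose v : 'cV[R]_m := delta_mx k ord0.
  apply: (@lin_boundR (fun u => f (q + tr k + u *: v)) (fun u => pd k f (q + tr k + u *: v))).
  move=> u uw.
  have B : nrm (q + tr k + u *: v - q) <= nrm w.
    rewrite add3K; apply: nrm_mono => i j; rewrite /tr !mxE (ord1 j) eqxx andbT.
    have [->|ne] := eqVneq i k; first by rewrite ltnn add0r mulr1.
    by rewrite mulr0 addr0; case: ifP => // _; rewrite normr0.
  split; last by apply: H1; exact: le_lt_trans B wd1.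
  by apply: derivable_line; apply: df; apply: H2; exact: le_lt_trans B wd2.
have K k : (k <= m)%N -> `|f (q + tr k) - f q - \sum_(l < m | (l < k)%N) w l ord0 * pd l f q|
    <= e * \sum_(l < m | (l < k)%N) `|w l ord0|.
  elim: k => [|k IH] km.
    rewrite !big_pred0 // (_ : tr 0%N = 0) ?addr0 ?subrr ?subr0 ?normr0 ?mulr0 //.
    by apply/matrixP => i j; rewrite !mxE.
  have S (g : 'I_m -> R) : \sum_(l < m | (l < k.+1)%N) g l =
      g (Ordinal km) + \sum_(l < m | (l < k)%N) g l.
    rewrite (bigD1 (Ordinal km)) //=; congr (_ + _); apply: eq_bigl => l.
    by rewrite ltnS ltn_neqAle andbC.
  rewrite !S mulrDr.
  have -> : f (q + tr k.+1) - f q - (w (Ordinal km) ord0 * pd (Ordinal km) f q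
       + \sum_(l < m | (l < k)%N) w l ord0 * pd l f q) =
     (f (q + tr k.+1) - f (q + tr k) - w (Ordinal km) ord0 * pd (Ordinal km) f q)
      + (f (q + tr k) - f q - \sum_(l < m | (l < k)%N) w l ord0 * pd l f q) by ring.
  apply: le_trans (ler_normD _ _) _; apply: lerD; first exact: (step (Ordinal km)).
  exact: IH (ltnW km).
have trm : tr m = w by apply/matrixP => i j; rewrite /tr mxE ltn_ord (ord1 j).
have := K m (leqnn m); rewrite trm nrm_cV.
by under eq_bigl do rewrite ltn_ord; under [in leRHS]eq_bigl do rewrite ltn_ord.
Qed.

Lemma C1_cts f q : Ck_on 1 U f -> U q -> {for q, continuous f}.
Proof.
move=> cf Uq; apply/cts_nrmP => e e0.
have [d d0 H] := C1_expansion cf Uq ltr01.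
pose c := 1 + \sum_k `|pd k f q|.
have c0 : 0 < c by rewrite ltr_pwDl // sumr_ge0.
exists (Num.min d (e / c)); first by rewrite lt_min d0 divr_gt0.
move=> w; rewrite lt_min => /andP[wd we].
have := H _ wd; rewrite (addrC q) subrK mul1r => Hw.
have : `|\sum_k (w - q) k ord0 * pd k f q| <= nrm (w - q) * \sum_k `|pd k f q|.
  apply: le_trans (ler_norm_sum _ _ _) _; rewrite mulr_sumr; apply: ler_sum => k _.
  by rewrite normrM ler_wpM2r // nrm_entry.
set S := \sum_k (w - q) k ord0 * _ in Hw *; move=> HS.
have : nrm (w - q) * c <= e by rewrite ltW // -ltr_pdivlMr.
rewrite mulrDr mulr1 -(subrK S (f w - f q)) => Hc.
apply: le_trans (ler_normD _ _) _; lra.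
Qed.

Lemma Ck_on_mono r f : Ck_on r.+1 U f -> Ck_on r U f.
Proof.
elim: r f => [|r IH] f; first by move=> cf q; exact: C1_cts.
by move=> [df cf]; split=> // k; apply: IH; exact: cf.
Qed.

Lemma Ck_on_le r s f : (r <= s)%N -> Ck_on s U f -> Ck_on r U f.
Proof.
move=> /subnK <-; elim: (s - r)%N => [|k IH] //; rewrite addSn => H; apply: IH; exact: Ck_on_mono.
Qed.

Lemma chain_rule f (c : R -> 'cV[R]_m) t c' :
  Ck_on 1 U f -> dmx c t c' -> U (c t) ->
  is_derive t (1 : R) (fun s => f (c s)) (\sum_k c' k ord0 * pd k f (c t)).
Proof.
move=> cf dc Uc; apply/is_derive_epsP => e e0.
pose A := nrm c' + 1; have A0 : 0 < A by rewrite ltr_wpDl ?nrm_ge0.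
pose B := \sum_k `|pd k f (c t)| + 1; have B0 : 0 < B by rewrite ltr_wpDl ?sumr_ge0.
have e1 : 0 < e / 2 / A by rewrite !divr_gt0.
have e2 : 0 < Num.min 1 (e / 2 / B) by rewrite lt_min ltr01 !divr_gt0.
have [d d0 H] := C1_expansion cf Uc e1.
have n1 := dmx_eps_near dc e2.
have n2 : \forall h \near (0 : R), `|h| < d / A.
  have := @nbhsx_ballx _ R^o 0 (d / A) (divr_gt0 d0 A0).
  by apply: filterS => h; rewrite /ball /= sub0r normrN.
apply: filterS2 n1 n2 => h h1 h2.
pose w := c (t + h) - c t.
have wA : nrm w <= A * `|h|.
  rewrite -(subrK (h *: c') w) mulrDl mul1r addrC; apply: le_trans (nrmD _ _) _.
  rewrite nrmZ mulrC lerD2l; apply: le_trans h1 _.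
  by rewrite -[leRHS]mul1r ler_wpM2r // ge_min lexx.
have := H w; rewrite (_ : c t + w = c (t + h)); last by rewrite /w addrC subrK.
move=> Hw; have {}Hw := Hw _.
have {}Hw : `|f (c (t + h)) - f (c t) - \sum_k w k ord0 * pd k f (c t)| <= e / 2 / A * nrm w.
  by apply: Hw; apply: le_lt_trans wA _; rewrite mulrC -ltr_pdivlMr.
have Hw2 : `|\sum_k (w - h *: c') k ord0 * pd k f (c t)| <= e / 2 * `|h|.
  apply: (@le_trans _ _ (nrm (w - h *: c') * B)).
    rewrite /B mulrDr mulr1 mulr_sumr; apply: ler_wpDr; first exact: nrm_ge0.
    apply: le_trans (ler_norm_sum _ _ _) _; apply: ler_sum => k _.
    by rewrite normrM ler_wpM2r // nrm_entry.
  apply: (@le_trans _ _ (e / 2 / B * `|h| * B)).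
    rewrite ler_wpM2r ?(ltW B0) //; apply: le_trans h1 _; rewrite ler_wpM2r //.
    by rewrite ge_min lexx orbT.
  by rewrite mulrAC divfK ?gt_eqF.
have -> : f (c (t + h)) - f (c t) - h * \sum_k c' k ord0 * pd k f (c t) =
    (f (c (t + h)) - f (c t) - \sum_k w k ord0 * pd k f (c t))
    + \sum_k (w - h *: c') k ord0 * pd k f (c t).
  have -> : \sum_k (w - h *: c') k ord0 * pd k f (c t) =
     \sum_k w k ord0 * pd k f (c t) - h * \sum_k c' k ord0 * pd k f (c t).
    rewrite mulr_sumr -sumrB; apply: eq_bigr => k _.
    by rewrite mxaddE mxoppE mxscaleE; ring.
  ring.
apply: le_trans (ler_normD _ _) _.
have : e / 2 / A * nrm w <= e / 2 * `|h|.
  apply: (@le_trans _ _ (e / 2 / A * (A * `|h|))); first by rewrite ler_wpM2l // ltW.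
  by rewrite mulrA divfK ?gt_eqF.
lra.
Qed.

(** The second difference of [f] over a square of side [h] is symmetric in the two directions, and
    two mean value estimates compare it with [h ^+ 2] times either mixed derivative. *)
Lemma clairaut a b f q : Ck_on 2 U f -> U q -> pd a (pd b f) q = pd b (pd a f) q.
Proof.
move=> cf Uq.
pose v k : 'cV[R]_m := delta_mx k ord0.
have nv k (h : R) : nrm (h *: v k) = `|h|.
  rewrite nrmZ nrm_cV (bigD1 k) //= big1 ?addr0 => [|i ik]; rewrite !mxE ?eqxx ?normr1 ?mulr1 //.
  by rewrite (negbTE ik) normr0.
have [df c1f] := cf.
have main k l (e : R) : 0 < e -> exists2 d : R, 0 < d & forall h, `|h| < d ->
    `|f (q + h *: v k + h *: v l) - f (q + h *: v k) - (f (q + h *: v l) - f q)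
       - h * (h * pd l (pd k f) q)| <= e * `|h| * `|h|.
  move=> e0; have [d2f c2f] := c1f k.
  have [d1 d10 H1] := (cts_nrmP _ _).1 (c2f l q Uq) e e0.
  have [d2 d20 H2] := open_tube Uq.
  exists (Num.min d1 d2 / 2); first by rewrite divr_gt0 // lt_min d10.
  move=> h; rewrite ltr_pdivlMr // lt_min => /andP[hd1 hd2].
  have small (u w : R) : `|u| <= `|h| -> `|w| <= `|h| -> nrm (u *: v k + w *: v l) <= `|h| * 2.
    by move=> uh wh; apply: le_trans (nrmD _ _) _; rewrite !nv; lra.
  have inU (u w : R) : `|u| <= `|h| -> `|w| <= `|h| -> U (q + u *: v k + w *: v l).
    by move=> uh wh; apply: H2; rewrite add3K (le_lt_trans (small _ _ uh wh)).
  have close (u w : R) : `|u| <= `|h| -> `|w| <= `|h| ->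
      `|pd l (pd k f) (q + u *: v k + w *: v l) - pd l (pd k f) q| <= e.
    by move=> uh wh; apply: H1; rewrite add3K (le_lt_trans (small _ _ uh wh)).
  have h00 : `|0 : R| <= `|h| by rewrite normr0.
  have inner u : `|u| <= `|h| ->
      `|pd k f (q + u *: v k + h *: v l) - pd k f (q + u *: v k) - h * pd l (pd k f) q| <= e * `|h|.
    move=> uh.
    have := @lin_boundR (fun w => pd k f (q + u *: v k + w *: v l))
      (fun w => pd l (pd k f) (q + u *: v k + w *: v l)) (pd l (pd k f) q) h e.
    rewrite scale0r addr0; apply=> w wh; split; last exact: close.
    by apply: derivable_line; apply: d2f; exact: inU.
  have := @lin_boundR (fun u => f (q + u *: v k + h *: v l) - f (q + u *: v k))
    (fun u => pd k f (q + u *: v k + h *: v l) - pd k f (q + u *: v k))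
    (h * pd l (pd k f) q) h (e * `|h|).
  rewrite scale0r addr0; apply=> u uh; split; last exact: inner.
  have i1 := inU u h uh (lexx _).
  have i2 := inU u 0 uh h00; rewrite scale0r addr0 in i2.
  apply: is_deriveB; last by apply: derivable_line; exact: df.
  have E : (fun u => f (q + u *: v k + h *: v l)) = (fun u => f (q + h *: v l + u *: v k)).
    by apply/funext => x; rewrite addrAC.
  rewrite E addrAC; apply: derivable_line; apply: df; by rewrite addrAC.
apply/eqP; rewrite -subr_eq0 -normr_le0; apply/ler_addgt0Pr => e e0; rewrite add0r.
have e20 : 0 < e / 2 by rewrite divr_gt0.
have [d1 d10 H1] := main b a _ e20.
have [d2 d20 H2] := main a b _ e20.
pose h := Num.min d1 d2 / 2.
have h0 : 0 < h by rewrite divr_gt0 // lt_min d10.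
have hd : h < Num.min d1 d2 by rewrite ltr_pdivrMr // mulr_natr mulr2n ltrDl lt_min d10.
have [hd1 hd2] : h < d1 /\ h < d2 by move: hd; rewrite lt_min => /andP[].
have {}H1 := H1 h; have {}H2 := H2 h; rewrite (gtr0_norm h0) in H1 H2.
have {}H1 := H1 hd1; have {}H2 := H2 hd2.
set x := pd a (pd b f) q in H1 *; set y := pd b (pd a f) q in H2 *.
have E : f (q + h *: v b + h *: v a) = f (q + h *: v a + h *: v b) by rewrite addrAC.
rewrite E in H1; move: H1 H2.
move: (f (q + h *: v a + h *: v b)) (f (q + h *: v a)) (f (q + h *: v b)) (f q) => A B C D H1 H2.
have : `|h * (h * (x - y))| <= e * h * h.
  have -> : h * (h * (x - y)) = (A - B - (C - D) - h * (h * y)) - (A - C - (B - D) - h * (h * x)).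
    by ring.
  apply: le_trans (ler_normB _ _) _; apply: le_trans (lerD H2 H1) _.
  by have -> : e * h * h = e / 2 * h * h + e / 2 * h * h by rewrite -mulrDl -mulrDl -splitr.
have -> : e * h * h = h * (h * e) by ring.
by clearbody h; rewrite !normrM (gtr0_norm h0) !ler_pM2l.
Qed.

Lemma Ck_on_eq r f g : (forall q, U q -> f q = g q) -> Ck_on r U f -> Ck_on r U g.
Proof.
elim: r f g => [|r IH] f g fg.
  move=> cf q Uq; have [d d0 H] := open_tube Uq.
  apply/cts_nrmP => e e0; have [d1 d10 H1] := (cts_nrmP _ _).1 (cf q Uq) e e0.
  exists (Num.min d d1); first by rewrite lt_min d0.
  by move=> w; rewrite lt_min => /andP[wd wd1]; rewrite -!fg //; [exact: H1|exact: H].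
have nfg q : U q -> \forall w \near q, f w = g w.
  move=> Uq; have [d d0 H] := open_tube Uq.
  by apply/near_nrmP; exists d => // w wd; apply: fg; exact: H.
move=> [df cf]; split=> [k q Uq|k].
  by apply: near_eq_derivable (df k q Uq); exact: nfg.
apply: IH (cf k) => q Uq; rewrite /pd; apply: near_eq_derive; exact: nfg.
Qed.

Lemma Ck_on_cst r c : Ck_on r U (fun=> c).
Proof.
elim: r c => [|r IH] c; first by move=> q _; apply/cts_nrmP => e e0; exists 1 => // w _; rewrite subrr normr0 ltW.
split=> [k q _|k]; first exact: derivable_cst.
by apply: (@Ck_on_eq _ (fun=> 0)) => // q _; rewrite /pd derive_cst.
Qed.

Lemma Ck_onD r f g : Ck_on r U f -> Ck_on r U g -> Ck_on r U (fun q => f q + g q).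
Proof.
elim: r f g => [|r IH] f g; first by move=> cf cg q Uq; exact: (cvgD (cf q Uq) (cg q Uq)).
move=> [df cf] [dg cg]; split=> [k q Uq|k]; first by apply: derivableD; [exact: df|exact: dg].
apply: (Ck_on_eq _ (IH _ _ (cf k) (cg k))) => q Uq.
by rewrite /pd deriveD //; [exact: df|exact: dg].
Qed.

Lemma Ck_onM r f g : Ck_on r U f -> Ck_on r U g -> Ck_on r U (fun q => f q * g q).
Proof.
elim: r f g => [|r IH] f g; first by move=> cf cg q Uq; exact: (cvgM (cf q Uq) (cg q Uq)).
move=> sf sg; have [df cf] := sf; have [dg cg] := sg.
split=> [k q Uq|k]; first by apply: derivableM; [exact: df|exact: dg].
have H : Ck_on r U (fun q => f q * pd k g q + g q * pd k f q).
  apply: Ck_onD; first exact: (IH _ _ (Ck_on_mono sf) (cg k)).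
  exact: (IH _ _ (Ck_on_mono sg) (cf k)).
apply: (Ck_on_eq _ H) => q Uq.
by rewrite /pd deriveM //; [exact: df|exact: dg].
Qed.

Lemma Ck_on_alg r : alg_closed (Ck_on r U).
Proof. by split=> [c|f g|f g]; [exact: Ck_on_cst|exact: Ck_onD|exact: Ck_onM]. Qed.

Lemma Ck_onV r f : (forall q, U q -> f q != 0) -> Ck_on r U f -> Ck_on r U (fun q => (f q)^-1).
Proof.
move=> f0; elim: r => [|r IH]; first by move=> cf q Uq; exact: (cvgV (f0 q Uq) (cf q Uq)).
move=> sf; have [df cf] := sf.
split=> [k q Uq|k]; first by apply: derivableV; [exact: f0|exact: df].
have H : Ck_on r U (fun q => -1 * ((f q)^-1 * (f q)^-1) * pd k f q).
  have fV := IH (Ck_on_mono sf).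
  exact: (Ck_onM (Ck_onM (Ck_on_cst r (-1)) (Ck_onM fV fV)) (cf k)).
apply: (Ck_on_eq _ H) => q Uq.
rewrite /pd deriveV ?f0 //; last exact: df.
by rewrite mulN1r /GRing.scale /= expr2 invfM.
Qed.

End C1.

(* A variant of 'D_u F that is linear in the direction even where F is not
   differentiable. *)
Definition mpd m a b (F : 'cV[R]_m -> 'M[R]_(a, b)) (q u : 'cV[R]_m) : 'M[R]_(a, b) :=
  \matrix_(i, j) \sum_k u k ord0 * pd k (fun w => F w i j) q.

Definition C_on m a b r (U : set 'cV[R]_m) (F : 'cV[R]_m -> 'M[R]_(a, b)) :=
  forall i j, Ck_on r U (fun w => F w i j).

Lemma pd_lincomb m I (r : seq I) (c : I -> R) (f : I -> 'cV[R]_m -> R) k q :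
  (forall l, derivable (f l) q (delta_mx k ord0 : 'cV[R]_m)) ->
  pd k (fun x => \sum_(l <- r) c l * f l x) q = \sum_(l <- r) c l * pd k (f l) q.
Proof.
move=> df.
have S : is_derive q (delta_mx k ord0 : 'cV[R]_m)
    (fun x => \sum_(l <- r) c l * f l x) (\sum_(l <- r) c l * pd k (f l) q).
  elim: r => [|b s IH].
    by under eq_fun do rewrite big_nil; rewrite big_nil; exact: is_derive_cst.
  under eq_fun do rewrite big_cons; rewrite big_cons; apply: is_deriveD IH.
  exact: (@is_deriveZ _ _ _ (f b) (c b) q _ _ (derivableP (df b))).
by rewrite /pd derive_val.
Qed.

Lemma mulmx_cV_inj m n (A B : 'M[R]_(m, n)) :
  (forall u : 'cV[R]_n, A *m u = B *m u) -> A = B.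
Proof.
move=> H; apply/matrixP => i j.
by have := congr1 (fun Z : 'cV[R]_m => Z i ord0) (H (delta_mx j ord0)); rewrite -!colE !mxE.
Qed.

Section MatrixC1.
Variables (m : nat) (U : set 'cV[R]_m).
Hypothesis oU : open U.
Implicit Types (q u : 'cV[R]_m).

Lemma mpd_chain a b (F : 'cV[R]_m -> 'M[R]_(a, b)) (c : R -> 'cV[R]_m) t c' :
  C_on 1 U F -> dmx c t c' -> U (c t) -> dmx (fun s => F (c s)) t (mpd F (c t) c').
Proof. by move=> cF dc Uc i j; rewrite mxE; exact: (chain_rule oU (cF i j)). Qed.

Lemma dmx_line q u (s : R) : dmx (fun s => q + s *: u) s u.
Proof.
have := dmxD (dmx_cst q s) (dmxZ (is_derive_id s (1 : R)) (dmx_cst u s)).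
by rewrite scale1r scaler0 addr0 add0r.
Qed.

Lemma mpd_line a b (F : 'cV[R]_m -> 'M[R]_(a, b)) q u :
  C_on 1 U F -> U q -> dmx (fun s : R => F (q + s *: u)) 0 (mpd F q u).
Proof.
move=> cF Uq; have := @mpd_chain _ _ F (fun s => q + s *: u) 0 u cF (dmx_line q u 0).
by rewrite scale0r addr0; apply.
Qed.

Lemma mpdE a b (F : 'cV[R]_m -> 'M[R]_(a, b)) q u D :
  C_on 1 U F -> U q -> dmx (fun s : R => F (q + s *: u)) 0 D -> mpd F q u = D.
Proof. by move=> cF Uq; apply: dmx_uniq; exact: mpd_line. Qed.

Lemma pd_eq k (f f' : 'cV[R]_m -> R) q :
  (forall w, U w -> f w = f' w) -> U q -> pd k f q = pd k f' q.
Proof.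
move=> ff Uq; rewrite /pd; apply: near_eq_derive.
have [d d0 H] := open_tube oU Uq.
by apply/near_nrmP; exists d => // w wd; rewrite ff //; exact: H.
Qed.

Lemma mpd_eq a b (F F' : 'cV[R]_m -> 'M[R]_(a, b)) q u :
  (forall w, U w -> F w = F' w) -> U q -> mpd F q u = mpd F' q u.
Proof.
move=> FF Uq; apply/matrixP => i j; rewrite !mxE; apply: eq_bigr => k _; congr (_ * _).
by apply: pd_eq => // w Uw; rewrite FF.
Qed.

Lemma mpdD a b (F : 'cV[R]_m -> 'M[R]_(a, b)) q u v :
  mpd F q (u + v) = mpd F q u + mpd F q v.
Proof.
apply/matrixP => i j; rewrite mxaddE !mxE -big_split; apply: eq_bigr => k _.
by rewrite mxaddE mulrDl.
Qed.

Lemma mpdZ a b (F : 'cV[R]_m -> 'M[R]_(a, b)) q c u : mpd F q (c *: u) = c *: mpd F q u.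
Proof.
apply/matrixP => i j; rewrite mxscaleE !mxE mulr_sumr; apply: eq_bigr => k _.
by rewrite mxscaleE mulrA.
Qed.

Lemma jacE p (F : 'cV[R]_m -> 'cV[R]_p) q u : jac F q *m u = mpd F q u.
Proof.
apply/matrixP => i j; rewrite !mxE; apply: eq_bigr => k _.
by rewrite mxE mulrC !(ord1 j).
Qed.

Lemma jac_C p r (F : 'cV[R]_m -> 'cV[R]_p) : C_on r.+1 U F -> C_on r U (jac F).
Proof.
move=> cF i j; have [_ /(_ j)] := cF i ord0.
by apply: Ck_on_eq => // q _; rewrite mxE.
Qed.

Lemma mpd_jac_sym p (F : 'cV[R]_m -> 'cV[R]_p) q u v :
  C_on 2 U F -> U q -> mpd (jac F) q u *m v = mpd (jac F) q v *m u.
Proof.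
move=> cF Uq.
have E w z i : (mpd (jac F) q w *m z) i ord0 =
    \sum_k \sum_l w k ord0 * z l ord0 * pd k (pd l (fun x => F x i ord0)) q.
  rewrite mxE exchange_big; apply: eq_bigr => l _; rewrite mxE mulr_suml.
  apply: eq_bigr => k _; rewrite mulrAC; congr (_ * _ * pd k _ q).
  by apply/funext => x; rewrite mxE.
apply/matrixP => i j; rewrite (ord1 j) !E exchange_big; apply: eq_bigr => k _.
apply: eq_bigr => l _; rewrite (mulrC (u _ _)).
exact: (congr1 (fun z => v k ord0 * u l ord0 * z) (clairaut oU l k (cF i ord0) Uq)).
Qed.

Lemma C_on_le a b r s (F : 'cV[R]_m -> 'M[R]_(a, b)) : (r <= s)%N -> C_on s U F -> C_on r U F.
Proof. by move=> rs cF i j; exact: (Ck_on_le oU rs (cF i j)). Qed.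

Lemma C_onM a b c r (F : 'cV[R]_m -> 'M[R]_(a, b)) (G : 'cV[R]_m -> 'M[R]_(b, c)) :
  C_on r U F -> C_on r U G -> C_on r U (fun w => F w *m G w).
Proof. exact: (alg_mulmx (Ck_on_alg oU r)). Qed.

Lemma C_onV a r (F : 'cV[R]_m -> 'M[R]_a) :
  (forall w, U w -> F w \in unitmx) -> C_on r U F -> C_on r U (fun w => invmx (F w)).
Proof.
move=> Fu cF i j.
apply: (@Ck_on_eq _ _ oU _ (fun w => (\det (F w))^-1 * (\adj (F w)) i j)).
  by move=> w Uw; rewrite invmxE //; exact: Fu.
apply: (Ck_onM oU); last exact: (alg_adj (Ck_on_alg oU r) cF).
apply: (Ck_onV oU); last exact: (alg_det (Ck_on_alg oU r) cF).
by move=> w Uw; rewrite -unitfE -unitmxE; exact: Fu.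
Qed.

Lemma C_on_mcts a b r (F : 'cV[R]_m -> 'M[R]_(a, b)) q : C_on r U F -> U q -> mcts F q.
Proof. move=> cF Uq i j.
have H : {for q, continuous (fun w => F w i j)} := Ck_on_le oU (leq0n r) (cF i j) _ Uq.
exact: H. Qed.

Lemma mpd_mcts (T : topologicalType) a b (F : 'cV[R]_m -> 'M[R]_(a, b))
    (c : T -> 'cV[R]_m) (u : T -> 'cV[R]_m) t :
  C_on 1 U F -> mcts c t -> mcts u t -> U (c t) -> mcts (fun s => mpd F (c s) (u s)) t.
Proof.
move=> cF cc cu Uc i j; rewrite mxE; under eq_fun do rewrite mxE.
apply: (@cts_sum R T _ _ (fun k s => u s k ord0 * pd k (fun w => F w i j) (c s))) => k.
apply: cvgM; first exact: cu.
have [_ /(_ k) H] := cF i j.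
exact: (@continuous_comp _ _ _ c (pd k (fun w => F w i j)) t ((mctsP _ _).1 cc) (H _ Uc)).
Qed.

Lemma C_on_tr a b r (F : 'cV[R]_m -> 'M[R]_(a, b)) : C_on r U F -> C_on r U (fun x => (F x)^T).
Proof.
move=> cF i j; apply: (@Ck_on_eq _ _ oU _ (fun w => F w j i)); last exact: cF.
by move=> x _; rewrite mxE.
Qed.

Lemma mpd_tr a b (F : 'cV[R]_m -> 'M[R]_(a, b)) q u :
  mpd (fun x => (F x)^T) q u = (mpd F q u)^T.
Proof.
apply/matrixP => i j; rewrite !mxE; apply: eq_bigr => k _; congr (_ * pd k _ q).
by apply/funext => x; rewrite mxE.
Qed.

Lemma mpdM a b c (F : 'cV[R]_m -> 'M[R]_(a, b)) (H : 'cV[R]_m -> 'M[R]_(b, c)) q u :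
  C_on 1 U F -> C_on 1 U H -> U q ->
  mpd (fun x => F x *m H x) q u = mpd F q u *m H q + F q *m mpd H q u.
Proof.
move=> cF cH Uq; apply: mpdE => //; first exact: C_onM.
have := dmxM (mpd_line u cF Uq) (mpd_line u cH Uq).
by rewrite scale0r addr0.
Qed.

Lemma mpd_sum a b (F H : 'cV[R]_m -> 'M[R]_(a, b)) q u :
  C_on 1 U F -> C_on 1 U H -> U q ->
  mpd (fun x => F x + H x) q u = mpd F q u + mpd H q u.
Proof.
move=> cF cH Uq; apply: mpdE => //; last exact: (dmxD (mpd_line u cF Uq) (mpd_line u cH Uq)).
move=> i j; apply: (@Ck_on_eq _ _ oU _ (fun x => F x i j + H x i j)).
  by move=> x _; rewrite mxaddE.
exact: (Ck_onD oU).
Qed.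

Lemma C_on_cst a b r (A : 'M[R]_(a, b)) : C_on r U (fun=> A).
Proof. by move=> i j; exact: Ck_on_cst. Qed.

Lemma mpd_cst a b (A : 'M[R]_(a, b)) q u : U q -> mpd (fun=> A) q u = 0.
Proof. by move=> Uq; apply: mpdE => //; [exact: C_on_cst|exact: dmx_cst]. Qed.

Lemma mpd_mulr a b c (F : 'cV[R]_m -> 'M[R]_(a, b)) (A : 'M[R]_(b, c)) q u :
  C_on 1 U F -> U q -> mpd (fun x => F x *m A) q u = mpd F q u *m A.
Proof.
by move=> cF Uq; rewrite mpdM //; [rewrite mpd_cst // mulmx0 addr0|exact: C_on_cst].
Qed.

Lemma C_on_pd a b r (F : 'cV[R]_m -> 'M[R]_(a, b)) u : C_on r.+1 U F -> C_on r U (fun x => mpd F x u).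
Proof.
move=> cF i j; apply: (@Ck_on_eq _ _ oU _ (fun x => \sum_k u k ord0 * pd k (fun w => F w i j) x)).
  by move=> x _; rewrite mxE.
have [Pc PD PM] := Ck_on_alg oU r.
apply: alg_sum; first exact: Ck_on_alg.
move=> k; apply: (PM (fun=> u k ord0)); first exact: Pc.
by have [_] := cF i j; apply.
Qed.

Lemma mpd2_sym a b (F : 'cV[R]_m -> 'M[R]_(a, b)) q u v : C_on 2 U F -> U q ->
  mpd (fun x => mpd F x u) q v = mpd (fun x => mpd F x v) q u.
Proof.
move=> cF Uq.
have E w z i j : mpd (fun x => mpd F x w) q z i j =
    \sum_k \sum_l z k ord0 * w l ord0 * pd k (pd l (fun x => F x i j)) q.
  rewrite mxE; apply: eq_bigr => k _.
  under [RHS]eq_bigr do rewrite -mulrA; rewrite -mulr_sumr; congr (_ * _).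
  rewrite -pd_lincomb; last by move=> l; have [_ /(_ l) [df _]] := cF i j; exact: df.
  by congr (pd k _ q); apply/funext => x; rewrite mxE.
apply/matrixP => i j; rewrite !E exchange_big; apply: eq_bigr => k _.
apply: eq_bigr => l _; rewrite (mulrC (v _ _)).
exact: (congr1 (fun z => u k ord0 * v l ord0 * z) (clairaut oU l k (cF i j) Uq)).
Qed.

End MatrixC1.

End Multivariate.

(** The matrix identity behind [Rm_skew]: [a] and [b] stand for the Christoffel matrices of two
    directions, [D] and [E] for their derivatives, and the right-hand side is the difference of two
    mixed second derivatives of the metric. *)
Lemma skew_algebra (R : comNzRingType) n (G D E a b : 'M[R]_n) :
  (D - E + (a *m b - b *m a))^T *m G + G *m (D - E + (a *m b - b *m a)) =
  (D^T *m G + b^T *m (a^T *m G + G *m a) + ((a^T *m G + G *m a) *m b + G *m D))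
  - (E^T *m G + a^T *m (b^T *m G + G *m b) + ((b^T *m G + G *m b) *m a + G *m E)).
Proof.
have -> : (D - E + (a *m b - b *m a))^T = D^T - E^T + (b^T *m a^T - a^T *m b^T).
  by rewrite !(linearD, linearN) /= !trmx_mul.
rewrite !(mulmxDl, mulmxDr, mulmxBl, mulmxBr, mulNmx, mulmxN) !mulmxA.
move: (D^T *m G) (E^T *m G) (G *m D) (G *m E) => c1 c2 c3 c4.
move: (b^T *m a^T *m G) (a^T *m b^T *m G) (b^T *m G *m a) (a^T *m G *m b) => d1 d2 d3 d4.
move: (G *m a *m b) (G *m b *m a) => e1 e2.
by apply/matrixP => i j; rewrite !mxE; ring.
Qed.

(** * Levi-Civita connection, curvature and Hessian in coordinates *)

Section LocalMetric.
Variables (R : realType) (n : nat) (U : set 'cV[R]_n) (G : 'cV[R]_n -> 'M[R]_n).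
Hypothesis oU : open U.
Hypothesis G_smooth : forall r, C_on r U G.
Hypothesis G_sym : forall q, (G q)^T = G q.
Hypothesis G_unit : forall q, U q -> G q \in unitmx.
Implicit Types (q u v w : 'cV[R]_n).

(** The Christoffel symbols contracted with one vector, as a matrix, so that connection terms become
    matrix products. *)
Definition gam q v : 'M[R]_n := \matrix_(k, b) \sum_a v a ord0 * christoffel G k a b q.

Lemma gamE q v w : christoffel_form G q v w = gam q v *m w.
Proof.
apply/matrixP => k j; rewrite (ord1 j) !mxE exchange_big; apply: eq_bigr => b _.
rewrite mxE mulr_suml; apply: eq_bigr => a _; by rewrite (mulrC (v _ _)).
Qed.

Lemma gamD q u v : gam q (u + v) = gam q u + gam q v.
Proof.
apply/matrixP => i j; rewrite mxaddE !mxE -big_split; apply: eq_bigr => k _.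
by rewrite mxaddE mulrDl.
Qed.

Lemma gamZ q c u : gam q (c *: u) = c *: gam q u.
Proof.
apply/matrixP => i j; rewrite mxscaleE !mxE mulr_sumr; apply: eq_bigr => k _.
by rewrite mxscaleE mulrA.
Qed.

Lemma gamN q u : gam q (- u) = - gam q u.
Proof. by rewrite -scaleN1r gamZ scaleN1r. Qed.

Let G_symE q i j : G q i j = G q j i.
Proof. by rewrite -{1}G_sym mxE. Qed.

Let pdG_sym k i j q : pd k (fun w => G w i j) q = pd k (fun w => G w j i) q.
Proof. by congr (pd k _ q); apply/funext => w. Qed.

Lemma christoffel_sym k a b q : christoffel G k a b q = christoffel G k b a q.
Proof.
rewrite /christoffel; congr (_ * _); apply: eq_bigr => l _.
by rewrite (pdG_sym l a b) (addrC (pd a _ _)).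
Qed.

Lemma gam_sym q v w : gam q v *m w = gam q w *m v.
Proof.
rewrite -!gamE; apply/matrixP => k j; rewrite !mxE exchange_big; apply: eq_bigr => b _.
by apply: eq_bigr => a _; rewrite christoffel_sym mulrAC.
Qed.

(** After lowering the index, the connection splits into half the derivative of the metric, which is
    symmetric, and an antisymmetric part that cancels in [metric_compat]. *)
Lemma G_gam q u : U q -> G q *m gam q u = 2^-1 *: (mpd G q u +
  \matrix_(m, b) \sum_a u a ord0 * (pd b (fun w => G w m a) q - pd m (fun w => G w a b) q)).
Proof.
move=> Uq; apply/matrixP => m b; rewrite mxscaleE mxaddE !mxE -big_split mulr_sumr.
transitivity (\sum_a u a ord0 * \sum_k G q m k * christoffel G k a b q).
  under eq_bigr do rewrite mxE mulr_sumr.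
  rewrite exchange_big; apply: eq_bigr => a _; rewrite mulr_sumr; apply: eq_bigr => k _.
  by rewrite mulrCA.
apply: eq_bigr => a _.
pose c l := pd a (fun w => G w l b) q + pd b (fun w => G w l a) q - pd l (fun w => G w a b) q.
have -> : \sum_k G q m k * christoffel G k a b q = 2^-1 * \sum_l (G q *m invmx (G q)) m l * c l.
  transitivity (\sum_k \sum_l 2^-1 * (G q m k * invmx (G q) k l * c l)).
    apply: eq_bigr => k _; rewrite /christoffel mulrCA mulr_sumr mulr_sumr.
    by apply: eq_bigr => l _; rewrite !mulrA.
  rewrite exchange_big mulr_sumr; apply: eq_bigr => l _; rewrite mxE mulr_suml mulr_sumr.
  by apply: eq_bigr => k _.
rewrite mulmxV ?G_unit // (bigD1 m) //= big1 ?addr0 => [|l lm]; last first.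
  by rewrite mxE eq_sym (negbTE lm) mul0r.
by rewrite mxE eqxx mul1r /c; ring.
Qed.

Lemma metric_compat q u : U q -> mpd G q u = (gam q u)^T *m G q + G q *m gam q u.
Proof.
move=> Uq.
have -> : (gam q u)^T *m G q = (G q *m gam q u)^T by rewrite trmx_mul G_sym.
rewrite !G_gam //; apply/matrixP => i j.
rewrite mxaddE [(_^T) i j]mxE !mxscaleE !mxaddE.
have -> : mpd G q u j i = mpd G q u i j.
  by rewrite !mxE; apply: eq_bigr => k _; rewrite pdG_sym.
have -> : (\matrix_(m, b) \sum_a u a ord0 * (pd b (fun w => G w m a) q - pd m (fun w => G w a b) q)) j i
   = - (\matrix_(m, b) \sum_a u a ord0 * (pd b (fun w => G w m a) q - pd m (fun w => G w a b) q)) i j.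
  rewrite !mxE -sumrN; apply: eq_bigr => a _.
  by rewrite (pdG_sym i j a) (pdG_sym j a i) -mulrN opprB.
by field.
Qed.

(* Koszul: these properties characterise the Levi-Civita connection. *)
Lemma gam_unique q (A : 'cV[R]_n -> 'M[R]_n) : U q ->
  (forall v w, A v *m w = A w *m v) ->
  (forall u, mpd G q u = (A u)^T *m G q + G q *m A u) -> forall v, A v = gam q v.
Proof.
move=> Uq As Ac.
pose D v := A v - gam q v.
have Ds v w : D v *m w = D w *m v by rewrite !mulmxBl As gam_sym.
pose c (u w z : 'cV[R]_n) := (z^T *m (G q *m D u) *m w) ord0 ord0.
have tr1 (X : 'M[R]_1) : X ord0 ord0 = X^T ord0 ord0 by rewrite mxE.
have c1 u w z : c u w z = c w u z by rewrite /c -!mulmxA Ds.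
have c2 u w z : c u w z = - c u z w.
  apply/eqP; rewrite -addr_eq0; apply/eqP; rewrite {2}/c tr1 !trmx_mul trmxK G_sym !mulmxA.
  rewrite /c -(mulmxA z^T (D u)^T) -mxaddE -mulmxDl -mulmxDr.
  have -> : G q *m D u + (D u)^T *m G q = 0.
    rewrite /D mulmxBr linearB /= mulmxBl addrACA -opprD (addrC (G q *m A u)) -Ac.
    by rewrite (addrC (G q *m gam q u)) -metric_compat // subrr.
  by rewrite mulmx0 mul0mx mxE.
(* A trilinear form that is symmetric in the first two arguments and skew in the last two vanishes:
   six transpositions lead back to itself with the opposite sign. *)
have c0 u w z : c u w z = 0.
  have := c2 u w z; rewrite (c1 u z w) (c2 z u w) (c1 z w u) (c2 w z u) (c1 w u z).
  by rewrite !opprK => /eqP; rewrite -addr_eq0 -mulr2n mulrn_eq0 => /eqP.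
have GD u : G q *m D u = 0.
  apply/matrixP => i j; rewrite [RHS]mxE -(c0 u (delta_mx j ord0) (delta_mx i ord0)) /c.
  by rewrite trmx_delta -rowE -colE !mxE.
move=> v; apply/eqP; rewrite -subr_eq0; apply/eqP.
by rewrite -[LHS]mul1mx -(mulVmx (G_unit Uq)) -mulmxA GD mulmx0.
Qed.

Lemma christoffel_C r k a b : Ck_on r U (christoffel G k a b).
Proof.
have [Pc PD PM] := Ck_on_alg oU r.
have pG l i j : Ck_on r U (pd l (fun w => G w i j)).
  by have [_] := G_smooth r.+1 i j; apply.
apply: (PM (fun=> 2^-1)); first exact: Pc.
apply: alg_sum; first exact: Ck_on_alg.
move=> l; apply: (PM); first exact: (C_onV oU (fun w Uw => G_unit Uw) (G_smooth r)).
apply: (PD); first by apply: (PD); exact: pG.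
have N : Ck_on r U (fun q => -1 * pd l (fun u => G u a b) q) by apply: (PM); [exact: Pc|exact: pG].
by apply: (Ck_on_eq oU _ N) => q _; rewrite mulN1r.
Qed.

Lemma gam_C r v : C_on r U (fun q => gam q v).
Proof.
move=> i j; apply: (@Ck_on_eq _ _ _ oU _ (fun q => \sum_a v a ord0 * christoffel G i a j q)).
  by move=> q _; rewrite mxE.
have [Pc PD PM] := Ck_on_alg oU r.
apply: alg_sum; first exact: Ck_on_alg.
by move=> a; apply: (PM (fun=> v a ord0)); [exact: Pc|exact: christoffel_C].
Qed.

Definition dgam q w v : 'M[R]_n := mpd (fun x => gam x v) q w.

Lemma dgamE q w v i j : U q -> dgam q w v i j =
  \sum_a \sum_b w a ord0 * v b ord0 * pd a (christoffel G i b j) q.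
Proof.
move=> Uq; rewrite mxE; apply: eq_bigr => a _.
under [RHS]eq_bigr do rewrite -mulrA; rewrite -mulr_sumr; congr (_ * _).
rewrite -pd_lincomb; last by move=> b; have [df _] := christoffel_C 1 i b j; exact: df.
by congr (pd a _ q); apply/funext => x; rewrite mxE.
Qed.

Definition Rm q u v : 'M[R]_n :=
  dgam q u v - dgam q v u + (gam q u *m gam q v - gam q v *m gam q u).

Lemma riemannE q u v w : U q -> riemann G q u v w = Rm q u v *m w.
Proof.
move=> Uq; apply/matrixP => d j; rewrite (ord1 j) !mxE.
transitivity (\sum_c (\sum_a \sum_b riem_coef G d a b c q * u a ord0 * v b ord0) * w c ord0).
  transitivity (\sum_c \sum_a \sum_b riem_coef G d a b c q * u a ord0 * v b ord0 * w c ord0).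
    rewrite [RHS]exchange_big; apply: eq_bigr => a _; rewrite exchange_big; apply: eq_bigr => b _.
    by [].
  by apply: eq_bigr => c _; rewrite mulr_suml; apply: eq_bigr => a _; rewrite mulr_suml.
apply: eq_bigr => c _; congr (_ * _).
rewrite /Rm !mxaddE !mxoppE !dgamE //.
have gg x y : (gam q x *m gam q y) d c = \sum_a \sum_b x a ord0 * y b ord0 *
    \sum_e (christoffel G d a e q * christoffel G e b c q).
  rewrite mxE; transitivity (\sum_e \sum_a \sum_b x a ord0 * y b ord0 *
     (christoffel G d a e q * christoffel G e b c q)).
    apply: eq_bigr => e _; rewrite !mxE mulr_suml; apply: eq_bigr => a _.
    by rewrite mulr_sumr; apply: eq_bigr => b _; rewrite mulrACA.
  rewrite exchange_big; apply: eq_bigr => a _; rewrite exchange_big; apply: eq_bigr => b _.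
  by rewrite mulr_sumr.
rewrite !gg.
have sw F : \sum_a \sum_b v a ord0 * u b ord0 * F a b = \sum_a \sum_b u a ord0 * v b ord0 * F b a.
  rewrite exchange_big; apply: eq_bigr => a _; apply: eq_bigr => b _.
  by rewrite (mulrC (v _ _)).
rewrite [X in _ - X + _]sw [X in _ + (_ - X)]sw -!sumrB -big_split; apply: eq_bigr => a _.
rewrite -!sumrB -big_split; apply: eq_bigr => b _.
rewrite /= -mulrBr -mulrBr -mulrDr /riem_coef sumrB -mulrA mulrC; congr (_ * _).
Qed.

Lemma mpd_gamM q u v w : U q -> mpd (fun x => gam x v *m w) q u = dgam q u v *m w.
Proof. by move=> Uq; rewrite (mpd_mulr oU) //; exact: gam_C. Qed.

Lemma dgam_sym q u v w : U q -> dgam q u v *m w = dgam q u w *m v.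
Proof.
move=> Uq; rewrite -!mpd_gamM //.
have -> // : (fun x => gam x v *m w) = (fun x => gam x w *m v).
by apply/funext => x; exact: gam_sym.
Qed.

(** Second derivatives of the metric commute; expanding both orders through [metric_compat] leaves
    exactly the failure of [Rm q u v] to be skew. *)
Lemma Rm_skew q u v : U q -> (Rm q u v)^T *m G q + G q *m Rm q u v = 0.
Proof.
move=> Uq.
have G1 := G_smooth 1.
have key w z : mpd (fun x => mpd G x z) q w =
    (dgam q w z)^T *m G q + (gam q z)^T *m ((gam q w)^T *m G q + G q *m gam q w)
    + (((gam q w)^T *m G q + G q *m gam q w) *m gam q z + G q *m dgam q w z).
  rewrite (mpd_eq oU _ (fun x Ux => metric_compat z Ux)) //.
  have cT : C_on 1 U (fun x => (gam x z)^T).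
    by apply: (C_on_tr oU); exact: gam_C.
  have cz := gam_C 1 z.
  rewrite (mpd_sum oU w (C_onM oU cT G1) (C_onM oU G1 cz) Uq).
  by rewrite (mpdM oU w cT G1 Uq) (mpdM oU w G1 cz Uq) mpd_tr metric_compat.
have := mpd2_sym oU u v (G_smooth 2) Uq; rewrite !key => /eqP.
rewrite eq_sym -subr_eq0 => /eqP E; rewrite -[RHS]E /Rm; exact: skew_algebra.
Qed.

Lemma bianchi q u v w : U q -> Rm q u v *m w + Rm q v w *m u + Rm q w u *m v = 0.
Proof.
move=> Uq; rewrite /Rm !(mulmxDl, mulmxBl, mulNmx) -!mulmxA.
rewrite (dgam_sym u w v Uq) (dgam_sym v u w Uq) (dgam_sym w v u Uq).
rewrite (gam_sym q w v) (gam_sym q u w) (gam_sym q v u).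
move: (dgam q u v *m w) (dgam q v w *m u) (dgam q w u *m v) => a1 a2 a3.
move: (gam q u *m (gam q v *m w)) (gam q v *m (gam q w *m u)) (gam q w *m (gam q u *m v)).
move=> b1 b2 b3.
by apply/matrixP => i j; rewrite !mxE; ring.
Qed.

(* Matrix of [u |-> R(u, v) v]. *)
Definition Kmx q v : 'M[R]_n := \matrix_(i, k) (Rm q (delta_mx k ord0) v *m v) i ord0.

Lemma dgam_linr q w c x y : U q -> dgam q w (c *: x + y) = c *: dgam q w x + dgam q w y.
Proof.
move=> Uq; apply/matrixP => i j; rewrite mxaddE mxscaleE !dgamE // mulr_sumr -big_split.
apply: eq_bigr => a _; rewrite mulr_sumr -big_split; apply: eq_bigr => b _ /=.
by rewrite mxaddE mxscaleE; ring.
Qed.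

Lemma KmxE q v u : U q -> Kmx q v *m u = Rm q u v *m v.
Proof.
move=> Uq.
have lin c x y : Rm q (c *: x + y) v *m v = c *: (Rm q x v *m v) + Rm q y v *m v.
  rewrite scalemxAl -mulmxDl; congr (_ *m v).
  have E : dgam q (c *: x + y) v = c *: dgam q x v + dgam q y v by rewrite /dgam mpdD mpdZ.
  rewrite /Rm dgam_linr // E gamD gamZ !(mulmxDl, mulmxDr) -!scalemxAl -!scalemxAr.
  move: (dgam q x v) (dgam q v x) (dgam q y v) (dgam q v y) => a1 a2 a3 a4.
  move: (gam q x *m gam q v) (gam q v *m gam q x) (gam q y *m gam q v) (gam q v *m gam q y).
  by move=> b1 b2 b3 b4; apply/matrixP => i j; rewrite !mxE; ring.
have R0 : Rm q 0 v *m v = 0.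
  have := lin 1 0 0; rewrite !scale1r addr0 => /eqP.
  by rewrite -subr_eq0 opprD addNKr oppr_eq0 => /eqP.
have uE : u = \sum_k u k ord0 *: delta_mx k ord0.
  apply/matrixP => i j; rewrite (ord1 j) summxE (bigD1 i) //= big1 => [|k ki].
    by rewrite !mxE !eqxx mulr1 addr0.
  by rewrite !mxE eq_sym (negbTE ki) mulr0.
rewrite {2}uE.
have -> : Rm q (\sum_k u k ord0 *: delta_mx k ord0) v *m v =
    \sum_k u k ord0 *: (Rm q (delta_mx k ord0) v *m v).
  elim: (index_enum _) => [|k s IH]; first by rewrite !big_nil R0.
  by rewrite !big_cons lin IH.
apply/matrixP => i j; rewrite (ord1 j) summxE mxE; apply: eq_bigr => k _.
by rewrite mxE [in RHS]mxE mulrC.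
Qed.

Lemma form_sym_mx (A : 'M[R]_n) :
  (forall x y : 'cV[R]_n, (x^T *m A *m y) ord0 ord0 = (y^T *m A *m x) ord0 ord0) -> A^T = A.
Proof.
have E (x y : 'I_n) : ((delta_mx x ord0 : 'cV[R]_n)^T *m A *m (delta_mx y ord0 : 'cV[R]_n)) ord0 ord0 = A x y.
  by rewrite trmx_delta -rowE -colE !mxE.
by move=> H; apply/matrixP => i j; rewrite mxE -!E.
Qed.

(** Of the pair symmetry of the curvature only the case with [v] repeated is needed. One instance of
    the Bianchi identity suffices, since its third term vanishes by skewness. *)
Lemma riem_sym q v : U q -> (G q *m Kmx q v)^T = G q *m Kmx q v.
Proof.
move=> Uq; apply: form_sym_mx => x y.
pose r (a b c d : 'cV[R]_n) := (d^T *m (G q *m Rm q a b) *m c) ord0 ord0.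
have E a b : (a^T *m (G q *m Kmx q v) *m b) ord0 ord0 = r b v v a.
  by rewrite /r -!mulmxA KmxE.
have r2 a b c d : r a b c d = - r a b d c.
  apply/eqP; rewrite -addr_eq0; apply/eqP.
  have tr1 (X : 'M[R]_1) : X ord0 ord0 = X^T ord0 ord0 by rewrite mxE.
  rewrite {2}/r tr1 !trmx_mul trmxK G_sym !mulmxA /r -(mulmxA d^T (Rm q a b)^T) -mxaddE.
  by rewrite -mulmxDl -mulmxDr addrC Rm_skew // mulmx0 mul0mx mxE.
have r1 a b c d : r a b c d = - r b a c d.
  have -> : r a b c d = (d^T *m (G q *m (- Rm q b a)) *m c) ord0 ord0.
    by rewrite /r; congr ((_ *m (_ *m _) *m _) _ _); rewrite /Rm opprD !opprB.
  by rewrite mulmxN mulmxN mulNmx mxoppE.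
have r3 : r x v y v + r v y x v + r y x v v = 0.
  have := congr1 (fun Z => (v^T *m (G q *m Z)) ord0 ord0) (bianchi x v y Uq).
  rewrite !mulmx0 [X in _ = X]mxE => B.
  by rewrite -[RHS]B !mulmxDr !mxaddE /r !mulmxA.
have r0 : r y x v v = 0.
  by have := r2 y x v v => /eqP; rewrite -addr_eq0 -mulr2n mulrn_eq0 => /eqP.
rewrite !E; move: r3; rewrite r0 addr0 (r2 x v y v) (r1 v y x v) (r2 y v x v) opprK addrC.
by move=> /eqP; rewrite subr_eq0 => /eqP.
Qed.

Section Hessian.
Variable f : 'cV[R]_n -> R.
Hypothesis f_smooth : smooth_on U f.

Let df q : 'cV[R]_n := \col_k pd k f q.

Lemma df_C r : C_on r U df.
Proof.
move=> i j; apply: (@Ck_on_eq _ _ _ oU _ (pd i f)); first by move=> q _; rewrite mxE.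
by have [_] := f_smooth r.+1; apply.
Qed.

Lemma gradient_C r : C_on r U (gradient G f).
Proof. by apply: (C_onM oU); [exact: (C_onV oU G_unit (G_smooth r))|exact: df_C]. Qed.

(** The Hessian as an endomorphism. Torsion-freeness allows the gradient to be the first argument of
    [gam], which leaves a matrix acting on the direction. *)
Definition Hmx q : 'M[R]_n := jac (gradient G f) q + gam q (gradient G f q).

Lemma cov_gradientE q v : cov_gradient G f q v = Hmx q *m v.
Proof. by rewrite /cov_gradient mulmxDl gamE (gam_sym q v). Qed.

(** Lowering the index turns the Hessian into the second derivative of [f] minus a Christoffel term;
    the first is symmetric by Clairaut and the second by torsion-freeness. *)
Lemma hess_sym q : U q -> (G q *m Hmx q)^T = G q *m Hmx q.
Proof.
move=> Uq; apply: form_sym_mx => x y.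
have Ggrad w : U w -> G w *m gradient G f w = df w.
  by move=> Uw; rewrite /gradient mulmxA mulmxV ?G_unit // mul1mx.
have E u : G q *m (Hmx q *m u) = jac df q *m u - (gam q u)^T *m df q.
  have := mpdM oU u (G_smooth 1) (gradient_C 1) Uq.
  rewrite (mpd_eq oU u Ggrad Uq) -!jacE metric_compat // => ->.
  rewrite /Hmx !mulmxDl -(gam_sym q u) -Ggrad // mulmxDr -!mulmxA.
  move: ((gam q u)^T *m _) (G q *m (gam q u *m _)) (G q *m (jac _ _ *m _)) => a1 a2 a3.
  by apply/matrixP => i j; rewrite !mxE; ring.
rewrite -!mulmxA !E !mulmxBr !mxaddE !mxoppE; congr (_ - _).
  have dfs : (jac df q)^T = jac df q.
    apply/matrixP => i j; rewrite !mxE.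
    have Ek k : (fun u => df u k ord0) = pd k f by apply/funext => u; rewrite mxE.
    by rewrite !Ek; exact: (clairaut oU i j (f_smooth 2) Uq).
  have tr1 (X : 'M[R]_1) : X ord0 ord0 = X^T ord0 ord0 by rewrite mxE.
  by rewrite tr1 !trmx_mul dfs trmxK mulmxA.
have sw a b : a^T *m ((gam q b)^T *m df q) = (gam q b *m a)^T *m df q.
  by rewrite trmx_mul mulmxA.
by rewrite !sw gam_sym.
Qed.

End Hessian.

End LocalMetric.

Section Composition.
Variables (R : realType) (m p : nat) (U : set 'cV[R]_m) (U' : set 'cV[R]_p).
Hypotheses (oU : open U) (oU' : open U').
Variable F : 'cV[R]_m -> 'cV[R]_p.
Hypothesis FU : forall q, U q -> U' (F q).

Lemma pd_comp g k q : C_on 1 U F -> Ck_on 1 U' g -> U q ->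
  derivable (fun q => g (F q)) q (delta_mx k ord0 : 'cV[R]_m) /\
  pd k (fun q => g (F q)) q = \sum_l pd k (fun w => F w l ord0) q * pd l g (F q).
Proof.
move=> cF1 cg1 Uq.
have D : is_derive (0 : R) (1 : R) (fun s => g (F (q + s *: (delta_mx k ord0 : 'cV[R]_m))))
    (\sum_l mpd F q (delta_mx k ord0) l ord0 * pd l g (F q)).
  have := chain_rule oU' cg1 (mpd_line oU (delta_mx k ord0) cF1 Uq).
  by rewrite scale0r addr0; apply; exact: FU.
have [d1 d2] := D.
have E : (fun h : R => h^-1 *: (g (F (q + (h *: 1 + 0) *: (delta_mx k ord0 : 'cV[R]_m)))
    - g (F (q + 0 *: (delta_mx k ord0 : 'cV[R]_m))))) =
    (fun h : R => h^-1 *: (g (F (h *: (delta_mx k ord0 : 'cV[R]_m) + q)) - g (F q))).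
  apply/funext => h; congr (_ *: (g (F _) - g (F _))); last by rewrite scale0r addr0.
  by rewrite addr0 /GRing.scale /= mulr1 -/(GRing.scale _ _) addrC.
rewrite /derivable E in d1; rewrite /derive E in d2; split; first exact: d1.
rewrite /pd /derive; apply: etrans d2 _; apply: eq_bigr => l _; congr (_ * _).
rewrite mxE (bigD1 k) //= big1 ?addr0 => [|j jk]; first by rewrite mxE !eqxx mul1r.
by rewrite mxE (negbTE jk) mul0r.
Qed.

Lemma Ck_on_comp r g : C_on r U F -> Ck_on r U' g -> Ck_on r U (fun q => g (F q)).
Proof.
elim: r g => [|r IH] g cF cg.
  move=> q Uq; have cFq : {for q, continuous F} by apply/mctsP; exact: (C_on_mcts oU cF Uq).
  exact: (@continuous_comp _ _ _ F g q cFq (cg _ (FU Uq))).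
have cF1 : C_on 1 U F by exact: (C_on_le oU _ cF).
have cg1 : Ck_on 1 U' g by exact: (Ck_on_le oU' _ cg).
split=> [k q Uq|k]; first by have [] := pd_comp k cF1 cg1 Uq.
apply: (@Ck_on_eq _ _ _ oU _ (fun q => \sum_l pd k (fun w => F w l ord0) q * pd l g (F q))).
  by move=> q Uq; have [_ ->] := pd_comp k cF1 cg1 Uq.
apply: alg_sum; first exact: Ck_on_alg.
move=> l; apply: (Ck_onM oU); first by have [_] := cF l ord0; apply.
by apply: IH; [exact: (C_on_le oU (leqnSn r) cF)|have [_] := cg; apply].
Qed.

Lemma C_on_comp r a b (H : 'cV[R]_p -> 'M[R]_(a, b)) :
  C_on r U F -> C_on r U' H -> C_on r U (fun q => H (F q)).
Proof. by move=> cF cH i j; exact: (Ck_on_comp cF (cH i j)). Qed.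

Lemma mpd_comp a b (H : 'cV[R]_p -> 'M[R]_(a, b)) q u :
  C_on 1 U F -> C_on 1 U' H -> U q ->
  mpd (fun q => H (F q)) q u = mpd H (F q) (mpd F q u).
Proof.
move=> cF cH Uq; apply: (mpdE oU _ Uq); first exact: C_on_comp.
have := mpd_chain oU' cH (mpd_line oU u cF Uq).
by rewrite scale0r addr0; apply; exact: FU.
Qed.

End Composition.

Section GamCurve.
Variables (R : realType) (n : nat) (U : set 'cV[R]_n) (G : 'cV[R]_n -> 'M[R]_n).
Hypothesis oU : open U.
Hypothesis G_smooth : forall r, C_on r U G.
Hypothesis G_unit : forall q, U q -> G q \in unitmx.

Lemma gam_dmx (c w : R -> 'cV[R]_n) t c' w' :
  dmx c t c' -> dmx w t w' -> U (c t) ->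
  dmx (fun s => gam G (c s) (w s)) t (dgam G (c t) c' (w t) + gam G (c t) w').
Proof.
move=> dc dw Uc i j.
rewrite mxaddE (dgamE oU) // exchange_big [X in _ + X]mxE -big_split /=.
under eq_fun do rewrite mxE.
apply: is_derive_sumfin => a.
have dch := chain_rule oU (christoffel_C oU G_smooth G_unit 1 i a j) dc Uc.
apply: is_derive_eq; first exact: (is_deriveM (dw a ord0) dch).
rewrite /GRing.scale /= [RHS]addrC addrC mulrC; congr (_ + _); last by rewrite mulrC.
by rewrite mulr_suml; apply: eq_bigr => b _; ring.
Qed.

Lemma gam_mcts (T : topologicalType) (c w : T -> 'cV[R]_n) t :
  mcts c t -> mcts w t -> U (c t) -> mcts (fun s => gam G (c s) (w s)) t.
Proof.
move=> cc cw Uc i j; rewrite mxE; under eq_fun do rewrite mxE.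
apply: (@cts_sum R T _ _ (fun a s => w s a ord0 * christoffel G i a j (c s))) => a.
apply: cvgM; first exact: cw.
have H : {for c t, continuous (christoffel G i a j)} := christoffel_C oU G_smooth G_unit 0 i a j _ Uc.
exact: (@continuous_comp _ _ _ c (christoffel G i a j) t ((mctsP _ _).1 cc) H).
Qed.

Lemma dgam_mcts (T : topologicalType) (c u w : T -> 'cV[R]_n) t :
  mcts c t -> mcts u t -> mcts w t -> U (c t) ->
  mcts (fun s => dgam G (c s) (u s) (w s)) t.
Proof.
move=> cc cu cw Uc.
have nU : \forall s \near t, U (c s) by exact: ((mctsP _ _).1 cc _ (open_nbhs_nbhs (conj oU Uc))).
pose D s := \matrix_(i < n, j < n) \sum_a \sum_b
  u s a ord0 * w s b ord0 * pd a (christoffel G i b j) (c s).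
apply: (@mcts_near_eq R T _ _ D).
  by apply: filterS nU => s Us; apply/matrixP => i j; rewrite mxE (dgamE oU).
apply: (@mcts_mx R T n n (fun i j s => \sum_a \sum_b
  u s a ord0 * w s b ord0 * pd a (christoffel G i b j) (c s))) => i j.
apply: (@cts_sum R T _ _ (fun a s => \sum_b u s a ord0 * w s b ord0 * pd a (christoffel G i b j) (c s))) => a.
apply: (@cts_sum R T _ _ (fun b s => u s a ord0 * w s b ord0 * pd a (christoffel G i b j) (c s))) => b.
apply: cvgM; first by apply: cvgM; [exact: cu|exact: cw].
have [_ /(_ a) H1] := christoffel_C oU G_smooth G_unit 1 i b j.
exact: (@continuous_comp _ _ _ c _ t ((mctsP _ _).1 cc) (H1 _ Uc)).
Qed.

End GamCurve.

(** * Behaviour under changes of coordinates *)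

Section ChartChange.
Variables (R : realType) (n : nat) (U U' : set 'cV[R]_n) (G G' : 'cV[R]_n -> 'M[R]_n).
Hypotheses (oU : open U) (oU' : open U').
Hypotheses (G_smooth : forall r, C_on r U G) (G'_smooth : forall r, C_on r U' G').
Hypotheses (G_sym : forall q, (G q)^T = G q) (G'_sym : forall q, (G' q)^T = G' q).
Hypotheses (G_unit : forall q, U q -> G q \in unitmx) (G'_unit : forall q, U' q -> G' q \in unitmx).
Variable F : 'cV[R]_n -> 'cV[R]_n.
Hypothesis F_smooth : forall r, C_on r U F.
Hypothesis FU : forall q, U q -> U' (F q).
Let T q := jac F q.
Hypothesis isoF : forall q, U q -> G q = (T q)^T *m G' (F q) *m T q.
Implicit Types (q u v w : 'cV[R]_n).

Let T_smooth r : C_on r U T.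
Proof. exact: (jac_C oU (F_smooth r.+1)). Qed.

Let T_unit q : U q -> T q \in unitmx.
Proof. by move=> Uq; have := G_unit Uq; rewrite isoF // unitmx_mul => /andP[]. Qed.

Let TF q u : mpd F q u = T q *m u.
Proof. by rewrite jacE. Qed.

(** The pulled-back connection is torsion-free, because second derivatives of [F] are symmetric, and
    compatible with the metric, because [F] is an isometry; uniqueness identifies it without
    expanding Christoffel symbols. *)
Lemma gam_change q v : U q ->
  T q *m gam G q v = mpd T q v + gam G' (F q) (T q *m v) *m T q.
Proof.
move=> Uq.
pose A v := invmx (T q) *m (mpd T q v + gam G' (F q) (T q *m v) *m T q).
suff <- : A v = gam G q v by rewrite mulKVmx ?T_unit.
apply: (gam_unique G_sym G_unit Uq) => [w z|u].
  rewrite -!mulmxA; congr (_ *m _); rewrite !mulmxDl -!mulmxA.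
  by rewrite (mpd_jac_sym oU w z (F_smooth 2) Uq) (gam_sym G'_sym).
have G'F : C_on 1 U (fun x => G' (F x)) by apply: (C_on_comp oU oU' FU (F_smooth 1) (G'_smooth 1)).
have TT : C_on 1 U (fun x => (T x)^T) by apply: (C_on_tr oU).
rewrite (mpd_eq oU u isoF Uq) (mpdM oU u (C_onM oU TT G'F) (T_smooth 1) Uq).
rewrite (mpdM oU u TT G'F Uq) mpd_tr (mpd_comp oU oU' FU u (F_smooth 1) (G'_smooth 1) Uq) TF.
rewrite (metric_compat G'_sym G'_unit _ (FU Uq)).
have -> : (A u)^T *m G q = (G q *m A u)^T by rewrite (trmx_mul (G q)) G_sym.
have -> : G q *m A u = (T q)^T *m G' (F q) *m (mpd T q u + gam G' (F q) (T q *m u) *m T q).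
  by rewrite isoF // -mulmxA mulKVmx ?T_unit.
move: (mpd T q u) (gam G' (F q) (T q *m u)) => a g.
move: (T q) (G' (F q)) (G'_sym (F q)) => t h hs.
have -> : (t^T *m h *m (a + g *m t))^T = (a^T + t^T *m g^T) *m h *m t.
  by rewrite trmx_mul linearD /= !trmx_mul trmxK hs !mulmxA.
rewrite !(mulmxDl, mulmxDr) !mulmxA.
move: (a^T *m h *m t) (t^T *m h *m a) (t^T *m g^T *m h *m t) (t^T *m h *m g *m t) => a1 a2 a3 a4.
by apply/matrixP => i j; rewrite !mxE; ring.
Qed.

Lemma dgam_change q u v : U q ->
  T q *m dgam G q u v = mpd (fun x => mpd T x v) q u
    + (dgam G' (F q) (T q *m u) (T q *m v) + gam G' (F q) (mpd T q u *m v)) *m T q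
    + gam G' (F q) (T q *m v) *m mpd T q u - mpd T q u *m gam G q v.
Proof.
move=> Uq.
have gC := gam_C oU G_smooth G_unit 1 v.
have F1 := F_smooth 1; have T1 := T_smooth 1.
pose W x := gam G' (F x) (T x *m v).
have dW : dmx (fun s : R => W (q + s *: u)) 0
    (dgam G' (F q) (T q *m u) (T q *m v) + gam G' (F q) (mpd T q u *m v)).
  have dTv := dmxM (mpd_line oU u T1 Uq) (dmx_cst v 0).
  have := gam_dmx oU' G'_smooth G'_unit (mpd_line oU u F1 Uq) dTv.
  by rewrite scale0r addr0 TF mulmx0 addr0; apply; exact: FU.
have WC : C_on 1 U W.
  move=> i j.
  apply: (@Ck_on_eq _ _ _ oU _ (fun x => \sum_a (T x *m v) a ord0 * christoffel G' i a j (F x))).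
    by move=> x _; rewrite mxE.
  apply: alg_sum; first exact: Ck_on_alg.
  move=> a; apply: (Ck_onM oU).
    exact: (C_onM oU T1 (C_on_cst oU 1 v)).
  exact: (Ck_on_comp oU oU' FU F1 (christoffel_C oU' G'_smooth G'_unit 1 i a j)).
have E : mpd (fun x => T x *m gam G x v) q u = mpd (fun x => mpd T x v + W x *m T x) q u.
  by apply: (mpd_eq oU _ _ Uq) => x Ux; exact: gam_change.
have pT : C_on 1 U (fun x => mpd T x v) by exact: (C_on_pd oU v (T_smooth 2)).
move: E; rewrite (mpdM oU u T1 gC Uq) (mpd_sum oU u pT (C_onM oU WC T1) Uq).
rewrite (mpdM oU u WC T1 Uq) (mpdE oU WC Uq dW) => E.
by rewrite -(addKr (mpd T q u *m gam G q v) (T q *m dgam G q u v)) E addrC !addrA.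
Qed.

(** In the antisymmetrisation, third derivatives of [F] cancel by symmetry and the terms with its
    second derivatives cancel against those produced by [gam_change]. *)
Lemma Rm_change q u v : U q ->
  T q *m Rm G q u v = Rm G' (F q) (T q *m u) (T q *m v) *m T q.
Proof.
move=> Uq.
have gg a b : T q *m (gam G q a *m gam G q b) =
    mpd T q a *m gam G q b + gam G' (F q) (T q *m a) *m (mpd T q b)
      + gam G' (F q) (T q *m a) *m gam G' (F q) (T q *m b) *m T q.
  by rewrite mulmxA gam_change // mulmxDl -!mulmxA gam_change // mulmxDr !addrA !mulmxA.
rewrite /Rm mulmxDr !mulmxBr !gg !dgam_change // (mpd2_sym oU u v (T_smooth 2) Uq).
rewrite (mpd_jac_sym oU u v (F_smooth 2) Uq) !(mulmxDl, mulmxBl, mulNmx).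
move: (mpd (fun x => mpd T x u) q v) => S.
move: (dgam G' (F q) (T q *m u) (T q *m v)) (dgam G' (F q) (T q *m v) (T q *m u)) => d1 d2.
move: (gam G' (F q) (T q *m u)) (gam G' (F q) (T q *m v)) => gu gv.
move: (mpd T q u) (mpd T q v) (gam G q u) (gam G q v) => Hu Hv hu hv.
move: (gam G' _ _ *m T q) (d1 *m T q) (d2 *m T q) => a1 a2 a3.
move: (gu *m gv *m T q) (gv *m gu *m T q) => b1 b2.
move: (gv *m Hu) (gu *m Hv) (Hu *m hv) (Hv *m hu) => c1 c2 c3 c4.
by apply/matrixP => i j; rewrite !mxE; ring.
Qed.

Lemma Kmx_change q v : U q -> T q *m Kmx G q v = Kmx G' (F q) (T q *m v) *m T q.
Proof.
move=> Uq; apply: mulmx_cV_inj => u.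
rewrite -!mulmxA (KmxE oU G_smooth G_unit _ _ Uq) (KmxE oU' G'_smooth G'_unit _ _ (FU Uq)).
by rewrite mulmxA Rm_change // !mulmxA.
Qed.

Section Potential.
Variables f f' : 'cV[R]_n -> R.
Hypotheses (f_smooth : smooth_on U f) (f'_smooth : smooth_on U' f').
Hypothesis fE : forall q, U q -> f q = f' (F q).

Lemma gradient_change q : U q -> T q *m gradient G f q = gradient G' f' (F q).
Proof.
move=> Uq.
have D : \col_k pd k f q = (T q)^T *m \col_l pd l f' (F q).
  apply/matrixP => k j; rewrite !mxE (pd_eq oU k fE Uq).
  have [_ ->] := pd_comp oU oU' FU k (F_smooth 1) (f'_smooth 1) Uq.
  by apply: eq_bigr => l _; rewrite !mxE.
have H : G' (F q) *m (T q *m gradient G f q) = \col_l pd l f' (F q).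
  have TT : (T q)^T \in unitmx by rewrite unitmx_tr T_unit.
  rewrite -[LHS]mul1mx -[RHS]mul1mx -(mulVmx TT) -!mulmxA -D; congr (_ *m _).
  have -> : (T q)^T *m (G' (F q) *m (T q *m gradient G f q)) = G q *m gradient G f q.
    by rewrite (isoF Uq) !mulmxA.
  by rewrite /gradient mulmxA (mulmxV (G_unit Uq)) mul1mx.
by rewrite [RHS]/gradient -H mulKmx //; apply: G'_unit; exact: FU.
Qed.

Lemma Hmx_change q : U q -> T q *m Hmx G f q = Hmx G' f' (F q) *m T q.
Proof.
move=> Uq; apply: mulmx_cV_inj => u.
have gC := gradient_C oU G_smooth G_unit f_smooth 1.
have g'C := gradient_C oU' G'_smooth G'_unit f'_smooth 1.
have E := mpd_eq oU u gradient_change Uq.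
rewrite (mpdM oU u (T_smooth 1) gC Uq) (mpd_comp oU oU' FU u (F_smooth 1) g'C Uq) TF in E.
rewrite -!mulmxA.
have -> : Hmx G f q *m u = mpd (gradient G f) q u + gam G q u *m gradient G f q.
  by rewrite /Hmx mulmxDl (jacE (gradient G f)) (gam_sym G_sym q _ u).
have -> : Hmx G' f' (F q) *m (T q *m u) =
    mpd (gradient G' f') (F q) (T q *m u) + gam G' (F q) (T q *m u) *m (T q *m gradient G f q).
  by rewrite /Hmx mulmxDl (jacE (gradient G' f')) (gam_sym G'_sym _ _ (T q *m u)) gradient_change.
rewrite -E mulmxDr (mulmxA (T q) (gam G q u)) gam_change // mulmxDl -!mulmxA.
move: (T q *m mpd _ q u) (mpd T q u *m _) (gam G' _ _ *m _) => a1 a2 a3.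
by apply/matrixP => i j; rewrite !mxE; ring.
Qed.
End Potential.

End ChartChange.

(** * Fields along curves in charts *)

Section ManifoldCharts.
Variables (R : realType) (n : nat) (M : smooth_manifold R n).
Implicit Types (i j k : chart_index M) (p : M) (q u v : 'cV[R]_n).

Definition trans i j q : 'cV[R]_n := chart j (chart_inv i q).
Definition ovl i j : set 'cV[R]_n := [set q | img i q /\ dom j (chart_inv i q)].

Lemma img_dom i q : img i q -> dom i (chart_inv i q) /\ chart i (chart_inv i q) = q.
Proof. by move=> [p ip <-]; rewrite chartK. Qed.

Lemma img_chart i p : dom i p -> img i (chart i p).
Proof. by move=> ip; exists p. Qed.

Lemma ovlE i j : ovl i j = chart i @` (dom i `&` dom j).
Proof.
apply/seteqP; split=> [q [iq jq]|q [p [ip jp] <-]].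
  by have [d e] := img_dom iq; exists (chart_inv i q).
by split; [exact: img_chart|rewrite chartK].
Qed.

Lemma ovl_chart i j p : dom i p -> dom j p -> ovl i j (chart i p).
Proof. by move=> ip jp; split; [exact: img_chart|rewrite chartK]. Qed.

Lemma chart_inv_cts i q : img i q -> {for q, continuous (chart_inv i)}.
Proof.
move=> iq A nA.
have H := @chart_inv_continuous _ _ M i.
have oi : open (img i) by exact: img_open.
move: H; rewrite continuous_open_subspace // => H; apply: H nA; by rewrite inE.
Qed.

Lemma open_ovl2 i j k : open [set q | [/\ img i q, dom j (chart_inv i q) & dom k (chart_inv i q)]].
Proof.
rewrite openE => q [iq jq kq]; rewrite /interior.
have c := chart_inv_cts iq.
have n1 : \forall w \near q, img i w by exact: (open_nbhs_nbhs (conj (@img_open _ _ M i) iq)).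
have n2 : \forall w \near q, dom j (chart_inv i w).
  exact: (c _ (open_nbhs_nbhs (conj (@dom_open _ _ M j) jq))).
have n3 : \forall w \near q, dom k (chart_inv i w).
  exact: (c _ (open_nbhs_nbhs (conj (@dom_open _ _ M k) kq))).
by near=> w; split; near: w.
Unshelve. all: by end_near.
Qed.

Lemma open_img i : open (img i). Proof. exact: img_open. Qed.

Lemma open_ovl i j : open (ovl i j).
Proof.
have -> : ovl i j = [set q | [/\ img i q, dom j (chart_inv i q) & dom j (chart_inv i q)]].
  by apply/seteqP; split=> q [].
exact: open_ovl2.
Qed.

Arguments open_ovl i j : clear implicits.

Lemma Ck_on_sub m r (U U' : set 'cV[R]_m) f : U `<=` U' -> Ck_on r U' f -> Ck_on r U f.
Proof.
move=> sU; elim: r f => [|r IH] f; first by move=> cf q Uq; apply: cf; exact: sU.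
by move=> [df cf]; split=> [k q Uq|k]; [apply: df; exact: sU|exact: (IH _ (cf k))].
Qed.

Lemma C_on_sub m a b r (U U' : set 'cV[R]_m) (F : 'cV[R]_m -> 'M[R]_(a, b)) :
  U `<=` U' -> C_on r U' F -> C_on r U F.
Proof. by move=> sU cF i j; exact: Ck_on_sub (cF i j). Qed.

Lemma trans_smooth i j r : C_on r (ovl i j) (trans i j).
Proof. by move=> a b; rewrite ovlE (ord1 b); exact: transition_smooth. Qed.

Lemma trans_ovl i j q : ovl i j q -> ovl j i (trans i j q).
Proof.
by move=> [iq jq]; split; [exact: img_chart|rewrite /trans chartK //; have [] := img_dom iq].
Qed.

Lemma tchgE i j p : tchg i j p = jac (trans i j) (chart i p).
Proof. by []. Qed.

Lemma tchg_comp i j k p : dom i p -> dom j p -> dom k p ->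
  tchg j k p *m tchg i j p = tchg i k p.
Proof.
move=> ip jp kp; apply: mulmx_cV_inj => u; rewrite -mulmxA !tchgE !jacE.
set U := [set q | [/\ img i q, dom j (chart_inv i q) & dom k (chart_inv i q)]].
have oU : open U by exact: open_ovl2.
have Up : U (chart i p) by split; rewrite ?chartK //; exact: img_chart.
have s1 : U `<=` ovl i j by move=> q [].
have FU q : U q -> ovl j k (trans i j q).
  by move=> [iq jq kq]; split; [exact: img_chart|rewrite /trans chartK].
have E w : U w -> trans i k w = trans j k (trans i j w).
  by move=> [iw jw kw]; rewrite /trans chartK.
rewrite (mpd_eq oU u E Up).
have cF : C_on 1 U (trans i j) by exact: (C_on_sub s1 (trans_smooth i j 1)).
rewrite (mpd_comp oU (open_ovl j k) FU u cF (trans_smooth j k 1) Up).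
by rewrite /trans chartK.
Qed.

Lemma tchg_id i p : dom i p -> tchg i i p = 1%:M.
Proof.
move=> ip; apply: mulmx_cV_inj => u; rewrite mul1mx tchgE jacE.
have ii : ovl i i (chart i p) by exact: ovl_chart.
have E w : ovl i i w -> trans i i w = w by move=> [iw _]; have [_] := img_dom iw.
apply: (mpdE (open_ovl i i) (trans_smooth i i 1) ii).
apply: (@dmx_near_eq R _ _ (fun s => chart i p + s *: u)); last exact: dmx_line.
have c0 : mcts (fun s : R => chart i p + s *: u) 0 by exact: (dmx_mcts (dmx_line _ _ _)).
have : \forall s \near (0 : R), ovl i i (chart i p + s *: u).
  apply: ((mctsP _ _).1 c0); rewrite scale0r addr0.
  exact: (open_nbhs_nbhs (conj (open_ovl i i) ii)).
by apply: filterS => s /E ->.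
Qed.

Lemma tchgK i j p : dom i p -> dom j p -> tchg j i p *m tchg i j p = 1%:M.
Proof. by move=> ip jp; rewrite tchg_comp // tchg_id. Qed.

Lemma tchg_unit i j p : dom i p -> dom j p -> tchg i j p \in unitmx.
Proof. by move=> ip jp; have [] := mulmx1_unit (tchgK ip jp). Qed.

End ManifoldCharts.

Section RiemannianCharts.
Variables (R : realType) (n : nat) (M : smooth_manifold R n) (g : riemannian_metric M).
Implicit Types (i j k : chart_index M) (p : M) (q u v : 'cV[R]_n).
Local Notation Gl := (metric_coord g).

Lemma metric_unit p : g p \in unitmx.
Proof.
rewrite -unitmx_tr unitmxE unitfE; apply/negP => /det0P[v v0 vg].
have vT : v^T != 0 by apply: contra_neq v0 => /(congr1 trmx); rewrite trmxK trmx0.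
have := metric_pos g p vT; by rewrite trmxK -(Defs.metric_sym g p) vg mul0mx mxE ltxx.
Qed.

Lemma metric_coordE i p : dom i p ->
  Gl i (chart i p) = (tchg i (chart_at p) p)^T *m g p *m tchg i (chart_at p) p.
Proof. by move=> ip; rewrite /metric_coord chartK. Qed.

Lemma metric_coord_smooth i r : C_on r (img i) (Gl i).
Proof. by move=> a b; exact: metric_smooth. Qed.

Lemma metric_coord_sym i q : (Gl i q)^T = Gl i q.
Proof. by rewrite /metric_coord !trmx_mul trmxK Defs.metric_sym mulmxA. Qed.

Lemma metric_coord_unit i q : img i q -> Gl i q \in unitmx.
Proof.
move=> [p ip <-]; rewrite metric_coordE // !unitmx_mul unitmx_tr metric_unit andbT.
by rewrite tchg_unit //; exact: mem_chart_at.
Qed.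

Lemma metric_coord_change i j q : ovl i j q ->
  Gl i q = (jac (trans i j) q)^T *m Gl j (trans i j q) *m jac (trans i j) q.
Proof.
rewrite ovlE => -[p [ip jp] <-]; rewrite /trans chartK // !metric_coordE //.
have cp := @mem_chart_at _ _ M p.
rewrite -(tchg_comp ip jp cp) -tchgE !trmx_mul !mulmxA.
by congr (_ *m _); rewrite !mulmxA.
Qed.

Lemma metric_coord_at p : Gl (chart_at p) (chart (chart_at p) p) = g p.
Proof.
have cp := @mem_chart_at _ _ M p.
by rewrite metric_coordE // tchg_id // trmx1 mul1mx mulmx1.
Qed.

End RiemannianCharts.

Section FieldsAlongCurves.
Variables (R : realType) (n : nat) (M : smooth_manifold R n) (g : riemannian_metric M).
Local Notation Gl := (metric_coord g).
Variable x : R -> M.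
Hypothesis cx : continuous x.
Implicit Types (i j k : chart_index M) (t s : R).

(** The preferred chart may jump along the curve, so a field is differentiated only after its
    components have been moved to a fixed chart [i]. *)
Definition fcoord m i (v : R -> 'M[R]_(n, m)) (s : R) : 'M[R]_(n, m) :=
  tchg (chart_at (x s)) i (x s) *m v s.

Lemma near_dom i t : dom i (x t) -> \forall s \near t, dom i (x s).
Proof. by move=> ix; exact: (cx (open_nbhs_nbhs (conj (@dom_open _ _ M i) ix))). Qed.

Lemma chart_curve_change i j t a : dom i (x t) -> dom j (x t) ->
  dmx (fun s => chart i (x s)) t a -> dmx (fun s => chart j (x s)) t (tchg i j (x t) *m a).
Proof.
move=> ix jx da.
apply: (@dmx_near_eq R _ _ (fun s => trans i j (chart i (x s)))).
  by apply: filterS (near_dom ix) => s is_; rewrite /trans chartK.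
rewrite tchgE jacE.
exact: (mpd_chain (@open_ovl _ _ M i j) (trans_smooth i j 1) da (ovl_chart ix jx)).
Qed.

Lemma tchg_curve i j t a : dom i (x t) -> dom j (x t) ->
  dmx (fun s => chart i (x s)) t a ->
  dmx (fun s => tchg i j (x s)) t (mpd (jac (trans i j)) (chart i (x t)) a).
Proof.
move=> ix jx da.
have cj : C_on 1 (ovl i j) (jac (trans i j)) by exact: (jac_C (@open_ovl _ _ M i j) (trans_smooth i j 2)).
exact: (mpd_chain (@open_ovl _ _ M i j) cj da (ovl_chart ix jx)).
Qed.

Lemma fcoord_comp m i j (v : R -> 'M[R]_(n, m)) s : dom i (x s) -> dom j (x s) ->
  fcoord j v s = tchg i j (x s) *m fcoord i v s.
Proof. by move=> ix jx; rewrite /fcoord mulmxA tchg_comp //; exact: mem_chart_at. Qed.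

Lemma fcoord_id m (v : R -> 'M[R]_(n, m)) s : fcoord (chart_at (x s)) v s = v s.
Proof. by rewrite /fcoord tchg_id ?mul1mx //; exact: mem_chart_at. Qed.

Lemma gam_tchg i j p v : dom i p -> dom j p ->
  tchg i j p *m gam (Gl i) (chart i p) v =
  mpd (jac (trans i j)) (chart i p) v
  + gam (Gl j) (chart j p) (tchg i j p *m v) *m tchg i j p.
Proof.
move=> ip jp.
have s1 : ovl i j `<=` img i by move=> q [].
have := @gam_change R n (ovl i j) (img j) (Gl i) (Gl j) (@open_ovl _ _ M i j) (@open_img _ _ M j).
have h3 (r : nat) : C_on r (img j) (Gl j) by exact: metric_coord_smooth.
have h6 q : ovl i j q -> Gl i q \in unitmx by move=> [iq _]; exact: metric_coord_unit.
have h7 q : img j q -> Gl j q \in unitmx by exact: metric_coord_unit.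
have h9 q : ovl i j q -> img j (trans i j q) by move=> /trans_ovl[].
move=> /(_ h3 (metric_coord_sym g i) (metric_coord_sym g j) h6 h7 _ (trans_smooth i j) h9
   (@metric_coord_change _ _ _ g i j) (chart i p) v (ovl_chart ip jp)).
by rewrite /trans chartK.
Qed.

(** The coordinate derivative plus its Christoffel term is a vector; transforming it by [tchg] and
    removing the Christoffel term of the new chart gives the new coordinate derivative. *)
Lemma field_change m i j (v : R -> 'M[R]_(n, m)) t b a : dom i (x t) -> dom j (x t) ->
  dmx (fun s => chart i (x s)) t b -> dmx (fcoord i v) t a ->
  dmx (fcoord j v) t (tchg i j (x t) *m (a + gam (Gl i) (chart i (x t)) b *m fcoord i v t)
    - gam (Gl j) (chart j (x t)) (tchg i j (x t) *m b) *m fcoord j v t).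
Proof.
move=> ix jx db da.
apply: (@dmx_near_eq R _ _ (fun s => tchg i j (x s) *m fcoord i v s)).
  by apply: filterS2 (near_dom ix) (near_dom jx) => s is_ js; rewrite -fcoord_comp.
have := dmxM (tchg_curve ix jx db) da.
suff -> : mpd (jac (trans i j)) (chart i (x t)) b *m fcoord i v t + tchg i j (x t) *m a =
    tchg i j (x t) *m (a + gam (Gl i) (chart i (x t)) b *m fcoord i v t)
    - gam (Gl j) (chart j (x t)) (tchg i j (x t) *m b) *m fcoord j v t by [].
rewrite mulmxDr (mulmxA (tchg i j _) (gam _ _ _)) gam_tchg // mulmxDl (fcoord_comp v ix jx).
rewrite !mulmxA; move: (tchg i j (x t) *m a) (mpd _ _ b *m _) (_ *m tchg i j (x t) *m _) => a1 a2 a3.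
by rewrite addrA addrK addrC.
Qed.

End FieldsAlongCurves.

Section TimeDependentPotential.
Variables (R : realType) (n : nat) (M : smooth_manifold R n) (g : riemannian_metric M).
Variable V : R -> M -> R.
Hypothesis sV : smooth_potential V.
Local Notation Gl := (metric_coord g).
Implicit Types (i j k : chart_index M) (t s : R) (q u : 'cV[R]_n).

Definition timed t q : 'cV[R]_(1 + n) := col_mx t%:M q.
Definition Vjoint i (u : 'cV[R]_(1 + n)) : R := V (usubmx u ord0 ord0) (chart_inv i (dsubmx u)).
Definition Vslice i t q : R := V t (chart_inv i q).
Definition jdom i : set 'cV[R]_(1 + n) := [set u | img i (dsubmx u)].

Lemma Vjoint_smooth i : smooth_on (jdom i) (Vjoint i).
Proof. by have [_] := sV; apply. Qed.

Lemma open_jdom i : open (jdom i).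
Proof.
rewrite openE => u iu; rewrite /interior.
have c : mcts (fun u : 'cV[R]_(1 + n) => dsubmx u) u.
  move=> a b; rewrite mxE; under eq_fun do rewrite mxE.
  by have := (mctsP (fun u : 'cV[R]_(1 + n) => u) u).2 cvg_id; apply.
exact: ((mctsP _ _).1 c _ (open_nbhs_nbhs (conj (@open_img _ _ M i) iu))).
Qed.

Lemma Vslice_joint i t q : Vslice i t q = Vjoint i (timed t q).
Proof. by rewrite /Vjoint /timed col_mxKu col_mxKd mxE eqxx. Qed.

Lemma coord_derive m (k : 'I_m) (q v : 'cV[R]_m) :
  is_derive q v (fun w : 'cV[R]_m => w k ord0) (v k ord0).
Proof.
have E : (fun h : R => h^-1 *: ((h *: v + q) k ord0 - q k ord0)) @ (0 : R)^' --> v k ord0.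
  apply/cvgrPdist_le => e e0; rewrite near_withinE; apply: filterE => h h0.
  rewrite mxaddE mxscaleE addrK /GRing.scale /= mulrA mulVf // mul1r subrr normr0.
  exact: ltW.
by apply: DeriveDef; [exact: (cvgP _ E)|exact: cvg_lim E].
Qed.

Lemma Ck_on_coord m r (U : set 'cV[R]_m) (k : 'I_m) :
  open U -> Ck_on r U (fun q : 'cV[R]_m => q k ord0).
Proof.
move=> oU; case: r => [|r].
  by move=> q _; have := (mctsP (fun u : 'cV[R]_m => u) q).2 cvg_id; apply.
split=> [l q _|l]; first by have [] := coord_derive k q (delta_mx l ord0).
apply: (Ck_on_eq oU _ (Ck_on_cst oU r ((delta_mx l ord0 : 'cV[R]_m) k ord0))) => q _.
by rewrite /pd; have [_ ->] := coord_derive k q (delta_mx l ord0).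
Qed.

Lemma timed_smooth r t (U : set 'cV[R]_n) : open U -> C_on r U (timed t).
Proof.
move=> oU a b; rewrite (ord1 b) /timed; case: (split_ordP a) => [a' ->|a' ->].
  apply: (Ck_on_eq oU _ (Ck_on_cst oU r t)) => q _.
  by rewrite col_mxEu (ord1 a') mxE eqxx.
by apply: (Ck_on_eq oU _ (Ck_on_coord r a' oU)) => q _; rewrite col_mxEd.
Qed.

Lemma mpd_timed t q u : mpd (timed t) q u = col_mx 0 u.
Proof.
have oT : open [set: 'cV[R]_n] by exact: openT.
apply: (mpdE oT (timed_smooth 1 t oT)) => //.
exact: (dmx_col (dmx_cst t%:M 0) (dmx_line q u 0)).
Qed.

Lemma timed_jdom i t q : img i q -> jdom i (timed t q).
Proof. by rewrite /jdom /= col_mxKd. Qed.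

Lemma Vslice_smooth i t : smooth_on (img i) (Vslice i t).
Proof.
move=> r; have E : (fun q => Vjoint i (timed t q)) = Vslice i t.
  by apply/funext => q; rewrite Vslice_joint.
rewrite -E.
exact: (Ck_on_comp (@open_img _ _ M i) (@open_jdom i) (@timed_jdom i t)
  (timed_smooth r t (@open_img _ _ M i)) (Vjoint_smooth i r)).
Qed.

Lemma pd_Vslice i t (k : 'I_n) q : img i q -> pd k (Vslice i t) q = pd (rshift 1 k) (Vjoint i) (timed t q).
Proof.
move=> iq; have E : (fun q => Vjoint i (timed t q)) = Vslice i t.
  by apply/funext => w; rewrite Vslice_joint.
have [_] := pd_comp (@open_img _ _ M i) (@open_jdom i) (@timed_jdom i t) k
  (timed_smooth 1 t (@open_img _ _ M i)) (Vjoint_smooth i 1) iq.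
have D l : pd k (fun w => timed t w l ord0) q = (delta_mx (rshift 1 k) ord0 : 'cV[R]_(1 + n)) l ord0.
  have := congr1 (fun A : 'cV[R]_(1 + n) => A l ord0) (mpd_timed t q (delta_mx k ord0)).
  rewrite mxE (bigD1 k) //= big1 ?addr0 => [|b bk]; last by rewrite mxE (negbTE bk) mul0r.
  rewrite mxE !eqxx mul1r => ->.
  case: (split_ordP l) => [a ->|a ->]; rewrite ?col_mxEu ?col_mxEd !mxE ?andbT.
    by rewrite eq_lrshift.
  by [].
rewrite E => ->; rewrite (bigD1 (rshift 1 k)) //= big1 ?addr0 => [|b bk].
  by rewrite D mxE !eqxx mul1r.
by rewrite D mxE (negbTE bk) mul0r.
Qed.

(** The gradient of [V] as a function of time and position jointly: continuity of the Hessian along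
    a moving point at a moving time cannot be read off from the slices. *)
Definition gradj i (u : 'cV[R]_(1 + n)) : 'cV[R]_n :=
  invmx (Gl i (dsubmx u)) *m \col_k pd (rshift 1 k) (Vjoint i) u.

Lemma gradj_smooth i r : C_on r (jdom i) (gradj i).
Proof.
have oj := @open_jdom i.
have dC : C_on r (jdom i) (fun u : 'cV[R]_(1 + n) => dsubmx u).
  move=> a b; rewrite (ord1 b).
  by apply: (Ck_on_eq oj _ (Ck_on_coord r (rshift 1 a) oj)) => q _; rewrite mxE.
have dU (u : 'cV[R]_(1 + n)) : jdom i u -> img i (dsubmx u) by [].
apply: (C_onM oj).
  apply: (C_onV oj); first by move=> u /dU; exact: metric_coord_unit.
  exact: (C_on_comp oj (@open_img _ _ M i) dU dC (metric_coord_smooth g i r)).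
move=> a b; apply: (Ck_on_eq oj (f := pd (rshift 1 a) (Vjoint i))).
  by move=> u _; rewrite mxE.
by have [_] := Vjoint_smooth i r.+1; apply.
Qed.

Lemma gradientE i t q : img i q -> gradient (Gl i) (Vslice i t) q = gradj i (timed t q).
Proof.
move=> iq; rewrite /gradient /gradj col_mxKd; congr (_ *m _).
by apply/matrixP => a b; rewrite !mxE pd_Vslice.
Qed.

Lemma mpd_gradient i t q u : img i q ->
  mpd (gradient (Gl i) (Vslice i t)) q u = mpd (gradj i) (timed t q) (col_mx 0 u).
Proof.
move=> iq.
have E w : img i w -> gradient (Gl i) (Vslice i t) w = gradj i (timed t w) by exact: gradientE.
rewrite (mpd_eq (@open_img _ _ M i) u E iq).
rewrite (mpd_comp (@open_img _ _ M i) (@open_jdom i) (@timed_jdom i t) u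
  (timed_smooth 1 t (@open_img _ _ M i)) (gradj_smooth i 1) iq).
by rewrite mpd_timed.
Qed.

Lemma timed_mcts (T : topologicalType) (f : T -> R) (c : T -> 'cV[R]_n) (t0 : T) :
  f @ t0 --> f t0 -> mcts c t0 -> mcts (fun z => timed (f z) (c z)) t0.
Proof.
move=> cf cc a b; rewrite /timed; case: (split_ordP a) => [a' ->|a' ->].
  under eq_fun do rewrite col_mxEu mxE (ord1 a') (ord1 b) eqxx.
  by rewrite col_mxEu mxE (ord1 a') (ord1 b) eqxx.
by under eq_fun do rewrite col_mxEd; rewrite col_mxEd; exact: cc.
Qed.

Lemma grad_change i j p t : dom i p -> dom j p ->
  tchg i j p *m gradient (Gl i) (Vslice i t) (chart i p) =
  gradient (Gl j) (Vslice j t) (chart j p).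
Proof.
move=> ip jp.
have h6 q : ovl i j q -> Gl i q \in unitmx by move=> [iq _]; exact: metric_coord_unit.
have h7 q : img j q -> Gl j q \in unitmx by exact: metric_coord_unit.
have h9 q : ovl i j q -> img j (trans i j q) by move=> /trans_ovl[].
have fE q : ovl i j q -> Vslice i t q = Vslice j t (trans i j q).
  by move=> [_ jq]; rewrite /Vslice /trans chartK.
have := @gradient_change R n (ovl i j) (img j) (Gl i) (Gl j) (@open_ovl _ _ M i j)
  (@open_img _ _ M j) h6 h7 _ (trans_smooth i j) h9 (@metric_coord_change _ _ _ g i j)
  _ _ (Vslice_smooth j t) fE _ (ovl_chart ip jp).
by rewrite /trans chartK.
Qed.

(* Matrix of [xi |-> R(xi, v) v + \nabla_xi \nabla V_t] in the chart [i]. *)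
Definition Qchart i t q v : 'M[R]_n := Kmx (Gl i) q v + Hmx (Gl i) (Vslice i t) q.

Lemma Qchart_change i j p t v : dom i p -> dom j p ->
  tchg i j p *m Qchart i t (chart i p) v =
  Qchart j t (chart j p) (tchg i j p *m v) *m tchg i j p.
Proof.
move=> ip jp.
have h2 (r : nat) : C_on r (ovl i j) (Gl i).
  by apply: (C_on_sub _ (metric_coord_smooth g i r)) => q [].
have h3 (r : nat) : C_on r (img j) (Gl j) by exact: metric_coord_smooth.
have h6 q : ovl i j q -> Gl i q \in unitmx by move=> [iq _]; exact: metric_coord_unit.
have h7 q : img j q -> Gl j q \in unitmx by exact: metric_coord_unit.
have h9 q : ovl i j q -> img j (trans i j q) by move=> /trans_ovl[].
have fE q : ovl i j q -> Vslice i t q = Vslice j t (trans i j q).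
  by move=> [_ jq]; rewrite /Vslice /trans chartK.
have V2 : smooth_on (ovl i j) (Vslice i t).
  by move=> r; apply: (Ck_on_sub _ (Vslice_smooth i t r)) => q [].
rewrite /Qchart mulmxDr [RHS]mulmxDl; congr (_ + _).
  have := @Kmx_change R n (ovl i j) (img j) (Gl i) (Gl j) (@open_ovl _ _ M i j)
    (@open_img _ _ M j) h2 h3 (metric_coord_sym g i) (metric_coord_sym g j) h6 h7 _
    (trans_smooth i j) h9 (@metric_coord_change _ _ _ g i j) _ v (ovl_chart ip jp).
  by rewrite /trans chartK.
have := @Hmx_change R n (ovl i j) (img j) (Gl i) (Gl j) (@open_ovl _ _ M i j)
  (@open_img _ _ M j) h2 h3 (metric_coord_sym g i) (metric_coord_sym g j) h6 h7 _
  (trans_smooth i j) h9 (@metric_coord_change _ _ _ g i j) _ _ V2 (Vslice_smooth j t) fE _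
  (ovl_chart ip jp).
by rewrite /trans chartK.
Qed.

Lemma Qchart_sym i t q v : img i q -> (Gl i q *m Qchart i t q v)^T = Gl i q *m Qchart i t q v.
Proof.
move=> iq; have oi := @open_img _ _ M i.
have h6 w : img i w -> Gl i w \in unitmx by exact: metric_coord_unit.
rewrite /Qchart mulmxDr linearD /=.
rewrite (riem_sym oi (metric_coord_smooth g i) (metric_coord_sym g i) h6 v iq).
by rewrite (hess_sym oi (metric_coord_smooth g i) (metric_coord_sym g i) h6 (Vslice_smooth i t) iq).
Qed.

Lemma Qchart_mcts (T : topologicalType) i (f : T -> R) (c w : T -> 'cV[R]_n) (t0 : T) :
  f @ t0 --> f t0 -> mcts c t0 -> mcts w t0 -> img i (c t0) ->
  mcts (fun z => Qchart i (f z) (c z) (w z)) t0.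
Proof.
move=> cf cc cw ic; have oi := @open_img _ _ M i.
have h6 q : img i q -> Gl i q \in unitmx by exact: metric_coord_unit.
have sG := metric_coord_smooth g i.
have ni : \forall z \near t0, img i (c z).
  exact: ((mctsP _ _).1 cc _ (open_nbhs_nbhs (conj oi ic))).
have ct := timed_mcts cf cc.
have jt : jdom i (timed (f t0) (c t0)) by exact: timed_jdom.
apply: mctsD.
  pose D z := \matrix_(a, b) ((Rm (Gl i) (c z) (delta_mx b ord0) (w z) *m w z) a ord0).
  apply: (@mcts_mx R T n n (fun a b z =>
    (Rm (Gl i) (c z) (delta_mx b ord0) (w z) *m w z) a ord0)) => a b.
  have cd : mcts (fun=> (delta_mx b ord0 : 'cV[R]_n)) t0 by exact: mcts_cst.
  suff H : mcts (fun z => Rm (Gl i) (c z) (delta_mx b ord0) (w z) *m w z) t0 by exact: H.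
  apply: (mctsM _ (cw)); apply: mctsD; first apply: mctsB.
  - exact: (dgam_mcts oi sG h6 cc cd cw ic).
  - exact: (dgam_mcts oi sG h6 cc cw cd ic).
  apply: mctsB; apply: mctsM.
  - exact: (gam_mcts oi sG h6 cc cd ic).
  - exact: (gam_mcts oi sG h6 cc cw ic).
  - exact: (gam_mcts oi sG h6 cc cw ic).
  - exact: (gam_mcts oi sG h6 cc cd ic).
have cg : mcts (fun z => gradj i (timed (f z) (c z))) t0.
  apply: (mcts_comp (F := gradj i) (f := fun z => timed (f z) (c z))).
    exact: ((mctsP _ _).1 ct).
  exact: (C_on_mcts (@open_jdom i) (gradj_smooth i 0) jt).
pose H z := \matrix_(a, b) (mpd (gradj i) (timed (f z) (c z)) (col_mx 0 (delta_mx b ord0)) a ord0)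
   + gam (Gl i) (c z) (gradj i (timed (f z) (c z))).
apply: (@mcts_near_eq R T _ _ H).
  apply: filterS ni => z iz; rewrite /Hmx gradientE //; congr (_ + _).
  apply/matrixP => a b; rewrite mxE -mpd_gradient // -jacE.
  by rewrite -colE mxE.
apply: mctsD; last exact: (gam_mcts oi sG h6 cc cg ic).
apply: (@mcts_mx R T n n (fun a b z =>
  mpd (gradj i) (timed (f z) (c z)) (col_mx 0 (delta_mx b ord0)) a ord0)) => a b.
have cst : mcts (fun=> (col_mx 0 (delta_mx b ord0) : 'cV[R]_(1 + n))) t0 by exact: mcts_cst.
suff K : mcts (fun z => mpd (gradj i) (timed (f z) (c z)) (col_mx 0 (delta_mx b ord0))) t0 by exact: K.
exact: (mpd_mcts (gradj_smooth i 1) ct cst jt).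
Qed.

End TimeDependentPotential.

(** * Newton's equation and the Hamiltonian flow *)

Section NewtonCurves.
Variables (R : realType) (n : nat) (M : smooth_manifold R n) (g : riemannian_metric M).
Variable V : R -> M -> R.
Hypothesis sV : smooth_potential V.
Local Notation Gl := (metric_coord g).
Implicit Types (i j k : chart_index M) (t s : R) (q u : 'cV[R]_n).

(* [v] is the velocity of [y], which solves Newton's equation
   [\nabla_t y' = - \nabla V_t]. *)
Definition newton_at (y : R -> M) (v : R -> 'cV[R]_n) i t : Prop :=
  dmx (fun s => chart i (y s)) t (fcoord y i v t) /\
  dmx (fcoord y i v) t (- (gam (Gl i) (chart i (y t)) (fcoord y i v t) *m fcoord y i v t)
    - gradient (Gl i) (Vslice V i t) (chart i (y t))).

Definition newton y v : Prop :=
  continuous y /\ forall t, newton_at y v (chart_at (y t)) t.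

(** The acceleration and the gradient transform as vectors, so an equation valid in the preferred
    charts holds in every chart around the point. *)
Lemma newton_chart y v i t : newton y v -> dom i (y t) -> newton_at y v i t.
Proof.
move=> [cy H] iy; have [d1 d2] := H t.
have cp := @mem_chart_at _ _ M (y t).
split; first by rewrite (fcoord_comp v cp iy); exact: (chart_curve_change cy cp iy d1).
have := field_change g cy cp iy d1 d2.
have alg (A B C : 'cV[R]_n) (T : 'M[R]_n) : T *m (- A - B + A) - C = - C - T *m B.
  by rewrite addrAC addNr add0r mulmxN addrC.
by rewrite -(fcoord_comp v cp iy) alg grad_change.
Qed.

End NewtonCurves.

Section CriticalPoints.
Variables (R : realType) (n : nat) (M : smooth_manifold R n) (g : riemannian_metric M).
Variable V : R -> M -> R.
Hypothesis sV : smooth_potential V.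
Variable x : R -> M.
Hypothesis xC : Crit g V x.
Local Notation Gl := (metric_coord g).

Lemma crit_cts : continuous x. Proof. by have [[]] := xC. Qed.

Lemma crit_chart_dmx i t : dom i (x t) ->
  dmx (fun s => chart i (x s)) t (fcoord x i (velocity x) t).
Proof.
move=> ix; have [[_ cx sx] _] := xC.
have cp := @mem_chart_at _ _ M (x t).
have d : dmx (fun s => chart (chart_at (x t)) (x s)) t (velocity x t).
  apply: derivable_dmx; exact: (sx (chart_at (x t)) 0%N t cp).
by rewrite (fcoord_comp _ cp ix) fcoord_id; exact: (chart_curve_change cx cp ix d).
Qed.

Lemma crit_newton : newton g V x (velocity x).
Proof.
have [[_ cx sx] eq0] := xC; split=> // t.
set i := chart_at (x t); have ix : dom i (x t) by exact: mem_chart_at.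
split; first exact: crit_chart_dmx.
(* Near [t] the velocity components are the derivative of the chart curve, so smoothness of the loop
   makes them differentiable. *)
have E : \forall s \near t, derive1 (fun t => chart i (x t)) s = fcoord x i (velocity x) s.
  apply: filterS (near_dom cx ix) => s is_.
  by have [] := dmx_derive1 (crit_chart_dmx is_).
have d2 : dmx (fcoord x i (velocity x)) t (derive1 (fcoord x i (velocity x)) t).
  have := derivable_dmx (sx i 1%N t ix).
  rewrite [derive1n 1 _]/= => /(dmx_near_eq E) H.
  by have [_ ->] := dmx_derive1 H.
have zm (A B C : 'cV[R]_n) : - (A + B) - C = 0 -> - B - C = A.
  by rewrite opprD -addrA addrC => /eqP; rewrite subr_eq0 => /eqP.
have := eq0 t; rewrite /cov_deriv -/i gamE => /zm H.
have vE : fcoord x i (velocity x) t = velocity x t by rewrite fcoord_id.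
rewrite vE; move: d2.
have -> : derive1 (fcoord x i (velocity x)) t =
    - (gam (Gl i) (chart i (x t)) (velocity x t) *m velocity x t)
    - gradient (Gl i) (Vslice V i t) (chart i (x t)) by exact: (esym H).
by [].
Qed.

End CriticalPoints.

Lemma compat_algebra (R : realType) n (G A B : 'M[R]_n) (v e : 'cV[R]_n) :
  G^T = G -> A *m v = B *m e ->
  (v^T *m (A^T *m G + G *m A) *m v) ord0 ord0 = 2 * (e^T *m (B^T *m (G *m v))) ord0 ord0.
Proof.
move=> Gs AB.
have tr1 (X : 'M[R]_1) : X ord0 ord0 = X^T ord0 ord0 by rewrite mxE.
have E1 : v^T *m (A^T *m G) *m v = e^T *m (B^T *m (G *m v)).
  by rewrite -!mulmxA (mulmxA v^T) -trmx_mul AB trmx_mul -!mulmxA.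
have E2 : (v^T *m (G *m A) *m v) ord0 ord0 = (e^T *m (B^T *m (G *m v))) ord0 ord0.
  by rewrite -E1 tr1 !trmx_mul trmxK Gs !mulmxA.
by rewrite mulmxDr mulmxDl mxaddE E1 E2 mulr_natl mulr2n.
Qed.

Section HamiltonToNewton.
Variables (R : realType) (n : nat) (M : smooth_manifold R n) (g : riemannian_metric M).
Variable V : R -> M -> R.
Hypothesis sV : smooth_potential V.
Variable psi : R -> M * 'cV[R]_n -> M * 'cV[R]_n.
Hypothesis flow : ham_flow g V psi.
Local Notation Gl := (metric_coord g).

Lemma omega_canE (v w : 'cV[R]_(n + n)) :
  omega_can v w = ((usubmx v)^T *m dsubmx w - (dsubmx v)^T *m usubmx w) ord0 ord0.
Proof.
rewrite /omega_can mxaddE mxoppE !mxE -sumrB; apply: eq_bigr => k _.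
by rewrite [_^T ord0 k]mxE [X in _ = _ - X * _]mxE.
Qed.

Definition Hloc i t (u : 'cV[R]_(n + n)) : R :=
  2^-1 * ((dsubmx u)^T *m invmx (Gl i (usubmx u)) *m dsubmx u) ord0 ord0
  + Vslice V i t (usubmx u).

Lemma Ham_loc i t (u : 'cV[R]_(n + n)) : img i (usubmx u) ->
  Ham g V t (cot_point i u) = Hloc i t u.
Proof.
move=> iu; have [ip pE] := img_dom iu.
rewrite /Ham /Hloc /cot_point.
set p := chart_inv i (usubmx u).
have cp := @mem_chart_at _ _ M p.
have gE := metric_coordE g ip; rewrite -/p pE in gE.
have u1 := tchg_unit cp ip; have u2 := tchg_unit ip cp.
have T1 : tchg i (chart_at p) p = invmx (tchg (chart_at p) i p).
  by rewrite -[LHS]mulmx1 -(mulmxV u1) mulmxA tchgK // mul1mx.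
have inv3 (A B : 'M[R]_n) : A \in unitmx -> B \in unitmx ->
    invmx ((invmx A)^T *m B *m invmx A) = A *m invmx B *m A^T.
  move=> Au Bu; have W : (invmx A)^T *m B *m invmx A *m (A *m invmx B *m A^T) = 1%:M.
    rewrite -!mulmxA (mulKmx Au) (mulmxA B) mulmxV // mul1mx.
    by rewrite -trmx_mul mulmxV // trmx1.
  have [uX _] := mulmx1_unit W.
  by rewrite -[LHS]mulmx1 -W mulKmx.
rewrite gE T1 inv3 //; last exact: metric_unit.
by rewrite (trmx_mul _ (dsubmx u)) trmxK !mulmxA.
Qed.

Lemma dir_derive m (f : 'cV[R]_m -> R) (u w : 'cV[R]_m) d :
  is_derive (0 : R) (1 : R) (fun s => f (u + s *: w)) d -> 'D_w f u = d.
Proof.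
case=> _; rewrite /derive.
have -> // : (fun h : R => h^-1 *: (f (u + (h *: 1 + 0) *: w) - f (u + 0 *: w))) =
    (fun h : R => h^-1 *: (f (h *: w + u) - f u)).
apply/funext => h; congr (_ *: (f _ - f _)); last by rewrite scale0r addr0.
by rewrite addr0 /GRing.scale /= mulr1 -/(GRing.scale _ _) addrC.
Qed.

Lemma Hloc_derive i t (u w : 'cV[R]_(n + n)) : img i (usubmx u) ->
  let q := usubmx u in let p := dsubmx u in
  let a := usubmx w in let b := dsubmx w in
  let v := invmx (Gl i q) *m p in
  'D_w (fun u => Ham g V t (cot_point i u)) u =
  (v^T *m b - 2^-1 *: (v^T *m mpd (Gl i) q a *m v)) ord0 ord0
   + \sum_k a k ord0 * pd k (Vslice V i t) q.
Proof.
move=> iq q p a b v; apply: dir_derive.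
have oi := @open_img _ _ M i.
have nq : \forall s \near (0 : R), img i (q + s *: a).
  have c0 := dmx_mcts (dmx_line q a 0).
  apply: ((mctsP _ _).1 c0); rewrite scale0r addr0.
  exact: (open_nbhs_nbhs (conj oi iq)).
suff main : is_derive (0 : R) (1 : R) (fun s => Hloc i t (u + s *: w))
    ((v^T *m b - 2^-1 *: (v^T *m mpd (Gl i) q a *m v)) ord0 ord0
   + \sum_k a k ord0 * pd k (Vslice V i t) q).
  apply: near_eq_is_derive main.
  apply: filterS nq => s is_; rewrite Ham_loc //.
  by rewrite linearD linearZ.
have E s : Hloc i t (u + s *: w) =
    (2^-1 *: ((p + s *: b)^T *m invmx (Gl i (q + s *: a)) *m (p + s *: b))) ord0 ord0
    + Vslice V i t (q + s *: a).
  by rewrite /Hloc mxscaleE !linearD !linearZ.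
under eq_fun do rewrite E.
apply: is_deriveD.
  have dq := mpd_line oi a (metric_coord_smooth g i 1) iq.
  have Gu := metric_coord_unit g iq.
  have Gu0 : Gl i (q + 0 *: a) \in unitmx by rewrite scale0r addr0.
  have db := dmx_line p b 0.
  have := dmxZ (is_derive_cst (2^-1 : R) (0 : R) (1 : R)) (dmxM (dmxM (dmx_tr db) (dmxV dq Gu0)) db).
  move=> /(_ ord0 ord0); rewrite !scale0r !addr0 add0r => H; apply: is_derive_eq H _.
  have tr1 (X : 'M[R]_1) : X^T = X by apply/matrixP => x y; rewrite !mxE !ord1.
  have Gs : (invmx (Gl i q))^T = invmx (Gl i q) by rewrite trmx_inv metric_coord_sym.
  have vt : v^T = p^T *m invmx (Gl i q) by rewrite trmx_mul Gs.
  rewrite /cst -/q mulmxDl.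
  have -> : b^T *m invmx (Gl i q) *m p = p^T *m invmx (Gl i q) *m b.
    by rewrite -[LHS]tr1 !trmx_mul trmxK Gs mulmxA.
  rewrite vt mulmxN mulNmx /v !mulmxA.
  move: (p^T *m invmx (Gl i q) *m b) (_ *m p) => X Y.
  by rewrite !(mxaddE, mxoppE, mxscaleE); field.
have := chain_rule oi (Vslice_smooth sV i t 1) (dmx_line q a 0).
by rewrite scale0r addr0; apply.
Qed.

(** The Legendre transform: Hamilton's equations, tested against momentum and position directions
    separately, give the velocity and the force, and metric compatibility turns the derivative of
    the metric into Christoffel terms. *)
Lemma flow_newton z : newton g V (fun t => (psi t z).1)
  (fun t => invmx (g (psi t z).1) *m (psi t z).2).
Proof.
have [_ cy H] := flow z; split=> // t.
have [] := H t; set i := chart_at (psi t z).1; set c := fun s => cot_coord i (psi s z).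
move=> /derivable_dmx dc' /(_ _) Hw.
set y := fun t => (psi t z).1; set v := fun t => _ *m _.
have iy : dom i (y t) by exact: mem_chart_at.
set c' := derive1 c t in dc' Hw.
have iq : img i (usubmx (c t)) by rewrite col_mxKu; exact: img_chart.
have qE s : usubmx (c s) = chart i (y s) by rewrite col_mxKu.
have vE s : dom i (y s) -> fcoord y i v s = invmx (Gl i (chart i (y s))) *m dsubmx (c s).
  move=> is_; have cp := @mem_chart_at _ _ M (y s).
  have Gu : Gl i (chart i (y s)) \in unitmx by apply: metric_coord_unit; exact: img_chart.
  apply: (canRL (mulKmx Gu)); rewrite metric_coordE // col_mxKd /fcoord -!mulmxA.
  rewrite (mulmxA (tchg i _ _) (tchg _ i _)) tchgK // mul1mx.
  by rewrite /v (mulmxA (g _)) mulmxV ?mul1mx //; exact: metric_unit.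
set vt := fcoord y i v t.
have vtE : vt = invmx (Gl i (usubmx (c t))) *m dsubmx (c t) by rewrite /vt vE // qE.
have key a b : ((usubmx c')^T *m b - (dsubmx c')^T *m a) ord0 ord0 =
    (vt^T *m b - 2^-1 *: (vt^T *m mpd (Gl i) (chart i (y t)) a *m vt)) ord0 ord0
   + \sum_k a k ord0 * pd k (Vslice V i t) (chart i (y t)).
  have := Hw (col_mx a b); rewrite omega_canE (Hloc_derive t (col_mx a b) iq).
  by rewrite vtE -qE !col_mxKu !col_mxKd.
(* Testing against pure momentum directions shows that the velocity is [G^-1 p]. *)
have qv : usubmx c' = vt.
  apply/matrixP => k l; rewrite (ord1 l).
  have := key 0 (delta_mx k ord0); rewrite mulmx0 subr0.
  have -> : mpd (Gl i) (chart i (y t)) 0 = 0.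
    by rewrite -(scale0r (0 : 'cV[R]_n)) mpdZ scale0r.
  rewrite mulmx0 mul0mx scaler0 subr0 big1 ?addr0 => [|l' _]; last by rewrite mxE mul0r.
  by rewrite -!colE !mxE.
have dq : dmx (fun s => chart i (y s)) t vt.
  by rewrite -qv; under eq_fun do rewrite -qE; exact: dmx_usub.
split; first exact: dq.
have iyt := img_chart iy.
have Gu : Gl i (chart i (y t)) \in unitmx by exact: metric_coord_unit.
have dG := mpd_chain (@open_img _ _ M i) (metric_coord_smooth g i 1) dq iyt.
apply: (@dmx_near_eq R _ _ (fun s => invmx (Gl i (chart i (y s))) *m dsubmx (c s))).
  by apply: filterS (near_dom cy iy) => s /vE ->.
have := dmxM (dmxV dG Gu) (dmx_dsub dc').
rewrite -/c' mulNmx -!mulmxA -[in dsubmx (c t)]/(c t).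
have -> : invmx (Gl i (chart i (y t))) *m dsubmx (c t) = vt by rewrite vtE qE.
rewrite -mulmxN -mulmxDr; set D := _ *m (_ + _) => dD.
suff E : D = - (gam (Gl i) (chart i (y t)) vt *m vt) - gradient (Gl i) (Vslice V i t) (chart i (y t)).
  by rewrite -E.
have -> : D = invmx (Gl i (chart i (y t))) *m
    (dsubmx c' - mpd (Gl i) (chart i (y t)) vt *m vt).
  by rewrite /D addrC.
rewrite -[RHS]mul1mx -(mulVmx Gu) -mulmxA; congr (_ *m _).
rewrite mulmxBr mulmxN /gradient (mulKVmx Gu).
apply/eqP; rewrite subr_eq addrAC eq_sym subr_eq eq_sym; apply/eqP.
apply/matrixP => k l; rewrite (ord1 l).
(* Testing against pure position directions gives the derivative of the momentum. *)
have K := key (delta_mx k ord0) 0; rewrite !mulmx0 !sub0r mxoppE in K.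
have col (A : 'cV[R]_n) : A k ord0 = ((delta_mx k ord0 : 'cV[R]_n)^T *m A) ord0 ord0.
  by rewrite trmx_delta -rowE mxE.
have tr1 (X : 'M[R]_1) : X ord0 ord0 = X^T ord0 ord0 by rewrite mxE.
set e : 'cV[R]_n := delta_mx k ord0 in K col.
have Ke : (e^T *m dsubmx c') ord0 ord0 = ((dsubmx c')^T *m e) ord0 ord0.
  by rewrite tr1 trmx_mul trmxK.
have mc := metric_compat (metric_coord_sym g i) (fun q iq => metric_coord_unit g iq) _ iyt.
have S1 : (vt^T *m mpd (Gl i) (chart i (y t)) e *m vt) ord0 ord0 =
    2 * (e^T *m ((gam (Gl i) (chart i (y t)) vt)^T *m (Gl i (chart i (y t)) *m vt))) ord0 ord0.
  rewrite mc; apply: compat_algebra; first exact: metric_coord_sym.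
  exact: (gam_sym (metric_coord_sym g i)).
have ek : \sum_l e l ord0 * pd l (Vslice V i t) (chart i (y t)) =
    pd k (Vslice V i t) (chart i (y t)).
  rewrite (bigD1 k) //= big1 ?addr0 => [|l' lk]; first by rewrite mxE !eqxx mul1r.
  by rewrite mxE (negbTE lk) mul0r.
rewrite ek mxoppE mxscaleE S1 in K.
rewrite !mxaddE mxoppE !col Ke mc mulmxDl mulmxDr mxaddE.
rewrite -(mulmxA (Gl i _)) -(mulmxA _^T (Gl i _)).
have -> : (e^T *m \col_k0 pd k0 (Vslice V i t) (chart i (y t))) ord0 ord0 =
    pd k (Vslice V i t) (chart i (y t)) by rewrite -col mxE.
move: K; move: (((dsubmx c')^T *m e) ord0 ord0) (pd k _ _) => a1 a2.
move: ((e^T *m (_ *m _)) ord0 ord0) ((e^T *m (_ *m _)) ord0 ord0) => a3 a4; lra.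
Qed.

End HamiltonToNewton.

(** * The linearised flow along a critical point *)

Section RealInduction.
Variable R : realType.

Lemma real_induction (P : R -> Prop) a b : a <= b -> P a ->
  (forall t, a <= t < b -> (forall s, a <= s <= t -> P s) ->
     exists2 d : R, 0 < d & forall s, t < s < t + d -> P s) ->
  (forall t, a < t <= b -> (forall s, a <= s < t -> P s) -> P t) ->
  forall t, a <= t <= b -> P t.
Proof.
move=> ab Pa step lim.
pose S := [set t | a <= t <= b /\ forall s, a <= s <= t -> P s].
have Sa : S a.
  split=> [|s /andP[as_ sa]]; first by rewrite lexx.
  by have -> : s = a by apply/eqP; rewrite eq_le as_ sa.
have hS : has_sup S by split; [exists a|exists b => t [/andP[]]].
set c := sup S.
have ac : a <= c by exact: sup_upper_bound.
have cb : c <= b by apply: ge_sup; [exists a|move=> t [/andP[]]].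
have below s : a <= s < c -> P s.
  move=> /andP[as_ sc]; have [t [tab Pt] st] := sup_gt hS.1 sc.
  by apply: Pt; rewrite as_ ltW.
have Pc : P c.
  by have [->//|ne] := eqVneq c a; apply: lim => //; rewrite lt_neqAle eq_sym ne ac.
have upto s : a <= s <= c -> P s.
  move=> /andP[as_ sc]; have [->//|ne] := eqVneq s c.
  by apply: below; rewrite as_ lt_neqAle ne.
have cE : c = b.
  apply/eqP; rewrite eq_le cb leNgt; apply/negP => cb'.
  have acb : a <= c < b by rewrite ac.
  have [d d0 Hd] := step c acb upto.
  pose e := Num.min (d / 2) (b - c).
  have e0 : 0 < e by rewrite lt_min divr_gt0 // subr_gt0.
  have : c + e <= c.
    apply: sup_upper_bound => //; split.
      apply/andP; split; first by apply: le_trans ac _; rewrite lerDl ltW.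
      by rewrite addrC -lerBrDr ge_min lexx orbT.
    move=> s /andP[as_ se]; have [sc|sc] := leP s c; first by apply: upto; rewrite as_.
    apply: Hd; rewrite sc /=; apply: le_lt_trans se _; rewrite ltrD2l.
    by rewrite gt_min ltr_pdivrMr // mulr_natr mulr2n ltrDl d0.
  by rewrite gerDl leNgt e0.
by move=> t; rewrite -cE; exact: upto.
Qed.

Definition colsmx m n (f : 'cV[R]_n -> 'cV[R]_m) : 'M[R]_(m, n) :=
  \matrix_(i, k) f (delta_mx k ord0) i ord0.

Lemma colsmxE m n (f : 'cV[R]_n -> 'cV[R]_m) u :
  (forall c x y, f (c *: x + y) = c *: f x + f y) -> colsmx f *m u = f u.
Proof.
move=> lin.
have f0 : f 0 = 0.
  have := lin 1 0 0; rewrite !scale1r addr0 => /eqP.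
  by rewrite -subr_eq0 opprD addNKr oppr_eq0 => /eqP.
have uE : u = \sum_k u k ord0 *: delta_mx k ord0.
  apply/matrixP => i j; rewrite (ord1 j) summxE (bigD1 i) //= big1 => [|k ki].
    by rewrite !mxE !eqxx mulr1 addr0.
  by rewrite !mxE eq_sym (negbTE ki) mulr0.
rewrite {2}uE.
have -> : f (\sum_k u k ord0 *: delta_mx k ord0) = \sum_k u k ord0 *: f (delta_mx k ord0).
  elim: (index_enum _) => [|k s IH]; first by rewrite !big_nil f0.
  by rewrite !big_cons lin IH.
apply/matrixP => i j; rewrite (ord1 j) summxE mxE; apply: eq_bigr => k _.
by rewrite mxE [in RHS]mxE mulrC.
Qed.

End RealInduction.

(** * Differentiable dependence of Newton's equation on initial data *)

Section NewtonField.
Variables (R : realType) (n : nat) (M : smooth_manifold R n) (g : riemannian_metric M).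
Variable V : R -> M -> R.
Hypothesis sV : smooth_potential V.
Local Notation Gl := (metric_coord g).
Variable j : chart_index M.
Implicit Types (t s : R) (q u v : 'cV[R]_n) (w d : 'cV[R]_(n + n)).

Let oj : open (img j) := @open_img _ _ M j.
Let Gs := metric_coord_smooth g j.
Let Gu q : img j q -> Gl j q \in unitmx. Proof. exact: metric_coord_unit. Qed.

(** Newton's equation as a first-order system for position and velocity in a chart of TM. *)
Definition nfield t w : 'cV[R]_(n + n) :=
  col_mx (dsubmx w) (- (gam (Gl j) (usubmx w) (dsubmx w) *m dsubmx w)
    - gradient (Gl j) (Vslice V j t) (usubmx w)).

Definition nfield_diff t w : 'M[R]_(n + n) :=
  block_mx 0 1%:M
    (- colsmx (fun u => dgam (Gl j) (usubmx w) u (dsubmx w) *m dsubmx w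
        + mpd (gradj g V j) (timed t (usubmx w)) (col_mx 0 u)))
    (- (gam (Gl j) (usubmx w) (dsubmx w) + gam (Gl j) (usubmx w) (dsubmx w))).

Lemma nfield_diffE t w d : img j (usubmx w) -> nfield_diff t w *m d =
  col_mx (dsubmx d) (- (dgam (Gl j) (usubmx w) (usubmx d) (dsubmx w) *m dsubmx w
      + mpd (gradient (Gl j) (Vslice V j t)) (usubmx w) (usubmx d))
    - (gam (Gl j) (usubmx w) (dsubmx w) *m dsubmx d + gam (Gl j) (usubmx w) (dsubmx w) *m dsubmx d)).
Proof.
move=> iw; rewrite -{1}[d]vsubmxK /nfield_diff mul_block_col mul0mx mul1mx add0r; congr col_mx.
rewrite !mulNmx mulmxDl colsmxE; first by rewrite (mpd_gradient g sV t _ iw).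
move=> c x y.
have -> : col_mx 0 (c *: x + y) = c *: (col_mx 0 x : 'cV[R]_(1 + n)) + col_mx 0 y.
  by rewrite scale_col_mx add_col_mx scaler0 addr0.
rewrite /dgam !mpdD !mpdZ mulmxDl -scalemxAl scalerDr.
by rewrite addrACA.
Qed.

Let newton_alg (A B C : 'M[R]_n) (y z c : 'cV[R]_n) : B *m y = C *m z ->
  - ((A + B) *m y + C *m z) - c = - (A *m y + c) - (C *m z + C *m z).
Proof.
move=> e; rewrite mulmxDl e; move: (A *m y) (C *m z) => a1 a2.
by apply/matrixP => i k; rewrite !mxE; ring.
Qed.

Lemma nfield_dmx t (w : R -> 'cV[R]_(n + n)) s d : dmx w s d -> img j (usubmx (w s)) ->
  dmx (fun s => nfield t (w s)) s (nfield_diff t (w s) *m d).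
Proof.
move=> dw iw; rewrite nfield_diffE //; apply: dmx_col; first exact: dmx_dsub.
have du := dmx_usub dw; have dd := dmx_dsub dw.
have dgm := dmxM (gam_dmx oj Gs Gu du dd iw) dd.
have gC := gradient_C oj Gs Gu (Vslice_smooth sV j t) 1.
have gs : gam (Gl j) (usubmx (w s)) (dsubmx d) *m dsubmx (w s) =
  gam (Gl j) (usubmx (w s)) (dsubmx (w s)) *m dsubmx d := gam_sym (metric_coord_sym g j) _ _ _.
have H := dmxB (dmxN dgm) (mpd_chain oj gC du iw).
exact: (eq_ind _ (fun u => dmx _ s u) H _ (newton_alg _ _ gs)).
Qed.

Lemma nfield_diff_mcts (T : topologicalType) (f : T -> R) (w : T -> 'cV[R]_(n + n)) (t0 : T) :
  f @ t0 --> f t0 -> mcts w t0 -> img j (usubmx (w t0)) ->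
  mcts (fun z => nfield_diff (f z) (w z)) t0.
Proof.
move=> cf cw iw.
have cu : mcts (fun z => usubmx (w z)) t0.
  by move=> a b; rewrite mxE; under eq_fun do rewrite mxE; exact: cw.
have cd : mcts (fun z => dsubmx (w z)) t0.
  by move=> a b; rewrite mxE; under eq_fun do rewrite mxE; exact: cw.
have ct := timed_mcts cf cu.
have jt : jdom j (timed (f t0) (usubmx (w t0))) by exact: timed_jdom.
have cg := gam_mcts oj Gs Gu cu cd iw.
have h0 : mcts (fun=> 0 : 'M[R]_n) t0 by exact: mcts_cst.
have h1 : mcts (fun=> 1%:M : 'M[R]_n) t0 by exact: mcts_cst.
have h3 := mctsN (mctsD cg cg).
apply: (mcts_block h0 h1 _ h3); apply: mctsN.
apply: (@mcts_mx R T n n (fun a b z =>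
  (dgam (Gl j) (usubmx (w z)) (delta_mx b ord0) (dsubmx (w z)) *m dsubmx (w z)
   + mpd (gradj g V j) (timed (f z) (usubmx (w z))) (col_mx 0 (delta_mx b ord0))) a ord0)) => a b.
have c1 : mcts (fun=> (delta_mx b ord0 : 'cV[R]_n)) t0 by exact: mcts_cst.
have c2 : mcts (fun=> (col_mx 0 (delta_mx b ord0) : 'cV[R]_(1 + n))) t0 by exact: mcts_cst.
suff H : mcts (fun z => dgam (Gl j) (usubmx (w z)) (delta_mx b ord0) (dsubmx (w z)) *m dsubmx (w z)
   + mpd (gradj g V j) (timed (f z) (usubmx (w z))) (col_mx 0 (delta_mx b ord0))) t0 by exact: H.
apply: mctsD; last exact: (mpd_mcts (gradj_smooth g sV j 1) ct c2 jt).
by apply: (mctsM _ (cd)); exact: (dgam_mcts oj Gs Gu cu c1 cd iw).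
Qed.

(** The linear map [L] is left free: with [L = 0] this is a Lipschitz bound, with the differential
    along the reference curve it is the Taylor remainder. *)
Lemma nfield_taylor t r w L e : (forall d, nrm d <= nrm (w - r) -> img j (usubmx (r + d)) /\
    nrm (nfield_diff t (r + d) - L) <= e) ->
  nrm (nfield t w - nfield t r - L *m (w - r)) <= e * nrm (w - r).
Proof.
move=> H.
have := @lin_bound R _ _ (fun s => nfield t (r + s *: (w - r)))
  (fun s => nfield_diff t (r + s *: (w - r)) *m (w - r)) (L *m (w - r)) 1 (e * nrm (w - r)).
rewrite !scale1r scale0r addr0 (addrC r) subrK normr1 mulr1; apply=> s s1.
have sm : nrm (s *: (w - r)) <= nrm (w - r) by rewrite nrmZ ler_piMl ?nrm_ge0.
have [i1 i2] := H _ sm; split; first by apply: nfield_dmx => //; exact: dmx_line.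
rewrite -mulmxBl; apply: le_trans (nrmM _ _) _; rewrite ler_wpM2r ?nrm_ge0 //.
Qed.

End NewtonField.

Section FamilyOfCurves.
Variables (R : realType) (n : nat) (M : smooth_manifold R n) (g : riemannian_metric M).
Variable V : R -> M -> R.
Hypothesis sV : smooth_potential V.
Local Notation Gl := (metric_coord g).
Implicit Types (j : chart_index M) (t s : R).

Definition state j (y : R -> M) (v : R -> 'cV[R]_n) t : 'cV[R]_(n + n) :=
  col_mx (chart j (y t)) (fcoord y j v t).

Let usub_shift (w : 'cV[R]_(n + n)) (c : 'cV[R]_n) :
  usubmx (w + col_mx (c - usubmx w) 0) = c.
Proof.
by apply/matrixP => k l; rewrite mxE mxaddE col_mxEu mxaddE mxoppE mxE addrC subrK.
Qed.

Lemma state_img j y v t : dom j (y t) -> img j (usubmx (state j y v t)).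
Proof. by move=> jy; rewrite col_mxKu; exact: img_chart. Qed.

Lemma state_dmx j y v t : newton g V y v -> dom j (y t) ->
  dmx (state j y v) t (nfield g V j t (state j y v t)).
Proof.
move=> N jy; have [d1 d2] := newton_chart sV N jy.
by have := dmx_col d1 d2; rewrite /nfield !col_mxKu !col_mxKd.
Qed.

Section Tube.
Variables (j : chart_index M) (x : R -> M) (v0 : R -> 'cV[R]_n) (a b : R).
Hypothesis Nx : newton g V x v0.
Hypothesis ab : a <= b.
Hypothesis jx : forall t, a <= t <= b -> dom j (x t).
Let r := state j x v0.

Let cr t : a <= t <= b -> mcts r t.
Proof. by move=> tab; exact: dmx_mcts (state_dmx Nx (jx tab)). Qed.

Let cshift t : a <= t <= b ->
  mcts (fun z : 'cV[R]_(n + n) * R => r z.2 + z.1) (0, t).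
Proof.
move=> tab; apply: mctsD.
  apply: (@mcts_comp _ _ _ _ _ r (fun z : 'cV[R]_(n + n) * R => z.2)); last exact: cr.
  exact: cvg_snd.
by apply/mctsP; exact: cvg_fst.
Qed.

Lemma tube_near : \forall d \near (0 : 'cV[R]_(n + n)),
  forall t, a <= t <= b -> img j (usubmx (r t + d)).
Proof.
apply: near_segment => t tab.
have c : mcts (fun z : 'cV[R]_(n + n) * R => usubmx (r z.2 + z.1)) (0, t).
  by move=> k l; rewrite mxE; under eq_fun do rewrite mxE; exact: (cshift tab).
apply: ((mctsP _ _).1 c); rewrite /= addr0.
exact: (open_nbhs_nbhs (conj (@open_img _ _ M j) (state_img v0 (jx tab)))).
Qed.

Lemma diff_near e : 0 < e -> \forall d \near (0 : 'cV[R]_(n + n)), forall t, a <= t <= b ->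
  nrm (nfield_diff g V j t (r t + d) - nfield_diff g V j t (r t)) <= e.
Proof.
move=> e0.
have H := @unif_near R _ _ _ (fun d t => nfield_diff g V j t (r t + d)) 0 a b _ e e0.
have : \forall d \near (0 : 'cV[R]_(n + n)), forall t, a <= t <= b ->
    nrm (nfield_diff g V j t (r t + d) - nfield_diff g V j t (r t + 0)) <= e.
  apply: H => t tab.
  apply: (@nfield_diff_mcts R n M g V sV j _ (fun z : 'cV[R]_(n + n) * R => z.2)
    (fun z => r z.2 + z.1)); [exact: cvg_snd|exact: cshift|].
  by rewrite /= addr0; exact: (state_img v0 (jx tab)).
by apply: filterS => d Hd t tab; have := Hd t tab; rewrite addr0.
Qed.

(** A tube of fixed radius around the reference curve lies in the chart, with a bound on the
    differential of the field that is uniform over the whole time segment. *)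
Lemma tube : exists rho L : R, [/\ 0 < rho, 0 < L & forall t d, a <= t <= b -> nrm d <= rho ->
  img j (usubmx (r t + d)) /\ nrm (nfield_diff g V j t (r t + d)) <= L].
Proof.
have cD t : a <= t <= b -> mcts (fun t => nfield_diff g V j t (r t)) t.
  move=> tab; apply: (@nfield_diff_mcts R n M g V sV j _ (fun t : R => t) r).
  - exact: cvg_id.
  - exact: cr.
  - exact: (state_img v0 (jx tab)).
have [L0 L00 HL] := nrm_bounded_on cD.
have [d1 d10 H1] := (near_nrmP _ _).1 tube_near.
have [d2 d20 H2] := (near_nrmP _ _).1 (diff_near ltr01).
exists (Num.min d1 d2 / 2), (L0 + 1); split.
- by rewrite divr_gt0 // lt_min d10.
- by rewrite addr_gt0.
move=> t d tab dr.
have : nrm (d - 0) < Num.min d1 d2.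
  by rewrite subr0 (le_lt_trans dr) // ltr_pdivrMr // mulr_natr mulr2n ltrDl lt_min d10.
rewrite lt_min => /andP[nd1 nd2]; split; first exact: H1.
apply: le_trans (nrm_dist _ (nfield_diff g V j t (r t))) _.
by apply: lerD; [exact: HL|exact: H2].
Qed.

Section Stay.
Variables (rho L : R).
Hypotheses (rho0 : 0 < rho) (L0 : 0 < L).
Hypothesis HT : forall t d, a <= t <= b -> nrm d <= rho ->
  img j (usubmx (r t + d)) /\ nrm (nfield_diff g V j t (r t + d)) <= L.
Variables (y : R -> M) (u : R -> 'cV[R]_n).
Hypothesis Ny : newton g V y u.
Let f t := state j y u t - r t.
Let C : R := 1 + expR (2 * L * (b - a)).

Let C0 : 0 < C. Proof. by rewrite addr_gt0 ?expR_gt0. Qed.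

Let f_bound c : a <= c <= b ->
  (forall s, a <= s <= c -> dom j (y s) /\ nrm (f s) <= rho) -> nrm (f c) <= C * nrm (f a).
Proof.
move=> /andP[ac cb] H.
have sab s : a <= s <= c -> a <= s <= b by move=> /andP[-> sc]; exact: le_trans sc cb.
have := @gronwall R _ _ (fun s => f s - f a)
  (fun s => nfield g V j s (state j y u s) - nfield g V j s (r s)) L (L * nrm (f a)) a c L0
  (mulr_ge0 (ltW L0) (nrm_ge0 _)).
rewrite subrr => /(_ _ erefl c); rewrite ac lexx => G.
have {}G : nrm (f c - f a) <= L * nrm (f a) / L * expR (2 * L * (c - a)).
  apply: G => // s sc; have [js fs] := H s sc; split.
    rewrite -[_ - nfield _ _ _ _ (r s)]subr0; apply: dmxB; last exact: dmx_cst.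
    by apply: dmxB; [exact: state_dmx|exact: (state_dmx Nx (jx (sab s sc)))].
  have := @nfield_taylor R n M g V sV j s (r s) (state j y u s) 0 L.
  rewrite mul0mx subr0 => T; apply: le_trans (T _) _.
    move=> d df; rewrite subr0; apply: HT; [exact: sab|exact: le_trans df fs].
  by rewrite -mulrDr ler_pM2l // [leRHS]addrC; exact: nrm_dist.
rewrite /C mulrDl mul1r; apply: le_trans (nrm_dist _ (f a)) _; rewrite lerD2l.
apply: le_trans G _; rewrite [X in X * _]mulrC mulKf ?gt_eqF // mulrC ler_wpM2r ?nrm_ge0 //.
by rewrite ler_expR ler_wpM2l ?mulr_ge0 ?(ltW L0) // lerD2r.
Qed.

Hypothesis ja : dom j (y a).
(** In [stay_lim], the distance to the reference curve and the motion of that curve each use half of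
    [rho / n.+1] per coordinate. A box of half-width [rho / n.+1] in [n] coordinates has [nrm]
    radius at most [rho] and stays in the tube. *)
Hypothesis fa : C * nrm (f a) <= rho / n.+1%:R / 2.

Let m_le : rho / n.+1%:R / 2 <= rho / 2.
Proof. by rewrite ler_wpM2r // ler_pdivrMr // ler_peMr ?(ltW rho0) // ler1n. Qed.

Let cf t : a <= t <= b -> dom j (y t) -> mcts f t.
Proof. by move=> tab jt; apply: mctsB; [exact: dmx_mcts (state_dmx Ny jt)|exact: cr]. Qed.

Let cy : continuous y. Proof. by case: Ny. Qed.

Let stay_open t : a <= t < b -> (forall s, a <= s <= t -> dom j (y s) /\ nrm (f s) <= C * nrm (f a)) ->
  exists2 d : R, 0 < d & forall s, t < s < t + d -> dom j (y s) /\ nrm (f s) <= C * nrm (f a).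
Proof.
move=> /andP[at_ tb] H; have [jt ft] := H t (introT andP (conj at_ (lexx t))).
have tab : a <= t <= b by rewrite at_ ltW.
have r20 : 0 < rho / 2 by rewrite divr_gt0.
have [d1 d10 H1] := near_dist (near_dom cy jt).
have [d2 d20 H2] := near_dist (mcts_nrm_near (cf tab jt) r20).
exists (Num.min (Num.min d1 d2) (b - t)); first by rewrite !lt_min d10 d20 subr_gt0.
move=> s /andP[ts]; rewrite -ltrBlDl !lt_min => /andP[/andP[s1 s2] sb].
have good s' : t <= s' <= s -> dom j (y s') /\ nrm (f s') <= rho.
  move=> /andP[ts' s's].
  have e : `|s' - t| = s' - t by rewrite ger0_norm // subr_ge0.
  have e' : s' - t <= s - t by rewrite lerD2r.
  split; first by apply: H1; rewrite e (le_lt_trans e').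
  apply: le_trans (nrm_dist _ (f t)) _.
  have h2 : nrm (f s' - f t) <= rho / 2 by apply: H2; rewrite e (le_lt_trans e').
  have h1 := le_trans ft (le_trans fa m_le); lra.
have sb' : s <= b by move: sb; rewrite ltrD2r => /ltW.
split; first by have [] := good s (introT andP (conj (ltW ts) (lexx s))).
apply: f_bound; first by rewrite (le_trans at_ (ltW ts)).
move=> s' /andP[as' s's]; have [s't|/ltW ts'] := leP s' t; last by apply: good; rewrite ts'.
have [js' fs'] := H s' (introT andP (conj as' s't)); split=> //.
apply: le_trans fs' _; apply: le_trans fa _; apply: le_trans m_le _.
by rewrite ler_pdivrMr // mulr_natr mulr2n lerDl ltW.
Qed.

(** A limit of points of a chart could lie outside its domain. Before time [t] the curve is in the
    image of a compact box under [chart_inv]; this image is closed because the manifold is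
    Hausdorff, so continuity keeps the limit point inside. *)
Let stay_lim t : a < t <= b -> (forall s, a <= s < t -> dom j (y s) /\ nrm (f s) <= C * nrm (f a)) ->
  dom j (y t) /\ nrm (f t) <= C * nrm (f a).
Proof.
move=> /andP[at_ tb] H; have tab : a <= t <= b by rewrite ltW.
pose k := rho / n.+1%:R.
have k0 : 0 < k by rewrite divr_gt0.
pose c := usubmx (r t).
(* The box is made of row vectors because the compactness of products of segments is used in that
   form. *)
pose B : set 'rV[R]_n := [set w | forall i, w ord0 i \in `[c i ord0 - k, c i ord0 + k]].
have cB : compact B.
  apply: (@rV_compact _ _ (fun i => `[c i ord0 - k, c i ord0 + k]%classic)) => i.
  exact: segment_compact.
have Bimg w : B w -> img j w^T.
  move=> Bw; pose d : 'cV[R]_(n + n) := col_mx (w^T - c) 0.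
  have : nrm d <= rho.
    rewrite nrm_cV big_split_ord /= [X in _ + X]big1 ?addr0 => [|i _]; last first.
      by rewrite col_mxEd mxE normr0.
    apply: (@le_trans _ _ (\sum_(i < n) k)).
      apply: ler_sum => i _; rewrite col_mxEu mxaddE mxoppE mxE ler_norml.
      by have := Bw i; rewrite in_itv /= => /andP[h1 h2]; rewrite lerBrDl h1 lerBlDl h2.
    rewrite sumr_const card_ord -mulr_natl /k mulrCA -[leRHS]mulr1 ler_wpM2l ?(ltW rho0) //.
    by rewrite ler_pdivrMr // mul1r ler_nat.
  move=> dr; have e : usubmx (r t + d) = w^T by exact: usub_shift.
  by have [] := HT tab dr; rewrite e.
pose K := (fun w : 'rV[R]_n => chart_inv j w^T) @` B.
have cK : compact K.
  apply: continuous_compact cB.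
  apply: continuous_in_subspaceT => w; rewrite inE => Bw.
  have ctr : {for w, continuous (fun w : 'rV[R]_n => w^T)}.
    apply/mctsP => p q; rewrite mxE; under eq_fun do rewrite mxE.
    by have := (mctsP (fun u : 'rV[R]_n => u) w).2 cvg_id; apply.
  exact: (@continuous_comp _ _ _ (fun w : 'rV[R]_n => w^T) (chart_inv j) w ctr
    (chart_inv_cts (Bimg w Bw))).
have clK : closed K by apply: compact_closed cK; exact: carrier_hausdorff.
have k20 : 0 < k / 2 by rewrite divr_gt0.
have [d1 d10 H1] := near_dist (mcts_nrm_near (cr tab) k20).
have Kt : K (y t).
  apply: contrapT => nK.
  have nn : \forall s \near t, (~` K) (y s).
    apply: cy; apply: open_nbhs_nbhs; split=> //; exact: closed_openC.
  have [d2 d20 H2] := near_dist nn.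
  pose e := Num.min (Num.min d1 d2) (t - a) / 2.
  have e0 : 0 < e by rewrite divr_gt0 // !lt_min d10 d20 subr_gt0.
  have el : e < Num.min (Num.min d1 d2) (t - a).
    by rewrite ltr_pdivrMr // mulr_natr mulr2n ltrDl !lt_min d10 d20 subr_gt0.
  move: el; rewrite !lt_min => /andP[/andP[e1 e2] e3].
  have te : `|t - e - t| = e by rewrite addrAC subrr add0r normrN gtr0_norm.
  have te' : a <= t - e < t by rewrite ltrBlDr ltrDl e0 andbT lerBrDl addrC -lerBrDl ltW.
  have [js fs] := H (t - e) te'.
  apply: (H2 (t - e)); first by rewrite te.
  exists (chart j (y (t - e)))^T; last by rewrite trmxK chartK.
  move=> i; rewrite in_itv /= -ler_distl [X in X - _]mxE.
  have rs := H1 (t - e); rewrite te in rs; have {}rs := rs e1.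
  have -> : chart j (y (t - e)) i ord0 - c i ord0 =
      f (t - e) (lshift n i) ord0 + (r (t - e) - r t) (lshift n i) ord0.
    rewrite !mxaddE !mxoppE /c [usubmx _ i ord0]mxE /f.
    have -> : state j y u (t - e) (lshift n i) ord0 = chart j (y (t - e)) i ord0 by exact: col_mxEu.
    by rewrite addrA subrK.
  apply: le_trans (ler_normD _ _) _.
  have h1 := le_trans (nrm_entry (f (t - e)) (lshift n i) ord0) (le_trans fs fa).
  have h2 := le_trans (nrm_entry (r (t - e) - r t) (lshift n i) ord0) rs.
  rewrite -/k in h1; lra.
have jt : dom j (y t).
  by case: Kt => w Bw <-; have [] := img_dom (Bimg w Bw).
split=> //; apply: f_bound => // s /andP[as_ st].
have rle : C * nrm (f a) <= rho.
  apply: le_trans fa _; apply: le_trans m_le _.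
  by rewrite ler_pdivrMr // mulr_natr mulr2n lerDl ltW.
have [st'|] := ltP s t; first by have [js fs] := H s (introT andP (conj as_ st')); split=> //; exact: le_trans rle.
move=> ts; have -> : s = t by apply/eqP; rewrite eq_le st.
split=> //; have r20 : 0 < rho / 2 by rewrite divr_gt0.
have [d2 d20 H2] := near_dist (mcts_nrm_near (cf tab jt) r20).
pose e := Num.min d2 (t - a) / 2.
have e0 : 0 < e by rewrite divr_gt0 // !lt_min d20 subr_gt0.
have el : e < Num.min d2 (t - a).
  by rewrite ltr_pdivrMr // mulr_natr mulr2n ltrDl !lt_min d20 subr_gt0.
move: el; rewrite lt_min => /andP[e1 e3].
have te : `|t - e - t| = e by rewrite addrAC subrr add0r normrN gtr0_norm.
have te' : a <= t - e < t by rewrite ltrBlDr ltrDl e0 andbT lerBrDl addrC -lerBrDl ltW.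
  have [js fs] := H (t - e) te'.
have h2 := H2 (t - e); rewrite te -nrmN opprB in h2; have {}h2 := h2 e1.
apply: le_trans (nrm_dist _ (f (t - e))) _.
have h1 := le_trans fs (le_trans fa m_le); lra.
Qed.

Lemma stay_in_tube t : a <= t <= b -> dom j (y t) /\ nrm (f t) <= C * nrm (f a).
Proof.
apply: (@real_induction R (fun t => dom j (y t) /\ nrm (f t) <= C * nrm (f a)) a b ab).
- split=> //; rewrite ler_peMl ?nrm_ge0 // /C lerDl expR_ge0 //.
- exact: stay_open.
- exact: stay_lim.
Qed.

End Stay.
End Tube.

End FamilyOfCurves.

Section Variation.
Variables (R : realType) (n : nat) (M : smooth_manifold R n) (g : riemannian_metric M).
Variable V : R -> M -> R.
Hypothesis sV : smooth_potential V.
Local Notation Gl := (metric_coord g).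
Implicit Types (j : chart_index M) (t s : R).
Variables (x : R -> M) (v0 : R -> 'cV[R]_n) (y : R -> R -> M) (u : R -> R -> 'cV[R]_n).
Hypothesis Nx : newton g V x v0.
Hypothesis Ny : forall h, newton g V (y h) (u h).

(** [w] is the derivative at [h = 0] of a family of curves at time [t], in coordinates of TM; the
    first clause makes these coordinates meaningful for small [h]. *)
Definition varies j t (w : 'cV[R]_(n + n)) : Prop :=
  [/\ \forall h \near (0 : R), dom j (y h t), y 0 t = x t, u 0 t = v0 t &
      dmx (fun h => state j (y h) (u h) t) 0 w].

Section Step.
Variables (j : chart_index M) (a b : R) (W : R -> 'cV[R]_(n + n)).
Hypothesis ab : a <= b.
Hypothesis jx : forall t, a <= t <= b -> dom j (x t).
Let r := state j x v0.
Let D t := nfield_diff g V j t (r t).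
Hypothesis HW : forall t, a <= t <= b -> dmx W t (D t *m W t).
Hypothesis va : varies j a (W a).
Let f h t := state j (y h) (u h) t - r t.

Let dom_dist (P : R -> Prop) : (\forall h \near (0 : R), P h) ->
  exists2 d : R, 0 < d & forall h : R, `|h| < d -> P h.
Proof. by move=> /near_dist[d d0 H]; exists d => // h hd; apply: H; rewrite subr0. Qed.

Let fa0 : f 0 a = 0.
Proof. by case: va => _ e1 e2 _; rewrite /f /r /state /fcoord e1 e2 subrr. Qed.

(** An estimate linear in [h] at the initial time is propagated by [stay_in_tube]; it also keeps the
    neighbouring curves in the chart on the whole segment. *)
Let f_lip : exists2 K : R, 0 < K & exists2 d : R, 0 < d &
  forall h : R, `|h| < d -> forall t, a <= t <= b ->
    dom j (y h t) /\ nrm (f h t) <= K * `|h|.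
Proof.
have [rho [L [rho0 L0 HT]]] := tube sV Nx jx.
have [nd e1 e2 dW] := va.
have [d1 d10 H1] := dom_dist nd.
have [d2 d20 H2] := dom_dist (dmx_eps_near dW ltr01).
pose C : R := 1 + expR (2 * L * (b - a)).
have C0 : 0 < C by rewrite addr_gt0 ?expR_gt0.
pose K0 : R := 1 + nrm (W a).
have K00 : 0 < K0 by rewrite ltr_pwDl ?nrm_ge0.
have fa h : `|h| < d2 -> nrm (f h a) <= K0 * `|h|.
  move=> hd; have := H2 _ hd; rewrite add0r mul1r => fl.
  have -> : f h a = (state j (y h) (u h) a - state j (y 0) (u 0) a - h *: W a) + h *: W a.
    by rewrite subrK -[LHS]subr0 -fa0 /f opprB addrA subrK.
  by apply: le_trans (nrmD _ _) _; rewrite nrmZ mulrDl mul1r [nrm _ * _]mulrC; exact: lerD.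
have k0 : 0 < rho / n.+1%:R / 2 by rewrite !divr_gt0.
exists (C * K0); first exact: mulr_gt0.
exists (Num.min (Num.min d1 d2) (rho / n.+1%:R / 2 / (C * K0))).
  by rewrite !lt_min d10 d20 divr_gt0 // mulr_gt0.
move=> h; rewrite !lt_min => /andP[/andP[h1 h2] h3] t tab.
have h4 : C * (K0 * `|h|) <= rho / n.+1%:R / 2.
  by move: h3; rewrite ltr_pdivlMr ?mulr_gt0 // => /ltW; rewrite mulrC mulrA.
have h5 : C * nrm (f h a) <= rho / n.+1%:R / 2.
  by apply: le_trans h4; rewrite ler_pM2l //; exact: fa.
have [jt ft] := stay_in_tube sV Nx ab jx rho0 L0 HT (Ny h) (H1 _ h1) h5 tab.
split=> //; apply: le_trans ft _; rewrite -[leRHS]mulrA; exact: (ler_wpM2l (ltW C0) (fa _ h2)).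
Qed.

Let remainder_alg (N F w : 'cV[R]_(n + n)) (A : 'M[R]_(n + n)) (h : R) :
  N - (0 *: w + h *: (A *m w)) - 0 = N - A *m F + A *m (F - h *: w).
Proof.
rewrite mulmxBr -scalemxAr scale0r add0r subr0; move: (A *m F) (h *: (A *m w)) => p q.
by apply/matrixP => i k; rewrite !mxE; ring.
Qed.

Let remainder e : 0 < e -> exists2 d : R, 0 < d & forall h : R, `|h| < d ->
  forall t, a <= t <= b -> nrm (f h t - h *: W t) <= e * `|h|.
Proof.
move=> e0; have [K K0 [d1 d10 H1]] := f_lip.
have [rho [L [rho0 L0 HT]]] := tube sV Nx jx.
have [nd E1 E2 dW] := va.
have LD t : a <= t <= b -> nrm (D t) <= L.
  by move=> tab; have := HT t 0 tab; rewrite nrm0 addr0 => /(_ (ltW rho0))[].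
pose C : R := expR (2 * L * (b - a)).
have C0 : 0 < C by exact: expR_gt0.
(* The constants are chosen so that [e2 * (1 + C)], coming from the initial error, and
   [e1 * K * C / L], coming from the Taylor remainder, are each [e / 2]. *)
pose e2 := e / 2 / (1 + C); have e20 : 0 < e2 by rewrite !divr_gt0 // addr_gt0.
pose e1 := e / 2 * L / (C * K).
have e10 : 0 < e1 by rewrite divr_gt0 ?mulr_gt0 ?invr_gt0.
have [d2 d20 H2] := dom_dist (dmx_eps_near dW e20).
have [d3 d30 H3] := (near_nrmP _ _).1 (diff_near sV Nx jx e10).
have [d4 d40 H4] := (near_nrmP _ _).1 (tube_near sV Nx jx).
exists (Num.min (Num.min d1 d2) (Num.min d3 d4 / K)).
  by rewrite !lt_min d10 d20 divr_gt0 // lt_min d30.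
move=> h; rewrite !lt_min => /andP[/andP[h1 h2] h3] t tab.
have {h3} [h3 h4] : K * `|h| < d3 /\ K * `|h| < d4.
  by move: h3; rewrite ltr_pdivlMr // mulrC lt_min => /andP.
pose z s := f h s - h *: W s.
have za : nrm (z a) <= e2 * `|h|.
  have := H2 _ h2; rewrite add0r /z /f.
  have -> : state j (y 0) (u 0) a = r a by apply/eqP; rewrite -subr_eq0; apply/eqP; exact: fa0.
  by [].
have dz s : a <= s <= b -> dmx (fun s => z s - z a) s
    ((nfield g V j s (state j (y h) (u h) s) - nfield g V j s (r s) - D s *m f h s)
     + D s *m z s).
  move=> sab; have [js _] := H1 _ h1 s sab.
  have dh := dmxZ (is_derive_cst h s (1 : R)) (HW sab).
  have := dmxB (dmxB (dmxB (state_dmx sV (Ny h) js) (state_dmx sV Nx (jx sab))) dh)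
    (dmx_cst (z a) s).
  move=> H; exact: (eq_ind _ (fun w => dmx _ s w) H _ (remainder_alg _ (f h s) _ _ _)).
have G := @gronwall R _ _ (fun s => z s - z a) _ L (e1 * (K * `|h|) + L * (e2 * `|h|)) a b L0.
have nz0 : 0 <= e1 * (K * `|h|) + L * (e2 * `|h|).
  apply: addr_ge0; apply: mulr_ge0; rewrite ?(ltW e10) ?(ltW L0) //; apply: mulr_ge0; rewrite ?(ltW K0) ?(ltW e20) ?normr_ge0 //.
have {}G : nrm (z t - z a) <= (e1 * (K * `|h|) + L * (e2 * `|h|)) / L * expR (2 * L * (t - a)).
  apply: G => //; last by rewrite subrr.
  move=> s sab; split; first exact: dz.
  have [js fs] := H1 _ h1 s sab.
  have T1 : nrm (nfield g V j s (state j (y h) (u h) s) - nfield g V j s (r s) - D s *m f h s)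
      <= e1 * nrm (f h s).
    apply: (nfield_taylor sV) => d df.
    have df' : nrm (d - 0) <= K * `|h| by rewrite subr0; exact: le_trans df fs.
    by split; [apply: H4 => //; exact: le_lt_trans df' h4|apply: H3 => //; exact: le_lt_trans df' h3].
  have T2 : nrm (D s *m z s) <= L * nrm (z s - z a) + L * (e2 * `|h|).
    apply: le_trans (nrmM _ _) _; rewrite -mulrDr.
    apply: le_trans (ler_wpM2r (nrm_ge0 _) (LD _ sab)) (ler_wpM2l (ltW L0) _).
    by rewrite addrC; apply: le_trans (nrm_dist _ (z a)) _; rewrite lerD2r.
  apply: le_trans (nrmD _ _) _; rewrite [leRHS]addrCA.
  exact: lerD (le_trans T1 (ler_wpM2l (ltW e10) fs)) T2.
have CE : expR (2 * L * (t - a)) <= C.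
  by rewrite ler_expR ler_wpM2l ?mulr_ge0 ?(ltW L0) // lerD2r; case/andP: tab.
rewrite -/(z t); apply: le_trans (nrm_dist _ (z a)) _.
apply: le_trans (lerD za (le_trans G (ler_wpM2l _ CE))) _.
  by rewrite divr_ge0 // ltW.
rewrite /e1 /e2 le_eqVlt; apply/orP; left; apply/eqP; field.
by rewrite !gt_eqF ?addr_gt0.
Qed.

(** Within one chart the derivative in [h] follows the linearised field. The Lipschitz bound at
    [h = 0] also shows that the curve of the family agrees with the reference curve. *)
Lemma variation_step t : a <= t <= b -> varies j t (W t).
Proof.
move=> tab; have [K K0 [d1 d10 H1]] := f_lip.
have [j0 f0] : dom j (y 0 t) /\ nrm (f 0 t) <= K * `|0 : R| by apply: H1; rewrite ?normr0.
have f0E : f 0 t = 0 by apply: nrm_le0; move: f0; rewrite normr0 mulr0.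
have sE : state j (y 0) (u 0) t = state j x v0 t by apply/eqP; rewrite -subr_eq0; apply/eqP.
have [cE vE] := eq_col_mx sE.
have yE : y 0 t = x t by rewrite -(chartK j0) cE chartK //; exact: jx.
split=> //.
- have := @nbhsx_ballx _ R^o 0 d1 d10; apply: filterS => h hb.
  by apply: (H1 h _ t tab).1; move: hb; rewrite /ball /= sub0r normrN.
- have e1 : u 0 t = tchg j (chart_at (y 0 t)) (y 0 t) *m fcoord (y 0) j (u 0) t.
    by rewrite -(fcoord_comp _ j0 (mem_chart_at (y 0 t))) fcoord_id.
  have e2 : v0 t = tchg j (chart_at (x t)) (x t) *m fcoord x j v0 t.
    by rewrite -(fcoord_comp _ (jx tab) (mem_chart_at (x t))) fcoord_id.
  by rewrite e1 vE yE -e2.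
apply: dmx_eps => e e0; have [d d0 H] := remainder e0.
have := @nbhsx_ballx _ R^o 0 d d0; apply: filterS => h hb.
have hd : `|h| < d by move: hb; rewrite /ball /= sub0r normrN.
have := H h hd t tab; rewrite add0r sE /f.
by [].
Qed.

End Step.

(** The differential of the coordinate change induced on TM: the velocity block picks up a second
    derivative of the transition map. *)
Definition vchange i j t (w : 'cV[R]_(n + n)) : 'cV[R]_(n + n) :=
  col_mx (tchg i j (x t) *m usubmx w)
    (mpd (jac (trans i j)) (chart i (x t)) (usubmx w) *m fcoord x i v0 t
     + tchg i j (x t) *m dsubmx w).

Lemma varies_chart i j t w : dom i (x t) -> dom j (x t) -> varies i t w ->
  varies j t (vchange i j t w).
Proof.
move=> ix jx [ni yE uE dw].
have oo := @open_ovl _ _ M i j.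
have du := dmx_usub dw; have dd := dmx_dsub dw.
have eu : (fun h => usubmx (state i (y h) (u h) t)) = (fun h => chart i (y h t)).
  by apply/funext => h; rewrite col_mxKu.
have ed : (fun h => dsubmx (state i (y h) (u h) t)) = (fun h => fcoord (y h) i (u h) t).
  by apply/funext => h; rewrite col_mxKd.
rewrite eu in du; rewrite ed in dd.
have o0 : ovl i j (chart i (y 0 t)) by rewrite yE; exact: ovl_chart.
have no : \forall h \near (0 : R), ovl i j (chart i (y h t)).
  by apply: ((mctsP _ _).1 (dmx_mcts du)); exact: open_nbhs_nbhs.
have nj : \forall h \near (0 : R), dom j (y h t).
  by near=> h; have [_] : ovl i j (chart i (y h t)) by [near: h]; rewrite chartK //; near: h.
split=> //.
have C1 := @trans_smooth _ _ M i j 1.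
have C2 : C_on 1 (ovl i j) (jac (trans i j)) by apply: jac_C => //; exact: trans_smooth.
have h1 := mpd_chain oo C1 du o0.
have h2 := dmxM (mpd_chain oo C2 du o0) dd.
have h0 := dmx_col h1 h2; rewrite yE in h0.
have f0 : fcoord (y 0) i (u 0) t = fcoord x i v0 t by rewrite /fcoord yE uE.
rewrite f0 -jacE -tchgE in h0.
apply: dmx_near_eq h0; near=> h.
have ih : dom i (y h t) by near: h.
have jh : dom j (y h t) by near: h.
rewrite /state /trans chartK // (fcoord_comp _ ih jh) tchgE.
by [].
Unshelve. all: by end_near. Qed.

Variable W : chart_index M -> R -> 'cV[R]_(n + n).
Hypothesis HW : forall j t, dom j (x t) ->
  dmx (W j) t (nfield_diff g V j t (state j x v0 t) *m W j t).
Hypothesis Wchange : forall i j t, dom i (x t) -> dom j (x t) -> vchange i j t (W i t) = W j t.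

(** Real induction in time carries the statement from chart to chart; on the overlaps [varies_chart]
    and the compatibility of [W] allow the switch. *)
Lemma variation_transport j0 : dom j0 (x 0) -> varies j0 0 (W j0 0) ->
  forall t, 0 <= t -> forall j, dom j (x t) -> varies j t (W j t).
Proof.
move=> j00 v00 t t0; have cx : continuous x by case: Nx.
suff H : varies (chart_at (x t)) t (W (chart_at (x t)) t).
  by move=> j jt; rewrite -(Wchange (mem_chart_at (x t)) jt); apply: varies_chart => //; exact: mem_chart_at.
pose P t := forall j, dom j (x t) -> varies j t (W j t).
have one i s : dom i (x s) -> varies i s (W i s) -> P s.
  by move=> is_ vs j js; rewrite -(Wchange is_ js); exact: varies_chart.
suff : P t by apply; exact: mem_chart_at.
apply: (@real_induction R P 0 t t0 _ _ _ t); last by rewrite t0 lexx.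
- exact: one v00.
- move=> s /andP[s0 st] H; set j := chart_at (x s).
  have [d d0 Hd] := near_dist (near_dom cx (mem_chart_at (x s))).
  exists d => // s' /andP[ss' s'd].
  have dj r : s <= r <= s' -> dom j (x r).
    by move=> /andP[sr rs']; apply: Hd; rewrite ger0_norm ?subr_ge0 // ltrBlDl (le_lt_trans rs').
  have vs : varies j s (W j s) by apply: (H s); [rewrite s0 lexx|exact: mem_chart_at].
  apply: (one j); first by apply: dj; rewrite lexx ltW.
  apply: (variation_step (ltW ss') dj _ vs); last by rewrite lexx ltW.
  by move=> r /dj; exact: HW.
move=> s /andP[s0 st] H; set j := chart_at (x s).
have [d d0 Hd] := near_dist (near_dom cx (mem_chart_at (x s))).
pose e := Num.min d s / 2.
have e0 : 0 < e by rewrite divr_gt0 // lt_min d0.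
have el : e < Num.min d s by rewrite ltr_pdivrMr // mulr_natr mulr2n ltrDl lt_min d0.
move: el; rewrite lt_min => /andP[ed es].
have dj r : s - e <= r <= s -> dom j (x r).
  move=> /andP[sr rs]; apply: Hd; rewrite distrC ger0_norm ?subr_ge0 //.
  by rewrite ltrBlDr -ltrBlDl (lt_le_trans _ sr) // ltrD2l ltrN2.
have le : s - e <= s by rewrite gerBl ltW.
have vs : varies j (s - e) (W j (s - e)).
  apply: (H (s - e)); first by rewrite subr_ge0 ltW //= ltrBlDr ltrDl.
  by apply: dj; rewrite lexx.
apply: (one j); first exact: mem_chart_at.
apply: (variation_step le dj _ vs); last by rewrite lexx le.
by move=> r /dj; exact: HW.
Qed.

End Variation.

(** * The linearised equation in an orthonormal frame *)

Section FrameAlgebra.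
Variables (R : realType) (n : nat).
Implicit Types (A B C G F T : 'M[R]_n).

Lemma frame_skew_algebra F B C G : F^T *m G *m F = 1%:M ->
  ((F *m B - C *m F)^T *m G + F^T *m (C^T *m G + G *m C)) *m F + F^T *m G *m (F *m B - C *m F) = 0 ->
  B^T = - B.
Proof.
move=> FGF; have -> : ((F *m B - C *m F)^T *m G + F^T *m (C^T *m G + G *m C)) *m F
   + F^T *m G *m (F *m B - C *m F) = B^T *m (F^T *m G *m F) + F^T *m G *m F *m B.
  rewrite linearB /= !trmx_mul mulmxDr !mulmxDl !mulmxBr !mulNmx !mulmxA.
  move: (_ *m F *m B) (B^T *m _ *m _ *m _) (_ *m C^T *m _ *m _) (_ *m C *m _) => a b c d.
  by apply/matrixP => i k; rewrite !mxE; ring.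
by rewrite FGF mulmx1 mul1mx => /eqP; rewrite addr_eq0 => /eqP.
Qed.

End FrameAlgebra.

Section Frame.
Variables (R : realType) (n : nat) (M : smooth_manifold R n) (g : riemannian_metric M).
Variable V : R -> M -> R.
Hypothesis sV : smooth_potential V.
Variable x : R -> M.
Hypothesis xC : Crit g V x.
Local Notation Gl := (metric_coord g).
Variable phi : R -> 'M[R]_n.
Hypothesis sphi : smooth_frame x phi.
Hypothesis ophi : forall t, (phi t)^T *m g (x t) *m phi t = 1%:M.

Lemma frame_unit t : phi t \in unitmx.
Proof. by have /mulmx1_unit[] := ophi t. Qed.

Lemma frame_inv t : invmx (phi t) = (phi t)^T *m g (x t).
Proof. by rewrite -[RHS]mulmx1 -(mulmxV (frame_unit t)) mulmxA ophi mul1mx. Qed.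

Lemma fcoord_frame i m (a : R -> 'M[R]_(n, m)) t :
  fcoord x i (fun s => phi s *m a s) t = fcoord x i phi t *m a t.
Proof. exact: mulmxA. Qed.

Lemma fcoord_frame_unit i t : dom i (x t) -> fcoord x i phi t \in unitmx.
Proof. by move=> ix; rewrite unitmx_mul frame_unit tchg_unit //; exact: mem_chart_at. Qed.

Local Notation vel := (fun i t => fcoord x i (velocity x) t).
Local Notation Gam i t := (gam (Gl i) (chart i (x t)) (fcoord x i (velocity x) t)).

(** The connection matrix of the frame, [phi^-1] times the covariant derivative of [phi]; [frame_Q]
    below is the endomorphism R(., x') x' + Hess V in the same frame. *)
Definition frame_B t : 'M[R]_n :=
  invmx (phi t) *m (derive1 (fcoord x (chart_at (x t)) phi) t
    + gam (Gl (chart_at (x t))) (chart (chart_at (x t)) (x t)) (velocity x t) *m phi t).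

Definition frame_Q t : 'M[R]_n :=
  invmx (phi t) *m Qchart g V (chart_at (x t)) t (chart (chart_at (x t)) (x t)) (velocity x t)
  *m phi t.

Lemma frame_dmx i t : dom i (x t) ->
  dmx (fcoord x i phi) t (fcoord x i phi t *m frame_B t - Gam i t *m fcoord x i phi t).
Proof.
move=> ix; have cp := mem_chart_at (x t).
have d := derivable_dmx (@sphi (chart_at (x t)) 0%N t cp).
have := field_change g (crit_cts xC) cp ix (crit_chart_dmx xC cp) d.
rewrite -(fcoord_comp _ cp ix) /frame_B !fcoord_id => H.
rewrite {1}/fcoord -!mulmxA (mulmxA (phi t)) (mulmxV (frame_unit t)) mul1mx.
exact: H.
Qed.

Lemma frame_Qchart i t : dom i (x t) ->
  Qchart g V i t (chart i (x t)) (vel i t) *m fcoord x i phi t = fcoord x i phi t *m frame_Q t.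
Proof.
move=> ix; have cp := mem_chart_at (x t).
rewrite /frame_Q [fcoord x i phi t]/fcoord -!mulmxA (mulmxA (phi t)) (mulmxV (frame_unit t)) mul1mx.
rewrite (mulmxA (tchg _ _ _) (Qchart _ _ _ _ _ _)) (Qchart_change g sV _ _ cp ix).
by rewrite mulmxA.
Qed.

Lemma frame_gram i t : dom i (x t) ->
  (fcoord x i phi t)^T *m Gl i (chart i (x t)) *m fcoord x i phi t = 1%:M.
Proof.
move=> ix; have cp := mem_chart_at (x t).
rewrite metric_coordE // /fcoord; have e := tchgK cp ix; have o := ophi t.
move: (tchg i _ _) (tchg _ i _) e (g (x t)) (phi t) o => T' T e G F o.
rewrite trmx_mul -!mulmxA (mulmxA T') e mul1mx (mulmxA T^T) -trmx_mul e trmx1 mul1mx.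
by rewrite mulmxA.
Qed.

(** Obtained by differentiating the orthonormality relation and using metric compatibility. *)
Lemma frame_B_skew t : (frame_B t)^T = - frame_B t.
Proof.
set i := chart_at (x t); have ix : dom i (x t) by exact: mem_chart_at.
have oi := @open_img _ _ M i; have Gs := metric_coord_smooth g i.
have dq := crit_chart_dmx xC ix.
have iq := img_chart ix.
have Gu q : img i q -> Gl i q \in unitmx by exact: metric_coord_unit.
have dG := mpd_chain oi (Gs 1%N) dq iq.
rewrite (metric_compat (metric_coord_sym g i) Gu _ iq) in dG.
have df := frame_dmx ix.
apply: (@frame_skew_algebra R n (fcoord x i phi t) _ (Gam i t) _ (frame_gram ix)).
  apply: dmx_uniq (dmxM (dmxM (dmx_tr df) dG) df) _.
  apply: dmx_near_eq (dmx_cst 1%:M t); apply: filterS (near_dom (crit_cts xC) ix) => s js.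
  by rewrite frame_gram.
Qed.

Lemma frame_Q_sym t : (frame_Q t)^T = frame_Q t.
Proof.
set i := chart_at (x t); have ix : dom i (x t) by exact: mem_chart_at.
have := Qchart_sym g sV t (velocity x t) (img_chart ix).
rewrite /frame_Q frame_inv -(metric_coord_at g (x t)) -/i.
move: (Gl i _) (Qchart _ _ _ _ _ _) => G Q GQ.
by rewrite -(mulmxA _ G Q) !trmx_mul trmxK -trmx_mul GQ -!mulmxA.
Qed.

Lemma frame_cts i t : dom i (x t) -> mcts (fcoord x i phi) t.
Proof. by move=> ix; exact: dmx_mcts (frame_dmx ix). Qed.

Lemma chart_crit_cts i t : dom i (x t) -> mcts (fun s => chart i (x s)) t.
Proof. by move=> ix; exact: dmx_mcts (crit_chart_dmx xC ix). Qed.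

Lemma velocity_cts i t : dom i (x t) -> mcts (vel i) t.
Proof. by move=> ix; have [_ d] := newton_chart sV (crit_newton xC) ix; exact: dmx_mcts d. Qed.

Lemma Gam_cts i t : dom i (x t) -> mcts (fun s => Gam i s) t.
Proof.
move=> ix; have Gu q : img i q -> Gl i q \in unitmx by exact: metric_coord_unit.
exact: (gam_mcts (@open_img _ _ M i) (metric_coord_smooth g i) Gu (chart_crit_cts ix)
  (velocity_cts ix) (img_chart ix)).
Qed.

Lemma frame_B_cts t : mcts frame_B t.
Proof.
set i := chart_at (x t); have ix : dom i (x t) by exact: mem_chart_at.
apply: (@mcts_near_eq _ _ _ _ (fun s => invmx (fcoord x i phi s) *m
   (derive1 (fcoord x i phi) s + Gam i s *m fcoord x i phi s))).
  apply: filterS (near_dom (crit_cts xC) ix) => s is_.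
  have [_ ->] := dmx_derive1 (frame_dmx is_).
  by rewrite subrK mulKmx // fcoord_frame_unit.
have cf := frame_cts ix.
apply: mctsM; first by apply: mctsV => //; exact: fcoord_frame_unit.
apply: mctsD; last by apply: mctsM => //; exact: Gam_cts.
exact: (dmx_mcts (derivable_dmx (@sphi i 1%N t ix))).
Qed.

Lemma frame_Q_cts t : mcts frame_Q t.
Proof.
set i := chart_at (x t); have ix : dom i (x t) by exact: mem_chart_at.
apply: (@mcts_near_eq _ _ _ _ (fun s => invmx (fcoord x i phi s) *m
   (Qchart g V i s (chart i (x s)) (vel i s) *m fcoord x i phi s))).
  apply: filterS (near_dom (crit_cts xC) ix) => s is_.
  by rewrite frame_Qchart // mulKmx // fcoord_frame_unit.
have cf := frame_cts ix.
apply: mctsM; first by apply: mctsV => //; exact: fcoord_frame_unit.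
apply: mctsM => //.
exact: (Qchart_mcts sV (f := fun s : R => s) cvg_id (chart_crit_cts ix) (velocity_cts ix) (img_chart ix)).
Qed.

(** The dictionary between the frame and covariant calculus: for xi = [phi a] and eta = [phi b], the
    system says that eta is the covariant derivative of xi and that the covariant derivative of eta
    is - Q xi - lam xi. *)
Lemma frame_ode i t lam m (a b : R -> 'M[R]_(n, m)) : dom i (x t) ->
  dmx a t (- (frame_B t *m a t) + b t) ->
  dmx b t (- ((frame_Q t + lam%:M) *m a t) - frame_B t *m b t) ->
  dmx (fcoord x i (fun s => phi s *m a s)) t
    (fcoord x i (fun s => phi s *m b s) t - Gam i t *m fcoord x i (fun s => phi s *m a s) t) /\
  dmx (fcoord x i (fun s => phi s *m b s)) t
    (- (Gam i t *m fcoord x i (fun s => phi s *m b s) t)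
     - Qchart g V i t (chart i (x t)) (vel i t) *m fcoord x i (fun s => phi s *m a s) t
     - lam *: fcoord x i (fun s => phi s *m a s) t).
Proof.
move=> ix da db.
have fE c : fcoord x i (fun s => phi s *m c s) = (fun s => fcoord x i phi s *m c s : 'M[R]_(n, m)).
  by apply/funext => s; exact: fcoord_frame.
rewrite !fE; have df := frame_dmx ix.
have H1 := dmxM df da; have H2 := dmxM df db.
have FQ := frame_Qchart ix.
have alg1 (F A C : 'M[R]_n) (u v : 'M[R]_(n, m)) :
    (F *m A - C *m F) *m u + F *m (- (A *m u) + v) = F *m v - C *m (F *m u).
  rewrite mulmxBl mulmxDr mulmxN !mulmxA; move: (F *m A *m u) (C *m F *m u) (F *m v) => p q r.
  by apply/matrixP => k l; rewrite !mxE; ring.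
have alg2 (F A C Q Q' : 'M[R]_n) (u v : 'M[R]_(n, m)) : Q' *m F = F *m Q ->
    (F *m A - C *m F) *m v + F *m (- ((Q + lam%:M) *m u) - A *m v) =
    - (C *m (F *m v)) - Q' *m (F *m u) - lam *: (F *m u).
  move=> e; rewrite [Q' *m _]mulmxA e mulmxBl !mulmxDl mulmxDr !mulmxN mulmxDr mul_scalar_mx -scalemxAr !mulmxA.
  move: (F *m A *m v) (C *m F *m v) (F *m Q *m u) (lam *: _) => p q r s.
  by apply/matrixP => k l; rewrite !mxE; ring.
split; first exact: (eq_ind _ (fun w => dmx _ t w) H1 _ (alg1 _ _ _ _ _)).
exact: (eq_ind _ (fun w => dmx _ t w) H2 _ (alg2 _ _ _ _ _ _ _ FQ)).
Qed.

Lemma frame_ode_inv i t (a b : R -> 'cV[R]_n) : dom i (x t) ->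
  dmx (fcoord x i (fun s => phi s *m a s)) t
    (fcoord x i phi t *m b t - Gam i t *m (fcoord x i phi t *m a t)) ->
  dmx a t (- (frame_B t *m a t) + b t).
Proof.
move=> ix da.
have df := frame_dmx ix; have fu := fcoord_frame_unit ix.
have H := dmxM (dmxV df fu) da.
apply: (@dmx_near_eq _ _ _ (fun s => invmx (fcoord x i phi s) *m fcoord x i (fun s => phi s *m a s) s)).
  apply: filterS (near_dom (crit_cts xC) ix) => s is_.
  by rewrite fcoord_frame mulKmx // fcoord_frame_unit.
rewrite fcoord_frame in H.
have alg (F A C : 'M[R]_n) (u v : 'cV[R]_n) : F \in unitmx ->
    - (invmx F *m (F *m A - C *m F) *m invmx F) *m (F *m u) + invmx F *m (F *m v - C *m (F *m u))
    = - (A *m u) + v.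
  move=> Fu; rewrite mulNmx !mulmxBr !mulmxBl !mulmxA !(mulVmx Fu) !mul1mx !mulmxKV //.
  by move: (A *m u) (_ *m u) => p q; apply/matrixP => k l; rewrite !mxE; ring.
exact: (eq_ind _ (fun w => dmx _ t w) H _ (alg _ _ _ _ _ fu)).
Qed.

(* The linearised Newton field along [x], for the coordinates (position, velocity)
   of TM; [Gam] converts covariant into coordinate derivatives. *)
Definition wvar (a b : R -> 'cV[R]_n) i t : 'cV[R]_(n + n) :=
  col_mx (fcoord x i (fun s => phi s *m a s) t)
    (fcoord x i (fun s => phi s *m b s) t - Gam i t *m fcoord x i (fun s => phi s *m a s) t).

Lemma wvar_dmx (a b : R -> 'cV[R]_n) i t : dom i (x t) ->
  dmx a t (- (frame_B t *m a t) + b t) ->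
  dmx b t (- (frame_Q t *m a t) - frame_B t *m b t) ->
  dmx (wvar a b i) t (nfield_diff g V i t (state i x (velocity x) t) *m wvar a b i t).
Proof.
move=> ix da db.
have [] := @frame_ode i t 0 1 a b ix da _.
  by rewrite raddf0 addr0.
set xi := fcoord x i _; set eta := fcoord x i _; rewrite scale0r subr0 => dxi deta.
have [dq dv] := newton_chart sV (crit_newton xC) ix.
have Gu q : img i q -> Gl i q \in unitmx by exact: metric_coord_unit.
have oi := @open_img _ _ M i; have Gs := metric_coord_smooth g i; have iq := img_chart ix.
have dG := gam_dmx oi Gs Gu dq dv iq.
have H := dmx_col dxi (dmxB deta (dmxM dG dxi)).
rewrite (@nfield_diffE R n M g V sV); last exact: state_img.
rewrite !col_mxKu !col_mxKd.
have gs := gam_sym (metric_coord_sym g i) (chart i (x t)).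
have ds := dgam_sym oi Gs (metric_coord_sym g i) Gu _ _ _ iq.
have KE := KmxE oi Gs Gu (vel i t) (xi t) iq.
have e1 := gs (vel i t) (xi t).
have e2 := gs (xi t) (Gam i t *m vel i t).
have e3 := ds (vel i t) (xi t) (vel i t).
have e4 := gs (gradient (Gl i) (Vslice V i t) (chart i (x t))) (xi t).
(* The differential of the Newton field contains only derivatives of Christoffel matrices and of the
   gradient. Expanding curvature and Hessian in the same terms is what identifies the linearised
   equation with the Jacobi equation. *)
have eK : Qchart g V i t (chart i (x t)) (vel i t) *m xi t =
  dgam (Gl i) (chart i (x t)) (xi t) (vel i t) *m vel i t
  - dgam (Gl i) (chart i (x t)) (vel i t) (vel i t) *m xi t
  + (gam (Gl i) (chart i (x t)) (Gam i t *m vel i t) *m xi t - Gam i t *m (Gam i t *m xi t))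
  + (mpd (gradient (Gl i) (Vslice V i t)) (chart i (x t)) (xi t)
     + gam (Gl i) (chart i (x t)) (gradient (Gl i) (Vslice V i t) (chart i (x t))) *m xi t).
  rewrite /Qchart mulmxDl KE /Rm mulmxDl !mulmxBl e3 -!mulmxA e2 -e1 /Hmx mulmxDl -jacE.
  by [].
have E : - (Gam i t *m eta t) - Qchart g V i t (chart i (x t)) (vel i t) *m xi t
   - ((dgam (Gl i) (chart i (x t)) (vel i t) (vel i t)
       + gam (Gl i) (chart i (x t)) (- (Gam i t *m vel i t) - gradient (Gl i) (Vslice V i t) (chart i (x t))))
        *m xi t + Gam i t *m (eta t - Gam i t *m xi t)) =
   - (dgam (Gl i) (chart i (x t)) (xi t) (vel i t) *m vel i t
      + mpd (gradient (Gl i) (Vslice V i t)) (chart i (x t)) (xi t))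
   - (Gam i t *m (eta t - Gam i t *m xi t) + Gam i t *m (eta t - Gam i t *m xi t)).
  rewrite eK gamD !gamN !mulmxDl !mulNmx !mulmxBr.
  move: (gam _ _ _ *m xi t) (dgam _ _ (xi t) _ *m _) (dgam _ _ _ _ *m xi t) (mpd _ _ _) (Gam i t *m eta t)
   (Gam i t *m (_ *m _)) (gam _ _ (Gam i t *m _) *m _) => a1 a2 a3 a4 a5 a6 a7.
  by apply/matrixP => k l; rewrite !mxE; ring.
exact: (eq_ind _ (fun w => dmx _ t (col_mx _ w)) H _ E).
Qed.

Lemma wvar_change (a b : R -> 'cV[R]_n) i j t : dom i (x t) -> dom j (x t) ->
  vchange x (velocity x) i j t (wvar a b i t) = wvar a b j t.
Proof.
move=> ix jx; rewrite /vchange /wvar !col_mxKu !col_mxKd.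
rewrite !(fcoord_comp _ ix jx); congr col_mx.
have gt := gam_tchg g (fcoord x i (velocity x) t) ix jx.
have sm := @mpd_jac_sym R n _ (@open_ovl _ _ M i j) n (trans i j) (chart i (x t))
  (fcoord x i (fun s => phi s *m a s) t) (fcoord x i (velocity x) t) (trans_smooth i j 2) (ovl_chart ix jx).
rewrite sm mulmxBr (mulmxA (tchg i j (x t)) (gam _ _ _)) gt mulmxDl -!mulmxA.
move: (mpd _ _ _ *m _) (tchg i j (x t) *m _) (gam _ _ _ *m _) => a1 a2 a3.
by apply/matrixP => k l; rewrite !mxE; ring.
Qed.

End Frame.

Section CotangentCoordinates.
Variables (R : realType) (n : nat) (M : smooth_manifold R n) (g : riemannian_metric M).
Local Notation Gl := (metric_coord g).
Implicit Types (i : chart_index M).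

Lemma cot_connectionE (G : 'cV[R]_n -> 'M[R]_n) q y w :
  cot_connection G q y *m w = (gam G q w)^T *m y.
Proof.
apply/matrixP => k l; rewrite !mxE.
rewrite (ord1 l); under eq_bigr do rewrite mxE mulr_suml; rewrite exchange_big; apply: eq_bigr => c _.
rewrite mxE [gam _ _ _ _ _]mxE mulr_suml; apply: eq_bigr => a _.
by rewrite mulrAC; congr (_ * _); exact: mulrC.
Qed.

Lemma cot_velocity i (z : M * 'cV[R]_n) : dom i z.1 ->
  dsubmx (cot_coord i z) =
  Gl i (chart i z.1) *m (tchg (chart_at z.1) i z.1 *m (invmx (g z.1) *m z.2)).
Proof.
move=> iz; have cp := mem_chart_at z.1.
rewrite metric_coordE // col_mxKd -!mulmxA (mulmxA (tchg i _ _) (tchg _ i _)) tchgK // mul1mx.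
by rewrite (mulmxA (g _)) mulmxV ?mul1mx //; exact: metric_unit.
Qed.

Lemma cot_coordK i (u : 'cV[R]_(n + n)) : img i (usubmx u) -> cot_coord i (cot_point i u) = u.
Proof.
move=> iu; have [ip pE] := img_dom iu.
rewrite /cot_coord /cot_point /= pE mulmxA -trmx_mul.
by rewrite tchgK // ?trmx1 ?mul1mx ?vsubmxK //; exact: mem_chart_at.
Qed.

Lemma cot_pointK (z : M * 'cV[R]_n) : cot_point (chart_at z.1) (cot_coord (chart_at z.1) z) = z.
Proof.
have cp := mem_chart_at z.1.
rewrite /cot_point /cot_coord col_mxKu col_mxKd chartK // tchg_id // trmx1 !mul1mx.
by case: z cp.
Qed.

Lemma cot_coord_at (z : M * 'cV[R]_n) :
  cot_coord (chart_at z.1) z = col_mx (chart (chart_at z.1) z.1) z.2.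
Proof. by rewrite /cot_coord tchg_id ?trmx1 ?mul1mx //; exact: mem_chart_at. Qed.

Lemma split_cotE (z : M * 'cV[R]_n) w p : split_cot g z *m col_mx w p =
  col_mx w (p - (gam (Gl (chart_at z.1)) (chart (chart_at z.1) z.1) w)^T *m z.2).
Proof.
rewrite /split_cot mul_block_col !mul1mx mul0mx addr0 mulNmx cot_connectionE.
by rewrite addrC.
Qed.

Lemma split_cot_unit (z : M * 'cV[R]_n) : split_cot g z \in unitmx.
Proof. by rewrite unitmxE /split_cot det_lblock !det1 mulr1 unitr1. Qed.

End CotangentCoordinates.

Section Pencil.
Variables (R : realType) (n : nat).

(** The first-order form of - (d/dt + B)^2 a - Q a = lam a, with second component b = a' + B a. *)
Definition pencil (B Q : R -> 'M[R]_n) (lam : R) t : 'M[R]_(n + n) :=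
  block_mx (- B t) 1%:M (- (Q t + lam%:M)) (- B t).

Lemma pencil_cts B Q lam t : mcts B t -> mcts Q t -> mcts (pencil B Q lam) t.
Proof.
move=> cB cQ; apply: mcts_block; [exact: mctsN|exact: mcts_cst| |exact: mctsN].
by apply: mctsN; apply: mctsD => //; exact: mcts_cst.
Qed.

Lemma Umat0 : @Umat R n 0 = 1%:M.
Proof.
have E c : @diagn R n c c = c%:M.
  by apply/matrixP => k l; rewrite !mxE; case: ifP.
rewrite /Umat mulr0 cos0 sin0 oppr0 !E [RHS]scalar_mx_block; congr block_mx.
  by apply/matrixP => k l; rewrite !mxE mul0rn.
by apply/matrixP => k l; rewrite !mxE mul0rn.
Qed.

End Pencil.

Section LinearizedFlow.
Variables (R : realType) (n : nat) (M : smooth_manifold R n) (g : riemannian_metric M).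
Variable V : R -> M -> R.
Hypothesis sV : smooth_potential V.
Variable psi : R -> M * 'cV[R]_n -> M * 'cV[R]_n.
Hypothesis flow : ham_flow g V psi.
Variable x : R -> M.
Hypothesis xC : Crit g V x.
Variable phi : R -> 'M[R]_n.
Hypothesis sphi : smooth_frame x phi.
Hypothesis ophi : forall t, (phi t)^T *m g (x t) *m phi t = 1%:M.
Local Notation Gl := (metric_coord g).
Local Notation B := (frame_B g x phi).
Local Notation Q := (frame_Q g V x phi).

Let X := pencil B Q 0.
Let cX t : mcts X t.
Proof. exact: (pencil_cts (@frame_B_cts _ _ _ _ _ sV _ xC _ sphi ophi t) (@frame_Q_cts _ _ _ _ _ sV _ xC _ sphi ophi t)). Qed.

Lemma mulmx_delta_inj p m (A A' : 'M[R]_(p, m)) :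
  (forall k, A *m (delta_mx k ord0 : 'cV[R]_m) = A' *m delta_mx k ord0) -> A = A'.
Proof.
move=> H; apply/matrixP => i j.
by have := congr1 (fun Z : 'cV[R]_p => Z i ord0) (H j); rewrite -!colE !mxE.
Qed.

Lemma Phi_frame t (a b : 'cV[R]_n) :
  Phi phi t *m col_mx a b = col_mx (phi t *m a) (g (x t) *m (phi t *m b)).
Proof.
have E : invmx (phi t)^T = g (x t) *m phi t.
  have u : (phi t)^T \in unitmx by rewrite unitmx_tr (frame_unit ophi).
  by rewrite -[LHS]mulmx1 -(ophi t) -!mulmxA mulKmx.
by rewrite /Phi mul_block_col E !mul0mx addr0 add0r mulmxA.
Qed.

Lemma Phi_unit t : Phi phi t \in unitmx.
Proof.
by rewrite unitmxE /Phi det_ublock unitrM -!unitmxE unitmx_inv unitmx_tr !(frame_unit ophi).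
Qed.

Let z0 := Defs.orbit g x 0.
Let i0 := chart_at (x 0).

Section Direction.
Variable k : 'I_(n + n).
Let e : 'cV[R]_(n + n) := delta_mx k ord0.
(** Initial points moving from [z0] along the coordinate direction [e]; [y h] and [u h] are base
    point and velocity of the orbit through them, and [ab] is the expected variation in the
    frame. *)
Let zh (h : R) := cot_point i0 (cot_coord i0 z0 + h *: e).
Let y h t := (psi t (zh h)).1.
Let u h t := invmx (g (y h t)) *m (psi t (zh h)).2.
Let ab t := fundamental X t *m (invmx (Phi phi 0) *m (split_cot g z0 *m e)).
Let a t := usubmx (ab t).
Let b t := dsubmx (ab t).

Let zh0 : zh 0 = z0.
Proof. by rewrite /zh scale0r addr0; exact: (cot_pointK z0). Qed.

Let Ny h : newton g V (y h) (u h). Proof. exact: (flow_newton sV flow (zh h)). Qed.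

Let dab t : dmx ab t (X t *m ab t).
Proof.
have := dmxM (fundamental_dmx cX t) (dmx_cst (invmx (Phi phi 0) *m (split_cot g z0 *m e)) t).
by rewrite mulmx0 addr0 -mulmxA.
Qed.

Let Xab t : X t *m ab t = col_mx (- (B t *m a t) + b t) (- (Q t *m a t) - B t *m b t).
Proof.
by rewrite -[ab t]vsubmxK mul_block_col -/(a t) -/(b t) !mulNmx mul1mx raddf0 addr0.
Qed.

Let da t : dmx a t (- (B t *m a t) + b t).
Proof. by have := dmx_usub (dab t); rewrite Xab col_mxKu. Qed.

Let db t : dmx b t (- (Q t *m a t) - B t *m b t).
Proof. by have := dmx_dsub (dab t); rewrite Xab col_mxKd. Qed.

Let init_eq : phi 0 *m a 0 = usubmx e /\
  g (x 0) *m (phi 0 *m b 0) = dsubmx e - (gam (Gl i0) (chart i0 (x 0)) (usubmx e))^T *m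
    (g (x 0) *m velocity x 0).
Proof.
have := split_cotE g z0 (usubmx e) (dsubmx e); rewrite vsubmxK => E.
have E2 : split_cot g z0 *m e = Phi phi 0 *m col_mx (a 0) (b 0).
  by rewrite /a /b vsubmxK /ab fundamental0 mul1mx mulKVmx // Phi_unit.
rewrite E2 Phi_frame in E.
by have [e1 e2] := eq_col_mx E.
Qed.

Let varies0 : varies x (velocity x) y u i0 0 (wvar g x phi a b i0 0).
Proof.
have ix : dom i0 (x 0) by exact: mem_chart_at.
have iq := img_chart ix; have oi := @open_img _ _ M i0.
have psi0 z : psi 0 z = z by have [] := flow z.
have c0E : cot_coord i0 z0 = col_mx (chart i0 (x 0)) (g (x 0) *m velocity x 0).
  exact: cot_coord_at.
have cE h : cot_coord i0 z0 + h *: e =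
   col_mx (chart i0 (x 0) + h *: usubmx e) (g (x 0) *m velocity x 0 + h *: dsubmx e).
  by rewrite -{1}[e]vsubmxK c0E scale_col_mx add_col_mx.
have nq : \forall h \near (0 : R), img i0 (chart i0 (x 0) + h *: usubmx e).
  have c0 := dmx_mcts (dmx_line (chart i0 (x 0)) (usubmx e) 0).
  apply: ((mctsP _ _).1 c0); rewrite scale0r addr0.
  exact: (open_nbhs_nbhs (conj oi iq)).
have good h : img i0 (chart i0 (x 0) + h *: usubmx e) -> dom i0 (y h 0) /\
    state i0 (y h) (u h) 0 = col_mx (chart i0 (x 0) + h *: usubmx e)
      (invmx (Gl i0 (chart i0 (x 0) + h *: usubmx e)) *m (g (x 0) *m velocity x 0 + h *: dsubmx e)).
  move=> ih; have [ip pE] := img_dom ih.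
  have y0E : y h 0 = chart_inv i0 (chart i0 (x 0) + h *: usubmx e).
    by rewrite /y psi0 /zh cE /cot_point col_mxKu.
  have iy : dom i0 (y h 0) by rewrite y0E.
  have qE : chart i0 (y h 0) = chart i0 (x 0) + h *: usubmx e by rewrite y0E pE.
  split=> //; rewrite /state qE; congr col_mx.
  have := @cot_velocity R n M g i0 (psi 0 (zh h)) iy.
  rewrite -/(y h 0) -/(u h 0) -/(fcoord (y h) i0 (u h) 0) qE psi0 /zh cot_coordK; last first.
    by rewrite cE col_mxKu.
  rewrite cE col_mxKd => ->; rewrite mulKmx //; exact: metric_coord_unit.
split.
- by apply: filterS nq => h /good[].
- by rewrite /y zh0 psi0.
- by rewrite /u /y zh0 psi0 /z0 /Defs.orbit /= mulKmx //; exact: metric_unit.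
have dq := mpd_line oi (usubmx e) (metric_coord_smooth g i0 1) iq.
have Gu := metric_coord_unit g iq.
have Gu0 : Gl i0 (chart i0 (x 0) + 0 *: usubmx e) \in unitmx by rewrite scale0r addr0.
have dv := dmxM (dmxV dq Gu0) (dmx_line (g (x 0) *m velocity x 0) (dsubmx e) 0).
have H := dmx_col (dmx_line (chart i0 (x 0)) (usubmx e) 0) dv.
apply: dmx_near_eq; first by apply: filterS nq => h /good[_ ->].
move: H; rewrite !scale0r !addr0 => H.
have [e1 e2] := init_eq.
have Gall q : img i0 q -> Gl i0 q \in unitmx by exact: metric_coord_unit.
have mc := metric_compat (metric_coord_sym g i0) Gall (usubmx e) iq.
have gE : Gl i0 (chart i0 (x 0)) = g (x 0) by exact: metric_coord_at.
have gs := gam_sym (metric_coord_sym g i0) (chart i0 (x 0)) (usubmx e) (velocity x 0).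
have alg (G G' N A C : 'M[R]_n) (v d q b0 : 'cV[R]_n) : G \in unitmx -> G' = G ->
    N = A^T *m G' + G' *m A -> A *m v = C *m q -> G *m b0 = d - A^T *m (G *m v) ->
    - (invmx G' *m N *m invmx G') *m (G *m v) + invmx G' *m d = b0 - C *m q.
  move=> Gu' -> -> Av eb; rewrite -Av -[b0](mulKmx Gu') eb mulmxBr mulmxDr mulKmx // mulNmx.
  rewrite mulmxDl mulmxDl -!mulmxA !(mulKmx Gu').
  move: (invmx G *m d) (A *m v) (invmx G *m (A^T *m _)) => p1 p2 p3.
  by apply/matrixP => k' l; rewrite !mxE; ring.
rewrite /wvar !fcoord_id e1.
exact: (eq_ind _ (fun w => dmx _ 0 (col_mx _ w)) H _ (alg _ _ _ _ _ _ _ _ _ (metric_unit g (x 0)) gE mc gs e2)).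
Qed.

Let varies_t t : 0 <= t -> forall j, dom j (x t) ->
  varies x (velocity x) y u j t (wvar g x phi a b j t).
Proof.
apply: (@variation_transport R n M g V sV x (velocity x) y u (crit_newton xC) Ny
  (wvar g x phi a b) _ _ i0); last exact: varies0.
- by move=> j t' jt; exact: wvar_dmx.
- by move=> i j t' ix jx; exact: wvar_change.
- exact: mem_chart_at.
Qed.

(** That the orbit through [z0] follows the critical loop is the member [h = 0] of the variation; no
    separate uniqueness theorem is invoked. *)
Lemma flow_orbit t : 0 <= t -> psi t z0 = Defs.orbit g x t.
Proof.
move=> t0; have [_ yE uE _] := varies_t t0 (mem_chart_at (x t)).
move: uE; rewrite /u yE -zh0 => uE.
rewrite [LHS]surjective_pairing -/(y 0 t) yE /Defs.orbit; congr pair.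
by rewrite -uE mulKVmx //; exact: metric_unit.
Qed.

(** The variation is known for velocities. Passing to momenta differentiates the metric, and metric
    compatibility cancels this against the Christoffel term of [split_cot], leaving [g phi b]. *)
Lemma linearized_flow_dir t : 0 <= t ->
  split_cot g (psi t z0) *m (cot_diff (psi t) z0 *m e) =
  Phi phi t *m (fundamental X t *m (invmx (Phi phi 0) *m (split_cot g z0 *m e))).
Proof.
move=> t0; set j := chart_at (x t); have jx : dom j (x t) by exact: mem_chart_at.
have zt := flow_orbit t0.
have [nd yE uE dst] := varies_t t0 jx.
have oi := @open_img _ _ M j; have iq := img_chart jx.
have dq := dmx_usub dst; have dv := dmx_dsub dst.
have eq : (fun h => usubmx (state j (y h) (u h) t)) = (fun h => chart j (y h t)).
  by apply/funext => h; rewrite col_mxKu.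
have ev : (fun h => dsubmx (state j (y h) (u h) t)) = (fun h => fcoord (y h) j (u h) t).
  by apply/funext => h; rewrite col_mxKd.
rewrite eq in dq; rewrite ev in dv.
have i0q : img j (chart j (y 0 t)) by rewrite yE.
have dG := mpd_chain oi (metric_coord_smooth g j 1) dq i0q.
have H := dmx_col dq (dmxM dG dv).
have v0 : fcoord (y 0) j (u 0) t = velocity x t by rewrite /fcoord yE uE tchg_id ?mul1mx.
rewrite /wvar !col_mxKu !col_mxKd !fcoord_id v0 yE in H.
have {H} H : dmx (fun h => cot_coord j (psi t (zh h))) 0
   (col_mx (phi t *m a t) (mpd (Gl j) (chart j (x t)) (phi t *m a t) *m velocity x t +
      Gl j (chart j (x t)) *m (phi t *m b t - gam (Gl j) (chart j (x t)) (velocity x t) *m (phi t *m a t)))).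
  apply: dmx_near_eq H; apply: filterS nd => h jh.
  by rewrite -[RHS]vsubmxK (cot_velocity g jh) col_mxKu.
have {H} H : cot_diff (psi t) z0 *m e =
   col_mx (phi t *m a t) (mpd (Gl j) (chart j (x t)) (phi t *m a t) *m velocity x t +
      Gl j (chart j (x t)) *m (phi t *m b t - gam (Gl j) (chart j (x t)) (velocity x t) *m (phi t *m a t))).
  apply/matrixP => r l; rewrite (ord1 l) -colE mxE /jac mxE.
  apply: dir_derive; have := H r ord0; rewrite zt.
  by apply.
rewrite H split_cotE zt /= -/j.
have Gall q : img j q -> Gl j q \in unitmx by exact: metric_coord_unit.
have mc := metric_compat (metric_coord_sym g j) Gall (phi t *m a t) iq.
have gE : Gl j (chart j (x t)) = g (x t) by exact: metric_coord_at.
have gs := gam_sym (metric_coord_sym g j) (chart j (x t)) (phi t *m a t) (velocity x t).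
have alg (G G' N A C : 'M[R]_n) (v q b0 : 'cV[R]_n) : G' = G ->
    N = A^T *m G' + G' *m A -> A *m v = C *m q ->
    N *m v + G' *m (b0 - C *m q) - A^T *m (G *m v) = G *m b0.
  move=> -> -> Av; rewrite -Av mulmxDl mulmxBr -!mulmxA.
  move: (A^T *m _) (G *m (A *m v)) (G *m b0) => p1 p2 p3.
  by apply/matrixP => k' l; rewrite !mxE; ring.
rewrite (alg _ _ _ _ _ _ _ _ gE mc gs).
by rewrite -/(ab t) -[ab t]vsubmxK Phi_frame.
Qed.

End Direction.

Lemma linearized_flow t : 0 <= t ->
  invmx (Phi phi t) *m (split_cot g (psi t z0) *m cot_diff (psi t) z0 *m invmx (split_cot g z0))
    *m Phi phi 0 = fundamental X t.
Proof.
move=> t0.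
have E : split_cot g (psi t z0) *m cot_diff (psi t) z0 =
    Phi phi t *m fundamental X t *m invmx (Phi phi 0) *m split_cot g z0.
  by apply: mulmx_delta_inj => k; rewrite -!mulmxA; exact: linearized_flow_dir.
rewrite E (mulmxK (split_cot_unit g z0)) -!mulmxA mulKmx ?Phi_unit // mulVmx ?Phi_unit //.
by rewrite mulmx1.
Qed.

Lemma gammaE t : 0 <= t -> @Umat R n t \in unitmx ->
  gamma g psi x phi t = (if sigma x then @Umat R n t else 1%:M) *m fundamental X t.
Proof.
move=> t0 Uu; rewrite -(linearized_flow t0) /gamma /Phi_U -/z0.
case: (sigma x); last by rewrite mul1mx.
rewrite Umat0 invmx1 mulmx1 !mulmxA; congr (_ *m _ *m _ *m _ *m _).
have PU : Phi phi t *m invmx (@Umat R n t) \in unitmx by rewrite unitmx_mul Phi_unit unitmx_inv.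
have W : @Umat R n t *m invmx (Phi phi t) *m (Phi phi t *m invmx (@Umat R n t)) = 1%:M.
  by rewrite mulmxA mulmxKV ?Phi_unit // mulmxV.
by rewrite -[LHS]mul1mx -W mulmxK.
Qed.

End LinearizedFlow.

(** * The index of a deformed path *)

Section LinearFlows.
Variable R : realType.

(** A nondecreasing function that does not gain on [0, 1] is constant; this is how definiteness
    rules out solutions with boundary conditions. *)
Lemma is_derive_mono0 (f f' : R -> R) :
  (forall t : R, 0 <= t <= 1 -> is_derive t (1 : R) f (f' t)) ->
  (forall t, 0 <= t <= 1 -> 0 <= f' t) -> f 1 <= f 0 ->
  forall t, 0 < t < 1 -> f' t = 0.
Proof.
move=> df f0 f10 t t01.
have df1 s : 0 <= s <= 1 -> derivable f s 1 by move=> /df[].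
have mono : forall a b, 0 <= a -> a <= b -> b <= 1 -> f a <= f b.
  apply: ger0_derive1_ndecr.
  - by move=> s; rewrite in_itv /= => /andP[s0 s1]; apply: df1; rewrite !ltW.
  - move=> s; rewrite in_itv /= => /andP[s0 s1].
    have s01 : 0 <= s <= 1 by rewrite !ltW.
    by have [_] := df s s01; rewrite -derive1E => ->; exact: f0.
  by apply: derivable_within_continuous => s; rewrite in_itv /=; exact: df1.
have fE s : 0 <= s <= 1 -> f s = f 0.
  move=> /andP[s0 s1]; apply/eqP; rewrite eq_le (mono 0 s) // andbT.
  by apply: le_trans f10; exact: mono.
have [t0 t1] := andP t01.
have nt : \forall s \near t, f s = f 0.
  have : t \in `]0, 1[ by rewrite in_itv.
  move=> /near_in_itvoo; apply: filterS => s; rewrite in_itv /= => /andP[s0 s1].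
  by apply: fE; rewrite !ltW.
have t01' : 0 <= t <= 1 by rewrite !ltW.
have [_ <-] := df t t01'.
have : is_derive t (1 : R) f 0.
  have dc := is_derive_cst (f 0) t (1 : R).
  apply: near_eq_is_derive dc.
  by move: nt; apply: filterS => s ->.
by case.
Qed.

Lemma crossingP n (beta : R -> 'M[R]_(n + n)) t :
  crossing beta t <-> exists2 z : 'cV[R]_(n + n), z != 0 & beta t *m z = z.
Proof.
rewrite /crossing; split=> [/rowV0Pn[v /sub_kermxP vk v0]|[z z0 bz]].
  exists v^T; first by rewrite -trmx_eq0 trmxK.
  apply/eqP; rewrite -subr_eq0 -oppr_eq0 opprB -{1}[v^T]mul1mx -mulmxBl -[_ *m _]trmxK.
  by rewrite trmx_mul trmxK vk trmx0.
apply/rowV0Pn; exists z^T; last by rewrite trmx_eq0.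
by apply/sub_kermxP; rewrite -trmx_mul mulmxBl mul1mx bz subrr trmx0.
Qed.

(** The product with the transposed solution of the adjoint equation, with matrix [- X^T], is
    constant, which exhibits an inverse. *)
Lemma fundamental_unit N (X : R -> 'M[R]_N) : (forall t, mcts X t) ->
  forall t, fundamental X t \in unitmx.
Proof.
move=> cX t.
have cXT s : mcts (fun s => - (X s)^T) s by apply: mctsN; apply: mcts_tr.
pose F := fundamental X; pose G := fundamental (fun s => - (X s)^T).
have d s : dmx (fun s => (G s)^T *m F s) s 0.
  have := dmxM (dmx_tr (fundamental_dmx cXT s)) (fundamental_dmx cX s).
  by rewrite trmx_mul linearN /= trmxK mulmxN mulNmx mulmxA addNr.
have E : (G t)^T *m F t = 1%:M.
  have e0 : (G 0)^T *m F 0 = 1%:M by rewrite /G /F !fundamental0 trmx1 mulmx1.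
  have [t0|t0] := leP 0 t; first by rewrite -e0; exact: (dmx_cst_of0 t0 (fun s _ => d s)).
  by rewrite -e0; apply/esym; exact: (dmx_cst_of0 (ltW t0) (fun s _ => d s)).
by have [] := mulmx1_unit E.
Qed.

Lemma fundamental_uniq N p (X : R -> 'M[R]_N) (F : R -> 'M[R]_(N, p)) :
  (forall t, mcts X t) -> (forall t, dmx F t (X t *m F t)) -> forall s, F s = 0 -> forall t, F t = 0.
Proof.
move=> cX dF s Fs t; have FE := fundamentalE cX dF.
have F0 : F 0 = 0 by rewrite -[LHS](mulKmx (fundamental_unit cX s)) -FE Fs mulmx0.
by rewrite FE F0 mulmx0.
Qed.

Lemma Sp_fundamental n (M : R -> 'M[R]_(n + n)) : (forall t, mcts M t) ->
  (forall t, (M t)^T *m J0 R n + J0 R n *m M t = 0) -> forall t, Sp (fundamental M t).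
Proof.
move=> cM H t; apply/SpE; set Y := fundamental M.
have d s : dmx (fun s => (Y s)^T *m J0 R n *m Y s) s 0.
  have dY := fundamental_dmx cM s.
  have := dmxM (dmxM (dmx_tr dY) (dmx_cst (J0 R n) s)) dY.
  rewrite mulmx0 addr0 trmx_mul -/Y.
  have -> // : (Y s)^T *m (M s)^T *m J0 R n *m Y s + (Y s)^T *m J0 R n *m (M s *m Y s) = 0.
  by rewrite -!mulmxA -mulmxDr (mulmxA _ (J0 R n)) (mulmxA (J0 R n)) -mulmxDl H mul0mx mulmx0.
have e0 : (Y 0)^T *m J0 R n *m Y 0 = J0 R n by rewrite /Y !fundamental0 trmx1 mul1mx mulmx1.
have [t0|t0] := leP 0 t; first by rewrite -[RHS]e0; exact: (dmx_cst_of0 t0 (fun s _ => d s)).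
by rewrite -[RHS]e0; apply/esym; exact: (dmx_cst_of0 (ltW t0) (fun s _ => d s)).
Qed.

Lemma fundamental_scale N (X : R -> 'M[R]_N) (c : R) : (forall t, mcts X t) ->
  forall t, fundamental (fun s => c *: X (c * s)) t = fundamental X (c * t).
Proof.
move=> cX t.
have cid s : (fun s : R => c * s) @ s --> c * s.
  by apply: cvgM; [exact: cvg_cst|exact: cvg_id].
have cY s : mcts (fun s => c *: X (c * s)) s.
  by apply: mctsZ; [exact: cvg_cst|exact: (mcts_comp (f := fun s : R => c * s))].
have dF s : dmx (fun s => fundamental X (c * s)) s (c *: X (c * s) *m fundamental X (c * s)).
  have := dmx_comp (is_derive_mulr c s) (_ : dmx (fundamental X) (s * c) _).
  move=> /(_ _ (fundamental_dmx cX _)); rewrite scalemxAl mulrC.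
  by under eq_fun do rewrite mulrC.
by rewrite (fundamentalE cY dF) mulr0 fundamental0 mulmx1.
Qed.

(** The parameter derivative is a block of the fundamental solution of the doubled system [[X, X'],
    [0, X]], so its continuity in [s] follows from [fundamental_cts]. *)
Lemma fundamental_C1 N (X X' : R -> R -> 'M[R]_N) :
  (forall s r, mcts (fun q : R * R => X q.1 q.2) (s, r)) ->
  (forall s r, mcts (fun q : R * R => X' q.1 q.2) (s, r)) ->
  (forall s r, dmx (fun s => X s r) s (X' s r)) ->
  exists V : R -> R -> 'M[R]_N, [/\ forall s, V s 0 = 0,
    forall s r, dmx (V s) r (X s r *m V s r + X' s r *m fundamental (X s) r),
    forall s, dmx (fun s => fundamental (X s) 1) s (V s 1) &
    forall s, mcts (fun s => V s 1) s].
Proof.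
move=> cX cX' dX.
have slice (F : R -> R -> 'M[R]_N) : (forall s r, mcts (fun q : R * R => F q.1 q.2) (s, r)) ->
    forall s r, mcts (F s) r.
  move=> cF s r; apply: (mcts_comp (F := fun q : R * R => F q.1 q.2) (f := fun r => (s, r))).
    by apply: cvg_to_pair; [exact: cvg_cst|exact: cvg_id].
  exact: cF.
have cXs := slice _ cX; have cXs' := slice _ cX'.
pose BB s r : 'M[R]_(N + N) := block_mx (X s r) (X' s r) 0 (X s r).
have cBB s r : mcts (fun q : R * R => BB q.1 q.2) (s, r).
  by apply: mcts_block => //; exact: mcts_cst.
have cBs s r : mcts (BB s) r by apply: mcts_block => //; exact: mcts_cst.
pose F s r := fundamental (BB s) r.
have dF s r : dmx (F s) r (BB s r *m F s r) by exact: fundamental_dmx.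
have FE s r : BB s r *m F s r = col_mx
   (X s r *m usubmx (F s r) + X' s r *m dsubmx (F s r)) (X s r *m dsubmx (F s r)).
  by rewrite -{1}[F s r]vsubmxK mul_block_col mul0mx add0r.
have drE s r : rsubmx (dsubmx (F s r)) = fundamental (X s) r.
  rewrite -[RHS]mulmx1.
  have := @fundamentalE _ _ _ (X s) (fun r => rsubmx (dsubmx (F s r))) (cXs s) _ r.
  rewrite /F fundamental0 scalar_mx_block /block_mx col_mxKd row_mxKr; apply=> t.
  have := dmx_dsub (dF s t); rewrite FE col_mxKd => H.
  have {}H : dmx (fun r => rsubmx (dsubmx (F s r))) t (rsubmx (X s t *m dsubmx (F s t))).
    by move=> i j; rewrite mxE; under eq_fun do rewrite mxE; exact: H.
  by rewrite mulmx_rsub; exact: H.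
exists (fun s r => rsubmx (usubmx (F s r))).
have V0 s : rsubmx (usubmx (F s 0)) = 0.
  by rewrite /F fundamental0 scalar_mx_block /block_mx col_mxKu row_mxKr.
have dV s r : dmx (fun r => rsubmx (usubmx (F s r))) r
   (X s r *m rsubmx (usubmx (F s r)) + X' s r *m fundamental (X s) r).
  have := dmx_usub (dF s r); rewrite FE col_mxKu => H.
  have {}H : dmx (fun r => rsubmx (usubmx (F s r))) r
     (rsubmx (X s r *m usubmx (F s r) + X' s r *m dsubmx (F s r))).
    by move=> i j; rewrite mxE; under eq_fun do rewrite mxE; exact: H.
  by move: H; rewrite linearD /= -drE !mulmx_rsub.
split=> //.
- by move=> s; apply: (fundamental_derive (X := X) (X' := X') cXs cXs'
   (fun s r _ => dX s r) (fun r _ => cX s r) (fun r _ => cX' s r) (V0 s) (dV s)).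
move=> s i j.
have := @fundamental_cts R (N + N) R BB s cBs (fun r _ => cBB s r) (lshift N i) (rshift N j).
by rewrite !mxE => H; under eq_fun do rewrite !mxE; exact: H.
Qed.

End LinearFlows.

Section QuadraticForms.
Variables (R : realType) (n : nat).
Implicit Types (u v : 'cV[R]_n) (A : 'M[R]_n).

Definition qf A u : R := (u^T *m A *m u) ord0 ord0.

Lemma qfD A A' u : qf (A + A') u = qf A u + qf A' u.
Proof. by rewrite /qf mulmxDr mulmxDl mxaddE. Qed.

Lemma qfN A u : qf (- A) u = - qf A u.
Proof. by rewrite /qf mulmxN mulNmx mxoppE. Qed.

Lemma qfZ c A u : qf (c *: A) u = c * qf A u.
Proof. by rewrite /qf -scalemxAr -scalemxAl mxscaleE. Qed.

Lemma qf1 u : qf 1%:M u = \sum_i u i ord0 ^+ 2.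
Proof. by rewrite /qf mulmx1 mxE; apply: eq_bigr => i _; rewrite mxE expr2. Qed.

Lemma qf1_ge0 u : 0 <= qf 1%:M u.
Proof. by rewrite qf1 sumr_ge0 // => i _; rewrite sqr_ge0. Qed.

Lemma qf1_eq0 u : qf 1%:M u = 0 -> u = 0.
Proof.
rewrite qf1 => /eqP; rewrite psumr_eq0 => [/allP H|i _]; last by rewrite sqr_ge0.
apply/matrixP => i j; rewrite (ord1 j) mxE.
by have := H i (mem_index_enum i); rewrite sqrf_eq0 => /eqP.
Qed.

Lemma qf_le A u : qf A u <= nrm A * qf 1%:M u.
Proof.
have -> : qf A u = \sum_i \sum_j A i j * (u i ord0 * u j ord0).
  rewrite /qf -mulmxA mxE; apply: eq_bigr => i _; rewrite !mxE mulr_sumr.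
  by apply: eq_bigr => j _; rewrite mulrCA !mulrA.
rewrite /nrm mulr_suml; apply: ler_sum => i _; rewrite mulr_suml; apply: ler_sum => j _.
apply: le_trans (ler_norm _) _; rewrite normrM ler_wpM2l //.
have le k : u k ord0 ^+ 2 <= qf 1%:M u.
  by rewrite qf1 (bigD1 k) //= lerDl sumr_ge0 // => l _; rewrite sqr_ge0.
have := le i; have := le j; have := sqr_ge0 (`|u i ord0| - `|u j ord0|).
rewrite normrM sqrrB !real_normK ?num_real // mulr2n; lra.
Qed.

End QuadraticForms.

(** * Piecewise quadratic cut-off functions *)

Section CutoffFunctions.
Variable R : realType.
Implicit Types (t u h : R).

Definition pos u : R := (u + `|u|) / 2.

Lemma pos_ge u : 0 <= u -> pos u = u.
Proof. by move=> u0; rewrite /pos ger0_norm //; field. Qed.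

Lemma pos_le u : u <= 0 -> pos u = 0.
Proof. by move=> u0; rewrite /pos ler0_norm // subrr mul0r. Qed.

Lemma cvg_pos (T : topologicalType) (f : T -> R) (x : T) :
  f @ x --> f x -> (fun z => pos (f z)) @ x --> pos (f x).
Proof. by move=> cf; apply: cvgMl; apply: cvgD => //; exact: cvg_norm. Qed.

Lemma pos_sqr_derive u : is_derive u (1 : R) (fun v => pos v ^+ 2) (2 * pos u).
Proof.
apply/is_derive_epsP => e e0.
have := @nbhsx_ballx _ R^o 0 e e0; apply: filterS => h.
rewrite /ball /= sub0r normrN => he.
apply: (@le_trans _ _ (h ^+ 2)); last first.
  by rewrite -real_normK ?num_real // expr2 ler_wpM2r // ltW.
rewrite ler_norml; apply/andP.
have [u0|u0] := leP 0 u; have [uh|uh] := leP 0 (u + h).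
- by rewrite !pos_ge //; split; nra.
- by rewrite (pos_ge u0) (pos_le (ltW uh)); split; nra.
- by rewrite (pos_ge uh) (pos_le (ltW u0)); split; nra.
- by rewrite (pos_le (ltW uh)) (pos_le (ltW u0)); split; nra.
Qed.

Lemma pos_aff_derive a b t :
  is_derive t (1 : R) (fun s => pos (a * s + b) ^+ 2) (2 * a * pos (a * t + b)).
Proof.
have d : is_derive t (1 : R) (fun s => a * s + b) a.
  have := is_deriveD (is_derive_mulr a t) (is_derive_cst b t (1 : R)).
  rewrite addr0; have -> // : ((fun s => s * a) + cst b)%R = (fun s => a * s + b).
  by apply/funext => s; rewrite /= mulrC.
have := @is_derive1_comp R (fun v => pos v ^+ 2) (fun s => a * s + b) t _ _ (pos_sqr_derive (a * t + b)) d.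
by rewrite /GRing.scale /= mulrC => H; apply: is_derive_eq H _; rewrite /GRing.scale /= mulrCA mulrA.
Qed.

(** Squares of positive parts are C^1, which is what [regular_path] requires. On [0, 1], [th], [sp]
    and [el] rise from 0 to 1 on the three consecutive thirds. The slope of [th] at 0 is 6, not 0,
    so that the initial crossing is regular, and [el] has positive slope after 2/3. *)
Definition th t : R := 1 - pos (-3 * t + 1) ^+ 2.
Definition th' t : R := 6 * pos (-3 * t + 1).
(** The primitive of a tent on [1/3, 2/3] with peak at 1/2 and area 1, so that it joins both
    neighbouring stages with zero slope. *)
Definition sp t : R :=
  2 * (pos (3 * t + -1) ^+ 2 - 2 * pos (3 * t + - (3 / 2)) ^+ 2 + pos (3 * t + -2) ^+ 2).
Definition sp' t : R :=
  12 * (pos (3 * t + -1) - 2 * pos (3 * t + - (3 / 2)) + pos (3 * t + -2)).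
Definition el t : R := pos (3 * t + -2) ^+ 2.
Definition el' t : R := 6 * pos (3 * t + -2).

Lemma th_derive t : is_derive t (1 : R) th (th' t).
Proof.
have := is_deriveB (is_derive_cst (1 : R) t (1 : R)) (pos_aff_derive (-3) 1 t).
by move=> H; apply: is_derive_eq H _; rewrite sub0r /th'; ring.
Qed.

Lemma el_derive t : is_derive t (1 : R) el (el' t).
Proof. by apply: is_derive_eq (pos_aff_derive 3 (-2) t) _; rewrite /el'; ring. Qed.

Lemma sp_derive t : is_derive t (1 : R) sp (sp' t).
Proof.
have h1 := pos_aff_derive 3 (-1) t; have h3 := pos_aff_derive 3 (-2) t.
have h2 := @is_deriveZ _ _ _ (fun s : R => pos (3 * s + - (3 / 2)) ^+ 2) 2 t _ _ (pos_aff_derive 3 (- (3 / 2)) t).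
have H := @is_deriveZ _ _ _ _ 2 t _ _ (is_deriveD (is_deriveB h1 h2) h3).
by apply: is_derive_eq H _; rewrite /GRing.scale /= /sp'; ring.
Qed.

Lemma cvg_aff (a b : R) t : (fun s => a * s + b) @ t --> a * t + b.
Proof. by apply: cvgD; [apply: cvgM; [exact: cvg_cst|exact: cvg_id]|exact: cvg_cst]. Qed.

Lemma th'_cts t : th' @ t --> th' t.
Proof. by apply: cvgM; [exact: cvg_cst|exact/cvg_pos/cvg_aff]. Qed.

Lemma el'_cts t : el' @ t --> el' t.
Proof. by apply: cvgM; [exact: cvg_cst|exact/cvg_pos/cvg_aff]. Qed.

Lemma sp'_cts t : sp' @ t --> sp' t.
Proof.
apply: cvgM; first exact: cvg_cst.
apply: cvgD; last exact/cvg_pos/cvg_aff.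
apply: cvgB; first exact/cvg_pos/cvg_aff.
by apply: cvgM; [exact: cvg_cst|exact/cvg_pos/cvg_aff].
Qed.

Lemma derive_cts (f : R -> R) t d : is_derive t (1 : R) f d -> f @ t --> f t.
Proof. by move=> [df _]; exact: (differentiable_continuous ((derivable1_diffP _ _).1 df)). Qed.

Lemma cutoff_low t : 0 <= t <= 1 / 3 -> [/\ th t = 1 - (1 - 3 * t) ^+ 2, sp t = 0 & el t = 0].
Proof.
move=> /andP[t0 t1]; rewrite /th /sp /el !(pos_le (u := 3 * t + _)); try lra.
by rewrite pos_ge; [split; ring|lra].
Qed.

Lemma cutoff_mid t : 1 / 3 < t <= 2 / 3 -> [/\ th t = 1, 0 < sp t <= 1 & el t = 0].
Proof.
move=> /andP[t0 t1]; rewrite /th /sp /el (pos_le (u := -3 * t + 1)); last lra.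
rewrite (pos_le (u := 3 * t + -2)); last lra.
rewrite (pos_ge (u := 3 * t + -1)); last lra.
split; [by ring| |by ring].
have [h|h] := leP (3 * t + - (3 / 2)) 0; first by rewrite (pos_le h); apply/andP; split; nra.
by rewrite (pos_ge (ltW h)); apply/andP; split; nra.
Qed.

Lemma cutoff_high t : 2 / 3 <= t -> [/\ th t = 1, sp t = 1 & el t = (3 * t - 2) ^+ 2].
Proof.
move=> t0; rewrite /th /sp /el (pos_le (u := -3 * t + 1)); last lra.
rewrite !(pos_ge (u := 3 * t + _)); try lra.
by split; [ring|field|ring].
Qed.

Lemma th'_high t : 2 / 3 <= t -> th' t = 0.
Proof. by move=> t0; rewrite /th' pos_le ?mulr0 //; lra. Qed.

Lemma sp'_high t : 2 / 3 <= t -> sp' t = 0.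
Proof. by move=> t0; rewrite /sp' !pos_ge; try lra; field. Qed.

End CutoffFunctions.

(** * An energy identity for linear systems *)

Section Energy.
Variables (R : realType) (n : nat).
Implicit Types (z : R -> 'cV[R]_(n + n)) (a b c : R -> 'M[R]_n).

Definition dot2 (w : 'cV[R]_(n + n)) : R := ((usubmx w)^T *m dsubmx w) ord0 ord0.

(** The pairing of position and momentum has a derivative to which the skew block [b] does not
    contribute. *)
Lemma energy_derive (a b c : 'M[R]_n) z t : b^T = - b -> a^T = a ->
  dmx z t (block_mx (- b) a c (- b) *m z t) ->
  is_derive t (1 : R) (fun t => dot2 (z t)) (qf a (dsubmx (z t)) + qf c (usubmx (z t))).
Proof.
move=> bT aT dz; have du := dmx_usub dz; have dd := dmx_dsub dz.
have E : block_mx (- b) a c (- b) *m z t = col_mx (- b *m usubmx (z t) + a *m dsubmx (z t))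
    (c *m usubmx (z t) + - b *m dsubmx (z t)) by rewrite -{1}[z t]vsubmxK mul_block_col.
rewrite E col_mxKu in du; rewrite E col_mxKd in dd.
have H := dmxM (dmx_tr du) dd ord0 ord0.
apply: is_derive_eq H _; rewrite /qf linearD /= !trmx_mul linearN /= bT aT opprK.
rewrite mulmxDl mulmxDr mulNmx mulmxN !mulmxA !mxaddE mxoppE.
move: (_ ord0 ord0) (_ ord0 ord0) (_ ord0 ord0) => p q r; ring.
Qed.

(** With nonnegative forms the pairing is nondecreasing; a boundary condition that prevents it from
    growing forces both forms to vanish along the solution. *)
Lemma energy_zero a b c z : (forall t, (b t)^T = - b t) -> (forall t, (a t)^T = a t) ->
  (forall t, dmx z t (block_mx (- b t) (a t) (c t) (- b t) *m z t)) ->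
  (forall t u, 0 <= t <= 1 -> 0 <= qf (a t) u) -> (forall t u, 0 <= t <= 1 -> 0 <= qf (c t) u) ->
  dot2 (z 1) <= dot2 (z 0) ->
  forall t, 0 < t < 1 -> qf (a t) (dsubmx (z t)) = 0 /\ qf (c t) (usubmx (z t)) = 0.
Proof.
move=> bT aT dz a0 c0 z10 t t01.
have t01' : 0 <= t <= 1 by case/andP: t01 => h1 h2; rewrite !ltW.
have := is_derive_mono0 (fun t _ => energy_derive (bT t) (aT t) (dz t)) _ z10 t01.
move=> H; have /eqP : qf (a t) (dsubmx (z t)) + qf (c t) (usubmx (z t)) = 0.
  by apply: H => s s01; apply: addr_ge0; [exact: a0|exact: c0].
by rewrite paddr_eq0; [move=> /andP[/eqP ? /eqP ?]|exact: a0|exact: c0].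
Qed.

Lemma ham_block (a b c : 'M[R]_n) : b^T = - b -> a^T = a -> c^T = c ->
  (block_mx (- b) a c (- b))^T *m J0 R n + J0 R n *m block_mx (- b) a c (- b) = 0.
Proof.
move=> bT aT cT; rewrite tr_block_mx linearN /= bT aT cT opprK /J0 !mulmx_block.
rewrite !mulmx0 !mul0mx !mulmx1 !mul1mx !add0r !addr0 !mulmxN !mulNmx !mulmx1 !mul1mx opprK.
by rewrite add_block_mx !subrr !addNr -[RHS]submxK; congr block_mx; apply/matrixP => i j; rewrite !mxE.
Qed.

End Energy.

(** * The rotation in the nontrivial case *)

Section Rotation.
Variables (R : realType) (n : nat) (sg : bool).

(** The projection onto the first coordinate if [sg] holds and 0 otherwise, so that the trivial and
    nontrivial bundles are treated by the same formulas. *)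
Definition mxP : 'M[R]_n := diagn n sg%:R 0.
Definition mxD : 'M[R]_n := 1%:M - mxP.

Definition rot (a : R) : 'M[R]_(n + n) :=
  block_mx (mxD + cos (pi * a) *: mxP) (- sin (pi * a) *: mxP)
           (sin (pi * a) *: mxP) (mxD + cos (pi * a) *: mxP).

Definition mxJP : 'M[R]_(n + n) := block_mx 0 (- mxP) mxP 0.

Lemma mxPT : mxP^T = mxP.
Proof. exact: tr_diag_mx. Qed.

Lemma mxPP : mxP *m mxP = mxP.
Proof.
rewrite /mxP /diagn mul_diag_mx; apply/matrixP => i j; rewrite !mxE.
case: ifP => _; last by rewrite mul0rn mulr0.
by case: sg; rewrite ?mul1r // mul0r mul0rn.
Qed.

Lemma mxDT : mxD^T = mxD.
Proof. by rewrite /mxD linearB /= trmx1 mxPT. Qed.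

Lemma mxDD : mxD *m mxD = mxD.
Proof.
rewrite /mxD mulmxBl !mulmxBr !mulmx1 mul1mx mxPP subrr subr0.
by [].
Qed.

Lemma mxDP : mxD *m mxP = 0.
Proof. by rewrite /mxD mulmxBl mul1mx mxPP subrr. Qed.

Lemma mxPD : mxP *m mxD = 0.
Proof. by rewrite /mxD mulmxBr mulmx1 mxPP subrr. Qed.

Lemma mxDaddP : mxD + mxP = 1%:M.
Proof. by rewrite /mxD subrK. Qed.

Lemma rot_Umat a : rot a = if sg then Umat n a else 1%:M.
Proof.
rewrite /rot /mxD /mxP; case: ifP => sgE.
  rewrite /Umat; congr block_mx; apply/matrixP => i j; rewrite !mxE;
  by case: (i == j) => //=; case: ifP => _; rewrite ?mulr1n ?mulr0n //=; ring.
rewrite [RHS]scalar_mx_block; congr block_mx; apply/matrixP => i j; rewrite !mxE;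
by case: (i == j) => //=; rewrite ?mulr1n ?mulr0n ?if_same; ring.
Qed.

Lemma rot0 : rot 0 = 1%:M.
Proof.
rewrite /rot mulr0 cos0 sin0 scale1r oppr0 !scale0r mxDaddP.
by rewrite -scalar_mx_block.
Qed.

Lemma rot1 : rot 1 = block_mx (mxD - mxP) 0 0 (mxD - mxP).
Proof. by rewrite /rot mulr1 cospi sinpi oppr0 !scale0r scaleN1r. Qed.

Let c2s2 (c s : R) (X Y : 'M[R]_n) : c ^+ 2 + s ^+ 2 = 1 ->
  X + (c * c) *: Y + (s * s) *: Y = X + Y.
Proof. by move=> e; rewrite -addrA -scalerDl -!expr2 e scale1r. Qed.

Lemma rot_orth a : (rot a)^T *m rot a = 1%:M.
Proof.
rewrite /rot; have := cos2Dsin2 (pi * a); move: (cos _) (sin _) => c s e.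
have [pT dT] := (mxPT, mxDT); have [pp dd] := (mxPP, mxDD); have [pd dp] := (mxPD, mxDP); have dap := mxDaddP.
move: mxD mxP pT dT pp dd pd dp dap => D P pT dT pp dd pd dp dap.
rewrite tr_block_mx !linearD !linearZ /= pT dT mulmx_block.
rewrite !(mulmxDl, mulmxDr) -!(scalemxAl, scalemxAr) dd pp dp pd !scaler0 !addr0 !add0r !scalerA.
rewrite [RHS]scalar_mx_block; congr block_mx.
- by rewrite c2s2 // dap.
- by apply/matrixP => i j; rewrite !mxE; ring.
- by apply/matrixP => i j; rewrite !mxE; ring.
- by rewrite mulrNN [LHS]addrC c2s2 // dap.
Qed.

Lemma rot_Sp a : Sp (rot a).
Proof.
have comm : J0 R n *m rot a = rot a *m J0 R n.
  rewrite /rot /J0 !mulmx_block !mulmx0 !mul0mx !addr0 !add0r !mulmx1 !mul1mx.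
  by rewrite !mulmxN !mulNmx !mulmx1 !mul1mx !scaleNr.
by apply/SpE; rewrite -mulmxA comm mulmxA rot_orth mul1mx.
Qed.

Lemma rot_unit a : rot a \in unitmx.
Proof. exact: Sp_unit (rot_Sp a). Qed.

Lemma rot_derive a : dmx rot a (pi *: (mxJP *m rot a)).
Proof.
have daff : is_derive a (1 : R) (fun s => pi * s) pi.
  have := is_derive_mulr pi a; have -> // : (fun s => s * pi : R) = (fun s => pi * s).
  by apply/funext => s; rewrite mulrC.
have dc := @is_derive1_comp R cos (fun s => pi * s) a _ _ (is_derive_cos _) daff.
have ds := @is_derive1_comp R sin (fun s => pi * s) a _ _ (is_derive_sin _) daff.
have dsn := is_deriveN ds.
have cP := dmx_cst mxP a.
have H1 := dmxD (dmx_cst mxD a) (dmxZ dc cP).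
have H := dmx_block H1 (dmxZ dsn cP) (dmxZ ds cP) H1.
rewrite !scaler0 !addr0 !add0r in H.
suff -> : pi *: (mxJP *m rot a) = block_mx ((- sin (pi * a) * pi) *: mxP) (- (cos (pi * a) * pi) *: mxP)
   ((cos (pi * a) * pi) *: mxP) ((- sin (pi * a) * pi) *: mxP).
  exact: H.
have [pT dT] := (mxPT, mxDT); have [pp dd] := (mxPP, mxDD); have [pd dp] := (mxPD, mxDP); have dap := mxDaddP.
rewrite /mxJP /rot; move: mxD mxP pT dT pp dd pd dp dap => D P pT dT pp dd pd dp dap.
rewrite mulmx_block !mul0mx !addr0 !add0r !mulNmx !mulmxDr pd !add0r -!scalemxAr pp.
rewrite scale_block_mx /GRing.scale /=; congr block_mx; by apply/matrixP => i j; rewrite !mxE; ring.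
Qed.

Lemma rot_cts (T : topologicalType) (f : T -> R) t : f @ t --> f t -> mcts (fun z => rot (f z)) t.
Proof.
by move=> cf; apply: (mcts_comp (F := rot) (f := f)) => //; exact: dmx_mcts (rot_derive _).
Qed.

Lemma dot2_rot1 w : dot2 (rot 1 *m w) = dot2 w.
Proof.
rewrite /dot2 rot1 -{1 2}[w]vsubmxK mul_block_col !mul0mx addr0 add0r col_mxKu col_mxKd.
rewrite trmx_mul linearB /= mxDT mxPT -!mulmxA (mulmxA (_ - _)).
have -> : (mxD - mxP) *m (mxD - mxP) = 1%:M.
  have [pT dT] := (mxPT, mxDT); have [pp dd] := (mxPP, mxDD); have [pd dp] := (mxPD, mxDP); have dap := mxDaddP.
  move: mxD mxP pT dT pp dd pd dp dap => D P pT dT pp dd pd dp dap.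
  by rewrite mulmxBl !mulmxBr dd pp dp pd subr0 sub0r opprK dap.
by rewrite mul1mx.
Qed.

Lemma rot_fix_P a (w : 'cV[R]_(n + n)) : cos (pi * a) != 1 -> rot a *m w = w ->
  mxP *m usubmx w = 0 /\ mxP *m dsubmx w = 0.
Proof.
move=> c1; have [pT dT] := (mxPT, mxDT); have [pp dd] := (mxPP, mxDD); have [pd dp] := (mxPD, mxDP); have dap := mxDaddP.
rewrite -{1 2}[w]vsubmxK /rot mul_block_col => /eq_col_mx[].
move: mxD mxP pT dT pp dd pd dp dap => D P pT dT pp dd pd dp dap.
move: (usubmx w) (dsubmx w) => u v /(congr1 (mulmx P)) + /(congr1 (mulmx P)).
rewrite !mulmxDl !mulmxDr -!scalemxAl -!scalemxAr !mulmxA pd pp !mul0mx !add0r.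
move: (P *m u) (P *m v) => x y e1 e2.
have := cos2Dsin2 (pi * a); move: (cos _) (sin _) c1 e1 e2 => c s c1 e1 e2 cs.
have zero i : x i ord0 = 0 /\ y i ord0 = 0.
  have := congr1 (fun Z : 'cV[R]_n => Z i ord0) e1; have := congr1 (fun Z : 'cV[R]_n => Z i ord0) e2.
  rewrite !mxE; move: (x i ord0) (y i ord0) => p q f2 f1.
  (* [2 - 2 * c] is the determinant of the identity minus the plane rotation, by c^2 + s^2 = 1; [g1]
     and [g2] are Cramer's rule. *)
  have d : 2 - 2 * c != 0 by apply: contra_neq c1 => h; lra.
  have g1 : (2 - 2 * c) * p = 0.
    have -> : (2 - 2 * c) * p = ((1 - c) * (1 - c) + s * s) * p + (1 - (c ^+ 2 + s ^+ 2)) * p by ring.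
    rewrite cs subrr mul0r addr0.
    have -> : ((1 - c) * (1 - c) + s * s) * p = (1 - c) * (p - (c * p + - s * q)) + (- s) * (q - (s * p + c * q)) by ring.
    by rewrite f1 f2 !subrr !mulr0 addr0.
  have g2 : (2 - 2 * c) * q = 0.
    have -> : (2 - 2 * c) * q = ((1 - c) * (1 - c) + s * s) * q + (1 - (c ^+ 2 + s ^+ 2)) * q by ring.
    rewrite cs subrr mul0r addr0.
    have -> : ((1 - c) * (1 - c) + s * s) * q = s * (p - (c * p + - s * q)) + (1 - c) * (q - (s * p + c * q)) by ring.
    by rewrite f1 f2 !subrr !mulr0 addr0.
  by move: g1 g2 => /eqP + /eqP; rewrite !mulf_eq0 !(negbTE d) /= => /eqP -> /eqP ->.
by split; apply/matrixP => i j; rewrite (ord1 j) mxE; case: (zero i).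
Qed.

Lemma rot_D a (w : 'cV[R]_(n + n)) : mxD *m usubmx (rot a *m w) = mxD *m usubmx w /\
  mxD *m dsubmx (rot a *m w) = mxD *m dsubmx w.
Proof.
have [pT dT] := (mxPT, mxDT); have [pp dd] := (mxPP, mxDD); have [pd dp] := (mxPD, mxDP); have dap := mxDaddP.
rewrite -{1 3}[w]vsubmxK /rot mul_block_col col_mxKu col_mxKd; move: mxD mxP pT dT pp dd pd dp dap => D P pT dT pp dd pd dp dap.
by rewrite !mulmxDl !mulmxDr -!scalemxAl -!scalemxAr !mulmxA dp dd !mul0mx !scaler0 !addr0 add0r.
Qed.

Lemma rot_P a (w : 'cV[R]_(n + n)) : rot a *m col_mx (mxP *m usubmx w) (mxP *m dsubmx w) =
  col_mx (mxP *m usubmx (rot a *m w)) (mxP *m dsubmx (rot a *m w)).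
Proof.
have [pT dT] := (mxPT, mxDT); have [pp dd] := (mxPP, mxDD); have [pd dp] := (mxPD, mxDP).
rewrite -{3 4}[w]vsubmxK /rot !mul_block_col col_mxKu col_mxKd.
move: mxD mxP pT dT pp dd pd dp => D P pT dT pp dd pd dp.
by rewrite !mulmxDl !mulmxDr -!scalemxAl -!scalemxAr !mulmxA dp pd pp !mul0mx !add0r.
Qed.

Lemma qf_mxD (u : 'cV[R]_n) : qf mxD u = qf 1%:M (mxD *m u).
Proof. by rewrite /qf mulmx1 trmx_mul mxDT -!mulmxA (mulmxA mxD) mxDD. Qed.

Lemma qf_mxP (u : 'cV[R]_n) : qf mxP u = qf 1%:M (mxP *m u).
Proof. by rewrite /qf mulmx1 trmx_mul mxPT -!mulmxA (mulmxA mxP) mxPP. Qed.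

End Rotation.

(** * The deformed path and the absence of early crossings *)

Section Deformation.
Variables (R : realType) (n : nat) (B Q : R -> 'M[R]_n) (sg : bool) (K : R).
Hypothesis cB : forall t, mcts B t.
Hypothesis cQ : forall t, mcts Q t.
Hypothesis BT : forall t, (B t)^T = - B t.
Hypothesis QT : forall t, (Q t)^T = Q t.
Hypothesis K0 : 0 < K.
Hypothesis KQ : forall t, 0 <= t <= 1 -> nrm (Q t) < K.

Local Notation D := (@mxD R n sg).
Local Notation P := (@mxP R n sg).
Local Notation rot := (@rot R n sg).
Local Notation J := (J0 R n).
Implicit Types (t r lam : R).

Definition aa t : 'M[R]_n := th t *: D + sp t *: P.
Definition cc t r : 'M[R]_n :=
  (K * th t) *: D + (K * sp t) *: P - sp t *: Q r - (K * el t)%:M.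
(* The endpoint of the flow of [Mt t] interpolates between the identity and that
   of [pencil B Q 0]: while [th] grows from 0 to 1 the generator grows to the
   hyperbolic [[0, D], [K D, 0]]; while [sp] does, it moves to [pencil B Q (- K)];
   while [el] does, to [pencil B Q 0]. As K > |Q|, crossings at t > 0 only
   occur in the last stage, where they are the negative eigenvalues K (el t - 1). *)
Definition Mt t r : 'M[R]_(n + n) :=
  block_mx (- (sp t *: B r)) (aa t) (cc t r) (- (sp t *: B r)).
Definition Mt' t r : 'M[R]_(n + n) :=
  block_mx (- (sp' t *: B r)) (th' t *: D + sp' t *: P)
    ((K * th' t) *: D + (K * sp' t) *: P - sp' t *: Q r - (K * el' t)%:M) (- (sp' t *: B r)).

Let scal (f : R -> R) (G : R -> 'M[R]_n) t r : f @ t --> f t -> mcts G r ->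
  mcts (fun q : R * R => f q.1 *: G q.2) (t, r).
Proof.
move=> cf cG; apply: mctsZ.
  by apply: (cvg_comp _ _ _ cf); exact: cvg_fst.
by apply: (mcts_comp (F := G) (f := fun q : R * R => q.2)) => //; exact: cvg_snd.
Qed.

Let form_cts (f1 f2 f3 : R -> R) t r : f1 @ t --> f1 t -> f2 @ t --> f2 t -> f3 @ t --> f3 t ->
  mcts (fun q : R * R => block_mx (- (f2 q.1 *: B q.2)) (f1 q.1 *: D + f2 q.1 *: P)
   ((K * f1 q.1) *: D + (K * f2 q.1) *: P - f2 q.1 *: Q q.2 - (K * f3 q.1)%:M)
   (- (f2 q.1 *: B q.2))) (t, r).
Proof.
move=> c1 c2 c3; have cK (f : R -> R) : f @ t --> f t -> (fun s => K * f s) @ t --> K * f t.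
  by move=> cf; apply: cvgM => //; exact: cvg_cst.
have h1 := mctsN (scal c2 (@cB r)).
apply: mcts_block => //.
  by apply: mctsD; [exact: (@scal _ (fun=> D) t r c1 (@mcts_cst _ _ _ _ D r))|exact: (@scal _ (fun=> P) t r c2 (@mcts_cst _ _ _ _ P r))].
apply: mctsB; last first.
  have H := @scal _ (fun=> 1%:M) t r (cK _ c3) (@mcts_cst _ _ _ _ 1%:M r).
  have -> : (fun q : R * R => (K * f3 q.1)%:M : 'M[R]_n) = (fun q => (K * f3 q.1) *: 1%:M).
    by apply/funext => q; rewrite scalemx1.
  exact: H.
apply: mctsB; last exact: scal.
by apply: mctsD; [exact: (@scal _ (fun=> D) t r (cK _ c1) (@mcts_cst _ _ _ _ D r))|exact: (@scal _ (fun=> P) t r (cK _ c2) (@mcts_cst _ _ _ _ P r))].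
Qed.

Lemma Mt_cts t r : mcts (fun q : R * R => Mt q.1 q.2) (t, r).
Proof.
exact: (@form_cts _ _ _ t r (derive_cts (th_derive t)) (derive_cts (sp_derive t)) (derive_cts (el_derive t))).
Qed.

Lemma Mt'_cts t r : mcts (fun q : R * R => Mt' q.1 q.2) (t, r).
Proof. exact: (@form_cts _ _ _ t r (@th'_cts R t) (@sp'_cts R t) (@el'_cts R t)). Qed.

Lemma Mt_slice t r : mcts (Mt t) r.
Proof.
apply: (mcts_comp (F := fun q : R * R => Mt q.1 q.2) (f := fun r => (t, r))); last exact: Mt_cts.
by apply: cvg_to_pair; [exact: cvg_cst|exact: cvg_id].
Qed.

Let dscal (f : R -> R) t d (A : 'M[R]_n) : is_derive t (1 : R) f d ->
  dmx (fun s => f s *: A) t (d *: A).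
Proof. by move=> df; have := dmxZ df (dmx_cst A t); rewrite scaler0 addr0. Qed.

Lemma Mt_derive t r : dmx (fun t => Mt t r) t (Mt' t r).
Proof.
have dK (f : R -> R) d : is_derive t (1 : R) f d -> is_derive t (1 : R) (fun s => K * f s) (K * d).
  by move=> df; exact: (@is_deriveZ _ _ _ f K t _ _ df).
have h1 := dmxN (dscal (B r) (sp_derive t)).
apply: dmx_block => //.
  by apply: dmxD; apply: dscal; [exact: th_derive|exact: sp_derive].
have hel : dmx (fun s => (K * el s)%:M : 'M[R]_n) t (K * el' t)%:M.
  have := dscal 1%:M (dK _ _ (el_derive t)); rewrite scalemx1.
  by under eq_fun do rewrite scalemx1.
apply: dmxB => //; apply: dmxB; last exact/dscal/sp_derive.
by apply: dmxD; apply: dscal; apply: dK; [exact: th_derive|exact: sp_derive].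
Qed.

Let sBT (s : R) r : (s *: B r)^T = - (s *: B r).
Proof. by rewrite linearZ /= BT scalerN. Qed.

Let aaT t : (aa t)^T = aa t.
Proof. by rewrite /aa linearD /= !linearZ /= mxDT mxPT. Qed.

Let ccT t r : (cc t r)^T = cc t r.
Proof.
have e X Y Z W : ((K * th t) *: X + (K * sp t) *: Y - sp t *: Z - W)^T =
  (K * th t) *: X^T + (K * sp t) *: Y^T - sp t *: Z^T - W^T :> 'M[R]_n.
  by apply/matrixP => i j; rewrite !mxE.
by rewrite /cc e mxDT mxPT QT tr_scalar_mx.
Qed.

Lemma Sp_Mt t r : Sp (fundamental (Mt t) r).
Proof. by apply: Sp_fundamental => s; [exact: Mt_slice|exact: ham_block]. Qed.

Definition beta t : 'M[R]_(n + n) := rot (th t) *m fundamental (Mt t) 1.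

Lemma Sp_beta t : Sp (beta t).
Proof. by apply: SpM; [exact: rot_Sp|exact: Sp_Mt]. Qed.

(** By the energy identity position and momentum both vanish at one interior time, here 1/2, and
    uniqueness for the linear system does the rest. *)
Lemma definite_zero (a b c : R -> 'M[R]_n) (z : R -> 'cV[R]_(n + n)) :
  (forall t, mcts (fun t => block_mx (- b t) (a t) (c t) (- b t)) t) ->
  (forall t, (b t)^T = - b t) -> (forall t, (a t)^T = a t) ->
  (forall t, dmx z t (block_mx (- b t) (a t) (c t) (- b t) *m z t)) ->
  (forall t u, 0 <= t <= 1 -> u != 0 -> 0 < qf (a t) u) ->
  (forall t u, 0 <= t <= 1 -> u != 0 -> 0 < qf (c t) u) ->
  dot2 (z 1) <= dot2 (z 0) -> forall t, z t = 0.
Proof.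
move=> cM bT aT dz a0 c0 z10.
have qf0 (A : 'M[R]_n) : qf A 0 = 0 by rewrite /qf mulmx0 mxE.
have ge0 (A : 'M[R]_n) : (forall u, u != 0 -> 0 < qf A u) -> forall u, 0 <= qf A u.
  by move=> H u; have [->|/H/ltW//] := eqVneq u 0; rewrite qf0.
have h : 0 < (2^-1 : R) < 1 by rewrite invr_gt0 ltr0n invf_lt1 ?ltr0n // ltr1n.
have h' : 0 <= (2^-1 : R) <= 1 by case/andP: h => h1 h2; rewrite !ltW.
have [e1 e2] := energy_zero bT aT dz (fun t u t01 => ge0 _ (fun u => a0 t u t01) u)
  (fun t u t01 => ge0 _ (fun u => c0 t u t01) u) z10 h.
apply: (fundamental_uniq cM dz (s := 2^-1)).
rewrite -[z _]vsubmxK.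
have -> : usubmx (z 2^-1) = 0.
  by apply: contraTeq isT => u0; have := c0 _ _ h' u0; rewrite e2 ltxx.
have -> : dsubmx (z 2^-1) = 0.
  by apply: contraTeq isT => u0; have := a0 _ _ h' u0; rewrite e1 ltxx.
by rewrite col_mx0.
Qed.

Let fix_sol t (z : 'cV[R]_(n + n)) r : dmx (fun r => fundamental (Mt t) r *m z) r
  (Mt t r *m (fundamental (Mt t) r *m z)).
Proof.
have := dmxM (fundamental_dmx (@Mt_slice t) r) (dmx_cst z r).
by rewrite mulmx0 addr0 mulmxA.
Qed.

Let qfQ (u : 'cV[R]_n) r : 0 <= r <= 1 -> u != 0 -> qf (Q r) u < K * qf 1%:M u.
Proof.
move=> r01 u0; apply: le_lt_trans (qf_le _ _) _; rewrite ltr_pM2r ?KQ //.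
by rewrite lt_neqAle qf1_ge0 andbT eq_sym; apply: contra_neq u0; exact: qf1_eq0.
Qed.

Let cos_lt1 (a : R) : 0 < a <= 1 -> cos (pi * a) != 1.
Proof.
move=> /andP[a0 a1]; apply/negP => /eqP c1.
have e : pi * a = (pi * a / 2) *+ 2 by rewrite -mulr_natr mulfVK.
have h : 0 < sin (pi * a / 2).
  apply: sin_gt0_pi; apply/andP; split; first by rewrite !mulr_gt0 ?pi_gt0 ?invr_gt0.
  rewrite -mulrA -[ltRHS]mulr1 ltr_pM2l ?pi_gt0 //; lra.
have := c1; rewrite e cos_mulr2n cos2sin2 => H.
have : sin (pi * a / 2) ^+ 2 = 0 by lra.
by move=> /eqP; rewrite sqrf_eq0 gt_eqF.
Qed.

(** A fixed vector is the initial value of a solution [y] with [rot (th t) *m y 1 = y 0]. For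
    [t <= 1/3] the P-part is rotated by an angle in ]0, pi] and the D-part is hyperbolic; afterwards
    both blocks are definite and the energy identity applies. *)
Lemma beta_no_crossing t : 0 < t <= 2 / 3 -> ~ crossing beta t.
Proof.
move=> /andP[t0 t23] /crossingP[z z0 bz].
pose y r := fundamental (Mt t) r *m z.
have y0 : y 0 = z by rewrite /y fundamental0 mul1mx.
have dy r : dmx y r (Mt t r *m y r) by exact: fix_sol.
have y1 : rot (th t) *m y 1 = z by rewrite -[RHS]bz /beta mulmxA.
suff : y 0 = 0 by rewrite y0 => /eqP; rewrite (negbTE z0).
have [t13|t13] := leP t (1 / 3).
  have [thE spE elE] := @cutoff_low R t (introT andP (conj (ltW t0) t13)).
  have th01 : 0 < th t <= 1 by rewrite thE; apply/andP; split; nra.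
  have ME r : Mt t r = block_mx 0 (th t *: D) ((K * th t) *: D) 0.
    by rewrite /Mt /aa /cc spE elE !mulr0 !scale0r !oppr0 raddf0 ?oppr0 !addr0.
  pose w r := col_mx (D *m usubmx (y r)) (D *m dsubmx (y r)) : 'cV[R]_(n + n).
  pose p r := col_mx (P *m usubmx (y r)) (P *m dsubmx (y r)) : 'cV[R]_(n + n).
  have yE r : y r = w r + p r.
    by rewrite /w /p add_col_mx -!mulmxDl mxDaddP !mul1mx vsubmxK.
  have My r : Mt t r *m y r = col_mx (th t *: (D *m dsubmx (y r))) ((K * th t) *: (D *m usubmx (y r))).
    by rewrite ME -{1}[y r]vsubmxK mul_block_col !mul0mx add0r addr0 -!scalemxAl.
  have du r : dmx (fun r => usubmx (y r)) r (th t *: (D *m dsubmx (y r))).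
    by have := dmx_usub (dy r); rewrite My col_mxKu.
  have dd r : dmx (fun r => dsubmx (y r)) r ((K * th t) *: (D *m usubmx (y r))).
    by have := dmx_dsub (dy r); rewrite My col_mxKd.
  have dA (A : 'M[R]_n) r : dmx (fun r => col_mx (A *m usubmx (y r)) (A *m dsubmx (y r))) r
      (col_mx (A *m (th t *: (D *m dsubmx (y r)))) (A *m ((K * th t) *: (D *m usubmx (y r))))).
    have h1 := dmxM (dmx_cst A r) (du r); have h2 := dmxM (dmx_cst A r) (dd r).
    by rewrite mul0mx add0r in h1; rewrite mul0mx add0r in h2; exact: dmx_col.
  have p0 : p 0 = 0.
    have pc : p 1 = p 0.
      apply: (@dmx_cst_of0 R _ _ p 0 1 ler01) => s _.
      have := dA P s; rewrite -!scalemxAr !mulmxA mxPD !mul0mx !scaler0 col_mx0.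
      by [].
    have fp : rot (th t) *m p 0 = p 0 by rewrite -{1}pc /p rot_P y1 y0.
    have [e1 e2] := rot_fix_P (cos_lt1 th01) fp.
    move: e1 e2; rewrite /p col_mxKu col_mxKd !mulmxA mxPP => -> ->.
    exact: col_mx0.
  have cMt r : mcts (fun _ : R => block_mx (- (0 : 'M[R]_n)) (th t *: D) ((K * th t) *: D) (- (0 : 'M[R]_n))) r.
    exact: mcts_cst.
  have dw r : dmx w r (block_mx (- (0 : 'M[R]_n)) (th t *: D) ((K * th t) *: D) (- (0 : 'M[R]_n)) *m w r).
    have := dA D r; rewrite mul_block_col oppr0 !mul0mx add0r addr0 -!scalemxAl -!scalemxAr.
    by [].
  have w10 : w 1 = w 0.
    have [e1 e2] := rot_D sg (th t) (y 1); rewrite y1 in e1 e2.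
    by rewrite /w -e1 -e2 y0.
  have h : 0 < (2^-1 : R) < 1 by rewrite invr_gt0 ltr0n invf_lt1 ?ltr0n // ltr1n.
  have qp (c : R) u : 0 < c -> 0 <= qf (c *: D) u.
    by move=> c0; rewrite qfZ qf_mxD mulr_ge0 ?qf1_ge0 // ltW.
  have th0 : 0 < th t by case/andP: th01.
  have sT (c : R) : (c *: D)^T = c *: D by rewrite linearZ /= mxDT.
  have b0T : (0 : 'M[R]_n)^T = - 0 by rewrite trmx0 oppr0.
  have [e1 e2] := @energy_zero R n (fun=> th t *: D) (fun=> 0) (fun=> (K * th t) *: D) w
    (fun=> b0T) (fun=> sT _) dw (fun _ u _ => qp _ u th0) (fun _ u _ => qp _ u (mulr_gt0 K0 th0))
    (eq_ind_r (fun v => dot2 v <= dot2 (w 0)) (lexx _) w10) _ h.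
  have w0 : w 0 = 0.
    apply: (fundamental_uniq cMt dw (s := 2^-1)).
    move: e1 e2 => /eqP + /eqP; rewrite !qfZ !qf_mxD !mulf_eq0 !(gt_eqF K0) !(gt_eqF th0) /=.
    rewrite /w col_mxKu col_mxKd !mulmxA mxDD => /eqP /qf1_eq0 -> /eqP /qf1_eq0 ->.
    exact: col_mx0.
  by rewrite yE w0 p0 addr0.
have [thE /andP[sp0 sp1] elE] := @cutoff_mid R t (introT andP (conj t13 t23)).
have qp (u : 'cV[R]_n) : u != 0 -> 0 < qf 1%:M u.
  by move=> u0; rewrite lt_neqAle qf1_ge0 andbT eq_sym; apply: contra_neq u0; exact: qf1_eq0.
have DPq u : qf D u + qf P u = qf 1%:M u by rewrite -qfD mxDaddP.
have Dq u : 0 <= qf D u by rewrite qf_mxD qf1_ge0.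
have Pq u : 0 <= qf P u by rewrite qf_mxP qf1_ge0.
apply: (@definite_zero (fun=> aa t) (fun r => sp t *: B r) (cc t) y) => //.
- exact: Mt_slice.
- move=> r u r01 u0; rewrite /aa thE scale1r qfD qfZ.
  have := qp u u0; rewrite -DPq => h; have := Dq u; have := Pq u; nra.
(* The block is [sp t] times K - Q, positive since K exceeds the norm of Q, plus [1 - sp t] times K
   D, which is nonnegative. *)
- move=> r u r01 u0; rewrite /cc thE elE !mulr1 mulr0 raddf0 subr0 qfD qfD qfN !qfZ.
  have := qfQ r01 u0; rewrite -DPq => h; have := Dq u; have := Pq u.
  move: (qf D u) (qf P u) (qf (Q r) u) h => d p q h p0 d0.
  have : 0 < sp t * (K * (d + p) - q) by rewrite mulr_gt0 // subr_gt0.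
  have : 0 <= K * d * (1 - sp t) by rewrite !mulr_ge0 ?subr_ge0 // ltW.
  by move=> h1 h2; lra.
by rewrite y0 -y1 thE dot2_rot1.
Qed.

(** Below - K the block - (Q + lam) is positive definite, so the spectrum of the twisted operator is
    bounded below by - K. *)
Lemma pencil_no_fix lam (z : 'cV[R]_(n + n)) : lam <= - K ->
  rot 1 *m fundamental (pencil B Q lam) 1 *m z = z -> z = 0.
Proof.
move=> lK bz; pose y r := fundamental (pencil B Q lam) r *m z.
have cp r : mcts (pencil B Q lam) r by exact: pencil_cts.
have y0 : y 0 = z by rewrite /y fundamental0 mul1mx.
have y1 : rot 1 *m y 1 = z by rewrite -[RHS]bz mulmxA.
have qp (u : 'cV[R]_n) : u != 0 -> 0 < qf 1%:M u.
  by move=> u0; rewrite lt_neqAle qf1_ge0 andbT eq_sym; apply: contra_neq u0; exact: qf1_eq0.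
rewrite -y0; apply: (@definite_zero (fun=> 1%:M) B (fun r => - (Q r + lam%:M)) y) => //.
- by move=> r; exact: trmx1.
- move=> r; have := dmxM (fundamental_dmx cp r) (dmx_cst z r).
  by rewrite mulmx0 addr0 -mulmxA.
- by move=> r u _; exact: qp.
- move=> r u r01 u0; rewrite qfN qfD -scalemx1 qfZ.
  have := qfQ r01 u0; have := qp u u0; nra.
by rewrite y0 -y1 dot2_rot1.
Qed.

Lemma Mt_high t : 2 / 3 <= t -> Mt t = pencil B Q (- (K * (1 - el t))).
Proof.
move=> t23; have [thE spE _] := @cutoff_high R t t23.
apply/funext => r; rewrite /Mt /pencil /aa /cc thE spE !mulr1 !scale1r mxDaddP.
congr (block_mx _ _ _ _); rewrite -scalerDr mxDaddP scalemx1.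
by apply/matrixP => i j; rewrite !mxE; case: (i == j) => /=; rewrite ?mulr1n ?mulr0n; ring.
Qed.

Lemma Mt'_high t r : 2 / 3 <= t -> Mt' t r = block_mx 0 0 (- (K * el' t)%:M) 0.
Proof.
move=> t23; rewrite /Mt' th'_high // sp'_high // !mulr0 !scale0r !oppr0 !addr0 add0r.
by [].
Qed.

End Deformation.

(** * Crossing forms of the deformed path *)

Section CrossingForms.
Variables (R : realType) (n : nat).
Local Notation J := (J0 R n).

Lemma fix_basis_row (bt : 'M[R]_(n + n)) (x : 'rV[R]_(\rank (kermx (1%:M - bt)^T))) :
  bt *m (x *m fix_basis bt)^T = (x *m fix_basis bt)^T.
Proof.
have : (x *m fix_basis bt <= kermx (1%:M - bt)^T)%MS.
  by apply: submx_trans (submxMl _ _) _; rewrite eq_row_base.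
move=> /sub_kermxP /(congr1 trmx); rewrite trmx0 trmx_mul trmxK mulmxBl mul1mx => /eqP.
by rewrite subr_eq0 eq_sym => /eqP.
Qed.

(** The derivative of the relation [bt^T J bt = J], conjugated by the inverse of [bt t]. *)
Lemma Smat_sym (bt : R -> 'M[R]_(n + n)) t : (forall t, Sp (bt t)) -> derivable bt t 1 ->
  (Smat bt t)^T = Smat bt t.
Proof.
move=> Sb db; have d := derivable_dmx db.
have u := Sp_unit (Sb t).
have E : (derive1 bt t)^T *m J *m bt t + (bt t)^T *m J *m derive1 bt t = 0.
  have H := dmxM (dmxM (dmx_tr d) (dmx_cst J t)) d.
  rewrite mulmx0 addr0 in H; apply: dmx_uniq H _.
  have -> : (fun s => (bt s)^T *m J *m bt s) = (fun=> J) by apply/funext => s; exact/SpE.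
  exact: dmx_cst.
have E2 : (invmx (bt t))^T *m (derive1 bt t)^T *m J = - (J *m derive1 bt t *m invmx (bt t)).
  have := congr1 (fun Z => (invmx (bt t))^T *m Z *m invmx (bt t)) E.
  have iu : (invmx (bt t))^T *m (bt t)^T = 1%:M by rewrite -trmx_mul mulmxV // trmx1.
  rewrite mulmx0 mul0mx mulmxDr mulmxDl !mulmxA mulmxK // iu mul1mx.
  by move=> /eqP; rewrite addr_eq0 => /eqP.
by rewrite /Smat !trmx_mul J0T !mulmxN mulmxA E2 opprK.
Qed.

Lemma crossing_form_sym (bt : R -> 'M[R]_(n + n)) t : (forall t, Sp (bt t)) -> derivable bt t 1 ->
  (crossing_form bt t)^T = crossing_form bt t.
Proof.
move=> Sb db; rewrite /crossing_form; move: (Smat_sym Sb db).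
by move: (Smat bt t) (fix_basis (bt t)) => S F SS; rewrite linearN /= !trmx_mul trmxK SS mulmxA.
Qed.

Lemma crossing_form_val (bt : R -> 'M[R]_(n + n)) t D
    (x : 'rV[R]_(\rank (kermx (1%:M - bt t)^T))) : Sp (bt t) -> dmx bt t D ->
  let v := (x *m fix_basis (bt t))^T in
  (x *m crossing_form bt t *m x^T) ord0 ord0 = - (v^T *m J *m D *m v) ord0 ord0.
Proof.
move=> Sb dD v; have [_ E] := dmx_derive1 dD.
have u := Sp_unit Sb.
have fv : invmx (bt t) *m v = v.
  by rewrite -[X in _ *m X](fix_basis_row x) mulKmx.
rewrite /crossing_form /Smat E mulmxN mulNmx mxoppE; congr (- _).
have -> : v^T *m J *m D *m v = v^T *m J *m D *m (invmx (bt t) *m v) by rewrite fv.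
by rewrite /v; move: (fix_basis (bt t)) => F; rewrite trmxK trmx_mul !mulmxA.
Qed.

End CrossingForms.

Section CoreIndex.
Variables (R : realType) (n : nat) (B Q : R -> 'M[R]_n) (sg : bool) (K : R).
Hypothesis cB : forall t, mcts B t.
Hypothesis cQ : forall t, mcts Q t.
Hypothesis BT : forall t, (B t)^T = - B t.
Hypothesis QT : forall t, (Q t)^T = Q t.
Hypothesis K0 : 0 < K.
Hypothesis KQ : forall t, 0 <= t <= 1 -> nrm (Q t) < K.

Local Notation D := (@mxD R n sg).
Local Notation P := (@mxP R n sg).
Local Notation rot := (@rot R n sg).
Local Notation J := (J0 R n).
Local Notation Mt := (@Mt R n B Q sg K).
Local Notation Mt' := (@Mt' R n B Q sg K).
Local Notation beta := (@beta R n B Q sg K).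
Implicit Types (t r lam : R).

Let cM t r : mcts (fun q : R * R => Mt q.1 q.2) (t, r).
Proof. exact: Mt_cts. Qed.
Let cM' t r : mcts (fun q : R * R => Mt' q.1 q.2) (t, r).
Proof. exact: Mt'_cts. Qed.
Let dM t r : dmx (fun t => Mt t r) t (Mt' t r).
Proof. exact: Mt_derive. Qed.
Let cMs t r : mcts (Mt t) r.
Proof. exact: Mt_slice. Qed.
Let SpB t : Sp (beta t).
Proof. exact: Sp_beta. Qed.

Section Derivative.
Variable V : R -> R -> 'M[R]_(n + n).
Hypothesis V0 : forall s, V s 0 = 0.
Hypothesis dV : forall s r, dmx (V s) r (Mt s r *m V s r + Mt' s r *m fundamental (Mt s) r).
Hypothesis dY : forall s, dmx (fun s => fundamental (Mt s) 1) s (V s 1).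
Hypothesis cV : forall s, mcts (fun s => V s 1) s.

Definition dbeta t : 'M[R]_(n + n) :=
  (th' t *: (pi *: (mxJP R n sg *m rot (th t)))) *m fundamental (Mt t) 1 + rot (th t) *m V t 1.

Lemma beta_dmx t : dmx beta t (dbeta t).
Proof.
have h := dmx_comp (th_derive t) (@rot_derive R n sg (th t)).
exact (dmxM h (dY t)).
Qed.

Lemma dbeta_cts t : mcts dbeta t.
Proof.
have cr : mcts (fun t => rot (th t)) t by apply: rot_cts; exact: derive_cts (th_derive t).
apply: mctsD; last exact: (mctsM cr (@cV t)).
apply: mctsM; last exact: (dmx_mcts (dY t)).
apply: mctsZ; first exact: th'_cts.
apply: mctsZ; first exact: cvg_cst.
by apply: mctsM => //; exact: mcts_cst.
Qed.

Lemma beta_derivable t : derivable beta t 1.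
Proof. by have [] := dmx_derive1 (beta_dmx t). Qed.

Lemma dbeta_continuous : continuous (derive1 beta).
Proof.
have -> : derive1 beta = dbeta by apply/funext => t; have [] := dmx_derive1 (beta_dmx t).
by move=> t; apply/mctsP; exact: dbeta_cts.
Qed.

(** Only the lower left block of the generator moves in this stage. The function [f], pairing the
    solution with its parameter derivative through J, starts at 0, has derivative [k] times the
    squared position component, and ends at the required value. If that value were not positive, the
    position would vanish identically, hence the whole solution. *)
Lemma dbeta_pos t (v : 'cV[R]_(n + n)) : 2 / 3 < t -> v != 0 -> beta t *m v = v ->
  0 < (v^T *m J *m dbeta t *m v) ord0 ord0.
Proof.
move=> t23 v0 bv; have t23' := ltW t23.
pose Y r := fundamental (Mt t) r.
pose k := K * el' t.
have k0 : 0 < k by rewrite mulr_gt0 // /el' pos_ge ?mulr_gt0 //; lra.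
pose y r := Y r *m v.
pose f r := ((y r)^T *m J *m (V t r *m v)) ord0 ord0.
have dYr r : dmx Y r (Mt t r *m Y r) by exact: fundamental_dmx.
have dy r : dmx y r (Mt t r *m y r).
  by have := dmxM (dYr r) (dmx_cst v r); rewrite mulmx0 addr0 -mulmxA.
have HM r : (Mt t r)^T *m J + J *m Mt t r = 0.
  rewrite Mt_high // /pencil; apply: ham_block => //; first exact: trmx1.
  by rewrite linearN linearD /= QT tr_scalar_mx.
have df r : is_derive r (1 : R) f (k * qf 1%:M (usubmx (y r))).
  have dVv := dmxM (dV t r) (dmx_cst v r); rewrite mulmx0 addr0 in dVv.
  have := dmxM (dmxM (dmx_tr (dy r)) (dmx_cst J r)) dVv ord0 ord0.
  rewrite mulmx0 addr0 => H; apply: is_derive_eq H _.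
  have -> : (Mt t r *m y r)^T *m J *m (V t r *m v) +
     (y r)^T *m J *m ((Mt t r *m V t r + Mt' t r *m fundamental (Mt t) r) *m v) =
     (y r)^T *m ((Mt t r)^T *m J + J *m Mt t r) *m (V t r *m v) + (y r)^T *m (J *m Mt' t r) *m y r.
    rewrite trmx_mul mulmxDl !mulmxDr mulmxDl /y -!mulmxA -addrA.
    by [].
  rewrite HM mulmx0 mul0mx add0r Mt'_high //.
  have -> : J *m (block_mx 0 0 (- k%:M) 0 : 'M[R]_(n + n)) = block_mx k%:M 0 0 0.
    by rewrite /J0 mulmx_block !mulmx0 !mul0mx !addr0 ?add0r mulNmx mulmxN opprK mul1mx.
  rewrite -[y r]vsubmxK tr_col_mx mul_row_block !mulmx0 !addr0 mul_row_col mul0mx addr0 col_mxKu.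
  by rewrite /qf mulmx1 mul_mx_scalar -scalemxAl mxscaleE.
have f0 : f 0 = 0 by rewrite /f V0 mul0mx mulmx0 mxE.
have fE : (v^T *m J *m dbeta t *m v) ord0 ord0 = f 1.
  rewrite /dbeta th'_high // scale0r mul0mx add0r /f /y.
  have yv : rot (th t) *m Y 1 *m v = v by exact: bv.
  rewrite -{1}yv !trmx_mul; have /SpE := rot_Sp sg (th t) : Sp (rot (th t)); move: (rot _) => r rJ.
  by rewrite !mulmxA -!mulmxA (mulmxA r^T) (mulmxA (r^T *m _)) rJ !mulmxA.
rewrite fE ltNge; apply/negP => f1.
have f10 : f 1 <= f 0 by rewrite f0.
have nn r : 0 <= r <= 1 -> 0 <= k * qf 1%:M (usubmx (y r)) by move=> _; rewrite mulr_ge0 ?qf1_ge0 // ltW.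
have u0 r : 0 < r < 1 -> usubmx (y r) = 0.
  move=> r01; have /eqP := is_derive_mono0 (fun t _ => df t) nn f10 r01.
  by rewrite mulf_eq0 gt_eqF //= => /eqP /qf1_eq0.
have h : 0 < (2^-1 : R) < 1 by rewrite invr_gt0 ltr0n invf_lt1 ?ltr0n // ltr1n.
(* Where the position vanishes on an interval its derivative vanishes too, and by the first row of
   the pencil this derivative is the momentum. *)
have y0 : y 2^-1 = 0.
  have uE := u0 _ h.
  have d1 := dmx_usub (dy 2^-1).
  have d2 : dmx (fun r => usubmx (y r)) 2^-1 0.
    have : (2^-1 : R) \in `]0, 1[ by rewrite in_itv.
    move=> /near_in_itvoo nt; apply: dmx_near_eq (dmx_cst 0 _).
    by apply: filterS nt => s; rewrite in_itv /= => /u0 ->.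
  have := dmx_uniq d1 d2; rewrite Mt_high // -[y 2^-1]vsubmxK mul_block_col uE.
  by rewrite col_mxKu mulmx0 add0r mul1mx => ->; exact: col_mx0.
have y00 : y 0 = 0 := fundamental_uniq (@cMs t) dy y0 0.
by move: v0; rewrite -[v]mul1mx -(fundamental0 (Mt t)) -/(Y 0) -/(y 0) y00 eqxx.
Qed.

Lemma crossing_form_high t : 2 / 3 < t ->
  sign (crossing_form beta t) = - (\rank (kermx (1%:M - beta t)^T))%:Z /\
  crossing_form beta t \in unitmx.
Proof.
move=> t23.
have sym := crossing_form_sym SpB (@beta_derivable t).
have neg (x : 'rV[R]_(\rank (kermx (1%:M - beta t)^T))) : x != 0 -> (x *m crossing_form beta t *m x^T) ord0 ord0 < 0.
  move=> x0; rewrite (crossing_form_val x (SpB t) (beta_dmx t)) oppr_lt0.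
  apply: dbeta_pos => //; last exact: fix_basis_row.
  rewrite trmx_eq0; apply: contra_neq x0 => xF.
  by apply: (row_free_inj (row_base_free _)); rewrite xF mul0mx.
have := @sign_split R _ _ 1%:M (crossing_form beta t) xpred0 erefl sym.
rewrite card0 add0r; case.
- move=> x x0 H; case/eqP: x0; apply/matrixP => i j; rewrite (ord1 i) mxE; exact: H.
- by move=> x x0 _; rewrite mulmx1; exact: neg.
move=> -> cu; split=> //; congr (- Posz _).
by rewrite -[RHS]card_ord; apply: eq_card.
Qed.

Lemma Mt0 r : Mt 0 r = 0.
Proof.
have h : (0 : R) <= 1 / 3 by lra.
have [thE spE elE] := cutoff_low (introT andP (conj (lexx 0) h)).
rewrite /Mt /aa /cc thE spE elE mulr0 subr0 expr1n subrr !mulr0 !scale0r !oppr0 raddf0 ?oppr0 !addr0.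
exact: block_mx0.
Qed.

Lemma fundamental_Mt0 r : fundamental (Mt 0) r = 1%:M.
Proof.
have d s : dmx (fun=> 1%:M : 'M[R]_(n + n)) s (Mt 0 s *m 1%:M).
  by rewrite Mt0 mul0mx; exact: dmx_cst.
by have := fundamentalE (@cMs 0) d r; rewrite mulmx1.
Qed.

Lemma beta0 : beta 0 = 1%:M.
Proof.
have h : (0 : R) <= 1 / 3 by lra.
have [thE _ _] := cutoff_low (introT andP (conj (lexx 0) h)).
by rewrite /beta fundamental_Mt0 mulmx1 thE mulr0 subr0 expr1n subrr rot0.
Qed.

(** At time 0 the generator is zero with constant derivative, so the derivative of its time-one flow
    is that constant. The factor 6 is the initial slope of [th], pi is the speed of the rotation,
    and K comes from the hyperbolic block. *)
Lemma dbeta0_form (v : 'cV[R]_(n + n)) : - (v^T *m J *m dbeta 0 *m v) ord0 ord0 =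
  6 * (pi * qf P (usubmx v) + K * qf D (usubmx v) + pi * qf P (dsubmx v) - qf D (dsubmx v)).
Proof.
have h : (0 : R) <= 1 / 3 by lra.
have [thE _ _] := cutoff_low (introT andP (conj (lexx 0) h)).
have th'E : th' (0 : R) = 6 by rewrite /th' mulr0 add0r pos_ge // mulr1.
have sp'E : sp' (0 : R) = 0.
  by rewrite /sp' mulr0 !add0r !pos_le ?lerN10 ?oppr_le0 ?divr_ge0 //; ring.
have el'E : el' (0 : R) = 0 by rewrite /el' mulr0 add0r pos_le ?mulr0 ?oppr_le0.
pose C : 'M[R]_(n + n) := block_mx 0 (6 *: D) ((K * 6) *: D) 0.
have M'E r : Mt' 0 r = C.
  by rewrite /Mt' th'E sp'E el'E !mulr0 !scale0r !oppr0 raddf0 ?oppr0 !addr0.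
have V1 : V 0 1 = C.
  have dW r : dmx (fun r => V 0 r - r *: C) r 0.
    have := dmxB (dV 0 r) (dmxZ (is_derive_id r (1 : R)) (dmx_cst C r)).
    by rewrite Mt0 mul0mx add0r M'E fundamental_Mt0 mulmx1 scale1r scaler0 addr0 subrr.
  have := dmx_cst_of0 ler01 (fun r _ => dW r).
  by rewrite V0 scale0r subr0 scale1r => /eqP; rewrite subr_eq0 => /eqP.
rewrite /dbeta th'E thE mulr0 subr0 expr1n subrr rot0 mulmx1 fundamental_Mt0 mulmx1 V1 mul1mx.
have E : J *m (6 *: (pi *: mxJP R n sg) + C) =
    block_mx (- (6 * pi) *: P - (K * 6) *: D) 0 0 (6 *: D - (6 * pi) *: P).
  rewrite /C /mxJP !scale_block_mx !scaler0 add_block_mx /J0 mulmx_block !mul0mx !addr0 !add0r.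
  rewrite !mulNmx !mul1mx oppr0; congr block_mx; apply/matrixP => i j; rewrite !mxE; ring.
rewrite -(mulmxA v^T J) E -{1 2}[v]vsubmxK tr_col_mx mul_row_block !mulmx0 addr0 add0r mul_row_col.
have F (a b : R) (x : 'cV[R]_n) : (x^T *m (a *: P + b *: D) *m x) ord0 ord0 = a * qf P x + b * qf D x.
  by rewrite -/(qf _ x) qfD !qfZ.
have -> : - (6 * pi) *: P - (K * 6) *: D = (- (6 * pi)) *: P + (- (K * 6)) *: D by rewrite scaleNr scaleNr.
have -> : 6 *: D - (6 * pi) *: P = (- (6 * pi)) *: P + 6 *: D by rewrite addrC scaleNr.
by rewrite mxaddE !F; ring.
Qed.

End Derivative.
End CoreIndex.

Section CoreTheorem.
Variables (R : realType) (n : nat) (B Q : R -> 'M[R]_n) (sg : bool).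
Hypothesis cB : forall t, mcts B t.
Hypothesis cQ : forall t, mcts Q t.
Hypothesis BT : forall t, (B t)^T = - B t.
Hypothesis QT : forall t, (Q t)^T = Q t.
Hypothesis sgn : sg -> (0 < n)%N.
Local Notation rot := (@rot R n sg).
Local Notation D := (@mxD R n sg).
Local Notation P := (@mxP R n sg).
Implicit Types (t r lam : R).

Definition null_dim lam : nat :=
  \rank (kermx (1%:M - rot 1 *m fundamental (pencil B Q lam) 1)^T).

Section Bound.
Variable K : R.
Hypothesis K0 : 0 < K.
Hypothesis KQ : forall t, 0 <= t <= 1 -> nrm (Q t) < K.
Local Notation Mt := (@Mt R n B Q sg K).
Local Notation Mt' := (@Mt' R n B Q sg K).
Local Notation beta := (@beta R n B Q sg K).

Let SpB t : Sp (beta t). Proof. exact: Sp_beta. Qed.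

Section Derivative.
Variable V : R -> R -> 'M[R]_(n + n).
Hypothesis V0 : forall s, V s 0 = 0.
Hypothesis dV : forall s r, dmx (V s) r (Mt s r *m V s r + Mt' s r *m fundamental (Mt s) r).
Hypothesis dY : forall s, dmx (fun s => fundamental (Mt s) 1) s (V s 1).

Let qf1_gt0 (v : 'cV[R]_(n + n)) : v != 0 ->
  0 < qf P (usubmx v) + qf D (usubmx v) + (qf P (dsubmx v) + qf D (dsubmx v)).
Proof.
move=> v0; have PDE (u : 'cV[R]_n) : qf P u + qf D u = qf 1%:M u by rewrite addrC -qfD mxDaddP.
rewrite !PDE lt_neqAle addr_ge0 ?qf1_ge0 // andbT eq_sym; apply: contra_neq v0 => /eqP.
rewrite paddr_eq0 ?qf1_ge0 // => /andP[/eqP /qf1_eq0 u0 /eqP /qf1_eq0 w0].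
by rewrite -[v]vsubmxK u0 w0 col_mx0.
Qed.

Let Pq (u : 'cV[R]_n) : 0 <= qf P u. Proof. by rewrite qf_mxP qf1_ge0. Qed.
Let Dq (u : 'cV[R]_n) : 0 <= qf D u. Proof. by rewrite qf_mxD qf1_ge0. Qed.

Let Pw (w : 'cV[R]_n) j : (P *m w) j ord0 = (if j == 0%N :> nat then sg%:R else 0) * w j ord0.
Proof. by rewrite /mxP /diagn mul_diag_mx !mxE. Qed.

Let qf0 (A : 'M[R]_n) : qf A 0 = 0. Proof. by rewrite /qf mulmx0 mxE. Qed.

Let card_pos (s : pred 'I_(n + n)) : (forall i, s i = (i < n)%N || (sg && (i == n :> nat))) ->
  #|s| = (n + sg)%N.
Proof.
move=> sE; rewrite -sum1_card big_split_ord /= (eq_bigl xpredT) => [|i]; last first.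
  by rewrite unfold_in sE /= ltn_ord.
rewrite sum1_card card_ord; congr (_ + _)%N.
rewrite (eq_bigl (fun i : 'I_n => sg && (i == 0%N :> nat))) => [|i]; last first.
  by rewrite unfold_in sE /= ltnNge leq_addr /= -[X in _ == X]addn0 eqn_add2l.
case: (boolP sg) => sgt; last by rewrite big_pred0.
by rewrite (big_pred1 (Ordinal (sgn sgt))).
Qed.

Let card_alg (m k : nat) (b : bool) : (m + b + k = m + m)%N ->
  (m + b)%N%:Z - k%:Z = (b.*2)%:Z.
Proof. by case: b => /= H; lia. Qed.

(** In [dbeta0_form] all [n] position coordinates are positive; of the momentum coordinates only the
    rotated one, present if [sg], is positive. The signature is therefore (n + sg) - (n - sg). *)
Lemma crossing_form0 : sign (crossing_form beta 0) = (sg.*2)%:Z /\ crossing_form beta 0 \in unitmx.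
Proof.
have bd := @beta_derivable R n B Q sg K V dY 0.
have sym := crossing_form_sym SpB bd.
have b0 : beta 0 = 1%:M by exact: beta0.
have ff : row_full (fix_basis (beta 0)).
  rewrite /row_full /fix_basis eq_row_base mxrank_ker b0 subrr trmx0 mxrank0 subn0.
  by [].
have [T TF] := row_fullP ff.
have rk : (n + n = \rank (kermx (1%:M - beta 0)^T))%N.
  by rewrite b0 subrr trmx0 mxrank_ker mxrank0 subn0.
pose s (i : 'I_(n + n)) := (i < n)%N || (sg && (i == n :> nat)).
have val (x : 'rV[R]_(n + n)) : ((x *m T) *m crossing_form beta 0 *m (x *m T)^T) 0 0 =
   6 * (pi * qf P (usubmx x^T) + K * qf D (usubmx x^T) + pi * qf P (dsubmx x^T) - qf D (dsubmx x^T)).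
  have vE : (x *m T *m fix_basis (beta 0))^T = x^T by rewrite -mulmxA TF mulmx1.
  rewrite (crossing_form_val _ (SpB 0) (@beta_dmx R n B Q sg K V dY 0)) vE.
  exact: dbeta0_form.
have := sign_split rk sym (T := T) (s := s).
case.
- move=> x x0 H; rewrite val.
  have x0' : x^T != 0 by rewrite trmx_eq0.
  have Dw : qf D (dsubmx x^T) = 0.
    have Dw : D *m dsubmx x^T = 0.
      apply/matrixP => j k; rewrite (ord1 k) /mxD mulmxBl mul1mx mxaddE mxoppE Pw [RHS]mxE.
      have [js|js] := boolP (s (rshift n j)).
        move: js; rewrite /s /= ltnNge leq_addr /= -[X in _ == X]addn0 eqn_add2l => /andP[-> ->].
        by rewrite mul1r subrr.
      by have := H _ js; rewrite [dsubmx _ _ _]mxE [x^T _ _]mxE => ->; rewrite mulr0 subrr.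
    by rewrite qf_mxD Dw qf0.
  have := qf1_gt0 x0'; rewrite Dw subr0 addr0; have := Pq (usubmx x^T); have := Dq (usubmx x^T).
  have := Pq (dsubmx x^T); have := pi_gt0 R; move: pi (qf P _) (qf P _) (qf D _) => p a c b p0 a0 b0' c0 h.
  rewrite mulr_gt0 //; have [bz|bp] := leP b 0.
    have h1 : 0 < a + c by lra.
    have : 0 < p * (a + c) by rewrite mulr_gt0.
    have : 0 <= K * b by rewrite mulr_ge0 // ltW.
    by move=> h2 h3; lra.
  have : 0 < K * b by rewrite mulr_gt0.
  have : 0 <= p * a by rewrite mulr_ge0 // ltW.
  have : 0 <= p * c by rewrite mulr_ge0 // ltW.
  by move=> h1 h2 h3; lra.
- move=> x x0 H; rewrite val.
  have x0' : x^T != 0 by rewrite trmx_eq0.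
  have u0 : usubmx x^T = 0.
    apply/matrixP => j k; rewrite (ord1 k) [LHS]mxE [LHS]mxE [RHS]mxE; apply: H.
    by rewrite /s /= ltn_ord.
  have w0 : qf P (dsubmx x^T) = 0.
    have Pw0 : P *m dsubmx x^T = 0.
      apply/matrixP => j k; rewrite (ord1 k) Pw [RHS]mxE.
      case: ifP => j0; last by rewrite mul0r.
      case: (boolP sg) => sgt; last by rewrite mul0r.
      rewrite [dsubmx _ _ _]mxE [x^T _ _]mxE H ?mulr0 // /s sgt /=.
      by rewrite (eqP j0) addn0 eqxx orbT.
    by rewrite qf_mxP Pw0 qf0.
  have := qf1_gt0 x0'; rewrite u0 !qf0 w0 !mulr0 !add0r => h.
  by rewrite mulrN oppr_lt0 mulr_gt0.
move=> -> cu; split=> //.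
have h1 := cardC s; rewrite card_ord in h1.
have h2 := @card_pos s (fun=> erefl).
by rewrite h2; apply: card_alg; rewrite -h2.
Qed.

End Derivative.

Let fst_cts (T U : topologicalType) (q : T * U) : (fun z : T * U => z.1) @ q --> q.1.
Proof. by case: q => a b; exact: cvg_fst. Qed.

Let snd_cts (T U : topologicalType) (q : T * U) : (fun z : T * U => z.2) @ q --> q.2.
Proof. by case: q => a b; exact: cvg_snd. Qed.

(** The homotopy interpolates generators, which form a linear space, instead of symplectic matrices.
    The factor [q.2] and the stretched time turn the flow up to time [q.2] into a time-one flow. At
    [q.2 = 1] both generators are [pencil B Q 0], which fixes the end point. *)
Let HX (q : R * R) r := ((1 - q.1) * q.2) *: pencil B Q 0 (q.2 * r) + q.1 *: Mt q.2 r.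

Let HX_cts (p0 : R * R) r : mcts (fun z : (R * R) * R => HX z.1 z.2) (p0, r).
Proof.
have c1 : (fun z : (R * R) * R => z.1.1) @ (p0, r) --> p0.1.
  exact: (cvg_comp _ _ (@fst_cts _ _ (p0, r)) (@fst_cts _ _ p0)).
have c2 : (fun z : (R * R) * R => z.1.2) @ (p0, r) --> p0.2.
  exact: (cvg_comp _ _ (@fst_cts _ _ (p0, r)) (@snd_cts _ _ p0)).
have c3 : (fun z : (R * R) * R => z.2) @ (p0, r) --> r by exact: cvg_snd.
apply: mctsD; apply: mctsZ => //.
- by apply: cvgM => //; apply: cvgB => //; exact: cvg_cst.
- apply: (mcts_comp (F := pencil B Q 0) (f := fun z : (R * R) * R => z.1.2 * z.2)).
    exact: cvgM.
  exact: pencil_cts.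
apply: (mcts_comp (F := fun z : R * R => Mt z.1 z.2) (f := fun z : (R * R) * R => (z.1.2, z.2))).
  exact: cvg_to_pair.
exact: Mt_cts.
Qed.

Let HX_slice q r : mcts (HX q) r.
Proof.
apply: (mcts_comp (F := fun z : (R * R) * R => HX z.1 z.2) (f := fun r => (q, r))); last exact: HX_cts.
by apply: cvg_to_pair; [exact: cvg_cst|exact: cvg_id].
Qed.

Let hom (q : R * R) : 'M[R]_(n + n) :=
  rot ((1 - q.1) * q.2 + q.1 * th q.2) *m fundamental (HX q) 1.

Let hom_cts q : mcts hom q.
Proof.
have c1 := @fst_cts _ _ q; have c2 := @snd_cts _ _ q.
apply: mctsM.
  apply: (@rot_cts R n sg _ (fun q : R * R => (1 - q.1) * q.2 + q.1 * th q.2) q).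
  apply: cvgD; apply: cvgM => //; first by apply: cvgB => //; exact: cvg_cst.
  exact: (cvg_comp _ _ c2 (derive_cts (th_derive q.2))).
by apply: fundamental_cts => [p t|t _]; [exact: HX_slice|exact: HX_cts].
Qed.

Let hom_Sp q : Sp (hom q).
Proof.
apply: SpM; first exact: rot_Sp.
apply: Sp_fundamental => r; first exact: HX_slice.
have hM : (Mt q.2 r)^T *m J0 R n + J0 R n *m Mt q.2 r = 0.
  apply: ham_block; first by rewrite linearZ /= BT scalerN.
    by rewrite /aa linearD /= !linearZ /= mxDT mxPT.
  have e X Y Z W : ((K * th q.2) *: X + (K * sp q.2) *: Y - sp q.2 *: Z - W)^T =
    (K * th q.2) *: X^T + (K * sp q.2) *: Y^T - sp q.2 *: Z^T - W^T :> 'M[R]_n.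
    by apply/matrixP => i j; rewrite !mxE.
  by rewrite /cc e mxDT mxPT QT tr_scalar_mx.
have hX : (pencil B Q 0 (q.2 * r))^T *m J0 R n + J0 R n *m pencil B Q 0 (q.2 * r) = 0.
  apply: ham_block => //; first exact: trmx1.
  by rewrite linearN linearD /= QT tr_scalar_mx.
rewrite /HX; move: (pencil _ _ _ _) (Mt _ _) hX hM => A A' hX hM.
rewrite linearD !linearZ /= mulmxDl mulmxDr -!scalemxAl -!scalemxAr addrACA -!scalerDr hX hM.
by rewrite !scaler0 addr0.
Qed.

Lemma core_homotopic (gam : R -> 'M[R]_(n + n)) :
  (forall t, 0 <= t <= 1 -> gam t = rot t *m fundamental (pencil B Q 0) t) ->
  sp_homotopic gam beta.
Proof.
move=> gE; exists hom.
have cp t : mcts (pencil B Q 0) t by exact: pencil_cts.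
have h01 : (0 <= (0 : R)) && ((0 : R) <= 1) := introT andP (conj (lexx _) ler01).
have h11 : (0 <= (1 : R)) && ((1 : R) <= 1) := introT andP (conj ler01 (lexx _)).
have h0 t : hom (0, t) = rot t *m fundamental (pencil B Q 0) t.
  rewrite /hom /HX /= subr0 !mul1r mul0r addr0.
  have -> : (fun r => t *: pencil B Q 0 (t * r) + 0 *: Mt t r) = (fun r => t *: pencil B Q 0 (t * r)).
    by apply/funext => r; rewrite scale0r addr0.
  by rewrite fundamental_scale // mulr1.
have h1 t : hom (1, t) = beta t.
  rewrite /hom /HX /= subrr !mul0r add0r mul1r /beta; congr (_ *m fundamental _ _).
  by apply/funext => r; rewrite scale0r scale1r add0r.
have ht0 s : hom (s, 0) = 1%:M.
  have th0 : th (0 : R) = 0 by rewrite /th mulr0 add0r pos_ge // expr1n subrr.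
  rewrite /hom /HX /= th0 !mulr0 addr0 rot0 mul1mx.
  have -> : (fun r => 0 *: pencil B Q 0 (0 * r) + s *: Mt 0 r) = Mt 0.
    by apply/funext => r; rewrite Mt0 // scale0r scaler0 addr0.
  exact: fundamental_Mt0.
have ht1 s : hom (s, 1) = rot 1 *m fundamental (pencil B Q 0) 1.
  have h : (2 / 3 : R) <= 1 by lra.
  have [th1 sp1 el1] := cutoff_high h.
  have M1 : Mt 1 = pencil B Q 0.
    rewrite Mt_high // el1; congr pencil; ring.
  rewrite /hom /HX /= th1 M1 !mulr1 subrK; congr (_ *m fundamental _ _).
  by apply/funext => r; rewrite mul1r -scalerDl subrK scale1r.
split.
- apply: continuous_subspaceT => q; apply/mctsP; exact: hom_cts.
- by move=> s t _ _; exact: hom_Sp.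
- by move=> t t01; rewrite h0 h1 gE.
- move=> s _; rewrite ht0 ht1 (gE 0 h01) (gE 1 h11); split=> //.
  by rewrite rot0 mul1mx fundamental0.
Qed.

End Bound.
End CoreTheorem.

Section CoreIndexFormula.
Variables (R : realType) (n : nat) (B Q : R -> 'M[R]_n) (sg : bool).
Hypothesis cB : forall t, mcts B t.
Hypothesis cQ : forall t, mcts Q t.
Hypothesis BT : forall t, (B t)^T = - B t.
Hypothesis QT : forall t, (Q t)^T = Q t.
Hypothesis sgn : sg -> (0 < n)%N.
Local Notation rot := (@rot R n sg).
Local Notation null_dim := (@null_dim R n B Q sg).
Implicit Types (t r lam : R).

Lemma sum_crossings (A : set R) (h : R -> R) (f : R -> int) (m : R -> nat) : finite_set A ->
  (forall t, A t -> f t = - (m (h t))%:Z) ->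
  set_bij A [set l | l < 0 /\ m l <> 0%N] h ->
  \sum_(t \in A) f t = - (\big[addn/0%N]_(l \in [set l : R | l < 0]) m l)%:Z.
Proof.
move=> fA fE bij.
have -> : \big[addn/0%N]_(l \in [set l : R | l < 0]) m l =
    \big[addn/0%N]_(l \in [set l : R | l < 0 /\ m l <> 0%N]) m l.
  apply/esym/fsbig_widen => [l [] //|l [l0 nl] /=].
  by apply: contrapT => ml; apply: nl; split.
rewrite (reindex_fsbig _ _ _ _ bij) (eq_fsbigr (fun t => - (m (h t))%:Z)) => [|t]; last first.
  by rewrite inE; exact: fE.
rewrite !fsbig_finite //; elim: (finmap.enum_fset _) => [|t s IH].
  by rewrite !big_nil oppr0.
by rewrite !big_cons PoszD opprD IH.
Qed.

Lemma null_dimP lam : null_dim lam <> 0%N <->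
  exists2 z : 'cV[R]_(n + n), z != 0 & rot 1 *m fundamental (pencil B Q lam) 1 *m z = z.
Proof.
rewrite -(crossingP (fun=> rot 1 *m fundamental (pencil B Q lam) 1) 0) /crossing /null_dim.
by rewrite -mxrank_eq0; split=> /eqP.
Qed.

Theorem core_index (gam : R -> 'M[R]_(n + n)) :
  (forall t, 0 <= t <= 1 -> gam t = rot t *m fundamental (pencil B Q 0) t) ->
  null_dim 0 = 0%N ->
  mu_CZ gam = sg%:R - (\big[addn/0%N]_(l \in [set l : R | l < 0]) null_dim l)%:R.
Proof.
move=> gE nd0.
have [C C0 HC] := nrm_bounded_on (fun t (_ : (0 : R) <= t <= 1) => @cQ t).
pose K := C + 1.
have K0 : 0 < K by rewrite addr_gt0.
have KQ t : 0 <= t <= 1 -> nrm (Q t) < K by move=> /HC h; rewrite (le_lt_trans h) // ltrDl.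
have [V [V0 dV dY cV]] := fundamental_C1 (@Mt_cts R n B Q sg K cB cQ)
  (@Mt'_cts R n B Q sg K cB cQ) (@Mt_derive R n B Q sg K).
pose bt := @beta R n B Q sg K.
have h01 : (0 <= (0 : R)) && ((0 : R) <= 1) := introT andP (conj (lexx _) ler01).
have h11 : (0 <= (1 : R)) && ((1 : R) <= 1) := introT andP (conj ler01 (lexx _)).
have g0 : gam 0 = 1%:M by rewrite (gE 0 h01) rot0 mul1mx fundamental0.
have g1 : gam 1 = rot 1 *m fundamental (pencil B Q 0) 1 by exact: (gE 1 h11).
have nc1 : ~ crossing gam 1.
  move=> /crossingP[z z0 gz]; have : null_dim 0 <> 0%N by apply/null_dimP; exists z; rewrite -?g1.
  by rewrite nd0.
have hom := @core_homotopic R n B Q sg cB cQ BT QT K gam gE.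
have b1 : bt 1 = gam 1 by have [h [_ _ /(_ 1 h11)[_ E1] /(_ 1 h11)[_ E2]]] := hom; rewrite -E2.
have low t : 0 < t <= 1 -> crossing bt t -> 2 / 3 < t < 1.
  move=> /andP[t0 t1] ct; have [h|h] := leP t (2 / 3).
    by case: (beta_no_crossing cB cQ BT K0 KQ (introT andP (conj t0 h)) ct).
  rewrite /= lt_neqAle t1 andbT; apply/eqP => t1'; apply: nc1.
  by move: ct; rewrite t1' /crossing b1.
have high t : 2 / 3 < t -> sign (crossing_form bt t) = - (\rank (kermx (1%:M - bt t)^T))%:Z /\
    crossing_form bt t \in unitmx.
  by move=> t23; exact: (crossing_form_high cB cQ BT QT K0 V0 dV dY t23).
have [s0 u0] : sign (crossing_form bt 0) = (sg.*2)%:Z /\ crossing_form bt 0 \in unitmx := crossing_form0 cB cQ BT QT sgn K0 V0 dV dY.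
have reg : regular_path bt.
  split.
  - by move=> t; exact: (beta_derivable dY).
  - exact: (dbeta_continuous dY cV).
  move=> t /andP[t0 t1] ct; have [->|tn] := eqVneq t 0; first exact: u0.
  have t01 : 0 < t <= 1 by rewrite lt_neqAle eq_sym tn t0.
  by have /andP[t23 _] := low t t01 ct; have [] := high t t23.
pose h t := - (K * (1 - el t)).
have bh t : 2 / 3 < t -> bt t = rot 1 *m fundamental (pencil B Q (h t)) 1.
  move=> t23; have [thE _ _] := @cutoff_high R t (ltW t23).
  by rewrite /bt /beta thE Mt_high // ltW.
rewrite (mu_CZ_eq g0 nc1 reg hom).
(* Used here for finiteness of the crossings only; the index itself is computed from the definition
   below. *)
have [N0 /(_ N0.*2 _ _)[]] := crossing_index_homotopic reg hom g0 nc1.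
- by rewrite -addnn leq_addr.
- by rewrite odd_double.
move=> _ fin; clearbody bt.
rewrite /crossing_index s0.
have inj2 t t' : 2 / 3 < t -> 2 / 3 < t' -> h t = h t' -> t = t'.
  move=> t23 t23'; rewrite /h => /oppr_inj /(mulfI (lt0r_neq0 K0)).
  have [_ _ ->] := @cutoff_high R t (ltW t23); have [_ _ ->] := @cutoff_high R t' (ltW t23').
  move=> /(congr1 (fun z => 1 - z)); rewrite !opprB !addrA !(addrC 1) !addrK.
  move=> /eqP; rewrite -subr_eq0 subr_sqr mulf_eq0 => /orP[] /eqP; lra.
rewrite (@sum_crossings _ h _ null_dim fin).
- by rewrite -muln2 PoszM intrM mulrCA mulVf ?mulr1 // rmorphN.
- move=> t [/andP[t0 t1] ct]; have /andP[t23 _] := low t (introT andP (conj t0 (ltW t1))) ct.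
  by have [-> _] := high t t23; rewrite (bh t t23).
split.
- move=> t [/andP[t0 t1] ct]; have /andP[t23 _] := low t (introT andP (conj t0 (ltW t1))) ct.
  split=> /=.
    rewrite /h oppr_lt0 mulr_gt0 // subr_gt0; have [_ _ ->] := @cutoff_high R t (ltW t23).
    by rewrite expr_lt1 //; lra.
  by apply/null_dimP; rewrite -(bh t t23); exact/crossingP.
- move=> t t'; rewrite !inE => -[/andP[t0 t1] ct] [/andP[t0' t1'] ct'].
  have /andP[t23 _] := low t (introT andP (conj t0 (ltW t1))) ct.
  have /andP[t23' _] := low t' (introT andP (conj t0' (ltW t1'))) ct'.
  exact: inj2.
move=> l [/= l0 /null_dimP[z z0 fz]].
have lK : - K < l.
  rewrite ltNge; apply/negP => lK.
  by move: z0; rewrite (pencil_no_fix cB cQ BT KQ lK fz) eqxx.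
(* Solves [h t = l] in the last stage: there [el t] is (3 t - 2)^2, which has to equal 1 + l / K. *)
pose q := Num.sqrt (1 + l / K).
have a0 : 0 < 1 + l / K by rewrite -(mulfV (lt0r_neq0 K0)) -mulrDl divr_gt0 // -ltrBlDl sub0r.
have a1 : 1 + l / K < 1 by rewrite gtrDl pmulr_llt0 // invr_gt0.
have q0 : 0 < q by rewrite sqrtr_gt0.
have q2 : q ^+ 2 = 1 + l / K by rewrite sqr_sqrtr // ltW.
have q1 : q < 1.
  by rewrite -(@ltr_pXn2r _ 2%N) ?nnegrE ?ltW // q2 expr1n.
pose t := (q + 2) / 3.
have t23 : 2 / 3 < t by rewrite /t; lra.
have t1 : t < 1 by rewrite /t; lra.
have ht : h t = l.
  rewrite /h; have [_ _ ->] := @cutoff_high R t (ltW t23).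
  have -> : 3 * t - 2 = q by rewrite /t; field.
  by rewrite q2; field; rewrite gt_eqF.
exists t => //; split; first by rewrite /= t1 andbT; lra.
by apply/crossingP; exists z => //; rewrite (bh t t23) ht.
Qed.

End CoreIndexFormula.

(** * Eigenfunctions of the Hessian *)

Section WeakDerivatives.
Variable R : realType.
Local Notation leb := (@lebesgue_measure R).
Implicit Types (F f h : R -> R) (a b t s : R).

Lemma within_itv_cts f a b : (forall s, a <= s <= b -> f @ s --> f s) ->
  {within `[a, b]%classic, continuous f}.
Proof.
by move=> cf; apply: continuous_in_subspaceT => s; rewrite inE /= in_itv /=; exact: cf.
Qed.

Lemma integrable_cts f a b : (forall s, a <= s <= b -> f @ s --> f s) ->
  leb.-integrable `[a, b]%classic (EFin \o f).
Proof.
by move=> cf; apply: continuous_compact_integrable; [exact: segment_compact|exact: within_itv_cts].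
Qed.

Lemma weak_cts F f a t b : a < t < b -> leb.-integrable `[a, b]%classic (EFin \o f) ->
  (forall s, a <= s <= b -> F s - F a = \int[leb]_(r in `[a, s]%classic) f r) -> F @ t --> F t.
Proof.
move=> /andP[at_ tb] fi FE; have ab := lt_trans at_ tb.
have := parameterized_integral_continuous (ltW ab) fi.
move=> /(continuous_within_itvP _ ab)[ci _ _].
have tab : t \in `]a, b[ by rewrite in_itv /= at_.
have ct := ci t tab.
have cG : (fun s => F a + parameterized_integral leb a s f) @ t --> F a + parameterized_integral leb a t f.
  by apply: cvgD; [exact: cvg_cst|exact: ct].
have E s : a <= s <= b -> F s = F a + parameterized_integral leb a s f.
  by move=> sab; rewrite /parameterized_integral -(FE s sab) addrC subrK.
rewrite (E t); last by rewrite !ltW.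
apply: cvg_trans cG; apply: near_eq_cvg.
apply: filterS (near_in_itvoo tab) => s; rewrite in_itv /= => /andP[s1 s2].
by rewrite (E s) // !ltW.
Qed.

(** Changing the integrand on a null set does not change [F], so [F] is also the integral of the
    continuous [h] and the fundamental theorem applies. *)
Lemma weak_derive F f h a t b : a < t < b -> leb.-integrable `[a, b]%classic (EFin \o f) ->
  (forall s, a <= s <= b -> F s - F a = \int[leb]_(r in `[a, s]%classic) f r) ->
  {ae leb, forall s, `[a, b]%classic s -> f s = h s} ->
  (forall s, a <= s <= b -> h @ s --> h s) -> is_derive t (1 : R) F (h t).
Proof.
move=> /andP[at_ tb] fi FE fh ch.
have hi := integrable_cts ch.
have tab : t \in `]a, b[ by rewrite in_itv /= at_.
have ct : {for t, continuous h} by apply: ch; rewrite !ltW.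
have [dG GE] := continuous_FTC1_closed tb hi at_ ct.
have E s : a <= s <= b -> F s = F a + \int[leb]_(r in `[a, s]%classic) h r.
  move=> /andP[as_ sb]; have sab : a <= s <= b by rewrite as_.
  rewrite -[F s](subrK (F a)) FE // addrC; congr (_ + _).
  have sub : `[a, s]%classic `<=` (`[a, b]%classic : set R).
    by move=> r /=; rewrite !in_itv /= => /andP[-> rs]; exact: le_trans rs sb.
  have res k : leb.-integrable `[a, b]%classic (EFin \o k) -> leb.-integrable `[a, s]%classic (EFin \o k).
    by move=> ki; apply: integrableS ki => //; exact: measurable_itv.
  rewrite /Rintegral; congr fine; apply: ae_eq_integral => //.
  - by have /integrableP[] := res _ fi.
  - by have /integrableP[] := res _ hi.
  case: fh => N [mN N0 sN]; exists N; split=> // r nr; apply: sN => Hr; apply: nr => rs.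
  by rewrite Hr //; exact: sub.
have dG' : is_derive t (1 : R) (fun s => F a + \int[leb]_(r in `[a, s]%classic) h r) (h t).
  have H := is_deriveD (is_derive_cst (F a) t (1 : R)) (derivableP dG).
  by apply: is_derive_eq H _; rewrite add0r -derive1E.
apply: near_eq_is_derive dG'.
apply: filterS (near_in_itvoo tab) => s; rewrite in_itv /= => /andP[s1 s2].
by rewrite (E s) // !ltW.
Qed.

Lemma strong_weak F f a b : a <= b -> (forall s, a <= s <= b -> is_derive s (1 : R) F (f s)) ->
  (forall s, a <= s <= b -> f @ s --> f s) ->
  leb.-integrable `[a, b]%classic (EFin \o f) /\
  F b - F a = \int[leb]_(s in `[a, b]%classic) f s.
Proof.
move=> ab dF cf; split; first exact: integrable_cts.
move: ab; rewrite le_eqVlt => /predU1P[eab|ab].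
  by rewrite eab subrr set_itv1 Rintegral_set1.
have cF s : a <= s <= b -> F @ s --> F s.
  by move=> sab; exact: derive_cts (dF s sab).
have lr := (continuous_within_itvP F ab).1 (within_itv_cts cF).
have := @continuous_FTC2 R f F a b ab (within_itv_cts cf).
case: lr => _ c1 c2.
move=> /(_ _ _); rewrite /Rintegral => ->; first by [].
- split=> //= s; rewrite in_itv /= => /andP[s1 s2].
  by have [] := dF s; rewrite ?ltW.
move=> s; rewrite in_itv /= => /andP[s1 s2].
by have [] := dF s; [rewrite !ltW|rewrite derive1E].
Qed.

End WeakDerivatives.

Section DimensionUnique.
Variables (R : realType) (n : nat) (E : set (R -> 'cV[R]_n)).

(** Two bases expand each other; uniqueness of coordinates makes the product of the two coefficient
    matrices the identity, which bounds the size by the rank. *)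
Lemma has_dim_le m r : has_dim E m -> has_dim E r -> (m <= r)%N.
Proof.
move=> [b [bE bU]] [b' [b'E b'U]].
have in_E k (c : 'I_k -> R -> 'cV[R]_n) (j : 'I_k) :
    c j = (fun t => \sum_i (i == j)%:R *: c i t).
  apply/funext => t; rewrite (bigD1 j) //= eqxx scale1r big1 ?addr0 // => i /negbTE ->.
  by rewrite scale0r.
have h j : exists c : 'I_r -> R, b j = (fun t => \sum_k c k *: b' k t).
  have := bE (fun i => (i == j)%:R); rewrite -(in_E _ b j) => /b'U[c [Hc _]].
  by exists c.
have h' k : exists c : 'I_m -> R, b' k = (fun t => \sum_j c j *: b j t).
  have := b'E (fun i => (i == k)%:R); rewrite -(in_E _ b' k) => /bU[c [Hc _]].
  by exists c.
have [C HC] := choice h; have [C' HC'] := choice h'.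
apply: (@mulmx1_min R m r (\matrix_(j, k) C j k) (\matrix_(k, j) C' k j)).
apply/matrixP => j l; rewrite !mxE.
under eq_bigr do rewrite !mxE.
have bjE := bE (fun i => (i == j)%:R); rewrite -(in_E _ b j) in bjE.
have [c [Hc cU]] := bU _ bjE.
have e1 : c = (fun l => (j == l)%:R).
  apply: cU; rewrite [LHS](in_E _ b j); apply/funext => t; apply: eq_bigr => i _.
  by rewrite eq_sym.
have e2 : c = (fun l => \sum_k C j k * C' k l).
  apply: cU; rewrite [LHS]HC; apply/funext => t.
  under eq_bigr do rewrite HC' scaler_sumr; rewrite exchange_big; apply: eq_bigr => i _.
  by rewrite scaler_suml; apply: eq_bigr => k _; rewrite scalerA.
by rewrite -[LHS]/((fun l => \sum_k C j k * C' k l) l) -e2 e1.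
Qed.

Lemma has_dim_xget r : has_dim E r -> xget 0%N [set m | has_dim E m] = r.
Proof.
move=> hr; apply: xget_unique => // m hm.
by apply/eqP; rewrite eqn_leq !has_dim_le.
Qed.

End DimensionUnique.

(** * Regularity of weak eigenfields *)

Section FieldsAlongCriticalPoint.
Variables (R : realType) (n : nat) (M : smooth_manifold R n) (g : riemannian_metric M).
Variable V : R -> M -> R.
Hypothesis sV : smooth_potential V.
Variable x : R -> M.
Hypothesis xC : Crit g V x.
Local Notation Gl := (metric_coord g).
Local Notation leb := (@lebesgue_measure R).
Local Notation vel := (fun i t => fcoord x i (velocity x) t).
Local Notation Gam i t := (gam (Gl i) (chart i (x t)) (fcoord x i (velocity x) t)).
Local Notation Qx i t := (Qchart g V i t (chart i (x t)) (fcoord x i (velocity x) t)).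
Implicit Types (i : chart_index M) (t s : R) (xi eta zeta rho : R -> 'cV[R]_n).

Lemma dom_itv i t : dom i (x t) ->
  exists a b, a < t < b /\ forall s, a <= s <= b -> dom i (x s).
Proof.
move=> ix; have [d d0 Hd] := near_dist (near_dom (crit_cts xC) ix).
exists (t - d / 2), (t + d / 2); split.
  by rewrite ltrBlDr !ltrDl divr_gt0.
move=> s /andP[s1 s2]; apply: Hd; apply: (@le_lt_trans _ _ (d / 2)); last lra.
by rewrite ler_distl s1 s2.
Qed.

Let conn i s xi eta : dom i (x s) ->
  vcoord i (x s) (eta s) - christoffel_form (Gl i) (chart i (x s))
    (derive1 (fun r => chart i (x r)) s) (vcoord i (x s) (xi s)) =
  fcoord x i eta s - Gam i s *m fcoord x i xi s.
Proof.
move=> ix; have [_ ->] := dmx_derive1 (crit_chart_dmx xC ix).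
by rewrite gamE.
Qed.

Let weak_split i a b k xi eta : a < b -> (forall s, a <= s <= b -> dom i (x s)) ->
  weak_cov_deriv g x xi eta ->
  let d := fun s => (fcoord x i eta s - Gam i s *m fcoord x i xi s) k ord0 in
  leb.-integrable `[a, b]%classic (EFin \o d) /\
  forall s, a <= s <= b -> fcoord x i xi s k ord0 - fcoord x i xi a k ord0 =
    \int[leb]_(r in `[a, s]%classic) d r.
Proof.
move=> ab ix W d.
have part s : a <= s <= b -> leb.-integrable `[a, s]%classic (EFin \o d) /\
  fcoord x i xi s k ord0 - fcoord x i xi a k ord0 = \int[leb]_(r in `[a, s]%classic) d r.
  move=> /andP[as_ sb].
  have ic : in_chart x i a s by split=> // r /andP[ar rs]; apply: ix; rewrite ar (le_trans rs).
  have [Wi We] := W i a s k ic.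
  have dE r : r \in (`[a, s]%classic : set R) ->
     (vcoord i (x r) (eta r) - christoffel_form (Gl i) (chart i (x r))
       (derive1 (fun r => chart i (x r)) r) (vcoord i (x r) (xi r))) k ord0 = d r.
    by rewrite inE /= in_itv /= => /andP[ar rs]; rewrite conn //; apply: (ix); rewrite ar (le_trans rs).
  split; last by rewrite [LHS]We; exact: eq_Rintegral.
  by apply: eq_integrable Wi => // r ri; rewrite /= dE.
split; first by have [] := part b; rewrite ?(ltW ab) ?lexx.
by move=> s /part[].
Qed.

Lemma weak_field_cts i t xi eta : dom i (x t) -> weak_cov_deriv g x xi eta ->
  mcts (fcoord x i xi) t.
Proof.
move=> ix W k l; rewrite (ord1 l).
have [a [b [/andP[at_ tb] H]]] := dom_itv ix.
have [di dE] := weak_split k (lt_trans at_ tb) H W.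
by apply: (weak_cts (F := fun s => fcoord x i xi s k ord0) _ di dE); rewrite at_.
Qed.

Lemma weak_field_dmx i t xi eta rho : dom i (x t) -> weak_cov_deriv g x xi eta ->
  {ae leb, forall s, dom i (x s) -> fcoord x i eta s = rho s} ->
  (forall s, dom i (x s) -> mcts rho s) ->
  dmx (fcoord x i xi) t (rho t - Gam i t *m fcoord x i xi t).
Proof.
move=> ix W er cr k l; rewrite (ord1 l).
have [a [b [/andP[at_ tb] H]]] := dom_itv ix.
have [di dE] := weak_split k (lt_trans at_ tb) H W.
have atb : a < t < b by rewrite at_.
apply: (weak_derive (F := fun s => fcoord x i xi s k ord0)
  (h := fun s => (rho s - Gam i s *m fcoord x i xi s) k ord0) atb di dE).
  case: er => N [mN N0 sN]; exists N; split=> // r nr; apply: sN => Hr; apply: nr => rs.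
  by rewrite Hr //; apply: H; move: rs; rewrite /= in_itv.
move=> s /H is_.
have : mcts (fun s => rho s - Gam i s *m fcoord x i xi s) s.
  apply: mctsB; first exact: cr.
  by apply: mctsM; [exact: (Gam_cts sV xC)|exact: (weak_field_cts is_ W)].
by apply.
Qed.

Lemma strong_field_weak xi eta : (forall i t, dom i (x t) ->
    dmx (fcoord x i xi) t (fcoord x i eta t - Gam i t *m fcoord x i xi t)) ->
  (forall i t, dom i (x t) -> mcts (fcoord x i eta) t) -> weak_cov_deriv g x xi eta.
Proof.
move=> dxi ceta i a b k [ab ix] d.
pose d' s := (fcoord x i eta s - Gam i s *m fcoord x i xi s) k ord0.
have dE r : r \in (`[a, b]%classic : set R) -> d r = d' r.
  by rewrite inE /= in_itv /= => rab; rewrite /d conn //; exact: ix.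
have cd s : a <= s <= b -> d' @ s --> d' s.
  move=> /ix is_; have : mcts (fun s => fcoord x i eta s - Gam i s *m fcoord x i xi s) s.
    apply: mctsB; first exact: ceta.
    by apply: mctsM; [exact: (Gam_cts sV xC)|exact: dmx_mcts (dxi i s is_)].
  by apply.
have dF s : a <= s <= b -> is_derive s (1 : R) (fun s => fcoord x i xi s k ord0) (d' s).
  by move=> /ix is_; exact: dxi.
have [h1 h2] := strong_weak ab dF cd.
split; last by rewrite [LHS]h2; apply: eq_Rintegral => r /dE.
by apply: eq_integrable h1 => // r ri; rewrite /= dE.
Qed.

Lemma cts_L2_field xi : (forall i t, dom i (x t) -> mcts (fcoord x i xi) t) -> L2_field x xi.
Proof.
move=> cxi i a b k [ab ix] f.
have cf s : a <= s <= b -> f @ s --> f s by move=> /ix is_; exact: cxi.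
split.
  by have /integrableP[mf _] := integrable_cts cf; exact/measurable_EFinP.
apply: (@integrable_cts R (fun s => f s ^+ 2)) => s sab.
by apply: (cvgM (cf s sab) (cf s sab)).
Qed.

Lemma curvature_Qchart t (u : 'cV[R]_n) :
  curvature g (x t) u (velocity x t) (velocity x t) + cov_gradV g V t (x t) u =
  Qx (chart_at (x t)) t *m u.
Proof.
set i := chart_at (x t).
have iq : img i (chart i (x t)) by apply: img_chart; exact: mem_chart_at.
have Gu q : img i q -> Gl i q \in unitmx by exact: metric_coord_unit.
have oi := @open_img _ _ M i; have Gs := metric_coord_smooth g i.
rewrite fcoord_id /curvature /cov_gradV -/i /Qchart mulmxDl.
rewrite (riemannE oi Gs Gu) // (KmxE oi Gs Gu) //; congr (_ + _).
exact: (cov_gradientE (metric_coord_sym g i)).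
Qed.

(** Regularity in dimension one: weakly differentiable fields are continuous, so eta is a continuous
    derivative of xi, and the eigenvalue equation makes zeta equal almost everywhere to a continuous
    field. Both derivatives are then classical. *)
Lemma weak_eigen_dmx lam xi eta zeta i t : W22_field g x xi eta zeta ->
  {ae leb, forall t, - zeta t - curvature g (x t) (xi t) (velocity x t) (velocity x t)
      - cov_gradV g V t (x t) (xi t) = lam *: xi t} -> dom i (x t) ->
  dmx (fcoord x i xi) t (fcoord x i eta t - Gam i t *m fcoord x i xi t) /\
  dmx (fcoord x i eta) t (- (Qx i t *m fcoord x i xi t) - lam *: fcoord x i xi t
    - Gam i t *m fcoord x i eta t).
Proof.
move=> [_ _ W1 W2] ev ix; split.
  apply: (weak_field_dmx (rho := fcoord x i eta) ix W1); first by apply: aeW => s.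
  by move=> s is_; exact: weak_field_cts W2.
apply: (weak_field_dmx (rho := fun t => - (Qx i t *m fcoord x i xi t) - lam *: fcoord x i xi t)) W2 _ _ => //.
  case: ev => N [mN N0 sN]; exists N; split=> // r nr; apply: sN => Hr; apply: nr => is_.
  have cp := mem_chart_at (x r).
  have zE : zeta r = - (Qx (chart_at (x r)) r *m xi r) - lam *: xi r.
    rewrite -curvature_Qchart -Hr; move: (curvature _ _ _ _ _) (cov_gradV _ _ _ _ _) (zeta r) => p q z.
    by apply/matrixP => k l; rewrite !mxE; ring.
  rewrite /fcoord zE mulmxBr mulmxN -scalemxAr; congr (- _ - _).
  by rewrite (mulmxA (tchg _ _ _) (Qchart _ _ _ _ _ _)) fcoord_id (Qchart_change g sV _ _ cp is_) -!mulmxA.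
move=> s is_; have cx := weak_field_cts is_ W1.
apply: mctsB; last by apply: mctsZ => //; exact: cvg_cst.
apply: mctsN; apply: mctsM => //.
exact: (Qchart_mcts sV (f := fun s : R => s) cvg_id (chart_crit_cts xC is_) (velocity_cts sV xC is_) (img_chart is_)).
Qed.

End FieldsAlongCriticalPoint.

(** * Eigenspaces as fixed spaces of the twisted flow *)

Section Eigenfunctions.
Variables (R : realType) (n : nat) (M : smooth_manifold R n) (g : riemannian_metric M).
Variable V : R -> M -> R.
Hypothesis sV : smooth_potential V.
Variable x : R -> M.
Hypothesis xC : Crit g V x.
Variable phi : R -> 'M[R]_n.
Hypothesis sphi : smooth_frame x phi.
Hypothesis ophi : forall t, (phi t)^T *m g (x t) *m phi t = 1%:M.
Hypothesis phi1 : phi 1 = phi 0 *m E_sigma x.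
Local Notation Gl := (metric_coord g).
Local Notation B := (frame_B g x phi).
Local Notation Q := (frame_Q g V x phi).
Local Notation sg := (sigma x).
Local Notation rot := (@rot R n sg).
Local Notation Gam i t := (gam (Gl i) (chart i (x t)) (fcoord x i (velocity x) t)).
Local Notation Qx i t := (Qchart g V i t (chart i (x t)) (fcoord x i (velocity x) t)).
Implicit Types (i : chart_index M) (t s lam : R) (xi eta zeta : R -> 'cV[R]_n).
Implicit Types (z : 'cV[R]_(n + n)).

Let cP lam t : mcts (pencil B Q lam) t.
Proof. exact: (pencil_cts (@frame_B_cts _ _ _ _ _ sV _ xC _ sphi ophi t) (@frame_Q_cts _ _ _ _ _ sV _ xC _ sphi ophi t)). Qed.

Let xper t : x (t + 1) = x t.
Proof. by have [[]] := xC. Qed.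

Let velper t : velocity x (t + 1) = velocity x t.
Proof.
rewrite /velocity xper; set i := chart_at (x t).
have ix : dom i (x (t + 1)) by rewrite xper; exact: mem_chart_at.
have h1 := dmx_comp (f := fun s => s + 1) _ (crit_chart_dmx xC ix).
have d1 : is_derive t (1 : R) (fun s => s + 1 : R) 1.
  have := is_deriveD (is_derive_id t (1 : R)) (is_derive_cst (1 : R) t (1 : R)).
  by rewrite addr0.
have := h1 1 d1; rewrite scale1r.
under eq_fun do rewrite xper.
move=> h2; have [_ ->] := dmx_derive1 h2.
by have [_ ->] := dmx_derive1 (crit_chart_dmx xC ix).
Qed.

Let Gamper i t : Gam i (t + 1) = Gam i t.
Proof. by rewrite /fcoord velper xper. Qed.

Let Qper i t : Qx i (t + 1) = Qx i t.
Proof.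
have Vt : Vslice V i (t + 1) = Vslice V i t.
  by apply/funext => q; rewrite /Vslice; case: sV => -> _.
by rewrite /fcoord velper xper /Qchart Vt.
Qed.

Let Qcper t : Qx (chart_at (x (t + 1))) (t + 1) = Qx (chart_at (x t)) t.
Proof. by have -> : chart_at (x (t + 1)) = chart_at (x t) by rewrite xper. Qed.

Let fcoord_shift m i (v : R -> 'M[R]_(n, m)) t :
  fcoord x i (fun s => v (s + 1)) t = fcoord x i v (t + 1).
Proof. by rewrite /fcoord xper. Qed.

Let dmx_shift m (F : R -> 'M[R]_(n, m)) t D : dmx F (t + 1) D -> dmx (fun s => F (s + 1)) t D.
Proof.
move=> dF; have d1 : is_derive t (1 : R) (fun s => s + 1 : R) 1.
  have := is_deriveD (is_derive_id t (1 : R)) (is_derive_cst (1 : R) t (1 : R)).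
  by rewrite addr0.
by have := dmx_comp d1 dF; rewrite scale1r.
Qed.

Lemma E_sigmaE : E_sigma x = mxD R n sg - mxP R n sg.
Proof.
apply/matrixP => i j; rewrite /mxD /mxP !mxE.
by case: (i == j) => //=; case: ifP => _; rewrite ?mulr1n ?mulr0n; case: sg => //=; rewrite ?expr1 ?expr0; ring.
Qed.

(** The field with initial frame coordinates [z] that solves the eigenvalue equation, disregarding
    periodicity; [dsol] is its covariant derivative. *)
Definition sol lam z t : 'cV[R]_n := phi t *m usubmx (fundamental (pencil B Q lam) t *m z).
Definition dsol lam z t : 'cV[R]_n := phi t *m dsubmx (fundamental (pencil B Q lam) t *m z).

Let zz lam z t := fundamental (pencil B Q lam) t *m z.

Let dzz lam z t : dmx (zz lam z) t (pencil B Q lam t *m zz lam z t).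
Proof.
have := dmxM (fundamental_dmx (@cP lam) t) (dmx_cst z t).
by rewrite mulmx0 addr0 -mulmxA.
Qed.

Lemma pencil_mul lam t (a b : 'cV[R]_n) : pencil B Q lam t *m col_mx a b =
  col_mx (- (B t *m a) + b) (- ((Q t + lam%:M) *m a) - B t *m b).
Proof. by rewrite mul_block_col !mulNmx mul1mx. Qed.

Lemma sol_dmx lam z i t : dom i (x t) ->
  dmx (fcoord x i (sol lam z)) t (fcoord x i (dsol lam z) t - Gam i t *m fcoord x i (sol lam z) t) /\
  dmx (fcoord x i (dsol lam z)) t (- (Gam i t *m fcoord x i (dsol lam z) t)
     - Qx i t *m fcoord x i (sol lam z) t - lam *: fcoord x i (sol lam z) t).
Proof.
move=> ix; have d := dzz lam z t.
have du := dmx_usub d; have dd := dmx_dsub d.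
rewrite -[zz lam z t]vsubmxK pencil_mul in du; rewrite -[zz lam z t]vsubmxK pencil_mul in dd.
rewrite col_mxKu in du; rewrite col_mxKd in dd.
exact: (frame_ode sV xC sphi ophi ix du dd).
Qed.

Lemma frame_ode_uniq lam (u v : R -> 'cV[R]_n) :
  (forall i t, dom i (x t) ->
    dmx (fcoord x i u) t (fcoord x i v t - Gam i t *m fcoord x i u t)) ->
  (forall i t, dom i (x t) ->
    dmx (fcoord x i v) t (- (Qx i t *m fcoord x i u t) - lam *: fcoord x i u t - Gam i t *m fcoord x i v t)) ->
  let z := col_mx (invmx (phi 0) *m u 0) (invmx (phi 0) *m v 0) in
  forall t, u t = sol lam z t /\ v t = dsol lam z t.
Proof.
move=> du dv z t.
have fu s := frame_unit ophi s.
have [a aE uE] : exists2 a, a = (fun t => invmx (phi t) *m u t) & u = (fun t => phi t *m a t).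
  by eexists; [reflexivity|apply/funext => s; rewrite mulKVmx].
have [b bE vE] : exists2 b, b = (fun t => invmx (phi t) *m v t) & v = (fun t => phi t *m b t).
  by eexists; [reflexivity|apply/funext => s; rewrite mulKVmx].
have da s : dmx a s (- (B s *m a s) + b s).
  have ix := mem_chart_at (x s); apply: (frame_ode_inv xC sphi ophi ix).
  by have := du _ s ix; rewrite [in X in X -> _]uE [in X in X -> _]vE !fcoord_frame.
have db s : dmx b s (- (B s *m b s) + (- ((Q s + lam%:M) *m a s))).
  have ix := mem_chart_at (x s); apply: (frame_ode_inv (b := fun s => - ((Q s + lam%:M) *m a s)) xC sphi ophi ix).
  have := dv _ s ix; rewrite [in X in X -> _]uE [in X in X -> _]vE !fcoord_frame.
  have alg (F A A' : 'M[R]_n) (w : 'cV[R]_n) c : A' *m F = F *m A ->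
     - (A' *m (F *m w)) - lam *: (F *m w) - c = F *m (- ((A + lam%:M) *m w)) - c.
    move=> e; rewrite mulmxN mulmxDl mulmxDr mul_scalar_mx -scalemxAr (mulmxA A') e -mulmxA.
    by rewrite opprD.
  have e := frame_Qchart sV ophi ix; rewrite /= in e; move: e alg.
  move: (fcoord _ _ phi s) (Qchart _ _ _ _ _ _) => F A' e alg.
  by rewrite (alg _ _ _ _ _ e).
have dab s : dmx (fun s => col_mx (a s) (b s)) s (pencil B Q lam s *m col_mx (a s) (b s)).
  rewrite pencil_mul [X in col_mx _ X]addrC; exact: dmx_col.
have zE : col_mx (a t) (b t) = fundamental (pencil B Q lam) t *m z.
  by rewrite (fundamentalE (@cP lam) dab t) /z aE bE.
by rewrite /sol /dsol -zE col_mxKu col_mxKd [in LHS]uE [in X in _ /\ X = _]vE.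
Qed.

Lemma rot1_fix (a b : 'cV[R]_n) : rot 1 *m col_mx a b = col_mx (E_sigma x *m a) (E_sigma x *m b).
Proof. by rewrite rot1 mul_block_col !mul0mx addr0 add0r E_sigmaE. Qed.

(** The frame, and with it [B] and [Q], need not be periodic, so periodicity is checked on the
    field: its translate by 1 solves the same covariant equation, and the twist [E_sigma] of the
    frame matches [rot 1], so the initial values agree. *)
Lemma sol_periodic lam z : rot 1 *m fundamental (pencil B Q lam) 1 *m z = z ->
  periodic1 (sol lam z) /\ periodic1 (dsol lam z).
Proof.
move=> fz.
have s0 : sol lam z 0 = phi 0 *m usubmx z /\ dsol lam z 0 = phi 0 *m dsubmx z.
  by rewrite /sol /dsol fundamental0 mul1mx.
pose w := fundamental (pencil B Q lam) 1 *m z.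
have e : col_mx (E_sigma x *m usubmx w) (E_sigma x *m dsubmx w) = z by rewrite -rot1_fix vsubmxK mulmxA.
have e1 : usubmx z = E_sigma x *m usubmx w by rewrite -[in LHS]e col_mxKu.
have e2 : dsubmx z = E_sigma x *m dsubmx w by rewrite -[in LHS]e col_mxKd.
have s1 : sol lam z 1 = phi 0 *m usubmx z /\ dsol lam z 1 = phi 0 *m dsubmx z.
  by rewrite /sol /dsol phi1 -/w e1 e2 -!mulmxA.
have fE i (v : R -> 'cV[R]_n) : fcoord x i (fun s => v (s + 1)) = (fun s => fcoord x i v (s + 1)).
  by apply/funext => s; exact: fcoord_shift.
have du i t : dom i (x t) -> dmx (fcoord x i (fun s => sol lam z (s + 1))) t
   (fcoord x i (fun s => dsol lam z (s + 1)) t - Gam i t *m fcoord x i (fun s => sol lam z (s + 1)) t).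
  move=> ix; have ix' : dom i (x (t + 1)) by rewrite xper.
  by have [h _] := sol_dmx lam z ix'; rewrite Gamper in h; rewrite !fE; exact: dmx_shift.
have dv i t : dom i (x t) -> dmx (fcoord x i (fun s => dsol lam z (s + 1))) t
   (- (Qx i t *m fcoord x i (fun s => sol lam z (s + 1)) t)
    - lam *: fcoord x i (fun s => sol lam z (s + 1)) t
    - Gam i t *m fcoord x i (fun s => dsol lam z (s + 1)) t).
  move=> ix; have ix' : dom i (x (t + 1)) by rewrite xper.
  have [_ h] := sol_dmx lam z ix'; rewrite Gamper Qper in h; rewrite !fE.
  have alg (p q r : 'cV[R]_n) : - p - q - r = - q - r - p by apply/matrixP => k l; rewrite !mxE; ring.
  by apply: dmx_shift; exact: (eq_ind _ (fun u => dmx _ (t + 1) u) h _ (alg _ _ _)).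
have zE : col_mx (invmx (phi 0) *m sol lam z (0 + 1)) (invmx (phi 0) *m dsol lam z (0 + 1)) = z.
  by rewrite add0r; case: s1 => -> ->; rewrite !mulKmx ?(frame_unit ophi) // vsubmxK.
have H t : sol lam z (t + 1) = sol lam z t /\ dsol lam z (t + 1) = dsol lam z t.
  by have := frame_ode_uniq du dv t; rewrite /= zE.
by split=> t; have [] := H t.
Qed.

Lemma sol_eigen lam z : rot 1 *m fundamental (pencil B Q lam) 1 *m z = z ->
  A_op g V x (sol lam z) (fun t => lam *: sol lam z t).
Proof.
move=> fz; have [ps pd] := sol_periodic fz.
pose zeta t := - (Qx (chart_at (x t)) t *m sol lam z t) - lam *: sol lam z t.
have zc i t : dom i (x t) -> fcoord x i zeta t =
    - (Qx i t *m fcoord x i (sol lam z) t) - lam *: fcoord x i (sol lam z) t.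
  move=> ix; have cp := mem_chart_at (x t).
  rewrite /fcoord /zeta mulmxBr mulmxN -scalemxAr; congr (- _ - _).
  by rewrite (mulmxA (tchg _ _ _) (Qchart _ _ _ _ _ _)) fcoord_id (Qchart_change g sV _ _ cp ix) -!mulmxA.
have cs i t : dom i (x t) -> mcts (fcoord x i (sol lam z)) t.
  by move=> ix; have [h _] := sol_dmx lam z ix; exact: dmx_mcts h.
have cd i t : dom i (x t) -> mcts (fcoord x i (dsol lam z)) t.
  by move=> ix; have [_ h] := sol_dmx lam z ix; exact: dmx_mcts h.
have cz i t : dom i (x t) -> mcts (fcoord x i zeta) t.
  move=> ix; apply: (@mcts_near_eq _ _ _ _ (fun t => - (Qx i t *m fcoord x i (sol lam z) t)
     - lam *: fcoord x i (sol lam z) t)).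
    by apply: filterS (near_dom (crit_cts xC) ix) => s is_; rewrite zc.
  apply: mctsB; last by apply: mctsZ; [exact: cvg_cst|exact: cs].
  apply: mctsN; apply: mctsM; last exact: cs.
  exact: (Qchart_mcts sV (f := fun s : R => s) cvg_id (chart_crit_cts xC ix) (velocity_cts sV xC ix) (img_chart ix)).
exists (dsol lam z), zeta; split; last first.
  apply: aeW => t; rewrite -addrA -opprD curvature_Qchart // /zeta.
  by rewrite opprD !opprK addrAC subrr add0r.
split.
- by split=> // t; rewrite /zeta Qcper ps.
- by split; apply: (cts_L2_field).
- by apply: (strong_field_weak sV xC) => // i t ix; have [] := sol_dmx lam z ix.
apply: (strong_field_weak sV xC) => // i t ix; have [_ h] := sol_dmx lam z ix.
rewrite zc //; move: h; move: (Gam i t *m _) (Qx i t *m _) (lam *: _) => p q r.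
have -> : - p - q - r = - q - r - p by apply/matrixP => k l; rewrite !mxE; ring.
by [].
Qed.

Lemma eigen_sol lam xi : A_op g V x xi (fun t => lam *: xi t) ->
  exists2 z, rot 1 *m fundamental (pencil B Q lam) 1 *m z = z & xi = sol lam z.
Proof.
move=> [eta [zeta [W ev]]].
have [[pxi peta _] _ _ _] := W.
have d i t (ix : dom i (x t)) := weak_eigen_dmx sV xC W ev ix.
pose z := col_mx (invmx (phi 0) *m xi 0) (invmx (phi 0) *m eta 0) : 'cV[R]_(n + n).
have H := @frame_ode_uniq lam xi eta (fun i t ix => (d i t ix).1) (fun i t ix => (d i t ix).2).
exists z; last by apply/funext => t; have [] := H t.
have [h1 h2] := H 1; rewrite -/z in h1 h2.
have fu := frame_unit ophi 0.
have p1 : xi 1 = xi 0 by rewrite -[1]add0r; exact: pxi.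
have p2 : eta 1 = eta 0 by rewrite -[1]add0r; exact: peta.
pose w := fundamental (pencil B Q lam) 1 *m z.
have zu : usubmx z = E_sigma x *m usubmx w.
  by rewrite col_mxKu -p1 h1 /sol phi1 -!mulmxA mulKmx.
have zd : dsubmx z = E_sigma x *m dsubmx w.
  by rewrite col_mxKd -p2 h2 /dsol phi1 -!mulmxA mulKmx.
by rewrite -mulmxA -/w -[w]vsubmxK rot1_fix -zu -zd vsubmxK.
Qed.

Lemma sol_lin lam k (c : 'I_k -> R) (zs : 'I_k -> 'cV[R]_(n + n)) t :
  sol lam (\sum_j c j *: zs j) t = \sum_j c j *: sol lam (zs j) t.
Proof.
rewrite /sol mulmx_sumr linear_sum /= mulmx_sumr; apply: eq_bigr => j _.
by rewrite -scalemxAr linearZ /= -scalemxAr.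
Qed.

(** The field determines its first frame component, and the first row of the pencil recovers the
    second one from its derivative; together they give [z]. *)
Lemma sol_inj lam z z' : sol lam z = sol lam z' -> z = z'.
Proof.
move=> e; apply/eqP; rewrite -subr_eq0; apply/eqP; set w := z - z'.
have a0 t : usubmx (zz lam w t) = 0.
  have := congr1 (fun f => f t) e; rewrite /sol => /(can_inj (mulKmx (frame_unit ophi t))) E.
  by rewrite /zz mulmxBr linearB /= E subrr.
have b0 t : dsubmx (zz lam w t) = 0.
  have du := dmx_usub (dzz lam w t).
  have d0 : dmx (fun s => usubmx (zz lam w s)) t 0.
    have -> : (fun s => usubmx (zz lam w s)) = (fun=> 0) by apply/funext => s; exact: a0.
    exact: dmx_cst.
  have := dmx_uniq du d0; rewrite -{1}[zz lam w t]vsubmxK pencil_mul col_mxKu a0.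
  by rewrite mulmx0 oppr0 add0r.
have := vsubmxK (zz lam w 0); rewrite a0 b0 col_mx0 /zz fundamental0 mul1mx.
by move=> <-.
Qed.

Lemma eigenspace_dim lam : has_dim (A_eigenspace g V x lam) (null_dim B Q sg lam).
Proof.
set N := 1%:M - rot 1 *m fundamental (pencil B Q lam) 1.
have fixN z : N *m z = 0 <-> rot 1 *m fundamental (pencil B Q lam) 1 *m z = z.
  rewrite /N mulmxBl mul1mx; split=> [/eqP|->]; last by rewrite subrr.
  by rewrite subr_eq0 eq_sym => /eqP.
pose K := row_base (kermx N^T).
pose zs (j : 'I_(null_dim B Q sg lam)) : 'cV[R]_(n + n) := (row j K)^T.
have sumE (c : 'I_(null_dim B Q sg lam) -> R) : \sum_j c j *: zs j = ((\row_j c j) *m K)^T.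
  rewrite mulmx_sum_row linear_sum; apply: eq_bigr => j _.
  by rewrite linearZ /= mxE.
have NK c : N *m (\sum_j c j *: zs j) = 0.
  rewrite sumE -[N]trmxK -trmx_mul; apply/eqP; rewrite trmx_eq0; apply/eqP.
  apply/sub_kermxP; apply: submx_trans (submxMl _ _) _; by rewrite eq_row_base.
exists (fun j => sol lam (zs j)); split=> [c|xi /eigen_sol[z /fixN Nz ->]].
  have -> : (fun t => \sum_j c j *: sol lam (zs j) t) = sol lam (\sum_j c j *: zs j).
    by apply/funext => t; rewrite sol_lin.
  by apply: sol_eigen; apply/fixN.
have zK : (z^T <= K)%MS.
  rewrite eq_row_base; apply/sub_kermxP.
  by rewrite -trmx_mul Nz trmx0.
have [v vE] := submxP zK.
have cE (c : 'I_(null_dim B Q sg lam) -> R) : \row_j c j = v -> \sum_j c j *: zs j = z.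
  by move=> cv; rewrite sumE cv -vE trmxK.
exists (fun j => v ord0 j); split.
  apply/funext => t; rewrite -sol_lin cE //.
  by apply/rowP => j; rewrite mxE.
move=> c' Hc; apply/funext => j.
have : \sum_j c' j *: zs j = z.
  by apply: (@sol_inj lam); rewrite Hc; apply/funext => t; rewrite sol_lin.
rewrite sumE => /(congr1 trmx); rewrite trmxK vE => /(row_free_inj (row_base_free _)) <-.
by rewrite mxE.
Qed.

Lemma multiplicityE lam : multiplicity g V x lam = null_dim B Q sg lam.
Proof. exact: has_dim_xget (eigenspace_dim lam). Qed.

Lemma nondegenerate_null_dim : nondegenerate_crit g V x -> null_dim B Q sg 0 = 0%N.
Proof.
move=> nd; apply: contrapT => /null_dimP[z z0 fz].
have A1 := sol_eigen fz; have A2 : A_op g V x (sol 0 0) (fun t => 0 *: sol 0 0 t).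
  by apply: sol_eigen; rewrite mulmx0.
have e0 y : (fun t => 0 *: sol 0 y t) = (fun=> 0).
  by apply/funext => t; rewrite scale0r.
rewrite e0 in A1; rewrite e0 in A2.
by move: z0; rewrite (sol_inj (nd _ _ _ A1 A2)) eqxx.
Qed.

End Eigenfunctions.

(** In dimension 0 every bundle is trivial; a positive dimension provides the coordinate on which
    the rotation acts. *)
Lemma sigma_dim_gt0 (R : realType) (n : nat) (M : smooth_manifold R n) (x : R -> M) :
  sigma x -> (0 < n)%N.
Proof.
rewrite lt0n; apply: contraL => /eqP n0; subst n.
rewrite /sigma negbK; apply/asboolP; exists (fun=> 1%:M); split=> [t//|i r t _|t].
  have -> : (fun t : R => tchg (chart_at (x t)) i (x t) *m (1%:M : 'M[R]_0)) = cst 0.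
    by apply/funext => s; apply/matrixP => -[].
  elim: r => [|r IH]; first exact: derivable_cst.
  rewrite derive1Sn (_ : derive1 _ = cst 0) //.
  by apply/funext => s; exact: derive1_cst.
exact: unitmx1.
Qed.

Theorem theorem1p2 (R : realType) (n : nat) (M : smooth_manifold R n)
    (g : riemannian_metric M) (V : R -> M -> R)
    (psi : R -> M * 'cV[R]_n -> M * 'cV[R]_n)
    (x : R -> M) (phi : R -> 'M[R]_n) :
  compact [set: M] ->
  smooth_potential V ->
  ham_flow g V psi ->
  Crit g V x ->
  nondegenerate_crit g V x ->
  adapted_frame g x phi ->
  (trivial_pullback x ->
     mu_CZ (gamma g psi x phi) = - (Ind g V x)%:R) /\
  (~ trivial_pullback x ->
     mu_CZ (gamma g psi x phi) = - (Ind g V x)%:R + 1).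
Proof.
move=> _ sV flow xC nd [sphi ophi phi1].
have gE t : 0 <= t <= 1 -> gamma g psi x phi t =
    rot n (sigma x) t *m fundamental (pencil (frame_B g x phi) (frame_Q g V x phi) 0) t.
  move=> /andP[t0 _]; rewrite rot_Umat.
  have Uu : Umat n t \in unitmx by rewrite -(rot_Umat n true) rot_unit.
  exact: (gammaE sV flow xC sphi ophi t0 Uu).
have muE := core_index (@frame_B_cts _ _ _ _ _ sV _ xC _ sphi ophi)
  (@frame_Q_cts _ _ _ _ _ sV _ xC _ sphi ophi) (frame_B_skew xC sphi ophi)
  (frame_Q_sym sV ophi) (@sigma_dim_gt0 _ _ _ x) gE
  (nondegenerate_null_dim sV xC sphi ophi phi1 nd).
have IndE : \big[addn/0%N]_(l \in [set l : R | l < 0])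
    null_dim (frame_B g x phi) (frame_Q g V x phi) (sigma x) l = Ind g V x.
  by apply: eq_fsbigr => l _; rewrite (multiplicityE sV xC sphi ophi phi1).
rewrite muE IndE; split=> tr.
  by rewrite (_ : sigma x = false) ?sub0r //; apply: negbF; exact/asboolP.
by rewrite (_ : sigma x = true) 1?addrC //; apply/asboolPn.
Qed.
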